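(* Let $F$ be a number field of degree $m=[F:\mathbb{Q}]$ with algebraic closure $\overline{F}$, let $n>1$ be an integer, and suppose $F$ and $\mathbb{Q}(\mu_n(\overline{F}))$ are linearly disjoint over $\mathbb{Q}$. Let $\ell$ be a positive integer and $\varepsilon>0$. Put $$\tilde{\delta}=\begin{cases}\frac{1}{8\phi(n)(n-1)} & \text{if } m=1,\\ \frac{1}{2(m+1)\phi(n)(n-1)} & \text{if } m\geq 2.\end{cases}$$ Then for all but $O_{F,n,\varepsilon}\big(X^{\frac{1}{n-1}-\min\{\frac{1}{2\ell(n-1)},\tilde{\delta}\}+\varepsilon}\big)$ fields $K\in\mathcal{T}_{F,n}$ with $D_K\leq X$ we have $$\#Cl_K[\ell]\ll_{F,n,\ell,\varepsilon} D_K^{\frac{1}{2}-\min\{\frac{1}{2\ell(n-1)},\tilde{\delta}\}+\varepsilon}.$$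
   Context: $\mu_n(\overline{F})$ is the group of $n$-th roots of unity in $\overline{F}$; $\phi$ is Euler's totient function. $\mathcal{T}_{F,n}$ is the set of Galois extensions $K\subseteq\overline{F}$ of $F$ with cyclic Galois group of order $n$ such that every prime ideal of $\mathcal{O}_F$ not dividing $n$ is either unramified or totally ramified in $K$. $D_K$ is the absolute value of the discriminant of $K$, $Cl_K[\ell]$ the $\ell$-torsion subgroup of the class group of $K$, and $X\geq 2$. *)

(* Defs.v *)
From mathcomp Require Import all_boot all_order all_algebra all_field.
Set Implicit Arguments. Unset Strict Implicit. Unset Printing Implicit Defensive.
Import Order.TTheory GRing.Theory Num.Theory.
Local Open Scope ring_scope.

(* Subsets of Fbar = algC (the algebraic numbers), as Prop-valued predicates. *)
Definition cset := algC -> Prop.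
Definition seteq (A B : cset) : Prop := forall x, A x <-> B x.
Definition subset (A B : cset) : Prop := forall x, A x -> B x.

Definition is_subfield (K : cset) : Prop :=
  K 0 /\ K 1 /\ (forall x y, K x -> K y -> K (x - y)) /\
  (forall x y, K x -> K y -> K (x * y)) /\ (forall x, K x -> x != 0 -> K x^-1).

Definition QQ : cset := fun x => x \in Crat.

Definition lin_indep (F : cset) (d : nat) (w : 'I_d -> algC) : Prop :=
  forall c : 'I_d -> algC, (forall i, F (c i)) ->
    \sum_(i < d) c i * w i = 0 -> forall i, c i = 0.
Definition spans (F K : cset) (d : nat) (w : 'I_d -> algC) : Prop :=
  forall x, K x -> exists c : 'I_d -> algC,
    (forall i, F (c i)) /\ x = \sum_(i < d) c i * w i.
Definition is_basis (F K : cset) (d : nat) (w : 'I_d -> algC) : Prop :=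
  (forall i, K (w i)) /\ lin_indep F w /\ spans F K w.
Definition ext_degree (F K : cset) (d : nat) : Prop :=
  exists w : 'I_d -> algC, is_basis F K w.

Definition number_field (K : cset) : Prop :=
  is_subfield K /\ exists d, ext_degree QQ K d.

Definition cyclo_field (n : nat) : cset := fun x =>
  forall L, is_subfield L -> (forall z : algC, z ^+ n = 1 -> L z) -> L x.

Definition lin_disjoint (F L : cset) : Prop :=
  forall d (w : 'I_d -> algC), (forall i, F (w i)) -> lin_indep QQ w -> lin_indep L w.

Definition is_autom (F K : cset) (s : algC -> algC) : Prop :=
  (forall x, K x -> K (s x)) /\ (forall y, K y -> exists x, K x /\ s x = y) /\
  (forall x y, K x -> K y -> s (x + y) = s x + s y) /\
  (forall x y, K x -> K y -> s (x * y) = s x * s y) /\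
  (forall x, F x -> s x = x).

(* K/F is Galois with cyclic Galois group of order n: [K:F] = n and
   Aut(K/F) = {sigma^k | k < n} with sigma of order exactly n
   (so #Aut(K/F) = n = [K:F] and Aut(K/F) is cyclic of order n). *)
Definition cyclic_galois (F K : cset) (n : nat) : Prop :=
  is_subfield K /\ subset F K /\ ext_degree F K n /\
  exists s, is_autom F K s /\
    (forall k, (0 < k < n)%N -> exists x, K x /\ iter k s x != x) /\
    (forall t, is_autom F K t ->
       exists k, (k < n)%N /\ forall x, K x -> t x = iter k s x).

Definition OK (K : cset) : cset := fun x => K x /\ x \in Aint.
Definition is_ideal (K I : cset) : Prop :=
  subset I (OK K) /\ I 0 /\ (forall x y, I x -> I y -> I (x + y)) /\
  (forall r x, OK K r -> I x -> I (r * x)).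
Definition nonzero_ideal (K I : cset) : Prop :=
  is_ideal K I /\ exists x, I x /\ x != 0.
Definition iprod (I J : cset) : cset := fun x =>
  exists k (a b : 'I_k -> algC), (forall i, I (a i) /\ J (b i)) /\
    x = \sum_(i < k) a i * b i.
Definition ipow (K I : cset) (l : nat) : cset := iter l (iprod I) (OK K).
Definition principal (K : cset) (a : algC) : cset := fun x =>
  exists r, OK K r /\ x = a * r.
Definition is_principal (K I : cset) : Prop :=
  exists a, OK K a /\ seteq I (principal K a).
Definition iequiv (K I J : cset) : Prop :=
  exists a b, OK K a /\ OK K b /\ a != 0 /\ b != 0 /\
    seteq (iprod (principal K a) I) (iprod (principal K b) J).
Definition cl_tors_card (K : cset) (l N : nat) : Prop :=
  exists Is : 'I_N -> cset,
    (forall i, nonzero_ideal K (Is i) /\ is_principal K (ipow K (Is i) l)) /\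
    (forall i j, iequiv K (Is i) (Is j) -> i = j) /\
    (forall I, nonzero_ideal K I -> is_principal K (ipow K I l) ->
       exists i, iequiv K I (Is i)).

Definition prime_ideal (K P : cset) : Prop :=
  nonzero_ideal K P /\ ~ P 1 /\
  forall a b, OK K a -> OK K b -> P (a * b) -> P a \/ P b.
Definition idvd (K A B : cset) : Prop :=
  exists J, is_ideal K J /\ seteq B (iprod A J).
Definition ext_ideal (K P : cset) : cset := iprod P (OK K).
Definition unramified (K P : cset) : Prop :=
  forall Q, prime_ideal K Q -> ~ idvd K (iprod Q Q) (ext_ideal K P).
Definition totally_ramified (K : cset) (n : nat) (P : cset) : Prop :=
  exists Q, prime_ideal K Q /\ seteq (ext_ideal K P) (ipow K Q n).

Definition in_T (F : cset) (n : nat) (K : cset) : Prop :=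
  cyclic_galois F K n /\
  forall P, prime_ideal F P -> ~ idvd F P (principal F n%:R) ->
    unramified K P \/ totally_ramified K n P.

Definition is_integral_basis (K : cset) (d : nat) (w : 'I_d -> algC) : Prop :=
  (forall i, OK K (w i)) /\ lin_indep QQ w /\
  (forall x, OK K x -> exists z : 'I_d -> algC,
     (forall i, z i \in Num.int) /\ x = \sum_(i < d) z i * w i).
Definition trace_wrt (d : nat) (w : 'I_d -> algC) (x t : algC) : Prop :=
  exists c : 'M[algC]_d, (forall i j, QQ (c i j)) /\
    (forall j, x * w j = \sum_(i < d) c i j * w i) /\ t = \tr c.
Definition absdisc (K : cset) (D : nat) : Prop :=
  exists d (w : 'I_d -> algC) (T : 'M[algC]_d),
    is_integral_basis K w /\ (forall i j, trace_wrt w (w i * w j) (T i j)) /\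
    D%:R = `|\det T|.

From Stdlib Require Import Reals.
Local Open Scope R_scope.

Definition delta_tilde (m n : nat) : R :=
  if Nat.eqb m 1 then 1 / (8 * INR (totient n) * INR (n - 1))
  else 1 / (2 * INR (m + 1) * INR (totient n) * INR (n - 1)).

Definition mu_exp (m n l : nat) : R :=
  Rmin (1 / (2 * INR l * INR (n - 1))) (delta_tilde m n).

(* Main.v *)
(* Let L = F(zeta_n). By Kummer theory each K in T_{F,n} is one of boundedly many fields attached to a code (x, beta),
   with K L generated by an n-th root of Theta(x) beta, where beta lies in a fixed finite set and x in a box of O_L of
   side about D_K^(1/((n-1)[L:Q])); total ramification at the tame primes gives N(f)^(n-1) <= O(D_K) for the conductor
   f, whence the exponent 1/(n-1). The 2k-th moments over the box of sums of the power residue symbols of Theta(x) beta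
   at degree-one primes of L show that, with few exceptions, a positive proportion of these primes lies above degree-one
   primes of F that split completely in K. Products of k such primes of K, paired with the inequivalent ideals whose
   l-th power is principal, inject up to D_K^eps into the ideals of norm O(D_K^(1/2)); hence the bound on the class
   group. Rankin's trick provides enough degree-one primes of L in some dyadic range. *)
Require Import Defs.
From HB Require Import structures.
From mathcomp Require Import all_boot all_order all_algebra all_field all_fingroup.
From mathcomp Require Import ring lra zify.
From Stdlib Require Import Classical ClassicalEpsilon FunctionalExtensionality PropExtensionality.
Set Implicit Arguments. Unset Strict Implicit. Unset Printing Implicit Defensive.
Import Order.TTheory GRing.Theory Num.Theory.
Local Open Scope ring_scope.
Local Notation aut := {rmorphism algC -> algC}.
Local Notation pQtoC := (map_poly (ratr : rat -> algC)).

(** For D_K about 2^t the primes in use are tiny: they lie in one dyadic range [2^i, 2^(i+1)) with i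
    small compared with t but 2^(i e1) >= t, and k of them are multiplied, where k i is about t mu,
    mu = min(1/(2 l (n-1)), delta). The moment runs over a box with A^d about D^(1/(n-1)), d = m
    phi(n), and has to save D^mu. Tuples in which no prime occurs exactly once save r^k up to
    factors k^(2k), harmless as k <= t <= 2^(i e1). All other tuples leave only the boundary of the
    box and save A/H, where H^d is about 2^(2 k i phi(n)), so that H is about D^(2 mu / m). Hence
    the condition mu (1 + 2/m) <= 1/(m phi(n) (n-1)), which both cases of delta satisfy. The other
    bound 1/(2 l (n-1)) is the range where the products of k primes can be separated: a coincidence
    would produce a full lattice in K of covolume below D^(1/2). The constant of the exceptional
    count is chosen before l; every threshold depending on l therefore goes into the constant of the
    class group bound, by means of the trivial estimate D^(1/2 + e) for small discriminants. *)

Lemma cset_ext (A B : cset) : (forall x, A x <-> B x) -> A = B.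
Proof.
by move=> AB; apply: functional_extensionality => x; apply: propositional_extensionality.
Qed.

(** * Number fields, embeddings and lattices *)

(** The roots of the minimal polynomial of [x] generate a normal number field inside [algC];
    normality gives an automorphism of it that moves [x] to [y], and this automorphism extends to
    [algC]. *)
Lemma conjugate_aut (x y : algC) : root (minCpoly x) y -> exists nu : aut, nu x = y.
Proof.
move=> rxy; have [p [Dp mon_p] dv_p] := minCpolyP x.
have [r Dr] := closed_field_poly_normal (pQtoC p).
have [Qs [QsC [rs Drs genr]]] := num_field_exists r.
have Qs_inj := fmorph_inj QsC.
have mapQ (q : {poly rat}) : map_poly QsC (map_poly (in_alg Qs) q) = pQtoC q.
  by rewrite -map_poly_comp; apply: eq_map_poly => a /=; rewrite alg_num_field fmorph_rat.
have lc1 : lead_coef (pQtoC p) = 1.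
  by apply/eqP; rewrite lead_coef_map; apply/eqP; rewrite (monicP mon_p) rmorph1.
have Dp1 : map_poly (in_alg Qs) p = \prod_(z <- rs) ('X - z%:P).
  apply: (map_poly_inj QsC); rewrite mapQ Dr lc1 scale1r -Drs big_map rmorph_prod /=.
  by apply: eq_bigr => z _; rewrite rmorphB /= map_polyX map_polyC.
have split_p : splittingFieldFor 1 (map_poly (in_alg Qs) p) {:Qs}.
  exists rs; first by rewrite Dp1 eqpxx.
  exact: genr.
have ax : SplittingField.axiom Qs.
  by exists (map_poly (in_alg Qs) p); [exact: alg_polyOver | exact: split_p].
pose QsS : splittingFieldType rat := HB.pack Qs
   (FieldExt_isSplittingField.Build rat Qs ax).
have rooted z : root (pQtoC p) z -> exists2 z1, z1 \in rs & QsC z1 = z.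
  rewrite Dr lc1 scale1r root_prod_XsubC -Drs => /mapP[z1 z1rs ->]; by exists z1.
have [|x1 x1rs Dx1] := rooted x; first by rewrite -Dp root_minCpoly.
have [|y1 y1rs Dy1] := rooted y; first by rewrite -Dp.
have rminy : root (minPoly (1%AS : {subfield QsS}) x1) y1.
  have [q Dq] := (@polyOver1P _ _ (minPoly (1%AS : {subfield QsS}) x1) (minPolyOver 1%AS x1)).
  rewrite Dq -(fmorph_root QsC) mapQ Dy1.
  have: root (pQtoC q) x by rewrite -Dx1 -mapQ fmorph_root -Dq root_minPoly.
  rewrite dv_p => /dvdpP[u ->]; rewrite rmorphM rootM; apply/orP; right.
  by rewrite Dp in rxy.
have [g _ Dg] := @normalField_root_minPoly rat QsS 1%AS {:QsS}%AS x1 y1 (sub1v _) (normalFieldf _) (memvf _) rminy.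
have [nu Dnu] := extend_algC_subfield_aut QsC (g : {rmorphism QsS -> QsS}).
by exists nu; rewrite -Dx1 -Dnu -Dy1 -Dg.
Qed.

Lemma conj_minCpoly (x y : algC) : root (minCpoly x) y -> minCpoly y = minCpoly x.
Proof. by move/conjugate_aut=> [nu <-]; rewrite minCpoly_aut. Qed.

(** A common root of the minimal polynomial and its derivative would be conjugate to [x], so the
    minimal polynomial would divide its own derivative, which has smaller degree. *)
Lemma minCpoly_roots (x : algC) :
  exists r : seq algC, uniq r /\ minCpoly x = \prod_(z <- r) ('X - z%:P).
Proof.
have [p [Dp mon_p] _] := minCpolyP x.
have [r Dr] := closed_field_poly_normal (minCpoly x).
move: Dr; rewrite (monicP (minCpoly_monic x)) scale1r => Dr.
exists r; split => //; rewrite -separable_prod_XsubC -Dr.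
rewrite separable_poly.unlock; apply/Pdiv.ClosedField.root_coprimep => y ry.
have [q [Dq mon_q] dv_q] := minCpolyP y.
have pq : p = q by apply: (map_poly_inj (ratr : {rmorphism rat -> algC})); rewrite -Dp -Dq (conj_minCpoly ry).
rewrite Dp deriv_map; apply/negP => /eqP/rootP; rewrite dv_q -pq => /dvdp_leq.
have p_gt1 : (1 < size p)%N by have := size_minCpoly x; rewrite Dp size_map_poly.
have p'_neq0 : p^`() != 0.
  apply/eqP => /(congr1 (fun q : {poly rat} => q`_(size p).-2)); rewrite coef_deriv coef0.
  have -> : (size p).-2.+1 = (size p).-1 by case: (size p) p_gt1 => [|[]].
  rewrite -lead_coefE (monicP mon_p) => /eqP; apply/negP; rewrite pnatr_eq0.
  by case: (size p) p_gt1 => [|[]].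
by move/(_ p'_neq0); rewrite leqNgt lt_size_deriv // -size_poly_gt0 (ltn_trans _ p_gt1).
Qed.

(** By [conjugate_aut] such an element has no conjugate but itself. Norms, traces and squared
    determinants are shown to be rational in this way. *)
Lemma fixed_rat (z : algC) : (forall nu : aut, nu z = z) -> z \in Crat.
Proof.
move=> fz; have [r [ur Dr]] := minCpoly_roots z.
have rz y : y \in r -> y = z.
  move=> yr; have [|nu <-] := @conjugate_aut z y; last exact: fz.
  by rewrite Dr root_prod_XsubC.
have zr : z \in r by rewrite -root_prod_XsubC -Dr root_minCpoly.
have {}Dr : minCpoly z = 'X - z%:P.
  rewrite Dr (perm_big [:: z]) ?big_seq1 //; apply: uniq_perm => // y.
  by rewrite inE; apply/idP/eqP => [/rz|->].
have [p [Dp _] _] := minCpolyP z.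
have := congr1 (fun q : {poly algC} => q`_0) Dp; rewrite Dr coefB coefX coefC sub0r coef_map /=.
by move/(canRL (@opprK _)) => ->; rewrite rpredN Crat_rat.
Qed.

Section SubfieldTheory.
Variables (K : cset) (sK : is_subfield K).
Lemma sf0 : K 0. Proof. by case: sK. Qed.
Lemma sf1 : K 1. Proof. by case: sK => _ []. Qed.
Lemma sfB x y : K x -> K y -> K (x - y). Proof. by case: sK => _ [_ [h _]]; apply: h. Qed.
Lemma sfN x : K x -> K (- x). Proof. by rewrite -sub0r; apply: sfB; apply: sf0. Qed.
Lemma sfD x y : K x -> K y -> K (x + y).
Proof. by move=> Kx Ky; rewrite -[y]opprK; apply: sfB => //; apply: sfN. Qed.
Lemma sfM x y : K x -> K y -> K (x * y). Proof. by case: sK => _ [_ [_ [h _]]]; apply: h. Qed.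
Lemma sfV x : K x -> K x^-1.
Proof.
by have [->|x0] := eqVneq x 0; [rewrite invr0 | case: sK => _ [_ [_ [_ h]]] Kx; apply: h].
Qed.
Lemma sfdiv x y : K x -> K y -> K (x / y). Proof. by move=> Kx Ky; apply: sfM => //; apply: sfV. Qed.
Lemma sfsum (I : Type) (r : seq I) (P : pred I) f :
  (forall i, P i -> K (f i)) -> K (\sum_(i <- r | P i) f i).
Proof. by move=> h; apply: big_ind => //; [exact: sf0 | exact: sfD]. Qed.
Lemma sfX x k : K x -> K (x ^+ k).
Proof. by move=> Kx; elim: k => [|k IH]; rewrite ?expr0 ?exprS; [exact: sf1 | exact: sfM]. Qed.
Lemma sfnat k : K k%:R.
Proof. by elim: k => [|k IH]; [exact: sf0 | rewrite -addn1 natrD; apply: sfD => //; exact: sf1]. Qed.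
Lemma sfMn x k : K x -> K (x *+ k). Proof. by move=> Kx; rewrite -mulr_natr; apply: sfM => //; exact: sfnat. Qed.
Lemma sfint (k : int) : K k%:~R.
Proof. by case: k => k; rewrite ?NegzE ?mulrNz; [|apply: sfN]; exact: sfnat. Qed.
Lemma sfrat (a : rat) : K (ratr a).
Proof. by rewrite /ratr; apply: sfdiv; apply: sfint. Qed.
Lemma sfCrat x : x \in Crat -> K x. Proof. by case/CratP=> a ->; apply: sfrat. Qed.
Lemma sfhorner (p : {poly rat}) x : K x -> K (pQtoC p).[x].
Proof.
move=> Kx; rewrite horner_coef; apply: sfsum => i _; apply: sfM; last exact: sfX.
by rewrite coef_map /=; apply: sfrat.
Qed.
End SubfieldTheory.

Lemma aut_QtoC (nu : aut) (p : {poly rat}) x : nu (pQtoC p).[x] = (pQtoC p).[nu x].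
Proof.
rewrite -horner_map -map_poly_comp; congr (_.[_]); apply: eq_map_poly => a /=.
exact: fmorph_rat.
Qed.

Lemma Aint_scale (x : algC) : exists2 N : nat, (0 < N)%N & N%:R * x \in Aint.
Proof.
have [p [Dp mon_p] dv_p] := minCpolyP x.
have [q [a a0 Dq]] := rat_poly_scale p.
have lq : lead_coef q = a.
  have := congr1 lead_coef Dq; rewrite (monicP mon_p) lead_coefZ lead_coef_map_inj //; last exact: intr_inj.
  move/(congr1 ( *%R a%:~R)); rewrite mulr1 mulrA mulfV ?intr_eq0 // mul1r => h.
  by apply: (@intr_inj rat); rewrite h.
have qx0 : (map_poly (intr : int -> algC) q).[x] = 0.
  have: root (pQtoC p) x by rewrite dv_p.
  rewrite Dq map_polyZ rootZ ?fmorph_eq0 ?invr_eq0 ?intr_eq0 // => /rootP.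
  rewrite -map_poly_comp; suff -> : map_poly (ratr \o intr) q = map_poly (intr : int -> algC) q by [].
  by apply: eq_map_poly => b /=; rewrite rmorph_int.
have q0 : q != 0 by rewrite -lead_coef_eq0 lq.
pose n := (size q).-1.
have szq : size q = n.+1 by rewrite /n prednK // size_poly_gt0.
have n_gt0 : (0 < n)%N.
  rewrite lt0n; apply/eqP => n0; move: qx0; rewrite horner_coef size_map_inj_poly ?szq ?n0 //; last exact: intr_inj.
  rewrite big_ord_recl big_ord0 addr0 expr0 mulr1 coef_map /= => /eqP; rewrite intr_eq0.
  by apply/negP; rewrite -lq lead_coefE szq n0 in a0.
(* [r] is a^(n-1) q(X / a), the monic polynomial whose roots are [a] times those of [q]. *)
pose r : {poly algC} := \poly_(i < n.+1) (if i == n then 1 else (q`_i * a ^+ (n - 1 - i))%:~R).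
have mr : r \is monic.
  rewrite monicE lead_coef_poly //; by rewrite eqxx ?oner_eq0.
have rr : root r (a%:~R * x).
  apply/rootP; rewrite horner_poly.
  have -> : \sum_(i < n.+1) (if i == n :> nat then 1 else (q`_i * a ^+ (n - 1 - i))%:~R) * (a%:~R * x) ^+ i
     = \sum_(i < n.+1) (a%:~R ^+ n.-1) * ((q`_i)%:~R * x ^+ i) :> algC.
    apply: eq_bigr => i _; rewrite exprMn; case: eqP => [Di|/eqP Di].
      rewrite mul1r Di -{1}(prednK n_gt0) exprS.
      by rewrite (_ : q`_n = a) ?mulrA ?(mulrC (a%:~R)) // -lq lead_coefE szq.
    have lin : (i <= n.-1)%N by rewrite -ltnS prednK // ltn_neqAle Di -ltnS ltn_ord.
    by rewrite intrM rmorphXn /= -[X in _ = _ ^+ X * _](subnK lin) exprD subn1 (mulrC _%:~R) mulrACA.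
  rewrite -mulr_sumr; have := qx0; rewrite horner_coef size_map_inj_poly ?szq //; last exact: intr_inj.
  under eq_bigr => i _ do rewrite coef_map /=.
  by move=> ->; rewrite mulr0.
have aint : a%:~R * x \in Aint.
  apply: root_monic_Aint rr mr _; apply/polyOverP => i; rewrite coef_poly.
  by case: ifP => [_|_]; [case: ifP => _; [exact: rpred1 | exact: intr_int] | exact: rpred0].
exists `|a|%N; first by rewrite absz_gt0.
have -> : (`|a|%N)%:R = `|a|%:~R :> algC by rewrite -abszE.
have [ha|ha] := lerP 0 a; first by rewrite ger0_norm.
by rewrite ltr0_norm // mulrNz mulNr rpredN.
Qed.

(** Embeddings of K are represented by automorphisms of [algC], so that they compose and invert
    freely; [s] lists them up to equality on K. The nonzero determinant encodes both the
    independence of [w] over the rationals and the distinctness of the [s i] on K. *)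
Definition qdata (K : cset) (d : nat) (s : 'I_d -> aut) (w : 'I_d -> algC) :=
  [/\ is_subfield K, (forall i, K (w i)),
   (forall x, K x -> exists c : 'I_d -> rat, x = \sum_i ratr (c i) * w i),
   \det (\matrix_(i, j) s i (w j)) != 0
   & forall nu : aut, exists i, forall x, K x -> nu x = s i x].

Lemma trunc_ub (x : algC) : 0 <= x -> x <= (Num.truncn x).+1%:R.
Proof. by move/Num.Theory.truncn_itv => /andP[_ /ltW]. Qed.
Lemma norm_ub (I : finType) (f : I -> algC) : exists C : nat, (0 < C)%N /\ forall i, `|f i| <= C%:R.
Proof.
exists (\sum_i (Num.truncn `|f i|).+1).+1; split => // i; apply: le_trans (trunc_ub (normr_ge0 (f i))) _.
by rewrite ler_nat (bigD1 i) //= leqW // leq_addr.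
Qed.
Lemma choice_ord n (T : Type) (P : 'I_n -> T -> Prop) :
  (forall i, exists y, P i y) -> exists f : 'I_n -> T, forall i, P i (f i).
Proof.
move=> h; exists (fun i => proj1_sig (constructive_indefinite_description _ (h i))) => i.
by case: (constructive_indefinite_description _ _).
Qed.

Lemma choice_fun (A T : Type) (P : A -> T -> Prop) :
  (forall i, exists y, P i y) -> exists f : A -> T, forall i, P i (f i).
Proof.
move=> h; exists (fun i => proj1_sig (constructive_indefinite_description _ (h i))) => i.
by case: (constructive_indefinite_description _ _).
Qed.

Definition Qadj (t : algC) : cset := fun x => exists p : {poly rat}, x = (pQtoC p).[t].

Lemma Qadj_modp t p : exists2 q : {poly rat}, (size q < size (minCpoly t))%N & (pQtoC p).[t] = (pQtoC q).[t].
Proof.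
have [m [Dm mon_m] dv_m] := minCpolyP t.
exists (p %% m); first by rewrite Dm size_map_poly ltn_modp monic_neq0.
rewrite {1}(divp_eq p m) rmorphD rmorphM /= hornerD hornerM.
have /rootP -> : root (pQtoC m) t by rewrite dv_m.
by rewrite mulr0 add0r.
Qed.

Lemma Qadj_subfield t : is_subfield (Qadj t).
Proof.
split; first by exists 0; rewrite rmorph0 horner0.
split; first by exists 1; rewrite rmorph1 hornerC.
split; first by move=> _ _ [p ->] [q ->]; exists (p - q); rewrite rmorphB hornerD hornerN.
split; first by move=> _ _ [p ->] [q ->]; exists (p * q); rewrite rmorphM hornerM.
move=> _ [p ->] p0; have [m [Dm mon_m] dv_m] := minCpolyP t.
have copm : coprimep p m.
  rewrite -(coprimep_map (ratr : {rmorphism rat -> algC})); apply/Pdiv.ClosedField.root_coprimep => y.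
  move=> py; apply/negP => my; have /conjugate_aut [nu Dnu] : root (minCpoly t) y by rewrite Dm.
  move: py; rewrite /root -Dnu -aut_QtoC fmorph_eq0 => /eqP pt0; by rewrite pt0 eqxx in p0.
have /Bezout_coprimepP [[u v] /= /eqpP [[a b] /= /andP[a0 b0] E]] := copm.
exists ((b^-1 * a) *: u); rewrite -[LHS]mulr1; apply: (mulfI p0); rewrite mulrA mulfV // mul1r.
have /(congr1 (fun q => (pQtoC q).[t])) := E.
rewrite !map_polyZ /= !hornerZ rmorphD !rmorphM /= rmorph1 hornerD !hornerM hornerC.
have /rootP -> : root (pQtoC m) t by rewrite dv_m.
rewrite mulr0 addr0 mulr1 => E1.
move: E1; move: (_.[t]) (_.[t]) => U P E1.
rewrite (_ : P * _ = ratr b^-1 * (ratr a * (U * P))); last by rewrite [LHS]mulrC !mulrA.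
by rewrite E1 fmorphV mulVf ?fmorph_eq0.
Qed.

(** The embeddings send [t] to the roots of its minimal polynomial, so the conjugates of the power
    basis form a Vandermonde matrix with distinct nodes. *)
Lemma Qadj_data t : exists d s, qdata (Qadj t) s (fun k : 'I_d => t ^+ k) /\ d = (size (minCpoly t)).-1.
Proof.
have [r [ur Dr]] := minCpoly_roots t.
pose d := (size (minCpoly t)).-1.
have sr : size r = d by rewrite /d Dr size_prod_XsubC.
have [s Hs] : exists s : 'I_d -> aut, forall i : 'I_d, s i t = r`_i.
  apply: (choice_ord (P := fun i (y : aut) => y t = r`_i)) => i; apply: conjugate_aut.
  by rewrite Dr root_prod_XsubC mem_nth ?sr.
exists d, s; split => //; split; first exact: Qadj_subfield.
- by move=> i; exists 'X^i; rewrite map_polyXn hornerXn.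
- move=> _ [p ->]; have [q szq ->] := Qadj_modp t p.
  have szq' : (size q <= d)%N by rewrite -ltnS prednK // (leq_ltn_trans _ szq).
  exists (fun i => q`_i); rewrite (@horner_coef_wide _ d); last by rewrite size_map_poly.
  by apply: eq_bigr => i _; rewrite coef_map.
- have -> : \matrix_(i, j) s i (t ^+ j) = (Vandermonde d (\row_(i < d) r`_i))^T.
    by apply/matrixP => i j; rewrite !mxE rmorphXn /= Hs.
  rewrite det_tr det_Vandermonde; apply/prodf_neq0 => i _; apply/prodf_neq0 => j ij.
  rewrite !mxE subr_eq0 nth_uniq ?sr //; by rewrite neq_ltn ij orbT.
- move=> nu; have : nu t \in r.
    by rewrite -root_prod_XsubC -Dr -(minCpoly_aut nu) root_minCpoly.
  case/(nthP 0) => i; rewrite sr => id Di; exists (Ordinal id) => _ [p ->].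
  by rewrite !aut_QtoC Hs /= Di.
Qed.

Lemma number_field_Qadj K : number_field K -> exists2 t, t \in Aint & K = Qadj t.
Proof.
move=> [sK [d [w [Kw [_ spw]]]]].
have [z [a Dz] [ps Dps]] := algC_PET [seq w i | i <- enum 'I_d].
have Kz : K z.
  rewrite Dz; apply: sfsum => // i _; apply: sfMn => //.
  have := mem_nth 0 (ltn_ord i); move: (_`_i) => y /mapP[j _ ->]; exact: Kw.
have wz i : Qadj z (w i).
  have : w i \in [seq w i | i <- enum 'I_d] by rewrite map_f ?mem_enum.
  by rewrite Dps => /mapP[p _ ->]; exists p.
have KQ : K = Qadj z.
  apply: cset_ext => x; split; last by move=> [p ->]; apply: sfhorner.
  move=> /spw[c [Qc ->]]; apply: sfsum => [|i _]; first exact: Qadj_subfield.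
  by apply: sfM => //; [exact: Qadj_subfield | apply: sfCrat; [exact: Qadj_subfield | exact: Qc]].
have [N N0 ANz] := Aint_scale z; exists (N%:R * z) => //.
rewrite KQ; apply: cset_ext => x; split => -[p ->].
  have {2}-> : z = N%:R^-1 * (N%:R * z) by rewrite mulKf // pnatr_eq0 -lt0n.
  apply: sfhorner; first exact: Qadj_subfield.
  apply: sfM; [exact: Qadj_subfield | apply: sfV; [exact: Qadj_subfield|apply: sfnat; exact: Qadj_subfield] |].
  by exists 'X; rewrite map_polyX hornerX.
apply: sfhorner; first exact: Qadj_subfield.
apply: sfM; [exact: Qadj_subfield | apply: sfnat; exact: Qadj_subfield |].
by exists 'X; rewrite map_polyX hornerX.
Qed.

Definition aut_inv (nu : aut) : aut := algC_invaut nu.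
Lemma aut_invK (nu : aut) x : nu (aut_inv nu x) = x. Proof. exact: algC_invautK. Qed.
Lemma autK (nu : aut) x : aut_inv nu (nu x) = x. Proof. exact: algC_autK. Qed.

Section Coord.
Variables (K : cset) (d : nat) (s : 'I_d -> aut) (w : 'I_d -> algC) (D : qdata K s w).
Let W := \matrix_(i, j) s i (w j).

Lemma qdata_inj i j : (forall x, K x -> s i x = s j x) -> i = j.
Proof.
move=> E; apply/eqP; apply/negPn/negP => ij.
case: D => _ Kw _ /negP[]; apply/eqP.
by apply: (determinant_alternate ij) => k; rewrite !mxE E.
Qed.

Lemma qdata_perm (nu : aut) : exists f : 'I_d -> 'I_d, bijective f /\ forall i x, K x -> nu (s i x) = s (f i) x.
Proof.
have [f Hf] : exists f : 'I_d -> 'I_d, forall i, forall x, K x -> nu (s i x) = s (f i) x.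
  apply: (choice_ord (P := fun i (y : 'I_d) => forall x, K x -> nu (s i x) = s y x)) => i; case: D => _ _ _ _ /(_ (nu \o s i)) [j Hj]; by exists j => x /Hj.
exists f; split => //; apply: injF_bij => i j fij; apply: qdata_inj => x Kx.
by apply: (fmorph_inj nu); rewrite !Hf // fij.
Qed.

(** Galois descent: the solution c of W c = z is fixed by every automorphism, because an
    automorphism permutes the rows of W and the entries of z in the same way. Hence c is
    rational. *)
Lemma qdata_coord (z : 'I_d -> algC) :
  (forall (nu : aut) i j, (forall x, K x -> nu (s i x) = s j x) -> nu (z i) = z j) ->
  exists c : 'I_d -> rat, forall i, z i = \sum_j ratr (c j) * s i (w j).
Proof.
move=> Hz; have uW : W \in unitmx by case: D => _ _ _ dW _; rewrite unitmxE unitfE.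
pose c : 'cV_d := invmx W *m \col_i z i.
have Wc : W *m c = \col_i z i by rewrite mulKVmx.
have fc (nu : aut) : map_mx nu c = c.
  apply: (can_inj (mulKmx uW)); rewrite Wc.
  have [f [bf Hf]] := qdata_perm nu.
  apply/matrixP => i k; case: bf => g fK gK; rewrite !mxE.
  rewrite -(gK i); rewrite -(Hz nu _ _ (Hf (g i))).
  have := congr1 (fun M : 'cV_d => nu (M (g i) k)) Wc; rewrite !mxE => <-.
  rewrite rmorph_sum; apply: eq_bigr => j _; rewrite !mxE rmorphM /= Hf //.
  by case: D.
have [a Ha] : exists a : 'I_d -> rat, forall j, c j 0 = ratr (a j).
  apply: (choice_ord (P := fun j a => c j 0 = ratr a)) => j; apply/CratP; apply: fixed_rat => nu.
  by have := congr1 (fun M : 'cV_d => M j 0) (fc nu); rewrite mxE.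
exists a => i; have := congr1 (fun M : 'cV_d => M i 0) Wc; rewrite !mxE => <-.
by apply: eq_bigr => j _; rewrite mxE mulrC Ha.
Qed.

(** An element fixed by all automorphisms trivial on K has conjugates that depend only on the
    embedding of K, so [qdata_coord] writes it in the basis [w]. Membership in F, K or L is mostly
    proved through this lemma. *)
Lemma fixed_mem z : (forall nu : aut, (forall x, K x -> nu x = x) -> nu z = z) -> K z.
Proof.
move=> Hz; have [|c Hc] := @qdata_coord (fun i => s i z).
  move=> nu i j Hij; have := Hz (aut_inv (s j) \o (nu \o s i)).
  rewrite /= => h; rewrite -[RHS](congr1 (s j) (h _)); first by rewrite aut_invK.
  by move=> x Kx; rewrite Hij // autK.
case: (D) => sK Kw _ _ /(_ idfun) [i Hi].
have := Hc i; rewrite Hz; last by move=> x /Hi <-.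
move=> ->; apply: sfsum => // j _; apply: sfM => //; first exact: sfrat.
by rewrite -Hi //; apply: Kw.
Qed.

Lemma qdata_pos : (0 < d)%N.
Proof. by case: D => _ _ _ _ /(_ idfun) [i _]; apply: leq_ltn_trans (ltn_ord i). Qed.

Lemma qdata_indep (c : 'I_d -> rat) : \sum_i ratr (c i) * w i = 0 -> forall i, c i = 0.
Proof.
move=> E; have uW : W \in unitmx by case: D => _ _ _ dW _; rewrite unitmxE unitfE.
have : W *m (\col_i ratr (c i)) = 0.
  apply/matrixP => i j; rewrite !mxE; transitivity (s i (\sum_k ratr (c k) * w k)); last by rewrite E rmorph0.
  rewrite rmorph_sum.
  by apply: eq_bigr => k _; rewrite !mxE rmorphM /= fmorph_rat mulrC.
move/(congr1 (mulmx (invmx W))); rewrite mulKmx // mulmx0 => /matrixP E2 i.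
by apply/eqP; have := E2 i 0; rewrite !mxE => /eqP; rewrite fmorph_eq0.
Qed.
End Coord.

Lemma nat_min (P : nat -> Prop) : (exists n, P n) -> exists n, P n /\ forall m, P m -> (n <= m)%N.
Proof.
case=> n; elim/ltn_ind: n => n IH Pn.
case: (classic (exists2 m, (m < n)%N & P m)) => [[m /IH h /h] //|h].
exists n; split=> // m Pm; rewrite leqNgt; apply/negP => mn; by apply: h; exists m.
Qed.

Section Index.
Variable V : zmodType.
Implicit Types G A B : V -> Prop.
Definition addcl (A : V -> Prop) := A 0 /\ forall x y, A x -> A y -> A (x - y).
(** The index [G : A], witnessed by a transversal; [idx_uniq] makes k well defined once A is a
    subgroup, so a norm can be computed from any transversal. *)
Definition idx G A (k : nat) := exists r : 'I_k -> V,
  [/\ forall i, G (r i), forall i j, A (r i - r j) -> i = j & forall x, G x -> exists i, A (x - r i)].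

Lemma addclN A x : addcl A -> A x -> A (- x).
Proof. by case=> A0 AB Ax; rewrite -sub0r; apply: AB. Qed.
Lemma addclD A x y : addcl A -> A x -> A y -> A (x + y).
Proof. by move=> hA Ax Ay; rewrite -[y]opprK; apply: (proj2 hA) => //; apply: addclN. Qed.
Lemma addclMn A x k : addcl A -> A x -> A (x *+ k).
Proof. by move=> hA Ax; elim: k => [|k IH]; [case: hA | rewrite mulrS; apply: addclD]. Qed.
Lemma addclMz A x (k : int) : addcl A -> A x -> A (x *~ k).
Proof. by move=> hA Ax; case: k => k; [|apply: addclN => //]; apply: addclMn. Qed.
Lemma addcl_sum A (I : Type) (r : seq I) (P : pred I) f : addcl A ->
  (forall i, P i -> A (f i)) -> A (\sum_(i <- r | P i) f i).
Proof. by move=> hA h; apply: big_ind => //; [case: hA | move=> *; apply: addclD]. Qed.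

Lemma idx_fin (T : finType) (r : T -> V) G A :
  (forall i, G (r i)) -> (forall i j, A (r i - r j) -> i = j) -> (forall x, G x -> exists i, A (x - r i)) ->
  idx G A #|T|.
Proof.
move=> h1 h2 h3; exists (r \o enum_val); split => //=.
- by move=> i j /h2 /enum_val_inj.
- by move=> x /h3[i Ai]; exists (enum_rank i); rewrite enum_rankK.
Qed.
End Index.

Section Index2.
Variables V V' : zmodType.
(** [f] induces an injection of classes. It need not be additive, which permits coordinates obtained
    by choice, as in [normI_ext_le]. *)
Lemma idx_le (G A : V -> Prop) (G' A' : V' -> Prop) k k' (f : V -> V') :
  addcl A' -> idx G A k -> idx G' A' k' -> (forall x, G x -> G' (f x)) ->
  (forall x y, G x -> G y -> A' (f x - f y) -> A (x - y)) -> (k <= k')%N.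
Proof.
move=> hA' [r [r1 r2 _]] [r' [_ _ r3]] h1 h2.
have [g Hg] : exists g : 'I_k -> 'I_k', forall i, A' (f (r i) - r' (g i)).
  by apply: (choice_ord (P := fun i y => A' (f (r i) - r' y))) => i; apply/r3/h1.
have gi : injective g.
  move=> i j gij; apply: r2; apply: h2 => //.
  have -> : f (r i) - f (r j) = (f (r i) - r' (g i)) - (f (r j) - r' (g j)).
    by rewrite gij opprB addrA subrK.
  by apply: (proj2 hA').
by have := leq_card g gi; rewrite !card_ord.
Qed.

Lemma idx_ge (G A : V -> Prop) (G' A' : V' -> Prop) k k' (f : V -> V') :
  addcl A -> addcl A' -> idx G A k -> idx G' A' k' ->
  (forall x y, G x -> G y -> A (x - y) -> A' (f x - f y)) ->
  (forall y, G' y -> exists2 x, G x & A' (y - f x)) -> (k' <= k)%N.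
Proof.
move=> hA hA' [r [r1 r2 r3]] [r' [r1' r2' r3']] h1 h2.
have [g Hg] : exists g : 'I_k' -> V, forall i, G (g i) /\ A' (r' i - f (g i)).
  by apply: (choice_ord (P := fun i y => G y /\ A' (r' i - f y))) => i; have [x ? ?] := h2 _ (r1' i); exists x.
have [l Hl] : exists l : 'I_k' -> 'I_k, forall i, A (g i - r (l i)).
  by apply: (choice_ord (P := fun i y => A (g i - r y))) => i; apply/r3/(Hg i).1.
have li : injective l.
  move=> i j lij; apply: r2'.
  have : A (g i - g j).
    have -> : g i - g j = (g i - r (l i)) - (g j - r (l j)) by rewrite lij opprB addrA subrK.
    by apply: (proj2 hA).
  move/(h1 _ _ (Hg i).1 (Hg j).1) => h.
  have -> : r' i - r' j = (r' i - f (g i)) + ((f (g i) - f (g j)) - (r' j - f (g j))).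
    by rewrite opprB !addrA !subrK.
  by apply: addclD => //; [case: (Hg i) | apply: (proj2 hA') => //; case: (Hg j)].
by have := leq_card l li; rewrite !card_ord.
Qed.
End Index2.

Section Index3.
Variable V : zmodType.
Implicit Types G A B : V -> Prop.
Lemma idx_uniq G A k k' : addcl A -> idx G A k -> idx G A k' -> k = k'.
Proof. by move=> hA h h'; apply/eqP; rewrite eqn_leq (@idx_le _ _ G A G A _ _ id) // (@idx_le _ _ G A G A k' k id). Qed.

Lemma idx_tower G A B k l : addcl G -> addcl A -> addcl B -> (forall x, A x -> G x) -> (forall x, B x -> A x) ->
  idx G A k -> idx A B l -> idx G B (k * l).
Proof.
move=> hG hA hB AG BA [r [r1 r2 r3]] [q [q1 q2 q3]].
rewrite -{1}[k]card_ord -{1}[l]card_ord -card_prod.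
apply: (@idx_fin _ _ (fun p : 'I_k * 'I_l => r p.1 + q p.2)).
- by move=> [i j] /=; apply: addclD => //; apply: AG.
- move=> [i j] [i' j'] /= h.
  have E : r i + q j - (r i' + q j') = (r i - r i') + (q j - q j') by rewrite opprD addrACA.
  have ii : i = i'.
    apply: r2; rewrite -(addrK (q j - q j') (r i - r i')) -E; apply: (proj2 hA); first exact: BA.
    by apply: (proj2 hA).
  by subst i'; congr (_, _); apply: q2; rewrite E subrr add0r in h.
- move=> x /r3[i Ai]; have [j Bj] := q3 _ Ai; exists (i, j); by rewrite /= opprD addrA.
Qed.

Lemma idx_gt0 G A k : G 0 -> idx G A k -> (0 < k)%N.
Proof. by move=> G0 [r [_ _ /(_ _ G0) [i _]]]; apply: leq_ltn_trans (ltn_ord i). Qed.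

Lemma idx1 G A : addcl A -> (forall x, A x -> G x) -> idx G A 1 -> forall x, G x -> A x.
Proof.
move=> hA AG [r [r1 r2 r3]] x Gx.
have [i hi] := r3 _ Gx; have [|j hj] := r3 0; first by apply: AG; case: hA.
have -> : x = (x - r i) - (0 - r j) by rewrite sub0r opprK !ord1 subrK.
by apply: (proj2 hA).
Qed.
Lemma idx_refl G : addcl G -> idx G G 1.
Proof.
move=> hG; exists (fun _ => 0); split=> [i|i j _|x Gx]; first by case: hG.
  by rewrite !ord1.
by exists ord0; rewrite subr0.
Qed.
End Index3.

Definition allv d (v : 'rV[int]_d) : Prop := True.
Definition mxlat d (A : 'M[int]_d) : 'rV[int]_d -> Prop := fun v => exists c : 'rV_d, v = c *m A.

Lemma mxlat_addcl d (A : 'M[int]_d) : addcl (mxlat A).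
Proof.
split; first by exists 0; rewrite mul0mx.
by move=> _ _ [c ->] [c' ->]; exists (c - c'); rewrite mulmxBl.
Qed.

Lemma int_subgroup (S : int -> Prop) (N : nat) : (0 < N)%N -> addcl S -> S N%:Z ->
  exists g : nat, [/\ (0 < g)%N, S g%:Z & forall a, S a -> (g%:Z %| a)%Z].
Proof.
move=> N0 hS SN; have [|g [[g0 Sg] gmin]] := @nat_min (fun n => (0 < n)%N /\ S n%:Z); first by exists N.
exists g; split => // a Sa; apply/dvdz_mod0P.
have Sm : S (a %% g%:Z)%Z.
  have -> : (a %% g)%Z = a - g%:Z *~ (a %/ g)%Z.
    by rewrite -mulrzr intz {2}(divz_eq a g) addrC mulrC addKr.
  by apply: (proj2 hS) => //; apply: addclMz.
have : 0 <= (a %% g%:Z)%Z < g%:Z by rewrite modz_ge0 ?ltz_pmod // -?lt0n // gt_eqF.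
case/andP; case: (a %% g%:Z)%Z Sm => // m Sm _; rewrite ltz_nat => mg.
case: m Sm mg => // m Sm mg; by have := gmin m.+1 (conj isT Sm); rewrite leqNgt mg.
Qed.

(** Hermite normal form: [g] generates the group of first coordinates of H, [h] completes [g] to a
    vector of H, and the induction is applied to the vectors of H with first coordinate 0. The
    hypothesis that H contains all multiples of N keeps the rank full. *)
Lemma hnf d (H : 'rV[int]_d -> Prop) (N : nat) : (0 < N)%N -> addcl H -> (forall v, H (v *+ N)) ->
  exists B : 'M[int]_d, [/\ \det B != 0, (forall v, H v <-> mxlat B v) & idx (@allv d) H `|\det B|%N].
Proof.
move=> N0; elim: d H => [|d IH] H hH HN.
  exists 1; rewrite det_mx00; split=> //.
    by move=> v; rewrite (thinmx0 v); split => _; [exists 0; rewrite mul0mx | case: hH].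
  exists (fun _ => 0); split => // [i j _|v _]; first by rewrite !ord1.
  by exists ord0; rewrite (thinmx0 (v - 0)); case: hH.
pose R (a : int) (v : 'rV[int]_d) : 'rV[int]_(1 + d) := row_mx a%:M v.
have RB a v b w : R a v - R b w = R (a - b) (v - w) by rewrite /R opp_row_mx add_row_mx raddfB.
have RMn a v k : R a v *+ k = R (a *+ k) (v *+ k).
  elim: k => [|k IHk]; first by rewrite !mulr0n /R raddf0 row_mx0.
  by rewrite !mulrS IHk /R add_row_mx raddfD.
have RE v : exists a w, v = R a w.
  by exists (lsubmx (v : 'rV_(1 + d)) 0 0), (rsubmx (v : 'rV_(1 + d))); rewrite /R -mx11_scalar hsubmxK.
have RZ a v q : R a v *~ q = R (q * a) (q *: v).
  by rewrite -scaler_int intz /R scale_row_mx scale_scalar_mx.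
pose S a := exists v', H (R a v').
pose H' v := H (R 0 v).
have hS : addcl S.
  split; first by exists 0; rewrite /R raddf0 row_mx0; case: hH.
  by move=> a b [v Hv] [w Hw]; exists (v - w); rewrite -RB; apply: (proj2 hH).
have hH' : addcl H'.
  split; first by rewrite /H' /R raddf0 row_mx0; case: hH.
  by move=> v w Hv Hw; rewrite /H' -[0](subrr 0) -RB; apply: (proj2 hH).
have [|g [g0 [h Hh] gdiv]] := @int_subgroup S N N0 hS.
  by exists 0; have := HN (R 1 0); rewrite RMn mul0rn natz.
have [|B' [dB' B'H B'i]] := IH H' hH'.
  by move=> v; rewrite /H' -[0](mul0rn _ N) -RMn.
pose B : 'M[int]_(1 + d) := block_mx g%:Z%:M h 0 B'.
have dB : \det B = g%:Z * \det B' by rewrite /B det_ublock det_scalar1.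
have RmB q c : R q c *m B = R (q * g%:Z) (q *: h + c *m B').
  by rewrite /R /B mul_row_block mulmx0 addr0 -scalar_mxM mul_scalar_mx.
have redH a v : H (R a v) -> exists q c, R a v = R q c *m B.
  move=> HRav; have /dvdzP[q Dq] : (g%:Z %| a)%Z by apply: gdiv; exists v.
  have /B'H[c Dc] : H' (v - q *: h).
    rewrite /H'; have -> : R 0 (v - q *: h) = R a v - R g%:Z h *~ q.
      by rewrite RZ RB Dq subrr.
    by apply: (proj2 hH) => //; apply: addclMz.
  by exists q, c; rewrite RmB -Dc addrC subrK Dq.
exists B; split.
- by rewrite dB mulf_neq0 // -lt0n.
- move=> v; have [a [w ->]] := RE v; split; first by move=> /redH[q [c ->]]; exists (R q c).
  case=> c0; have [q [c ->]] := RE c0; rewrite RmB => ->.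
  have -> : R (q * g%:Z) (q *: h + c *m B') = R g%:Z h *~ q - R 0 (- (c *m B')).
    by rewrite RZ RB subr0 opprK.
  apply: (proj2 hH); first exact: addclMz.
  by apply/B'H; exists (- c); rewrite mulNmx.
- rewrite dB abszM absz_nat; case: B'i => r [r1 r2 r3].
  rewrite -{1}[g]card_ord -{1}[`|\det B'|%N]card_ord -card_prod.
  apply: (@idx_fin _ _ (fun p : 'I_g * 'I_(`|\det B'|%N) => R (p.1 : nat)%:Z (r p.2))) => //.
    move=> [i j] [i' j'] /=; rewrite RB => h1.
    have : (g%:Z %| (i : nat)%:Z - (i' : nat)%:Z)%Z by apply: gdiv; eexists; exact: h1.
    rewrite -eqz_mod_dvd !modz_nat eqz_nat !modn_small // => /eqP ii.
    have {}ii : i = i' by apply: val_inj.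
    by rewrite -ii subrr in h1; move: h1 => /r2 ->; rewrite ii.
  move=> v _; have [a [w ->]] := RE v.
  have m0 : 0 <= (a %% g%:Z)%Z < g%:Z by rewrite modz_ge0 ?ltz_pmod // -?lt0n // gt_eqF.
  have [i Di] : exists i : 'I_g, (a %% g%:Z)%Z = (i : nat)%:Z.
    by case: (a %% g%:Z)%Z m0 => // m; rewrite ltz_nat => mg; exists (Ordinal mg).
  have [j Hj] := r3 (w - (a %/ g%:Z)%Z *: h) I.
  exists (i, j); rewrite RB /=.
  have -> : R (a - (i : nat)%:Z) (w - r j) = R g%:Z h *~ (a %/ g%:Z)%Z - R 0 (- (w - (a %/ g%:Z)%Z *: h - r j)).
    rewrite RZ RB subr0; congr (R _ _); first by rewrite {1}(divz_eq a g) -Di addrK.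
    by rewrite opprK addrAC [RHS]addrC subrK.
  apply: (proj2 hH); [exact: addclMz | rewrite -[R _ (- _)]opprK; apply: addclN => //].
  rewrite (_ : - R 0 _ = R 0 (w - (a %/ g)%Z *: h - r j)); first exact: Hj.
  by rewrite -[LHS]sub0r (_ : 0 = R 0 0) ?RB ?subrr ?sub0r ?opprK // /R raddf0 row_mx0.
Qed.

(** [hnf] gives a matrix B with the same row lattice and index |det B|; each of A and B is an
    integral multiple of the other, so the determinants divide each other. *)
Lemma idx_mxlat d (A : 'M[int]_d) : \det A != 0 -> idx (@allv d) (mxlat A) `|\det A|%N.
Proof.
move=> dA; have [||B [dB BH Bi]] := @hnf d (mxlat A) `|\det A|%N _ (mxlat_addcl A).
- by rewrite absz_gt0.
- move=> v; exists (v *m (sgz (\det A) *: \adj A)).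
  rewrite -scalemxAr -scalemxAl -mulmxA mul_adj_mx mul_mx_scalar scalerA.
  by rewrite -scaler_nat; congr (_ *: _); rewrite -abszEsg natz.
- suff -> : `|\det A|%N = `|\det B|%N by [].
  have [U DU] : exists U : 'M_d, A = U *m B.
    have h i : mxlat B (row i A) by apply/BH; exists (delta_mx 0 i); rewrite rowE.
    have [u Hu] := choice_ord h.
    by exists (\matrix_i u i); apply/row_matrixP => i; rewrite row_mul rowK.
  have [U' DU'] : exists U : 'M_d, B = U *m A.
    have h i : mxlat A (row i B) by apply/BH; exists (delta_mx 0 i); rewrite rowE.
    have [u Hu] := choice_ord h.
    by exists (\matrix_i u i); apply/row_matrixP => i; rewrite row_mul rowK.
  apply/eqP; rewrite eqn_dvd; apply/andP; split.
    by rewrite [X in (_ %| `|\det X|)%N]DU' det_mulmx abszM dvdn_mull.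
  by rewrite [X in (_ %| `|\det X|)%N]DU det_mulmx abszM dvdn_mull.
Qed.

(** The integral counterpart of [qdata]: [w] is a Z-basis of the ring of integers, so the squared
    determinant is the discriminant. *)
Definition nfdata (K : cset) (d : nat) (s : 'I_d -> aut) (w : 'I_d -> algC) :=
  [/\ is_subfield K, (forall i, OK K (w i)),
   (forall x, OK K x -> exists z : 'I_d -> int, x = \sum_i (z i)%:~R * w i),
   \det (\matrix_(i, j) s i (w j)) != 0
   & forall nu : aut, exists i, forall x, K x -> nu x = s i x].

Lemma intr_rat (z : int) : z%:~R = ratr z%:~R :> algC.
Proof. by rewrite rmorph_int. Qed.

Lemma OK_scale K x : is_subfield K -> K x -> exists2 N : nat, (0 < N)%N & OK K (N%:R * x).
Proof.
move=> sK Kx; have [N N0 h] := Aint_scale x; exists N => //; split=> //.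
by apply: sfM => //; apply: sfnat.
Qed.

Lemma nfdata_sub K d s w : @nfdata K d s w -> is_subfield K.
Proof. by case. Qed.

Lemma nfdata_qdata K d s w : @nfdata K d s w -> qdata K s w.
Proof.
case=> sK Ow spw dW cov; split=> //; first by move=> i; case: (Ow i).
move=> x Kx; have [N N0 /spw[z Dz]] := OK_scale sK Kx.
exists (fun i => (z i)%:~R / N%:R); have N0' : (N%:R : algC) != 0 by rewrite pnatr_eq0 -lt0n.
apply: (mulfI N0'); rewrite Dz mulr_sumr; apply: eq_bigr => i _.
by rewrite fmorph_div /= rmorph_int rmorph_nat mulrA [N%:R * _]mulrC divfK.
Qed.

Lemma det_sq_rat K d s w : @qdata K d s w -> (\det (\matrix_(i, j) s i (w j))) ^+ 2 \in Crat.
Proof.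
move=> D; apply: fixed_rat => nu; have [f [bf Hf]] := qdata_perm D nu.
have fi : injective f by apply: bij_inj.
rewrite rmorphXn /= -det_map_mx.
have -> : map_mx nu (\matrix_(i, j) s i (w j)) = row_perm (perm fi) (\matrix_(i, j) s i (w j)).
  apply/matrixP => i j; rewrite !mxE permE Hf //; by case: D.
by rewrite row_permE det_mulmx det_perm exprMn sqrr_sign mul1r.
Qed.

Lemma Aint_det d (A : 'M[algC]_d) : (forall i j, A i j \in Aint) -> \det A \in Aint.
Proof.
move=> hA; apply: rpred_sum => p _; apply: rpredM; last by apply: rpred_prod => i _.
by rewrite rpredX // rpredN1.
Qed.

Lemma OK_add K x y : is_subfield K -> OK K x -> OK K y -> OK K (x + y).
Proof. by move=> sK [? ?] [? ?]; split; [apply: sfD | apply: rpredD]. Qed.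
Lemma OK_sub K x y : is_subfield K -> OK K x -> OK K y -> OK K (x - y).
Proof. by move=> sK [? ?] [? ?]; split; [apply: sfB | apply: rpredB]. Qed.
Lemma OK_mul K x y : is_subfield K -> OK K x -> OK K y -> OK K (x * y).
Proof. by move=> sK [? ?] [? ?]; split; [apply: sfM | apply: rpredM]. Qed.
Lemma OK_int K (z : int) : is_subfield K -> OK K z%:~R.
Proof. by move=> sK; split; [apply: sfint | apply: Aint_int]. Qed.
Lemma OK_nat K (z : nat) : is_subfield K -> OK K z%:R.
Proof. by move=> sK; apply: (@OK_int _ z). Qed.
Lemma OK_addcl K : is_subfield K -> addcl (OK K).
Proof. by move=> sK; split; [exact: (OK_nat 0) | move=> x y; apply: OK_sub]. Qed.

Lemma rat_Aint_int (a : rat) : (ratr a : algC) \in Aint -> exists z : int, a = z%:~R.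
Proof.
move=> h; have /intrP [z Dz] := Cint_rat_Aint (Crat_rat a) h.
exists z; apply: (fmorph_inj (ratr : {rmorphism rat -> algC})).
exact: (etrans Dz (esym (rmorph_int _ _))).
Qed.

(** With N the absolute discriminant of a power basis, the ring of integers lies between Z[t] and
    N^(-1) Z[t], and [hnf] extracts a basis of it. *)
Lemma nfdata_exists K : number_field K -> exists d s w, @nfdata K d s w.
Proof.
move=> /number_field_Qadj[t At ->]; have [d [s [D _]]] := Qadj_data t.
exists d, s; set u := fun k : 'I_d => t ^+ k in D.
pose W := \matrix_(i, j) s i (u j).
have sK := Qadj_subfield t.
have uA i j : W i j \in Aint by rewrite mxE Aint_aut rpredX.
have dW : \det W != 0 by case: D.
have [z Dz] : exists z : int, (\det W) ^+ 2 = z%:~R.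
  have /CratP[a Da] := det_sq_rat D.
  have [|z Dz] := @rat_Aint_int a; first by rewrite -Da rpredX // Aint_det.
  by exists z; rewrite Da Dz rmorph_int.
have z0 : z != 0 by apply: contraNneq dW => z0; rewrite -sqrf_eq0 Dz z0.
pose N := `|z|%N; have N0 : (0 < N)%N by rewrite absz_gt0.
have N0' : (N%:R : algC) != 0 by rewrite pnatr_eq0 -lt0n.
pose ev (v : 'rV[int]_d) : algC := \sum_k (v 0 k)%:~R * (u k / N%:R).
have evB v v' : ev (v - v') = ev v - ev v'.
  by rewrite /ev -sumrB; apply: eq_bigr => k _; rewrite !mxE rmorphB mulrBl.
have ev0 : ev 0 = 0 by rewrite /ev big1 // => k _; rewrite mxE mul0r.
have [||B [dB BH _]] := @hnf d (fun v => OK (Qadj t) (ev v)) N N0.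
- split; first by rewrite ev0; exact: (OK_nat 0).
  by move=> v v'; rewrite evB; apply: OK_sub.
- move=> v; have -> : ev (v *+ N) = \sum_k (v 0 k)%:~R * u k.
    apply: eq_bigr => k _; have -> : (v *+ N) 0 k = v 0 k * N%:R.
      by rewrite mulmxnE mulr_natr.
    by rewrite rmorphM /= rmorph_nat -mulrA [N%:R * _]mulrC divfK.
  split; first by apply: sfsum => // k _; apply: sfM => //; [apply: sfint | case: D].
  by apply: rpred_sum => k _; apply: rpredM; [apply: Aint_int | apply: rpredX].
pose w i := ev (row i B).
have evM c : ev (c *m B) = \sum_i (c 0 i)%:~R * w i.
  rewrite /w /ev; under [RHS]eq_bigr => i _ do rewrite mulr_sumr.
  rewrite exchange_big /=; apply: eq_bigr => k _; rewrite mxE rmorph_sum mulr_suml.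
  by apply: eq_bigr => i _; rewrite mxE rmorphM mulrA.
exists w; split=> //.
- by move=> i; apply/BH; exists (delta_mx 0 i); rewrite rowE.
- move=> x [Kx Ax]; have [c Dc] : exists c : 'I_d -> rat, x = \sum_i ratr (c i) * u i by case: D => _ _ /(_ _ Kx).
  have uW : W \in unitmx by rewrite unitmxE unitfE.
  (* Cramer's rule: det(W)^2 c_i is rational and an algebraic integer, so N clears the denominator
     of c_i. *)
  have Ac i : exists b : int, ratr (c i) = b%:~R / N%:R :> algC.
    pose cc : 'cV[algC]_d := \col_k ratr (c k).
    pose xx : 'cV[algC]_d := \col_k s k x.
    have Wc : W *m cc = xx.
      apply/matrixP => k j; rewrite !mxE Dc rmorph_sum; apply: eq_bigr => l _.
      by rewrite !mxE rmorphM /= fmorph_rat mulrC.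
    have E : (\det W) *: cc = \adj W *m xx by rewrite -Wc mulmxA mul_adj_mx mul_scalar_mx.
    have A1 : (\det W) ^+ 2 * ratr (c i) \in Aint.
      have := congr1 (fun M : 'cV_d => M i 0) E; rewrite !mxE => E1.
      rewrite expr2 -mulrA E1; apply: rpredM; first exact: Aint_det.
      apply: rpred_sum => k _; rewrite !mxE; apply: rpredM; last by rewrite Aint_aut.
      by apply: rpredM; [rewrite rpredX // rpredN1 | apply: Aint_det => a b; rewrite !mxE Aint_aut rpredX].
    have [|b Hb] := @rat_Aint_int (z%:~R * c i); first by rewrite rmorphM /= rmorph_int -Dz.
    exists (b * sgz z); have := congr1 (ratr : rat -> algC) Hb; rewrite rmorphM /= !rmorph_int => E2.
    apply: (mulIf N0'); rewrite divfK // rmorphM /= -E2 [RHS]mulrAC -rmorphM /= mulrC; congr (_ * _).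
    by rewrite mulrC -abszEsg.
  have [b Hb] := choice_ord Ac.
  have Dx : x = ev (\row_i b i).
    by rewrite Dc; apply: eq_bigr => i _; rewrite mxE Hb mulrAC -mulrA.
  have [c' Dc'] : mxlat B (\row_i b i) by apply/BH; rewrite -Dx; split.
  by exists (fun i => c' 0 i); rewrite Dx Dc' evM.
- have -> : \matrix_(i, j) s i (w j) = N%:R^-1 *: (W *m (map_mx intr B)^T).
    apply/matrixP => i j; rewrite !mxE rmorph_sum mulr_sumr; apply: eq_bigr => k _.
    rewrite !mxE !rmorphM /= rmorph_int fmorphV rmorph_nat.
    by rewrite mulrC -mulrA mulrCA.
  rewrite detZ det_mulmx det_tr det_map_mx mulf_neq0 //.
    by rewrite expf_neq0 // invr_eq0.
  by rewrite mulf_neq0 // intr_eq0.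
- by case: D.
Qed.

Lemma Aint_integralOver x : x \in Aint <-> integralOver (intr : int -> algC) x.
Proof.
split; last first.
  by case=> p mp rp; apply: (root_monic_Aint rp); rewrite ?monic_map //; apply/polyOverP => i; rewrite coef_map /= intr_int.
move=> /floorpP[p Dp]; exists p; last by rewrite -Dp root_minCpoly.
have := minCpoly_monic x; rewrite Dp !monicE lead_coef_map_inj //; last exact: intr_inj.
by rewrite -[1]/(1%:~R) eqr_int.
Qed.

Lemma lead_root_Aint (f : {poly algC}) r : f \is a polyOver Aint -> root f r -> lead_coef f * r \in Aint.
Proof.
move=> Af rf; have [->|f0] := eqVneq f 0; first by rewrite lead_coef0 mul0r rpred0.
set l := lead_coef f; pose m := (size f).-1.
have szf : size f = m.+1 by rewrite /m prednK // size_poly_gt0.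
have lm : f`_m = l by rewrite /l lead_coefE.
case: (posnP m) => [m0|m_gt0].
  move: rf; rewrite (size1_polyC (_ : size f <= 1)%N) ?szf ?m0 // rootC => /eqP f00.
  by move: f0; rewrite -lead_coef_eq0 lead_coefE szf m0 /= f00 eqxx.
pose h : {poly algC} := \poly_(i < m.+1) (if i == m then 1 else f`_i * l ^+ (m.-1 - i)).
have mh : h \is monic by rewrite monicE lead_coef_poly ?eqxx ?oner_eq0.
have Al : l \in Aint by rewrite -lm; apply: (polyOverP Af).
apply/Aint_integralOver; apply: (integral_root_monic mh).
  apply/rootP; rewrite horner_poly.
  transitivity (l ^+ m.-1 * f.[r]); last by rewrite (rootP rf) mulr0.
  rewrite horner_coef szf mulr_sumr; apply: eq_bigr => i _; rewrite exprMn; case: eqP => [Di|/eqP Di].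
    by rewrite Di lm mul1r -{1}(prednK m_gt0) exprSr mulrA.
  have lin : (i <= m.-1)%N by rewrite -ltnS prednK // ltn_neqAle Di -ltnS ltn_ord.
  by rewrite -[X in _ = _ ^+ X * _](subnK lin) exprD (mulrC f`_i) mulrACA.
move=> c /(nthP 0) [i _ <-]; apply/Aint_integralOver; rewrite coef_poly; case: ifP => _; last exact: rpred0.
by case: ifP => _; [exact: rpred1 | apply: rpredM; [exact: (polyOverP Af) | exact: rpredX]].
Qed.

(** The leading coefficient l of q and, by [lead_root_Aint], the product l r are integral, so the
    leading term of q can be removed and the degree drops. *)
Lemma Aint_div_root (q : {poly algC}) r : q * ('X - r%:P) \is a polyOver Aint -> q \is a polyOver Aint.
Proof.
move: {2}(size q) (leqnn (size q)) => n; elim: n q => [|n IH] q.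
  by rewrite leqn0 size_poly_eq0 => /eqP ->; rewrite rpred0.
move=> szq Af; have [->|q0] := eqVneq q 0; first exact: rpred0.
set f := q * _ in Af; pose l := lead_coef q; pose m := (size q).-1.
have lf : lead_coef f = l by rewrite lead_coef_Mmonic ?monicXsubC.
have Alr : l * r \in Aint.
  by rewrite -lf; apply: lead_root_Aint => //; rewrite rootM root_XsubC eqxx orbT.
have Al : l \in Aint by rewrite -lf lead_coefE; apply: (polyOverP Af).
have szm : size q = m.+1 by rewrite /m prednK // size_poly_gt0.
pose q' := q - l *: 'X^m.
suff Aq' : q' \is a polyOver Aint.
  by rewrite -(subrK (l *: 'X^m) q); apply: rpredD => //; apply: polyOverZ => //; apply: rpredX; apply: polyOverX.
apply: IH.
  apply/leq_sizeP => j; rewrite coefB coefZ coefXn.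
  have := szq; rewrite szm ltnS => mn nj; have := leq_trans mn nj; rewrite leq_eqVlt => /orP[/eqP <-|mj].
    by rewrite eqxx mulr1 /l lead_coefE szm subrr.
  by rewrite (gtn_eqF mj) mulr0 subr0 nth_default // szm.
have -> : q' * ('X - r%:P) = f - (l *: 'X^(m.+1) - (l * r) *: 'X^m).
  rewrite mulrBl; congr (_ - _); rewrite mulrBr exprSr -scalerAl; congr (_ - _).
  by rewrite mulrC mul_polyC scalerA mulrC.
by rewrite rpredB // rpredB // polyOverZ // rpredX // polyOverX.
Qed.

(** Dedekind's Prague theorem, the form of Gauss's lemma on which the invertibility of ideals rests.
    A linear factor X - r is split off from f; the induction hypothesis is applied to the remaining
    factor f1 both with g (X - r) and, by [Aint_div_root], with g. *)
Lemma prague (f g : {poly algC}) : f * g \is a polyOver Aint -> forall i j, f`_i * g`_j \in Aint.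
Proof.
move: (size f).-1 (leqSpred (size f)) => n; elim: n f g => [|n IH] f g szf Afg i j.
  move: Afg; rewrite (size1_polyC szf) mul_polyC => /polyOverP /(_ j); rewrite coefZ coefC.
  by case: eqP => // _ _; rewrite mul0r rpred0.
have [sz1|sz1] := leqP (size f) 1.
  move: Afg; rewrite (size1_polyC sz1) mul_polyC => /polyOverP /(_ j); rewrite coefZ coefC.
  by case: eqP => // _ _; rewrite mul0r rpred0.
have [|r rf] := closed_rootP f _; first by rewrite eqn_leq leqNgt sz1.
have /factor_theorem [f1 Df] := rf.
have f0 : f != 0 by rewrite -size_poly_gt0 ltnW.
have f10 : f1 != 0 by apply: contraNneq f0 => f10; rewrite Df f10 mul0r.
have szf1 : (size f1 <= n.+1)%N.
  by move: szf; rewrite Df size_Mmonic ?monicXsubC // size_XsubC addn2 ltnS.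
have HA a b : f1`_a * (g * ('X - r%:P))`_b \in Aint.
  by apply: IH => //; move: Afg; rewrite Df -mulrA (mulrC g).
have HB a b : f1`_a * g`_b \in Aint.
  by apply: IH => //; apply: (@Aint_div_root _ r); move: Afg; rewrite Df mulrAC.
have HX (p q : {poly algC}) a b : (forall a b, p`_a * q`_b \in Aint) -> (p * 'X)`_a * q`_b \in Aint.
  by move=> h; rewrite coefMX; case: eqP => _; rewrite ?mul0r ?rpred0.
rewrite Df mulrBr coefB coefMC mulrBl rpredB //; first exact: HX.
have := HA i j; rewrite mulrBr coefB coefMC mulrBr => h.
rewrite -mulrA [r * _]mulrC -[X in X \in _](subKr (f1`_i * (g * 'X)`_j)) rpredB //.
by rewrite mulrC; apply: HX => a b; rewrite mulrC.
Qed.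

(** Classical equality turns lists of ideals and of fields into lists over an [eqType], so
    multiplicities and membership make sense for them. *)
Definition cset_eqb (A B : cset) : bool := if excluded_middle_informative (A = B) then true else false.
Lemma cset_eqP : Equality.axiom cset_eqb.
Proof. by move=> A B; rewrite /cset_eqb; case: excluded_middle_informative => h; constructor. Qed.
HB.instance Definition _ := hasDecEq.Build cset cset_eqP.

(** * Ideals *)

Section IProd.
Implicit Types I J M : cset.
Lemma iprod_mul I J a b : I a -> J b -> iprod I J (a * b).
Proof. by move=> Ia Jb; exists 1%N, (fun _ => a), (fun _ => b); split => //; rewrite big_ord1. Qed.
Lemma iprod0 I J : iprod I J 0.
Proof. by exists 0%N, (fun _ => 0), (fun _ => 0); split; [case | rewrite big_ord0]. Qed.
Lemma iprod_add I J x y : iprod I J x -> iprod I J y -> iprod I J (x + y).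
Proof.
move=> [k [a [b [ab ->]]]] [l [a' [b' [ab' ->]]]].
exists (k + l)%N, (fun i => match split i with inl j => a j | inr j => a' j end).
exists (fun i => match split i with inl j => b j | inr j => b' j end); split.
  by move=> i; case: (split i).
rewrite big_split_ord /=; congr (_ + _); apply: eq_bigr => i _.
  by rewrite (unsplitK (inl i)).
by rewrite (unsplitK (inr i)).
Qed.
Lemma iprod_min I J C : addcl C -> (forall a b, I a -> J b -> C (a * b)) -> forall x, iprod I J x -> C x.
Proof. by move=> hC h x [k [a [b [ab ->]]]]; apply: addcl_sum => // i _; apply: h; case: (ab i). Qed.
Lemma iprod_addcl I J : addcl I -> addcl (iprod I J).
Proof.
move=> hI; split; first exact: iprod0.
move=> x y hx [k [a [b [ab ->]]]]; apply: iprod_add => //.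
exists k, (fun i => - a i), b; split; last by rewrite -sumrN; apply: eq_bigr => i _; rewrite mulNr.
by move=> i; have [? ?] := ab i; split => //; apply: addclN.
Qed.
Lemma iprodC I J : iprod I J = iprod J I.
Proof.
by apply: cset_ext => x; split => -[k [a [b [ab ->]]]]; exists k, b, a; split;
 [by move=> i; case: (ab i) | by apply: eq_bigr => i _; rewrite mulrC | by move=> i; case: (ab i) | by apply: eq_bigr => i _; rewrite mulrC].
Qed.
Lemma iprodA I J M : addcl I -> addcl J -> addcl M -> iprod I (iprod J M) = iprod (iprod I J) M.
Proof.
move=> hI hJ hM; apply: cset_ext => x; split.
  apply: iprod_min; first by apply: iprod_addcl; apply: iprod_addcl.
  move=> a y Ia [k [b [c [bc ->]]]]; rewrite mulr_sumr; apply: addcl_sum; first by apply: iprod_addcl; apply: iprod_addcl.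
  by move=> i _; rewrite mulrA; have [? ?] := bc i; apply: iprod_mul => //; apply: iprod_mul.
apply: iprod_min; first exact: iprod_addcl.
move=> y c [k [a [b [ab ->]]]] Mc; rewrite mulr_suml; apply: addcl_sum; first exact: iprod_addcl.
by move=> i _; rewrite -mulrA; have [? ?] := ab i; apply: iprod_mul => //; apply: iprod_mul.
Qed.
Lemma iprod_mono I J I' J' : (forall x, I x -> I' x) -> (forall x, J x -> J' x) -> forall x, iprod I J x -> iprod I' J' x.
Proof.
move=> h h' x [k [a [b [ab ->]]]]; exists k, a, b; split => // i; have [? ?] := ab i; split; auto.
Qed.
End IProd.

Section Ideals.
Variables (K : cset) (sK : is_subfield K).
Implicit Types I J : cset.
Lemma idsub I x : is_ideal K I -> I x -> OK K x. Proof. by case=> h _; apply: h. Qed.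
Lemma idmul I r x : is_ideal K I -> OK K r -> I x -> I (r * x). Proof. by case=> _ [_ [_ h]]; apply: h. Qed.
Lemma idmulr I r x : is_ideal K I -> OK K r -> I x -> I (x * r). Proof. by rewrite mulrC; apply: idmul. Qed.
Lemma id_addcl I : is_ideal K I -> addcl I.
Proof.
case=> h [h0 [hD hM]]; split => // x y Ix Iy; apply: hD => //; rewrite -mulN1r; apply: hM => //.
by rewrite -[-1]/((-1)%:~R); apply: OK_int.
Qed.
Lemma OK_ideal : is_ideal K (OK K).
Proof. by split=> //; split; [exact: (OK_nat 0)|split; [move=> *; apply: OK_add|move=> *; apply: OK_mul]]. Qed.
Lemma OK1 : OK K 1. Proof. exact: (OK_nat 1). Qed.
Lemma mk_ideal I : (forall x, I x -> OK K x) -> addcl I -> (forall r x, OK K r -> I x -> I (r * x)) -> is_ideal K I.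
Proof. by move=> h1 h2 h3; split => //; split; [case: h2 | split => //; move=> *; apply: addclD]. Qed.
Lemma iprod_ideal I J : is_ideal K I -> is_ideal K J -> is_ideal K (iprod I J).
Proof.
move=> hI hJ; apply: mk_ideal.
- apply: iprod_min; first exact: OK_addcl.
  by move=> a b Ia Jb; apply: OK_mul => //; [apply: idsub hI _ | apply: idsub hJ _].
- by apply: iprod_addcl; apply: id_addcl.
- move=> r x Kr [k [a [b [ab ->]]]]; rewrite mulr_sumr.
  apply: addcl_sum; first by apply: iprod_addcl; apply: id_addcl.
  by move=> i _; rewrite mulrA; have [? ?] := ab i; apply: iprod_mul => //; apply: idmul.
Qed.
Lemma iprod_OK I : is_ideal K I -> iprod I (OK K) = I.
Proof.
move=> hI; apply: cset_ext => x; split.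
  by apply: iprod_min; [apply: id_addcl | move=> a b Ia Kb; apply: idmulr].
by move=> Ix; rewrite -[x]mulr1; apply: iprod_mul => //; apply: OK1.
Qed.
Lemma OK_iprod I : is_ideal K I -> iprod (OK K) I = I.
Proof. by rewrite iprodC; apply: iprod_OK. Qed.
Lemma iprodAK I J M : is_ideal K I -> is_ideal K J -> is_ideal K M -> iprod I (iprod J M) = iprod (iprod I J) M.
Proof. by move=> *; apply: iprodA; apply: id_addcl. Qed.
Lemma iprod_subl I J x : is_ideal K I -> is_ideal K J -> iprod I J x -> I x.
Proof. by move=> hI hJ; move: x; apply: iprod_min; [apply: id_addcl | move=> a b Ia Jb; apply: idmulr => //; apply: idsub hJ _]. Qed.
Lemma principal_ideal a : OK K a -> is_ideal K (principal K a).
Proof.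
move=> Ka; apply: mk_ideal.
- by move=> _ [r [Kr ->]]; apply: OK_mul.
- split; first by exists 0; split; [exact: (OK_nat 0) | rewrite mulr0].
  by move=> _ _ [r [Kr ->]] [q [Kq ->]]; exists (r - q); split; [apply: OK_sub | rewrite mulrBr].
- by move=> r _ Kr [q [Kq ->]]; exists (r * q); split; [apply: OK_mul | rewrite mulrCA].
Qed.
Lemma principal_mem a : principal K a a.
Proof. by exists 1; split; [exact: OK1 | rewrite mulr1]. Qed.
Lemma principal_nz a : OK K a -> a != 0 -> nonzero_ideal K (principal K a).
Proof. by move=> Ka a0; split; [apply: principal_ideal | exists a; split => //; apply: principal_mem]. Qed.
Lemma iprod_principal a I x : is_ideal K I -> iprod (principal K a) I x <-> exists y, I y /\ x = a * y.
Proof.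
move=> hI; split.
  move: x; apply: iprod_min.
    split; first by exists 0; split; [case: (id_addcl hI) | rewrite mulr0].
    by move=> _ _ [y [Iy ->]] [z [Iz ->]]; exists (y - z); split; [apply: (proj2 (id_addcl hI)) | rewrite mulrBr].
  by move=> _ b [r [Kr ->]] Ib; exists (r * b); split; [apply: idmul | rewrite mulrA].
by move=> [y [Iy ->]]; apply: iprod_mul => //; apply: principal_mem.
Qed.
Lemma principalM a b : OK K a -> OK K b -> iprod (principal K a) (principal K b) = principal K (a * b).
Proof.
move=> Ka Kb; apply: cset_ext => x; rewrite iprod_principal; last exact: principal_ideal.
split; first by move=> [_ [[r [Kr ->]] ->]]; exists r; rewrite mulrA.
by move=> [r [Kr ->]]; exists (b * r); split; [exists r | rewrite mulrA].
Qed.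
Lemma principal1 : principal K 1 = OK K.
Proof.
by apply: cset_ext => x; split; [move=> [r [Kr ->]]; rewrite mul1r | move=> Kx; exists x; rewrite mul1r].
Qed.
Lemma iprod_principal_inj a I J : a != 0 -> is_ideal K I -> is_ideal K J ->
  iprod (principal K a) I = iprod (principal K a) J -> I = J.
Proof.
move=> a0 hI hJ E; apply: cset_ext => x.
have := congr1 (fun S : cset => S (a * x)) E => E1.
split=> hx.
  have : iprod (principal K a) J (a * x) by rewrite -E1; apply/iprod_principal => //; exists x.
  by case/iprod_principal => // y [Jy /(mulfI a0) ->].
have : iprod (principal K a) I (a * x) by rewrite E1; apply/iprod_principal => //; exists x.
by case/iprod_principal => // y [Jy /(mulfI a0) ->].
Qed.
Lemma nz_iprod I J : nonzero_ideal K I -> nonzero_ideal K J -> nonzero_ideal K (iprod I J).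
Proof.
move=> [hI [x [Ix x0]]] [hJ [y [Jy y0]]]; split; first exact: iprod_ideal.
by exists (x * y); split; [apply: iprod_mul | rewrite mulf_neq0].
Qed.
Lemma nz_OK : nonzero_ideal K (OK K).
Proof. by split; [exact: OK_ideal | exists 1; split; [exact: OK1 | exact: oner_neq0]]. Qed.
Lemma ideal_1 I : is_ideal K I -> I 1 -> I = OK K.
Proof.
move=> hI I1; apply: cset_ext => x; split; first exact: idsub.
by move=> Kx; rewrite -[x]mulr1; apply: idmul.
Qed.
Definition isum I J : cset := fun x => exists a b, [/\ I a, J b & x = a + b].
Lemma isum_ideal I J : is_ideal K I -> is_ideal K J -> is_ideal K (isum I J).
Proof.
move=> hI hJ; apply: mk_ideal.
- by move=> _ [a [b [Ia Jb ->]]]; apply: OK_add => //; [apply: idsub hI _ | apply: idsub hJ _].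
- have [aI aJ] := (id_addcl hI, id_addcl hJ).
  split; first by exists 0, 0; split; [case: aI | case: aJ | rewrite addr0].
  move=> _ _ [a [b [Ia Jb ->]]] [a' [b' [Ia' Jb' ->]]]; exists (a - a'), (b - b').
  by split; [apply: (proj2 aI) | apply: (proj2 aJ) | rewrite opprD addrACA].
- move=> r _ Kr [a [b [Ia Jb ->]]]; exists (r * a), (r * b).
  by split; [apply: idmul | apply: idmul | rewrite mulrDr].
Qed.
Lemma isuml I J x : is_ideal K J -> I x -> isum I J x.
Proof. by move=> /id_addcl[J0 _] Ix; exists x, 0; rewrite addr0. Qed.
Lemma isumr I J x : is_ideal K I -> J x -> isum I J x.
Proof. by move=> /id_addcl[J0 _] Ix; exists 0, x; rewrite add0r. Qed.
End Ideals.

Section Dedekind.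
Variables (K : cset) (d : nat) (s : 'I_d -> aut) (w : 'I_d -> algC).
Hypothesis D : nfdata K s w.
Let sK := nfdata_sub D.
Let Dq : qdata K s w := nfdata_qdata D.
Implicit Types I J : cset.

Definition ev (v : 'rV[int]_d) : algC := \sum_i (v 0 i)%:~R * w i.
Lemma evB v v' : ev (v - v') = ev v - ev v'.
Proof. by rewrite /ev -sumrB; apply: eq_bigr => k _; rewrite !mxE rmorphB mulrBl. Qed.
Lemma ev0 : ev 0 = 0.
Proof. by rewrite /ev big1 // => k _; rewrite mxE mul0r. Qed.
Lemma evMn v n : ev (v *+ n) = n%:R * ev v.
Proof.
rewrite /ev mulr_sumr; apply: eq_bigr => k _.
by rewrite mulmxnE rmorphMn /= -mulr_natl mulrA.
Qed.
Lemma OK_ev x : OK K x <-> exists v, x = ev v.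
Proof.
split.
  case: D => _ _ h _ _ /h[z ->]; exists (\row_i z i).
  by apply: eq_bigr => i _; rewrite mxE.
move=> [v ->]; apply: addcl_sum; first exact: OK_addcl.
by move=> i _; apply: OK_mul => //; [apply: OK_int | case: D].
Qed.
Lemma evK v : OK K (ev v). Proof. by apply/OK_ev; exists v. Qed.
Lemma ev_inj : injective ev.
Proof.
move=> v v' E; apply/rowP => i; apply/eqP; rewrite -subr_eq0.
have := @qdata_indep K d s w Dq (fun i => (v 0 i - v' 0 i)%:~R) _ i.
move=> /(_ _)/eqP; rewrite intr_eq0; apply.
transitivity (ev (v - v')); last by rewrite evB E subrr.
by apply: eq_bigr => j _; rewrite rmorph_int !mxE.
Qed.

Definition idi := proj1_sig (constructive_indefinite_description _ (let: And5 _ _ _ _ h := Dq in h idfun)).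
Lemma idiP x : K x -> s idi x = x.
Proof. by move=> Kx; rewrite /idi; case: constructive_indefinite_description => i /= h; rewrite -h. Qed.

Definition nm (x : algC) := \prod_i s i x.
Lemma nm_nat n : nm n%:R = n%:R ^+ d.
Proof. by rewrite /nm (eq_bigr (fun _ => n%:R)) ?prodr_const ?card_ord // => i _; rewrite rmorph_nat. Qed.
Lemma nm_eq0 x : (nm x == 0) = (x == 0).
Proof.
apply/idP/eqP => [|->]; first by move/prodf_eq0 => [i _]; rewrite fmorph_eq0 => /eqP.
by rewrite /nm (bigD1 idi) //= rmorph0 mul0r.
Qed.
Lemma nm_rat x : K x -> nm x \in Crat.
Proof.
move=> Kx; apply: fixed_rat => nu; rewrite rmorph_prod.
have [f [bf Hf]] := qdata_perm Dq nu.
rewrite [RHS](reindex f) /=; last by apply: onW_bij.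
by apply: eq_bigr => i _; apply: Hf.
Qed.
Lemma nm_int x : OK K x -> exists z : int, nm x = z%:~R.
Proof.
move=> [Kx Ax]; apply/intrP/Cint_rat_Aint; first exact: nm_rat.
by apply: rpred_prod => i _; rewrite Aint_aut.
Qed.
Definition nmn (x : algC) : nat := `|Num.floor (nm x)|%N.
Lemma nmnE x : OK K x -> (nmn x)%:R = `|nm x|.
Proof.
by move=> /nm_int[z Dz]; rewrite /nmn Dz intrKfloor -intr_norm -abszE.
Qed.
Lemma nmn_gt0 x : OK K x -> x != 0 -> (0 < nmn x)%N.
Proof.
move=> Kx x0; rewrite lt0n; apply: contra x0 => /eqP n0.
by rewrite -nm_eq0 -normr_eq0 -nmnE // n0.
Qed.
Lemma nm_div x : OK K x -> exists y, OK K y /\ x * y = nm x.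
Proof.
move=> [Kx Ax]; have [x0|x0] := eqVneq x 0.
  by exists 0; split; [exact: (OK_nat 0) | apply/esym/eqP; rewrite mulr0 nm_eq0 x0].
exists (nm x / x); split; last by rewrite mulrC divfK.
split; first by apply: sfdiv => //; apply: sfCrat => //; apply: nm_rat.
rewrite /nm (bigD1 idi) //= (idiP Kx) mulrAC mulfV // mul1r.
by apply: rpred_prod => i _; rewrite Aint_aut.
Qed.
Lemma nmn_mem I x : is_ideal K I -> I x -> I (nmn x)%:R.
Proof.
move=> hI Ix; have Ox := idsub hI Ix; have [y [Oy E]] := nm_div Ox.
have Inm : I (nm x) by rewrite -E; apply: (idmulr hI).
have [z Dz] := nm_int Ox; rewrite nmnE // Dz.
have [h|h] := lerP 0 z; first by rewrite ger0_norm ?ler0z // -Dz.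
by rewrite ltr0_norm ?ltrz0 // -Dz; apply: addclN => //; apply: id_addcl hI.
Qed.
Lemma nz_pos I : nonzero_ideal K I -> exists2 n : nat, (0 < n)%N & I n%:R.
Proof.
move=> [hI [x [Ix x0]]]; exists (nmn x); last exact: nmn_mem.
by apply: nmn_gt0 => //; apply: idsub hI _.
Qed.

Lemma lat_basis I (n : nat) : (0 < n)%N -> addcl I -> (forall x, I x -> OK K x) -> (forall x, OK K x -> I (n%:R * x)) ->
  exists B : 'M[int]_d, [/\ \det B != 0, (forall x, I x <-> exists c : 'rV_d, x = ev (c *m B)) & idx (OK K) I `|\det B|%N].
Proof.
move=> n0 aI IO hn.
have [||B [dB BH Bi]] := @hnf d (fun v => I (ev v)) n n0.
- by split; [rewrite ev0; case: aI | move=> v v' h h'; rewrite evB; apply: (proj2 aI)].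
- by move=> v; rewrite evMn; apply: hn; apply: evK.
exists B; split => //.
  move=> x; split; first by move=> /[dup] /IO /OK_ev [v ->] /BH[c ->]; exists c.
  by move=> [c ->]; apply/BH; exists c.
case: Bi => r [r1 r2 r3]; exists (fun i => ev (r i)); split.
- by move=> i; apply: evK.
- by move=> i j; rewrite -evB; apply: r2.
- by move=> x /OK_ev[v ->]; have [i] := r3 v Logic.I; rewrite evB; exists i.
Qed.

Lemma ideal_basis I : nonzero_ideal K I ->
  exists B : 'M[int]_d, [/\ \det B != 0, (forall x, I x <-> exists c : 'rV_d, x = ev (c *m B)) & idx (OK K) I `|\det B|%N].
Proof.
move=> nI; have [n n0 In] := nz_pos nI; have [hI _] := nI.
apply: (lat_basis n0); [exact: (id_addcl sK hI) | by move=> x; apply: (idsub hI) | by move=> x Ox; apply: (idmulr hI)].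
Qed.

Definition normI I : nat := epsilon (inhabits 0%N) (idx (OK K) I).
Lemma normIP I : nonzero_ideal K I -> idx (OK K) I (normI I).
Proof. by move=> /ideal_basis[B [_ _ h]]; apply: (epsilon_spec (inhabits 0%N)); exists `|\det B|%N. Qed.
Lemma normI_uniq I k : addcl I -> idx (OK K) I k -> normI I = k.
Proof.
move=> aI h; apply: (idx_uniq aI _ h).
exact: (@epsilon_spec nat (inhabits 0%N) (idx (OK K) I) (ex_intro _ k h)).
Qed.
Lemma normI_gt0 I : nonzero_ideal K I -> (0 < normI I)%N.
Proof. by move/normIP; apply: idx_gt0; apply: (OK_nat 0). Qed.
Lemma normI_OK : normI (OK K) = 1%N.
Proof. by apply: normI_uniq; [exact: OK_addcl | apply: idx_refl; exact: OK_addcl]. Qed.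

(** Multiplication by [a] in the basis [w] is conjugate, through the matrix W of embeddings, to the
    diagonal matrix of the conjugates of [a]; its determinant is therefore the norm. *)
Lemma normI_principal a : OK K a -> a != 0 -> normI (principal K a) = nmn a.
Proof.
move=> Oa a0.
have [A HA] : exists A : 'I_d -> 'rV[int]_d, forall i, a * w i = ev (A i).
  by apply: (choice_ord (P := fun i (v : 'rV[int]_d) => a * w i = ev v)) => i; apply/OK_ev/OK_mul => //; case: D.
pose B := \matrix_i A i.
have evM c : ev (c *m B) = a * ev c.
  rewrite /ev mulr_sumr; under [RHS]eq_bigr => i _ do rewrite mulrCA HA /ev mulr_sumr.
  rewrite exchange_big /=; apply: eq_bigr => k _; rewrite mxE rmorph_sum mulr_suml.
  by apply: eq_bigr => i _; rewrite !mxE rmorphM mulrA.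
pose W := \matrix_(i, j) s i (w j).
have dW : \det W != 0 by case: D.
have detB : (\det B)%:~R = nm a.
  have E : diag_mx (\row_i s i a) *m W = W *m (map_mx intr B)^T.
    rewrite mul_diag_mx; apply/matrixP => i j; rewrite !mxE -rmorphM /= HA rmorph_sum.
    by apply: eq_bigr => k _; rewrite !mxE rmorphM /= rmorph_int mulrC.
  have := congr1 determinant E; rewrite !det_mulmx det_diag det_tr det_map_mx mulrC => /(mulfI dW) <-.
  by apply: eq_bigr => i _; rewrite mxE.
have dB : \det B != 0 by rewrite -(intr_eq0 algC) detB nm_eq0.
apply: normI_uniq; first by apply: (@id_addcl K) => //; apply: principal_ideal.
have -> : nmn a = `|\det B|%N by rewrite /nmn -detB intrKfloor.
case: (idx_mxlat dB) => r [r1 r2 r3]; exists (fun i => ev (r i)).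
have L v : principal K a (ev v) <-> mxlat B v.
  split; first by move=> [x [/OK_ev[c ->]]]; rewrite -evM => /ev_inj ->; exists c.
  by move=> [c ->]; rewrite evM; exists (ev c); split => //; apply: evK.
split.
- by move=> i; apply: evK.
- by move=> i j; rewrite -evB => /L; apply: r2.
- by move=> x /OK_ev[v ->]; have [i] := r3 v Logic.I; exists i; rewrite -evB; apply/L.
Qed.

Lemma fixed_prod_poly (p : {poly algC}) : (forall i, K p`_i) ->
  exists q : {poly algC}, (forall i, q`_i \in Crat) /\ q = \prod_i map_poly (s i) p.
Proof.
move=> Kp; exists (\prod_i map_poly (s i) p); split => // k; apply: fixed_rat => nu.
rewrite -coef_map; suff -> : map_poly nu (\prod_i map_poly (s i) p) = \prod_i map_poly (s i) p by [].
rewrite rmorph_prod.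
have [f [bf Hf]] := qdata_perm Dq nu.
rewrite [RHS](reindex f) /=; last by apply: onW_bij.
by apply: eq_bigr => i _; rewrite -map_poly_comp; apply/polyP => l; rewrite !coef_map /= Hf.
Qed.

(** Hurwitz's argument: f has a Z-basis of I as coefficients, g is the product of its other
    conjugates, and J is generated by the coefficients of g. The coefficients of f g are rational
    integers in I J, hence multiples of the positive generator c of the integers in I J, and
    [prague] applied to f g / c shows that all products of coefficients are divisible by c. *)
Lemma ideal_inv I : nonzero_ideal K I -> exists J (c : nat), [/\ nonzero_ideal K J, (0 < c)%N & iprod I J = principal K c%:R].
Proof.
move=> nI; have [hI _] := nI; have [B [dB HB _]] := ideal_basis nI.
pose f : {poly algC} := \poly_(i < d) (if insub i is Some j then ev (row j B) else 0).
have fE (i : 'I_d) : f`_i = ev (row i B) by rewrite coef_poly ltn_ord valK.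
have If i : I f`_i.
  rewrite coef_poly; case: ifP => [h|_]; last exact: (proj1 (id_addcl sK hI)).
  by rewrite insubT; apply/HB; exists (delta_mx 0 (Sub i h)); rewrite rowE.
have Ispan x : I x -> exists c : 'I_d -> int, x = \sum_i (c i)%:~R * f`_i.
  move=> /HB[c ->]; exists (fun i => c 0 i); under [RHS]eq_bigr => i _ do rewrite fE /ev mulr_sumr.
  rewrite exchange_big /=; apply: eq_bigr => k _; rewrite mxE rmorph_sum mulr_suml.
  by apply: eq_bigr => i _; rewrite !mxE rmorphM mulrA.
have Of i : OK K f`_i by apply: idsub hI _.
have f0 : f != 0.
  have [_ [x [/Ispan[c Dx] x0]]] := nI; apply: contraNneq x0 => f0; rewrite Dx big1 // => i _.
  by rewrite f0 coef0 mulr0.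
pose g := \prod_(i | i != idi) map_poly (s i) f.
have [h [Qh Dh]] : exists h : {poly algC}, (forall i, h`_i \in Crat) /\ h = \prod_i map_poly (s i) f.
  by apply: fixed_prod_poly => i; case: (Of i).
have sf : map_poly (s idi) f = f by apply/polyP => i; rewrite coef_map /= idiP //; case: (Of i).
have Dfg : h = f * g by rewrite Dh (bigD1 idi) //= sf.
have Ah : h \is a polyOver Aint.
  rewrite Dh; apply: rpred_prod => i _; apply/polyOverP => k; rewrite coef_map /= Aint_aut.
  by case: (Of k).
have g0 : g != 0.
  by apply/prodf_neq0 => i _; rewrite map_poly_eq0.
have Ag : g \is a polyOver Aint.
  by apply: rpred_prod => i _; apply/polyOverP => k; rewrite coef_map /= Aint_aut; case: (Of k).
have Kg i : K g`_i.
  apply: (fixed_mem Dq) => nu Hnu; rewrite -coef_map; suff -> : map_poly nu g = g by [].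
  have mf : map_poly nu f = f by apply/polyP => k; rewrite coef_map /= Hnu //; case: (Of k).
  apply: (mulfI f0); rewrite -{1}mf -rmorphM -Dfg; apply/polyP => k; rewrite coef_map /=.
  exact: aut_Crat.
have Og i : OK K g`_i by split => //; apply: (polyOverP Ag).
have hint k : exists z : int, h`_k = z%:~R.
  by apply/intrP/Cint_rat_Aint => //; apply: (polyOverP Ah).
pose J : cset := fun x => exists r : 'I_(size g) -> algC, (forall i, OK K (r i)) /\ x = \sum_i r i * g`_i.
have hJ : is_ideal K J.
  apply: mk_ideal => //.
  - move=> _ [r [Or ->]]; apply: addcl_sum; first exact: OK_addcl.
    by move=> i _; apply: OK_mul.
  - split; first by exists (fun _ => 0); split=> [_|]; [exact: (OK_nat 0) | rewrite big1 // => i _; rewrite mul0r].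
    move=> _ _ [r [Or ->]] [q [Oq ->]]; exists (fun i => r i - q i); split; first by move=> i; apply: OK_sub.
    by rewrite -sumrB; apply: eq_bigr => i _; rewrite mulrBl.
  - move=> x _ Ox [r [Or ->]]; exists (fun i => x * r i); split; first by move=> i; apply: OK_mul.
    by rewrite mulr_sumr; apply: eq_bigr => i _; rewrite mulrA.
have Jg i : J g`_i.
  have [iz|iz] := ltnP i (size g); last by rewrite nth_default //; exact: (proj1 (id_addcl sK hJ)).
  exists (fun j => (j == Ordinal iz)%:R); split; first by move=> j; apply: OK_nat.
  by rewrite (bigD1 (Ordinal iz)) //= eqxx mul1r big1 ?addr0 // => j /negPf ->; rewrite mul0r.
have nJ : nonzero_ideal K J.
  split => //; exists (lead_coef g); split; last by rewrite lead_coef_eq0.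
  by rewrite lead_coefE.
have [n n0 IJn] := nz_pos (nz_iprod sK nI nJ).
have aIJ : addcl (iprod I J) by apply: (@id_addcl K) => //; apply: iprod_ideal.
have [|c [c0 Ic cdiv]] := @int_subgroup (fun z => iprod I J z%:~R) n n0 _ IJn.
  by split; [exact: iprod0 | move=> x y hx hy; rewrite rmorphB; apply: (proj2 aIJ)].
exists J, c; split => //; apply: cset_ext => x; split; last first.
  by move=> [r [Or ->]]; apply: (idmulr (iprod_ideal sK hI hJ)).
have c0' : (c%:R : algC) != 0 by rewrite pnatr_eq0 -lt0n.
have key i j : OK K (f`_i * g`_j / c%:R).
  split; first by apply: sfdiv => //; [apply: sfM => //; case: (Of i) | apply: sfnat].
  rewrite mulrAC (_ : f`_i / c%:R = (c%:R^-1 *: f)`_i); last by rewrite coefZ mulrC.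
  apply: prague; rewrite -scalerAl -Dfg; apply/polyOverP => k; rewrite coefZ.
  have [z Dz] := hint k; rewrite Dz.
  have /dvdzP[q ->] : (c%:Z %| z)%Z.
    apply: cdiv; rewrite -Dz Dfg coefM; apply: addcl_sum => // l _; exact: iprod_mul.
  by rewrite rmorphM /= mulrC -mulrA mulfV // mulr1 Aint_int.
move: x; apply: iprod_min; first by apply: (@id_addcl K) => //; apply: principal_ideal => //; apply: OK_nat.
move=> a b /Ispan[z ->] [r [Or ->]]; rewrite mulr_suml.
have aP : addcl (principal K c%:R) by apply: (@id_addcl K) => //; apply: principal_ideal => //; apply: OK_nat.
apply: addcl_sum => // i _; rewrite mulr_sumr; apply: addcl_sum => // j _.
exists ((z i)%:~R * r j * (f`_i * g`_j / c%:R)); split.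
  by apply: OK_mul => //; apply: OK_mul => //; apply: OK_int.
by rewrite [RHS]mulrCA [c%:R * (_ / _)]mulrC divfK // mulrACA.
Qed.

Lemma ideal_cancel M I J : nonzero_ideal K M -> is_ideal K I -> is_ideal K J -> iprod M I = iprod M J -> I = J.
Proof.
move=> nM hI hJ E; have [M' [c [[hM' _] c0 DM]]] := ideal_inv nM; have [hM _] := nM.
apply: (@iprod_principal_inj K sK c%:R) => //; first by rewrite pnatr_eq0 -lt0n.
by rewrite -DM -(iprodAK sK hM hM' hI) -(iprodAK sK hM hM' hJ) !(iprodC M') !(iprodAK sK) // E.
Qed.

Lemma ideal_dvd M I : nonzero_ideal K M -> is_ideal K I -> (forall x, I x -> M x) -> exists A, is_ideal K A /\ I = iprod M A.
Proof.
move=> nM hI IM; have [M' [c [[hM' _] c0 DM]]] := ideal_inv nM; have [hM _] := nM.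
have c0' : (c%:R : algC) != 0 by rewrite pnatr_eq0 -lt0n.
have hMI := iprod_ideal sK hM' hI; have aMI := id_addcl sK hMI.
pose A : cset := fun x => iprod M' I (c%:R * x).
have Asub x : iprod M' I x -> OK K (x / c%:R).
  move=> h; have : iprod M M' x by rewrite iprodC; apply: iprod_mono h.
  by rewrite DM => -[r [Or ->]]; rewrite mulrC mulKf.
have hA : is_ideal K A.
  apply: mk_ideal => //.
  - by move=> x /Asub; rewrite mulrC mulKf.
  - split; first by rewrite /A mulr0; apply: iprod0.
    by move=> x y hx hy; rewrite /A mulrBr; apply: (proj2 aMI).
  - by move=> r x Or hx; rewrite /A mulrCA; apply: (idmul hMI).
exists A; split => //.
apply: (@iprod_principal_inj K sK c%:R) => //; first exact: iprod_ideal.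
rewrite -{1}DM -(iprodAK sK hM hM' hI).
have -> : iprod M' I = iprod (principal K c%:R) A.
  apply: cset_ext => x; rewrite iprod_principal //; split.
    by move=> h; exists (x / c%:R); rewrite /A mulrC divfK.
  by move=> [y [Ay ->]].
have hP := principal_ideal sK (OK_nat c sK).
by rewrite (iprodAK sK hM hP hA) (iprodC M) -(iprodAK sK hP hM hA).
Qed.

(** A covering family of least size has no repeated class, since a repeated class could be
    dropped. *)
Lemma idx_exists (G A : cset) k (r : 'I_k -> algC) : addcl A -> (forall i, G (r i)) ->
  (forall x, G x -> exists i, A (x - r i)) -> exists k', idx G A k'.
Proof.
move=> aA r1 r2.
have [|k0 [[q [q1 q2]] kmin]] := @nat_min (fun k => exists r : 'I_k -> algC, (forall i, G (r i)) /\ forall x, G x -> exists i, A (x - r i)).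
  by exists k, r.
exists k0, q; split => // i j Aij; apply/eqP/negPn/negP => ij.
case: k0 i j q q1 q2 kmin Aij ij => [[]//|k0] i j q q1 q2 kmin Aij ij.
have /kmin : exists r : 'I_k0 -> algC, (forall i, G (r i)) /\ forall x, G x -> exists i, A (x - r i).
  exists (fun l => q (lift i l)); split => // x /q2 [l Al].
  have [li|li] := eqVneq l i.
    have [j' Dj'] : exists j', j = lift i j' by case: (unliftP i j) ij => [j' ->|->]; [exists j' | rewrite eqxx].
    exists j'; rewrite -Dj' -(subrK (q i) x) -addrA; apply: addclD => //; by rewrite -li.
  case: (unliftP i l) li Al => [l' ->|->]; last by rewrite eqxx.
  by move=> _ Al; exists l'.
by rewrite ltnn.
Qed.

Lemma idx_sub I J : nonzero_ideal K I -> is_ideal K J -> (forall x, I x -> J x) ->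
  exists k, idx J I k /\ normI I = (normI J * k)%N.
Proof.
move=> nI hJ IJ; have [hI _] := nI.
have nJ : nonzero_ideal K J by split => //; case: nI => _ [x [Ix x0]]; exists x; split=> //; apply: IJ.
have [aI aJ] := (id_addcl sK hI, id_addcl sK hJ).
have [r [r1 r2 r3]] := normIP nI.
have [q Hq] : exists q : 'I_(normI I) -> algC, forall i, J (q i) /\ forall x, J x -> I (x - r i) -> I (x - q i).
  apply: (choice_ord (P := fun i q => J q /\ forall x, J x -> I (x - r i) -> I (x - q))) => i.
  case: (classic (exists y, J y /\ I (y - r i))) => [[y [Jy Iy]]|h].
    exists y; split => // x Jx Ix; have -> : x - y = (x - r i) - (y - r i) by rewrite opprB addrA subrK.
    by apply: (proj2 aI).
  by exists 0; split; [case: aJ | move=> x Jx Ix; case: h; exists x].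
have [||k hk] := @idx_exists J I (normI I) q aI.
- by move=> i; case: (Hq i).
- by move=> x Jx; have [i Ii] := r3 x (idsub hJ Jx); exists i; apply: (Hq i).2.
exists k; split => //; apply: (normI_uniq aI).
apply: (@idx_tower _ _ J) => //; [exact: OK_addcl | by move=> x; apply: idsub hJ | exact: normIP].
Qed.

Lemma normI_lt I J : nonzero_ideal K I -> is_ideal K J -> (forall x, I x -> J x) -> I <> J -> (normI J < normI I)%N.
Proof.
move=> nI hJ IJ neq; have [k [hk ->]] := idx_sub nI hJ IJ; have [hI _] := nI.
have nJ : nonzero_ideal K J by split => //; case: nI => _ [x [Ix x0]]; exists x; split=> //; apply: IJ.
have k0 : (0 < k)%N by apply: idx_gt0 hk; case: (id_addcl sK hJ).
have k1 : k != 1%N.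
  apply/eqP => k1; apply: neq; apply: cset_ext => x; split; first exact: IJ.
  by rewrite k1 in hk; apply: (idx1 (id_addcl sK hI) IJ hk).
by rewrite -{1}[normI J]muln1 ltn_pmul2l ?normI_gt0 // ltn_neqAle eq_sym k1.
Qed.

(** The residue ring of P is finite, so two powers of an element [a] outside P agree modulo P;
    cancelling the smaller power makes [a] invertible modulo P. *)
Lemma prime_max P J : prime_ideal K P -> is_ideal K J -> (forall x, P x -> J x) -> J = P \/ J = OK K.
Proof.
move=> [nP [P1 Pp]] hJ PJ; have [hP _] := nP.
case: (classic (exists2 a, J a & ~ P a)) => [[a Ja Pa]|h]; last first.
  left; apply: cset_ext => x; split; last exact: PJ.
  by move=> Jx; apply: NNPP => Px; apply: h; exists x.
right; apply: ideal_1 => //.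
have Oa := idsub hJ Ja; have [r [r1 r2 r3]] := normIP nP.
have OX i : OK K (a ^+ i) by elim: i => [|i IH]; rewrite ?expr0 ?exprS; [exact: OK1 | apply: OK_mul].
have PX i : ~ P (a ^+ i).
  elim: i => [|i IH]; rewrite ?expr0 // exprS => /Pp h; by case: h.
have [g Hg] : exists g : 'I_(normI P).+1 -> 'I_(normI P), forall i : 'I_(normI P).+1, P (a ^+ i - r (g i)).
  by apply: (choice_ord (P := fun (i : 'I_(normI P).+1) (l : 'I_(normI P)) => P (a ^+ i - r l))) => i; apply: r3.
have : ~ injective g by move=> gi; have := leq_card g gi; rewrite !card_ord ltnn.
move=> ninj; have [i [j [ij gij]]] : exists i j : 'I_(normI P).+1, (i < j)%N /\ g i = g j.
  apply: NNPP => h; apply: ninj => i j gij; apply/eqP/negPn/negP => nij; apply: h.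
  by case: (ltngtP i j) => [ij|ij|/val_inj ij]; [exists i, j | exists j, i | rewrite ij eqxx in nij].
have : P (a ^+ j - a ^+ i).
  have -> : a ^+ j - a ^+ i = (a ^+ j - r (g j)) - (a ^+ i - r (g i)) by rewrite gij opprB addrA subrK.
  by apply: (proj2 (id_addcl sK hP)).
rewrite -(subnK (ltnW ij)) exprD -{2}[a ^+ i]mul1r -mulrBl => hP2; have [||hP1|/PX //] := Pp _ _ _ _ hP2.
- by apply: OK_sub => //; apply: OK1.
- exact: OX.
- have -> : 1 = a ^+ (j - i) - (a ^+ (j - i) - 1) by rewrite subKr.
  apply: (proj2 (id_addcl sK hJ)); last exact: PJ.
  by rewrite -(prednK (_ : 0 < j - i)%N) ?subn_gt0 // exprS; apply: (idmulr hJ).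
Qed.

Lemma prime_exists I : nonzero_ideal K I -> ~ I 1 -> exists2 P, prime_ideal K P & forall x, I x -> P x.
Proof.
move: {2}(normI I) (leqnn (normI I)) => n; elim: n I => [|n IH] I nle nI I1.
  by move: nle; rewrite leqNgt normI_gt0.
case: (classic (prime_ideal K I)) => [pI|npI]; first by exists I.
have [hI [x0 [Ix0 x0n]]] := nI; have aI := id_addcl sK hI.
have [a [b [Oa Ob Iab Ia Ib]]] : exists a b, [/\ OK K a, OK K b, I (a * b), ~ I a & ~ I b].
  apply: NNPP => h; apply: npI; split => //; split => // a b Oa Ob Iab.
  by apply: NNPP => h'; apply: h; exists a, b; split => //; move=> ?; apply: h'; [left|right].
pose J := isum I (principal K a).
have hJ : is_ideal K J by apply: isum_ideal => //; apply: principal_ideal.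
have IJ x : I x -> J x by apply: (isuml sK (principal_ideal sK Oa)).
have Ja : J a by apply: (isumr sK hI); apply: principal_mem.
have nJ : nonzero_ideal K J by split => //; exists x0; split => //; apply: IJ.
have ltJ : (normI J < normI I)%N by apply: normI_lt => // E; apply: Ia; rewrite E.
have [|//|P pP JP] := IH J _ nJ.
- by rewrite -ltnS; apply: leq_trans ltJ nle.
- move=> [i [_ [Ii [r [Or ->]] E]]]; apply: Ib.
  rewrite -[b]mul1r E mulrDl; apply: addclD => //; first exact: (idmulr hI).
  by rewrite mulrAC; apply: (idmulr hI).
by exists P => // x /IJ /JP.
Qed.

Lemma primeP_nz P : prime_ideal K P -> nonzero_ideal K P. Proof. by case. Qed.
Lemma primeP_id P : prime_ideal K P -> is_ideal K P. Proof. by case=> -[]. Qed.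

Lemma prime_neqOK P : prime_ideal K P -> P <> OK K.
Proof. by move=> [_ [P1 _]] E; apply: P1; rewrite E; apply: OK1. Qed.

(** For [a] in J outside P J, multiplication by [a] induces a bijection from O/P to J/PJ. It is onto
    because a O + P J strictly contains P J and so equals J, by maximality of P; it is injective
    because the multipliers sending [a] into P J form a proper ideal containing P. *)
Lemma normI_prod_prime P J : prime_ideal K P -> nonzero_ideal K J -> normI (iprod P J) = (normI P * normI J)%N.
Proof.
move=> pP nJ; have nP := primeP_nz pP; have hP := primeP_id pP; have [hJ _] := nJ.
have nPJ := nz_iprod sK nP nJ; have [hPJ _] := nPJ.
have PJJ x : iprod P J x -> J x by rewrite iprodC; apply: (iprod_subl sK hJ hP).
have [k [hk ->]] := idx_sub nPJ hJ PJJ; rewrite mulnC; congr (_ * _)%N.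
have aP := id_addcl sK hP; have aJ := id_addcl sK hJ; have aPJ := id_addcl sK hPJ.
have [a Ja Pa] : exists2 a, J a & ~ iprod P J a.
  apply: NNPP => h; have E : iprod J P = iprod J (OK K).
    rewrite iprod_OK // iprodC; apply: cset_ext => x; split; first exact: PJJ.
    by move=> Jx; apply: NNPP => nx; apply: h; exists x.
  by apply: (prime_neqOK pP); apply: (ideal_cancel nJ hP (OK_ideal sK) E).
have Oa := idsub hJ Ja.
have gen x : J x -> exists r, OK K r /\ iprod P J (x - r * a).
  pose S := isum (principal K a) (iprod P J).
  have hS : is_ideal K S by apply: isum_ideal => //; apply: principal_ideal.
  have [|A [hA SA]] := ideal_dvd nJ hS.
    move=> y [b [c [[r [Or ->]] Jc ->]]]; apply: addclD => //; first exact: (idmulr hJ).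
    exact: PJJ.
  have PA y : P y -> A y.
    move=> Py; have [J' [c [[hJ' _] c0 DJ]]] := ideal_inv nJ.
    have : iprod (principal K c%:R) A (c%:R * y).
      rewrite -DJ (iprodC J) -(iprodAK sK hJ' hJ hA) -SA.
      have : iprod J' (iprod P J) (c%:R * y).
        rewrite (iprodC P) (iprodAK sK hJ' hJ hP) (iprodC J') DJ.
        by apply: iprod_mul => //; apply: principal_mem.
      by apply: iprod_mono => // z; apply: (isumr sK); apply: principal_ideal.
    case/(iprod_principal sK _ _ hA) => z [Az] /mulfI; rewrite pnatr_eq0 -lt0n => -> //.
  have [EA|EA] := prime_max pP hA PA.
    case: Pa; have : S a by apply: (isuml sK hPJ); apply: principal_mem.
    by rewrite SA EA iprodC.
  move=> Jx; have : S x by rewrite SA EA iprod_OK.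
  move=> [b [c [[r [Or ->]] Jc ->]]]; exists r; split => //; by rewrite [r * a]mulrC addrC addKr.
have ker r : OK K r -> iprod P J (r * a) <-> P r.
  move=> Or; split; last by move=> Pr; apply: iprod_mul.
  pose T : cset := fun r => OK K r /\ iprod P J (r * a).
  have hT : is_ideal K T.
    apply: mk_ideal => //.
    - by move=> x [].
    - split; first by split; [exact: (OK_nat 0) | rewrite mul0r; case: aPJ].
      by move=> x y [Ox hx] [Oy hy]; split; [apply: OK_sub | rewrite mulrBl; apply: (proj2 aPJ)].
    - by move=> x y Ox [Oy hy]; split; [apply: OK_mul | rewrite -mulrA; apply: (idmul hPJ)].
  have [|ET|ET] := prime_max pP hT.
  - by move=> x Px; split; [apply: (idsub hP) | apply: iprod_mul].
  - by move=> h; rewrite -ET.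
  - case: Pa; have : T 1 by rewrite ET; apply: OK1.
    by case; rewrite mul1r.
apply/eqP; rewrite eqn_leq; apply/andP; split.
  apply: (@idx_ge _ _ (OK K) P J (iprod P J) _ _ (fun r => r * a)) => //; [exact: normIP | |].
    by move=> x y Ox Oy Pxy; rewrite -mulrBl; apply/ker => //; apply: OK_sub.
  by move=> y /gen[r [Or hr]]; exists r.
apply: (@idx_le _ _ (OK K) P J (iprod P J) _ _ (fun r => r * a)) => //; [exact: normIP | |].
  by move=> x Ox; apply: (idmul hJ).
by move=> x y Ox Oy; rewrite -mulrBl => /ker; apply; apply: OK_sub.
Qed.

Definition primes_of (l : seq cset) := forall P : cset, P \in l -> prime_ideal K P.
Lemma primes_cons P l : primes_of (P :: l) <-> prime_ideal K P /\ primes_of l.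
Proof.
split; first by move=> h; split; [apply: h; rewrite mem_head | move=> Q Ql; apply: h; rewrite inE Ql orbT].
by move=> [pP pl] Q; rewrite inE => /orP[/eqP ->|/pl].
Qed.
Lemma primes_of_cat l l' : primes_of l -> primes_of l' -> primes_of (l ++ l').
Proof. by move=> h h' P; rewrite mem_cat => /orP[/h|/h']. Qed.
Lemma primes_of_perm l l' : perm_eq l l' -> primes_of l -> primes_of l'.
Proof. by move=> p h P; rewrite -(perm_mem p) => /h. Qed.
Definition prodI (l : seq cset) : cset := foldr iprod (OK K) l.
Lemma prodI_nz l : primes_of l -> nonzero_ideal K (prodI l).
Proof.
elim: l => [|P l IH] /=; first by move=> _; exact: nz_OK.
by move=> /primes_cons[pP /IH nl]; apply: nz_iprod => //; apply: primeP_nz.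
Qed.
Lemma prodI_id l : primes_of l -> is_ideal K (prodI l).
Proof. by case/prodI_nz. Qed.
Lemma normI_prodI l : primes_of l -> normI (prodI l) = \prod_(P <- l) normI P.
Proof.
elim: l => [|P l IH] /=; first by rewrite big_nil normI_OK.
by move=> /primes_cons[pP pl]; rewrite big_cons normI_prod_prime ?IH //; exact: prodI_nz.
Qed.
Lemma uf_exists I : nonzero_ideal K I -> exists2 l, primes_of l & I = prodI l.
Proof.
move: {2}(normI I) (leqnn (normI I)) => n; elim: n I => [|n IH] I nle nI.
  by move: nle; rewrite leqNgt normI_gt0.
have [hI [x0 [Ix0 x0n]]] := nI.
case: (classic (I 1)) => [I1|I1]; first by exists [::] => //=; apply: ideal_1.
have [P pP IP] := prime_exists nI I1; have hP := primeP_id pP.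
have [A [hA EI]] := ideal_dvd (primeP_nz pP) hI IP.
have IA x : I x -> A x by rewrite EI iprodC; apply: (iprod_subl sK hA hP).
have nA : nonzero_ideal K A by split => //; exists x0; split => //; apply: IA.
have [|l pl Al] := IH A _ nA.
  rewrite -ltnS; apply: leq_trans nle; apply: normI_lt => // E.
  apply: (prime_neqOK pP); apply: (ideal_cancel nA hP (OK_ideal sK)).
  by rewrite iprod_OK // iprodC -EI E.
by exists (P :: l); [apply/primes_cons | rewrite /= -Al].
Qed.
Lemma prodI_cat l l' : primes_of l -> primes_of l' -> prodI (l ++ l') = iprod (prodI l) (prodI l').
Proof.
move=> pl pl'; elim: l pl => [|P l IH] /=; first by rewrite OK_iprod //; exact: prodI_id.
move=> /primes_cons[pP pl]; rewrite IH // (iprodAK sK) //; [exact: primeP_id | exact: prodI_id | exact: prodI_id].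
Qed.

Lemma normIM I J : nonzero_ideal K I -> nonzero_ideal K J -> normI (iprod I J) = (normI I * normI J)%N.
Proof.
move=> nI nJ; have [l pl ->] := uf_exists nI; have [l' pl' ->] := uf_exists nJ.
by rewrite -prodI_cat // !normI_prodI ?big_cat //; apply: primes_of_cat.
Qed.

Lemma prime_prodI P l : prime_ideal K P -> primes_of l -> (forall x, prodI l x -> P x) -> P \in l.
Proof.
move=> pP; elim: l => [|Q l IH]; first by move=> _ h; case: (pP) => _ [[]]; apply: h; exact: OK1.
move=> /primes_cons[pQ pl] h; have hQ := primeP_id pQ; have hl := prodI_id pl.
rewrite inE; case: (classic (forall x, Q x -> P x)) => [QP|nQP].
  by have [->|E] := prime_max pQ (primeP_id pP) QP; [rewrite eqxx | case: (prime_neqOK pP)].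
rewrite IH ?orbT // => x lx; apply: NNPP => Px; apply: nQP => y Qy.
have : P (y * x) by apply: h; apply: iprod_mul.
by case: (pP) => _ [_ /(_ _ _ (idsub hQ Qy) (idsub hl lx)) h1] /h1 [].
Qed.

Lemma prodI_perm l l' : perm_eq l l' -> primes_of l -> prodI l = prodI l'.
Proof.
elim: l l' => [|P l IH] l' p pl; first by move: p; rewrite perm_sym => /perm_nilP ->.
have Pl' : P \in l' by rewrite -(perm_mem p) mem_head.
have pl' := primes_of_perm p pl; have /primes_cons[pP pl1] := pl.
case/splitPr: Pl' p pl' => l1 l2 p pl'.
have p2 : perm_eq (l1 ++ P :: l2) (P :: (l1 ++ l2)) by rewrite -cat1s perm_catCA.
have /primes_cons[_ p12] := primes_of_perm p2 pl'.
have h1 : primes_of l1 by move=> Q Q1; apply: p12; rewrite mem_cat Q1.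
have h2 : primes_of l2 by move=> Q Q1; apply: p12; rewrite mem_cat Q1 orbT.
rewrite /= (IH (l1 ++ l2)) //; last by rewrite -(perm_cons P) (perm_trans p).
rewrite !prodI_cat //=; last by apply/primes_cons.
have [hP i1 i2] := And3 (primeP_id pP) (prodI_id h1) (prodI_id h2).
by rewrite (iprodAK sK) // (iprodC P) -(iprodAK sK).
Qed.

Lemma uf_unique l l' : primes_of l -> primes_of l' -> prodI l = prodI l' -> perm_eq l l'.
Proof.
elim: l l' => [|P l IH] l' pl pl' E.
  case: l' pl' E => // Q l' /primes_cons[pQ pl'] /= E; case: (pQ) => _ [[]]; rewrite -[Q](iprod_OK sK (primeP_id pQ)).
  have : iprod Q (prodI l') 1 by rewrite -E; exact: OK1.
  by apply: iprod_mono => // x; apply: idsub; exact: prodI_id.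
have /primes_cons[pP pl1] := pl.
have Pl' : P \in l'.
  by apply: prime_prodI => // x; rewrite -E /=; apply: (iprod_subl sK (primeP_id pP)); exact: prodI_id.
have p2 := perm_to_rem Pl'; have E2 := prodI_perm p2 pl'.
have /primes_cons[_ pr] := primes_of_perm p2 pl'.
rewrite perm_sym (perm_trans p2) // perm_cons perm_sym; apply: IH => //.
by apply: (ideal_cancel (primeP_nz pP)); [exact: prodI_id | exact: prodI_id | rewrite -[RHS]E2 -E].
Qed.

Definition fac I : seq cset := epsilon (inhabits [::]) (fun l => primes_of l /\ I = prodI l).
Lemma facP I : nonzero_ideal K I -> primes_of (fac I) /\ I = prodI (fac I).
Proof.
move=> /uf_exists[l pl El].
by apply: (@epsilon_spec _ (inhabits [::]) (fun l => primes_of l /\ I = prodI l)); exists l.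
Qed.
Definition vI (P : cset) I : nat := count_mem P (fac I).
Lemma vI_prodI P l : primes_of l -> vI P (prodI l) = count_mem P l.
Proof.
move=> pl; have [pf Ef] := facP (prodI_nz pl).
by rewrite /vI; have /seq.permP -> := uf_unique pf pl (esym Ef).
Qed.
Lemma vIM P I J : nonzero_ideal K I -> nonzero_ideal K J -> vI P (iprod I J) = (vI P I + vI P J)%N.
Proof.
move=> nI nJ; have [l pl ->] := uf_exists nI; have [l' pl' ->] := uf_exists nJ.
by rewrite -prodI_cat // !vI_prodI ?count_cat //; apply: primes_of_cat.
Qed.
Lemma vI_gt0 P I : prime_ideal K P -> nonzero_ideal K I -> (0 < vI P I)%N <-> (forall x, I x -> P x).
Proof.
move=> pP nI; have [l pl ->] := uf_exists nI; rewrite vI_prodI // -has_count has_pred1; split.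
  move=> Pl x; rewrite (prodI_perm (perm_to_rem Pl)) //.
  have /primes_cons[_ pr] := primes_of_perm (perm_to_rem Pl) pl.
  by apply: (iprod_subl sK (primeP_id pP)); exact: prodI_id.
by apply: prime_prodI.
Qed.
Lemma vI_P P : prime_ideal K P -> vI P P = 1%N.
Proof.
move=> pP; have -> : vI P P = vI P (prodI [:: P]) by rewrite /= iprod_OK //; exact: primeP_id.
by rewrite vI_prodI /= ?eqxx //; apply/primes_cons; split.
Qed.
Lemma vI_OK P : vI P (OK K) = 0%N.
Proof. by have -> : OK K = prodI [::] by []; rewrite vI_prodI. Qed.
Lemma vI_prime_neq P Q : prime_ideal K Q -> P <> Q -> vI P Q = 0%N.
Proof.
move=> pQ PQ; have -> : vI P Q = vI P (prodI [:: Q]) by rewrite /= iprod_OK //; exact: primeP_id.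
rewrite vI_prodI; last by apply/primes_cons; split.
by rewrite /= addn0; case: eqP => // E; case: PQ.
Qed.
Lemma ipow_nz I k : nonzero_ideal K I -> nonzero_ideal K (ipow K I k).
Proof. by move=> nI; elim: k => [|k IH]; [exact: nz_OK | apply: nz_iprod]. Qed.
Lemma vI_pow P I k : nonzero_ideal K I -> vI P (ipow K I k) = (k * vI P I)%N.
Proof.
move=> nI; elim: k => [|k IH]; first by rewrite vI_OK.
by rewrite /ipow iterS -/(ipow K I k) vIM // ?IH ?mulSn //; exact: ipow_nz.
Qed.
Lemma ideal_eq_vI I J : nonzero_ideal K I -> nonzero_ideal K J ->
  (forall P, prime_ideal K P -> vI P I = vI P J) -> I = J.
Proof.
move=> nI nJ h; have [pf Ef] := facP nI; have [pg Eg] := facP nJ.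
have p : perm_eq (fac I) (fac J).
  rewrite /perm_eq; apply/allP => P; rewrite mem_cat => H.
  have pP : prime_ideal K P by case/orP: H => [/pf|/pg].
  by move: (h P pP); rewrite /vI /= => ->.
exact: (etrans Ef (etrans (prodI_perm p pf) (esym Eg))).
Qed.
Lemma vI_ge P I k : prime_ideal K P -> nonzero_ideal K I -> (k <= vI P I)%N <-> (forall x, I x -> ipow K P k x).
Proof.
move=> pP nI; have nPk := ipow_nz k (primeP_nz pP); split.
  move=> kv; suff [A [hA ->]] : exists A, is_ideal K A /\ I = iprod (ipow K P k) A.
    by move=> x; apply: (iprod_subl sK _ hA); case: nPk.
  elim: k kv nPk => [|k IH] kv nPk; first by exists I; case: nI => hI _; rewrite OK_iprod.
  have nPk' := ipow_nz k (primeP_nz pP); have [A [hA EA]] := IH (ltnW kv) nPk'.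
  have nA : nonzero_ideal K A.
    split => //; case: nI => _ [x [Ix x0]]; exists x; split => //; move: Ix; rewrite EA iprodC.
    by apply: (iprod_subl sK hA); case: nPk'.
  have : (0 < vI P A)%N.
    move: kv; rewrite EA vIM // vI_pow; last exact: primeP_nz.
    by rewrite vI_P // muln1 -{1}[k]addn0 ltn_add2l.
  move/(vI_gt0 pP nA) => AP; have [B [hB EB]] := ideal_dvd (primeP_nz pP) hA AP.
  exists B; split => //; rewrite EA EB /ipow iterS -/(ipow K P k).
  by rewrite (iprodAK sK nPk'.1 (primeP_id pP) hB) (iprodC (ipow K P k)).
move=> IP; have [A [hA EA]] := ideal_dvd nPk (proj1 nI) IP.
have nA : nonzero_ideal K A.
  split => //; case: nI => _ [x [Ix x0]]; exists x; split => //; move: Ix; rewrite EA iprodC.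
  by apply: (iprod_subl sK hA); case: nPk.
rewrite EA vIM // vI_pow; last exact: primeP_nz.
by rewrite vI_P // muln1 leq_addr.
Qed.
End Dedekind.

(** * Minkowski's theorem through Hermite's constant *)

Section Hermite.
Variable R : archiRealFieldType.
Definition qf d (G : 'M[R]_d) (v : 'rV[R]_d) : R := (v *m G *m v^T) 0 0.
Definition zrow d (z : 'rV[int]_d) : 'rV[R]_d := map_mx intr z.

(** Origin of 5/12: an exactly minimal vector would give the classical factor 1 - 1/4 in each
    reduction step, whereas a vector minimal up to the factor 2/3 gives 2/3 - 1/4. *)
Fixpoint hermc d : R := if d is d'.+1 then (5 / 12) ^+ d' * hermc d' else 1.
Lemma hermc_gt0 d : 0 < hermc d.
Proof. by elim: d => //= d IH; rewrite mulr_gt0 // exprn_gt0 //; lra. Qed.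

(** An almost minimal vector spares a compactness argument for the real form Q. Each replacement of
    z0 by a vector of value below 2/3 Q(z0) lowers 3 Q(z0) / mu by at least 1, so the descent
    stops. *)
Lemma near_min d (Q : 'rV[int]_d -> R) (mu : R) (z0 : 'rV[int]_d) : 0 < mu -> z0 != 0 ->
  (forall z, z != 0 -> mu <= Q z) -> exists2 v, v != 0 & forall z, z != 0 -> 2 / 3 * Q v <= Q z.
Proof.
move=> mu0; move: {2}(Num.truncn (Q z0 * 3 / mu)) (leqnn (Num.truncn (Q z0 * 3 / mu))) => n.
elim: n z0 => [|n IH] z0 hn z0n hQ.
  have : Q z0 * 3 / mu < 1.
    have := Num.Theory.truncnS_gt (Q z0 * 3 / mu); rewrite (eqP (_ : Num.truncn _ == 0)) //; by rewrite -leqn0.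
  rewrite ltr_pdivrMr // mul1r => h; have := hQ z0 z0n => h2; lra.
case: (classic (exists2 z, z != 0 & Q z < 2 / 3 * Q z0)) => [[z zn Qz]|h].
  apply: (IH z) => //; rewrite -ltnS; apply: leq_trans hn.
  have Qz0 : 0 <= Q z * 3 / mu by rewrite divr_ge0 ?mulr_ge0 // ltW // (lt_le_trans mu0) // hQ.
  have E : Q z * 3 / mu + 1 <= Q z0 * 3 / mu.
    rewrite -(ler_pM2r mu0) mulrDl !divfK ?gt_eqF // mul1r.
    have := hQ z0 z0n; have := hQ z zn; lra.
  have h1 := Num.Theory.truncn_itv Qz0.
  have : (Num.truncn (Q z * 3 / mu) + 1 <= Num.truncn (Q z0 * 3 / mu))%N.
    rewrite Num.Theory.truncn_ge_nat; last by apply: le_trans E; rewrite addr_ge0.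
    by rewrite natrD; apply: le_trans E; rewrite lerD2r; case/andP: h1.
  by rewrite addn1.
exists z0 => // z zn; rewrite leNgt; apply/negP => hz; by apply: h; exists z.
Qed.

(** The Smith normal form of a primitive row has a unit as its only invariant, so the row is, up to
    sign, the first row of the unimodular right factor. *)
Lemma unimod_row d (v : 'rV[int]_d.+1) : (forall (k : nat) u, v = u *+ k -> k = 1%N) ->
  exists2 U : 'M[int]_d.+1, U \in unitmx & row 0 U = v.
Proof.
move=> prim; have [L uL [R' uR [D _ DM]]] := int_Smith_normal_form v.
have L1 : exists2 e : int, e \is a GRing.unit & L = e%:M.
  exists (L 0 0); last by rewrite {1}[L]mx11_scalar.
  by move: uL; rewrite unitmxE {1}[L]mx11_scalar det_scalar1.
case: L1 => e ue De.
have Ev : v = (e * D`_0) *: row 0 R'.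
  rewrite DM De mul_scalar_mx -scalemxAl -scalerA; congr (_ *: _).
  apply/rowP => j; rewrite !mxE (bigD1 ord0) //= big1 ?addr0 ?mxE ?eqxx ?mulr1n //.
  by move=> k kn; rewrite mxE /= (_ : (0 == k :> nat) = false) ?mulr0n ?mul0r // eq_sym; apply/negP => /eqP kk; case/eqP: kn; apply: val_inj.
pose c : int := e * D`_0.
have k1 : `|c|%N = 1%N.
  apply: (prim _ (sgz c *: row 0 R')).
  by rewrite -scaler_nat scalerA natz mulrC -intEsg.
have uc : c \is a GRing.unit by move: k1; case: (intP c) => [|k|k] //= [->].
pose f (i : 'I_d.+1) : int := if i == 0 then c else 1.
exists (diag_mx (\row_i f i) *m R').
  rewrite unitmx_mul uR andbT unitmxE det_diag big_ord_recl mxE /f eqxx unitrMl //.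
  by rewrite big1 ?unitr1 // => i _; rewrite mxE /=.
by rewrite Ev; apply/rowP => j; rewrite mul_diag_mx !mxE /f eqxx.
Qed.

Lemma qf_unimod d (G : 'M[R]_d) (U : 'M[int]_d) z :
  qf (map_mx intr U *m G *m (map_mx intr U)^T) (zrow z) = qf G (zrow (z *m U)).
Proof. by rewrite /qf /zrow map_mxM trmx_mul !mulmxA. Qed.

(** Hermite's reduction: an almost minimal vector becomes the first basis vector, the square in its
    coordinate is completed, and the induction runs on the form G' in the remaining coordinates,
    with minimum at least 5/12 q. *)
Lemma hermite d (G : 'M[R]_d) mu : 0 < mu -> G^T = G ->
  (forall z, z != 0 -> mu <= qf G (zrow z)) -> hermc d * mu ^+ d <= \det G.
Proof.
elim: d G mu => [|d IH] G mu mu0 sG hG; first by rewrite det_mx00 /= mul1r expr0.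
have [|v vn vmin] := @near_min _ (fun z => qf G (zrow z)) mu (delta_mx 0 0) mu0 _ hG.
  by apply/eqP => /matrixP /(_ 0 0); rewrite !mxE !eqxx.
set q := qf G (zrow v) in vmin; have q_mu : mu <= q by apply: hG.
have q0 : 0 < q by apply: lt_le_trans q_mu.
(* [v] is primitive: v = k u with k >= 2 would give Q(u) <= Q(v) / 4, below the bound 2/3 Q(v). *)
have [U uU rU] : exists2 U : 'M[int]_d.+1, U \in unitmx & row 0 U = v.
  apply: unimod_row => k u Ek.
  have un : u != 0 by apply: contraNneq vn => u0; rewrite Ek u0 mul0rn.
  have Eq : q = k%:R ^+ 2 * qf G (zrow u).
    have -> : q = qf G (k%:R *: zrow u).
      by rewrite /q Ek; congr (qf G _); apply/rowP => j; rewrite !mxE mulmxnE rmorphMn mulr_natl.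
    by rewrite /qf linearZ /= -!scalemxAl -scalemxAr !mxE expr2 mulrA.
  have h1 := vmin u un; have h2 := hG u un.
  case: k Ek Eq => [|[|k]] // Ek Eq; first by rewrite Ek mulr0n eqxx in vn.
  exfalso; have : 2%:R <= k.+2%:R :> R by rewrite ler_nat.
  move: h1; rewrite Eq; move: (k.+2%:R) (qf G _) h2 => x y h2 h1 h3.
  have : 4 <= x ^+ 2 by rewrite (_ : 4 = 2 ^+ 2) ?ler_sqr ?nnegrE //; [lra | ring].
  have y0 : 0 < y by apply: lt_le_trans h2.
  by move=> h4; have := ler_wpM2r (ltW y0) h4; lra.
pose V := map_mx (intr : int -> R) U.
pose G1 : 'M[R]_(1 + d) := V *m G *m V^T.
have dG1 : \det G1 = \det G.
  rewrite !det_mulmx det_tr det_map_mx mulrAC -rmorphM /=.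
  suff -> : \det U * \det U = 1 by rewrite mul1r.
  by move: uU; rewrite unitmxE => /orP[]/eqP ->.
have sG1 : G1^T = G1 by rewrite /G1 !trmx_mul trmxK sG mulmxA.
have hG1 z : z != 0 -> 2 / 3 * q <= qf G1 (zrow z).
  move=> zn; rewrite qf_unimod; apply: vmin; apply: contraNneq zn => E.
  by rewrite -[z](mulmxK uU) E mul0mx.
have G00 : ulsubmx G1 = q%:M.
  rewrite [LHS]mx11_scalar; congr (_%:M).
  have -> : q = qf G1 (zrow (delta_mx 0 0)) by rewrite qf_unimod -rowE rU.
  rewrite /qf /zrow map_delta_mx trmx_delta -rowE -colE !mxE.
  by rewrite (_ : lshift d 0 = 0); last exact: val_inj.
pose b := ursubmx G1; pose C := drsubmx G1.
have Gdl : dlsubmx G1 = b^T by rewrite -[G1 in LHS]sG1 /b trmx_ursub.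
have DG1 : G1 = block_mx q%:M b b^T C by rewrite -Gdl -G00 submxK.
pose G' := C - q^-1 *: (b^T *m b).
have detG : \det G = q * \det G'.
  have -> : \det G = \det (block_mx 1%:M 0 (q^-1 *: b^T) 1%:M *m block_mx q%:M b 0 G').
    rewrite -dG1 DG1; congr (\det _); rewrite mulmx_block !mul1mx !mul0mx !addr0.
    congr (block_mx _ _ _ _).
      by rewrite mul_mx_scalar scalerA mulfV ?gt_eqF // scale1r.
    by rewrite -scalemxAl /G' addrC subrK.
  by rewrite det_mulmx det_lblock det_ublock !det1 !mul1r det_scalar1.
(* The first coordinate a is chosen by rounding, so that the completed square contributes at most q
   / 4 of the total, which is at least 2/3 q. *)
have h' z' : z' != 0 -> 5 / 12 * q <= qf G' (zrow z').
  move=> zn; pose Z := zrow z'; pose be := (b *m Z^T) 0 0.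
  have [a h2] : exists a : int, `|a%:~R + be / q| <= 1 / 2.
    exists (- Num.floor (be / q + 1 / 2)).
    rewrite rmorphN /= ler_norml; have := Num.Theory.floor_itv (be / q + 1 / 2).
    rewrite intrD; case/andP; move: (be / q) (_%:~R) => x y; lra.
  have zn1 : (row_mx a%:M z' : 'rV[int]_(1 + d)) != 0.
    by apply: contraNneq zn => /(congr1 rsubmx); rewrite row_mxKr raddf0 => ->.
  have E : qf G1 (zrow (row_mx a%:M z')) = q * (a%:~R + be / q) ^+ 2 + qf G' Z.
    rewrite /qf {1 2}/zrow map_row_mx map_scalar_mx /= (_ : map_mx _ z' = Z) // DG1 tr_row_mx mul_row_block mul_row_col tr_scalar_mx.
    have Zb : (Z *m b^T) 0 0 = be by rewrite /be !mxE; apply: eq_bigr => j _; rewrite !mxE mulrC.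
    rewrite -scalar_mxM mul_mx_scalar mul_scalar_mx mulmxDl -scalemxAl.
    rewrite /G' mulmxBr mulmxBl -scalemxAr -scalemxAl mulmxA -(mulmxA (Z *m b^T)).
    have Eb : (b *m Z^T) 0 0 = be by [].
    move: Zb Eb; move: (Z *m C *m Z^T) (b *m Z^T) (Z *m b^T) (a%:~R) be h2 => zcz bz zb al be' _ Zb Eb.
    by rewrite !mxE !big_ord1 Zb Eb eqxx !mulr1n; field; rewrite gt_eqF.
  have h1 := hG1 _ zn1; rewrite E in h1.
  have h3 : (a%:~R + be / q) ^+ 2 <= 1 / 4.
    by rewrite -real_normK ?num_real // (_ : 1 / 4 = (1 / 2) ^+ 2 :> R) ?ler_sqr ?nnegrE //; [lra | field].
  by move: h1 h3; rewrite -/Z; move: (_ ^+ 2) (qf _ _) => x y; nra.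
have sG' : G'^T = G'.
  rewrite /G' linearB linearZ /= trmx_mul trmxK; congr (_ - _).
  by rewrite /C trmx_drsub sG1.
have := IH G' (5 / 12 * q) _ sG' h'; rewrite detG exprMn => /(_ _) h.
apply: (@le_trans _ _ (q * (hermc d * ((5 / 12) ^+ d * q ^+ d)))); last by rewrite ler_pM2l //; apply: h; rewrite mulr_gt0 //; lra.
rewrite /= exprS; have -> : q * (hermc d * ((5 / 12) ^+ d * q ^+ d)) = (5 / 12) ^+ d * hermc d * (q * q ^+ d) by ring.
rewrite ler_pM2l; last by rewrite mulr_gt0 ?hermc_gt0 // exprn_gt0 //; lra.
by rewrite ler_pM ?exprn_ge0 ?(ltW mu0) // lerXn2r ?nnegrE ?(ltW mu0) ?(ltW q0).
Qed.
End Hermite.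

Section Minkowski.
Variables (K : cset) (d : nat) (s : 'I_d -> aut) (w : 'I_d -> algC).
Hypothesis D : nfdata K s w.
Let sK := nfdata_sub D.
Let W := \matrix_(i, j) s i (w j).

(** An integer above the inverse of Hermite's constant; it replaces the constant of Minkowski's
    theorem and depends on [d] alone. *)
Definition minkC : nat := (Num.truncn (hermc algR d)^-1).+1.
Lemma minkC_ge : 1 < minkC%:R * hermc algR d.
Proof.
rewrite -ltr_pdivrMr ?hermc_gt0 // mul1r; exact: Num.Theory.truncnS_gt.
Qed.

Lemma conj_idx : exists2 f : 'I_d -> 'I_d, injective f & forall i x, K x -> s (f i) x = (s i x)^*.
Proof.
have [f [bf Hf]] := qdata_perm (nfdata_qdata D) (Num.conj : aut).
by exists f; [apply: bij_inj | move=> i x Kx; rewrite -Hf].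
Qed.

Lemma sEv i v : s i (ev w v) = \sum_j (v 0 j)%:~R * s i (w j).
Proof. by rewrite /ev rmorph_sum; apply: eq_bigr => j _; rewrite rmorphM /= rmorph_int. Qed.

(** [hermite] is applied to the form sum_i |s_i x|^2 / c_i^2 on I. If I had no nonzero point in the
    box, the form would be at least 1 on nonzero vectors, while its determinant is (N(I) |det W| /
    prod c_i)^2, too small by hypothesis. The symmetry of [c] under complex conjugation makes the
    Gram matrix real. *)
Lemma minkowski I (c : 'I_d -> algC) : nonzero_ideal K I -> (forall i, 0 < c i) ->
  (forall i j, (forall x, K x -> s j x = (s i x)^*) -> c i = c j) ->
  minkC%:R * (normI K I)%:R * `|\det W| <= \prod_i c i ->
  exists x, [/\ I x, x != 0 & forall i, `|s i x| <= c i].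
Proof.
move=> nI c0 csym hc; have [B [dB HB hidx]] := ideal_basis D nI.
have nB : normI K I = `|\det B|%N by apply: (normI_uniq _ hidx); apply: (id_addcl sK); case: nI.
pose e j := ev w (row j B).
have eM z : ev w (z *m B) = \sum_j (z 0 j)%:~R * e j.
  rewrite /e /ev; under [RHS]eq_bigr => i _ do rewrite mulr_sumr.
  rewrite exchange_big /=; apply: eq_bigr => k _; rewrite mxE rmorph_sum mulr_suml.
  by apply: eq_bigr => i _; rewrite mxE rmorphM mulrA.
have eK j : K (e j) by case: (evK D (row j B)).
pose E := \matrix_(i, j) (s i (e j) / c i).
have dE : `|\det E| ^+ 2 = ((normI K I)%:R * `|\det W|) ^+ 2 / (\prod_i c i) ^+ 2.
  have -> : E = diag_mx (\row_i (c i)^-1) *m (W *m (map_mx intr B)^T).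
    rewrite mul_diag_mx; apply/matrixP => i j; rewrite !mxE /e sEv mulrC; congr (_ * _).
    by apply: eq_bigr => k _; rewrite !mxE mulrC.
  rewrite !det_mulmx det_diag det_tr det_map_mx !normrM -expr_div_n; congr (_ ^+ 2).
  rewrite mulrC [_ * `|_%:~R|]mulrC nB pmulrn abszE intr_norm; congr (_ * _).
  rewrite normr_prod -prodfV; apply: eq_bigr => i _; rewrite mxE normfV gtr0_norm //.
pose Gc := \matrix_(j, k) \sum_i (E i j)^* * E i k.
have Gr j k : Gc j k \is Num.real.
  rewrite CrealE mxE rmorph_sum /=; apply/eqP.
  have [f fi Hf] := conj_idx; rewrite [RHS](reindex_inj fi) /=; apply: eq_bigr => i _.
  have cf : c (f i) = c i by apply/esym/csym => x; apply: Hf.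
  have cr : (c i)^* = c i by apply/CrealP/gtr0_real.
  have Ef l : E (f i) l = (E i l)^* by rewrite !mxE Hf // cf rmorphM fmorphV /= cr.
  by rewrite !Ef rmorphM.
pose G : 'M[algR]_d := \matrix_(j, k) in_algR (Gr j k).
have mG : map_mx algRval G = Gc by apply/matrixP => j k; rewrite !mxE.
have GE : Gc = (map_mx Num.conj E)^T *m E.
  by apply/matrixP => j k; rewrite !mxE; apply: eq_bigr => i _; rewrite !mxE.
have sG : G^T = G.
  have GG j k : algRval (G j k) = Gc j k by rewrite -mG [in RHS]mxE.
  apply/matrixP => j k; apply: val_inj; rewrite [G^T j k]mxE /= !GG -[RHS](CrealP (Gr j k)) !mxE.
  by rewrite rmorph_sum; apply: eq_bigr => i _; rewrite rmorphM /= conjCK mulrC.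
have dG : algRval (\det G) = `|\det E| ^+ 2.
  by rewrite -det_map_mx mG GE det_mulmx det_tr det_map_mx normCK mulrC.
have qG z : algRval (qf G (zrow algR z)) = \sum_i `|s i (ev w (z *m B))| ^+ 2 / c i ^+ 2.
  have -> : algRval (qf G (zrow algR z)) = (map_mx algRval (zrow algR z *m G *m (zrow algR z)^T)) 0 0 by rewrite mxE.
  rewrite !map_mxM mG GE; set zz := map_mx (intr : int -> algC) z.
  have -> : map_mx algRval (zrow algR z) = zz by apply/matrixP => a b; rewrite !mxE rmorph_int.
  have -> : map_mx algRval (zrow algR z)^T = zz^T by apply/matrixP => a b; rewrite !mxE rmorph_int.
  have -> : zz *m ((map_mx Num.conj E)^T *m E) *m zz^T = (map_mx Num.conj (E *m zz^T))^T *m (E *m zz^T).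
    rewrite map_mxM trmx_mul !mulmxA; congr (_ *m _ *m _ *m _); rewrite map_trmx trmxK.
    by apply/matrixP => a b; rewrite !mxE /= rmorph_int.
  rewrite mxE; apply: eq_bigr => i _; rewrite !mxE.
  have -> : \sum_j E i j * zz^T j 0 = s i (ev w (z *m B)) / c i.
    rewrite eM rmorph_sum mulr_suml; apply: eq_bigr => j _; rewrite !mxE rmorphM /= rmorph_int.
    by rewrite mulrC mulrA.
  by rewrite mulrC -normCK normf_div exprMn exprVn (gtr0_norm (c0 i)).
apply: NNPP => hno.
have := @hermite algR d G 1 ltr01 sG; rewrite expr1n mulr1 => /(_ _) hh.
have {}hh : hermc algR d <= \det G.
  apply: hh => z zn; change (algRval 1 <= algRval (qf G (zrow algR z))); rewrite qG.
  have [i hi] : exists i, ~~ (`|s i (ev w (z *m B))| <= c i).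
    apply: NNPP => h; apply: hno; exists (ev w (z *m B)); split.
    - by apply/HB; exists z.
    - apply: contraNneq zn => /eqP; rewrite -(ev0 w) => /eqP /(ev_inj D) z0.
      have : \det B *: z = 0 by rewrite -mul_mx_scalar -mul_mx_adj mulmxA z0 mul0mx.
      move=> h0; apply/eqP/matrixP => i j; have := congr1 (fun M : 'rV_d => M i j) h0.
      by rewrite !mxE => /eqP; rewrite mulf_eq0 (negPf dB) => /eqP.
    - by move=> i; apply/negPn/negP => hi; apply: h; exists i.
  have hi' : c i < `|s i (ev w (z *m B))| by rewrite real_ltNge ?normr_real ?gtr0_real.
  rewrite (bigD1 i) //= -[1]addr0 lerD //.
    by rewrite -expr_div_n exprn_ege1 // ler_pdivlMr ?mul1r ?ltW.
  by apply: sumr_ge0 => k _; rewrite divr_ge0 // exprn_ge0 // ?ltW.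
have h2 : algRval (hermc algR d) <= ((normI K I)%:R * `|\det W|) ^+ 2 / (\prod_i c i) ^+ 2.
  by rewrite -dE -dG.
have pc : 0 < \prod_i c i by apply: prodr_gt0.
have h3 : algRval 1 < algRval (minkC%:R * hermc algR d) := minkC_ge.
rewrite rmorphM /= rmorph_nat in h3.
have hpos : 0 < algRval (hermc algR d) by exact: (hermc_gt0 algR d).
rewrite ler_pdivlMr ?exprn_gt0 // in h2.
have C1 : (1 <= minkC%:R :> algC) by rewrite ler1n.
have h4 : (minkC%:R * ((normI K I)%:R * `|\det W|)) ^+ 2 <= (\prod_i c i) ^+ 2.
  by rewrite lerXn2r ?nnegrE ?(ltW pc) ?mulr_ge0 // mulrA.
rewrite (exprMn _ minkC%:R) in h4; set a := ((normI K I)%:R * _) ^+ 2 in h2 h4.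
move: h2 h3 h4 hpos pc; move: (algRval _) a (\prod_i _) => h a p h2 h3 h4 h0 p0.
have p20 : 0 < p ^+ 2 by rewrite exprn_gt0.
have : p ^+ 2 < p ^+ 2.
  apply: lt_le_trans h4; apply: (@lt_le_trans _ _ (minkC%:R * h * p ^+ 2)); first by rewrite -{1}[p ^+ 2]mul1r ltr_pM2r.
  rewrite -mulrA; apply: (@le_trans _ _ (minkC%:R * a)); first by rewrite ler_wpM2l.
  rewrite ler_wpM2r //; first by apply: le_trans h2; rewrite mulr_ge0 ?ltW.
  by rewrite expr2 ler_peMr.
by rewrite ltxx.
Qed.
End Minkowski.

Section Msets.
Variables (T : eqType) (nrm : T -> nat).
(** Multisets of elements of [Ps] whose norms multiply to at most B. Taking the multiplicity of each
    element in turn makes the length of the list accessible to Rankin's trick by induction on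
    [Ps]. *)
Fixpoint msets (Ps : seq T) (B : nat) : seq (seq T) :=
  if Ps is P :: Ps' then
    flatten [seq [seq nseq e P ++ l | l <- msets Ps' (B %/ nrm P ^ e)] | e <- iota 0 B.+1]
  else if (0 < B)%N then [:: [::]] else [::].

Lemma msets_cover Ps B l : (forall P, P \in Ps -> 1 < nrm P)%N -> {subset l <= Ps} ->
  (\prod_(P <- l) nrm P <= B)%N -> exists2 l', l' \in msets Ps B & perm_eq l l'.
Proof.
elim: Ps B l => [|P Ps IH] B l hn sub hB.
  case: l sub hB => [|x l] sub hB; last by have := sub x; rewrite mem_head => /(_ isT).
  by exists [::] => //=; rewrite big_nil in hB; rewrite hB mem_head.
pose e := count_mem P l; pose r := filter (predC (pred1 P)) l.
have pl : perm_eq l (nseq e P ++ r).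
  have <- : filter (pred1 P) l = nseq e P.
    by rewrite /e; elim: l {sub hB r e} => //= x l ->; case: eqP => [->|].
  by rewrite perm_sym; apply/permPl/perm_filterC.
have hP : (1 < nrm P)%N by apply: hn; rewrite mem_head.
have E : (\prod_(Q <- l) nrm Q = nrm P ^ e * \prod_(Q <- r) nrm Q)%N.
  rewrite (perm_big _ pl) big_cat /= big_nseq iter_muln_1; congr (_ * _)%N.
have hr : (\prod_(Q <- r) nrm Q <= B %/ nrm P ^ e)%N.
  by rewrite leq_divRL ?expn_gt0 ?(ltnW hP) // mulnC -E.
have [|||l' l'in pl'] := IH (B %/ nrm P ^ e)%N r.
- by move=> Q QPs; apply: hn; rewrite inE QPs orbT.
- move=> Q; rewrite mem_filter /= => /andP[QP /sub]; by rewrite inE (negPf QP).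
- exact: hr.
exists (nseq e P ++ l'); last by rewrite (perm_trans pl) // perm_cat2l.
apply/flatten_mapP; exists e; last by apply/mapP; exists l'.
rewrite mem_iota add0n ltnS /=; apply: leq_trans hB; rewrite E.
have r0 : (0 < \prod_(Q <- r) nrm Q)%N.
  rewrite big_seq_cond; apply: prodn_cond_gt0 => Q /andP[+ _]; rewrite mem_filter => /andP[/= QP /sub].
  by rewrite inE (negPf QP) /= => QPs; apply: ltnW; apply: hn; rewrite inE QPs orbT.
apply: leq_trans (leq_pmulr _ r0); apply: ltnW; exact: ltn_expl.
Qed.
End Msets.

Section PrimeIdeals.
Variables (K : cset) (d : nat) (s : 'I_d -> aut) (w : 'I_d -> algC).
Hypothesis D : nfdata K s w.
Let sK := nfdata_sub D.
Implicit Types I J P : cset.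

Lemma nat_nz n : (0 < n)%N -> nonzero_ideal K (principal K n%:R).
Proof. by move=> n0; apply: principal_nz => //; [apply: OK_nat | rewrite pnatr_eq0 -lt0n]. Qed.

Lemma normI_nat n : (0 < n)%N -> normI K (principal K n%:R) = (n ^ d)%N.
Proof.
move=> n0; have On := OK_nat n sK; rewrite (normI_principal D) // ?pnatr_eq0 -?lt0n //.
apply/eqP; rewrite -(eqr_nat algC) (nmnE D) // nm_nat natrX ger0_norm ?exprn_ge0 //.
Qed.

Lemma principal_sub I a x : is_ideal K I -> I a -> principal K a x -> I x.
Proof. by move=> hI Ia [r [Or ->]]; apply: (idmulr hI). Qed.

Lemma pideal_gt1 P : prime_ideal K P -> (1 < normI K P)%N.
Proof.
move=> pP; rewrite ltn_neqAle (normI_gt0 D (primeP_nz pP)) andbT eq_sym; apply/eqP => E.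
have h := normIP D (primeP_nz pP); rewrite E in h.
have hP := primeP_id pP; apply: (pP.2.1).
by apply: (idx1 (id_addcl sK hP) _ h); [move=> x; apply: (idsub hP) | apply: OK1].
Qed.

Lemma prime_norm_ge P p : prime_ideal K P -> prime p -> P p%:R -> (p <= normI K P)%N.
Proof.
move=> pP pp Pp; have [|A [hA EA]] := ideal_dvd D (primeP_nz pP) (principal_ideal sK (OK_nat p sK)).
  by move=> x; apply: principal_sub => //; apply: primeP_id.
have nA : nonzero_ideal K A.
  split => //; exists p%:R; split; last by rewrite pnatr_eq0 -lt0n prime_gt0.
  have : principal K p%:R p%:R by apply: principal_mem.
  by rewrite EA iprodC; apply: (iprod_subl sK hA); apply: primeP_id.
have : (normI K P %| p ^ d)%N by rewrite -normI_nat ?prime_gt0 // EA (normIM D (primeP_nz pP) nA) dvdn_mulr.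
case/(dvdn_pfactor _ _ pp) => k _ Ek; have := pideal_gt1 pP; rewrite Ek.
by case: k {Ek} => // k _; rewrite expnS leq_pmulr // expn_gt0 prime_gt0.
Qed.

Lemma prime_char P : prime_ideal K P -> exists2 p, prime p & P p%:R.
Proof.
move=> pP; have [n n0 Pn] := nz_pos D (primeP_nz pP).
elim/ltn_ind: n n0 Pn => n IH n0 Pn.
have n1 : (1 < n)%N by rewrite ltn_neqAle n0 andbT eq_sym; apply/eqP => E; apply: (pP.2.1); rewrite E in Pn.
have pp := pdiv_prime n1; have := pdiv_dvd n => /dvdnP[q Eq].
have q0 : (0 < q)%N by rewrite lt0n; apply: contraTneq n0 => q0; rewrite Eq q0.
have : P (q%:R * (pdiv n)%:R) by rewrite -natrM -Eq.
case/(pP.2.2 _ _ (OK_nat q sK) (OK_nat _ sK)) => h; last by exists (pdiv n).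
by apply: (IH q) => //; rewrite Eq ltn_Pmulr // prime_gt1.
Qed.

Definition primesOver (p : nat) : seq cset := undup (fac K (principal K p%:R)).

Lemma primesOverP p P : prime p -> P \in primesOver p <-> prime_ideal K P /\ P p%:R.
Proof.
move=> pp; have nz := nat_nz (prime_gt0 pp); have [pf Ef] := facP D nz.
rewrite mem_undup; split.
  move=> Pf; have pP := pf _ Pf; split => //.
  have : (0 < vI K P (principal K p%:R))%N by rewrite /vI -has_count has_pred1.
  by move/(vI_gt0 D pP nz); apply; apply: principal_mem.
move=> [pP Pp]; rewrite -has_pred1 has_count; apply/(vI_gt0 D pP nz) => x.
by apply: principal_sub => //; apply: primeP_id.
Qed.

Lemma size_primesOver p : prime p -> (size (primesOver p) <= d)%N.
Proof.
move=> pp; have nz := nat_nz (prime_gt0 pp); have [pf Ef] := facP D nz.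
apply: leq_trans (size_undup _) _.
rewrite -(leq_exp2l _ _ (prime_gt1 pp)) -normI_nat ?prime_gt0 // [X in (_ <= normI K X)%N]Ef (normI_prodI D pf).
have : {in fac K (principal K p%:R), forall P, p <= normI K P}%N.
  move=> P Pf; have : P \in primesOver p by rewrite mem_undup.
  by move/(primesOverP _ pp) => -[pP Pp]; apply: prime_norm_ge.
elim: (fac _ _) => [|P l IH] h; first by rewrite big_nil.
rewrite big_cons expnS leq_mul //; first by apply: h; rewrite mem_head.
by apply: IH => Q Ql; apply: h; rewrite inE Ql orbT.
Qed.

Definition primesUpto (B : nat) : seq cset := flatten [seq primesOver p | p <- iota 0 B.+1 & prime p].

Lemma primesUpto_prime B P : P \in primesUpto B -> prime_ideal K P.
Proof.
by move/flatten_mapP => [p]; rewrite mem_filter => /andP[pp _] /(primesOverP _ pp)[].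
Qed.

Lemma ideals_upto B I : nonzero_ideal K I -> (normI K I <= B)%N ->
  exists2 l, l \in msets (normI K) (primesUpto B) B & I = prodI K l.
Proof.
move=> nI hB; have [l pl El] := uf_exists D nI.
have hn : (\prod_(P <- l) normI K P <= B)%N by rewrite -(normI_prodI D pl) -El.
have [|||l' l'in pll'] := @msets_cover _ (normI K) (primesUpto B) B l.
- by move=> P /primesUpto_prime; apply: pideal_gt1.
- move=> P Pl; have pP := pl _ Pl; have [p pp Pp] := prime_char pP.
  apply/flatten_mapP; exists p; last by apply/(primesOverP _ pp).
  rewrite mem_filter pp mem_iota add0n ltnS /=; apply: leq_trans hn.
  apply: leq_trans (prime_norm_ge pP pp Pp) _; rewrite (perm_big _ (perm_to_rem Pl)) big_cons leq_pmulr //.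
  rewrite big_seq_cond; apply: prodn_cond_gt0 => Q /andP[Qr _]; apply: ltnW; apply: pideal_gt1.
  by apply: pl; apply: mem_rem Qr.
- exact: hn.
by exists l' => //; rewrite El; apply: (prodI_perm D).
Qed.
End PrimeIdeals.

(** An integral substitute for the d-th root, at the price of a factor 2^d, which keeps the sides of
    boxes integral. *)
Lemma root_ceil (d b : nat) : (0 < d)%N -> (0 < b)%N -> exists h, [/\ 0 < h, h <= b, b <= h ^ d & h ^ d <= 2 ^ d * b]%N.
Proof.
move=> d0 b0; have [|h [hb hmin]] := @nat_min (fun h => b <= h ^ d)%N.
  by exists b; rewrite -{1}[b]expn1 leq_pexp2l.
have h0 : (0 < h)%N by rewrite lt0n; apply: contraTneq hb => ->; rewrite exp0n // -ltnNge.
have hb' : (h <= b)%N by apply: hmin; rewrite -{1}[b]expn1 leq_pexp2l.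
exists h; split => //; case: h h0 hb hmin hb' => // h _ hb hmin hb'.
have [->|h0] := posnP h; first by rewrite exp1n muln_gt0 expn_gt0.
have lt : (h ^ d < b)%N by rewrite ltnNge; apply/negP => /hmin; rewrite ltnn.
apply: leq_trans (leq_mul (leqnn _) (ltnW lt)); rewrite -expnMn leq_exp2r // mul2n -addnn -addn1 leq_add2l //.
Qed.

(** * Counting torsion classes *)

Section ClassMap.
Variables (K : cset) (d : nat) (s : 'I_d -> aut) (w : 'I_d -> algC).
Hypothesis D : nfdata K s w.
Let sK := nfdata_sub D.
Let W := \matrix_(i, j) s i (w j).

Lemma ipow_principal a k : OK K a -> ipow K (principal K a) k = principal K (a ^+ k).
Proof.
move=> Oa; elim: k => [|k IH]; first by rewrite expr0 principal1.
have Ok : OK K (a ^+ k) by elim: k {IH} => [|k IH]; rewrite ?expr0 ?exprS; [exact: OK1 | exact: OK_mul].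
by rewrite /ipow iterS -/(ipow K _ k) IH (principalM sK Oa Ok) exprS.
Qed.
Lemma ipowM I J k : is_ideal K I -> is_ideal K J -> ipow K (iprod I J) k = iprod (ipow K I k) (ipow K J k).
Proof.
move=> hI hJ; have hp (M : cset) k' : is_ideal K M -> is_ideal K (ipow K M k').
  by move=> hM; elim: k' => [|k' IH]; [exact: OK_ideal | exact: iprod_ideal].
elim: k => [|k IH]; first by rewrite [RHS]iprod_OK //; exact: OK_ideal.
rewrite /ipow !iterS -!/(ipow K _ k) IH.
have [h1 h2] := (hp I k hI, hp J k hJ).
rewrite -(iprodAK sK hI hJ (iprod_ideal sK h1 h2)) (iprodAK sK hJ h1 h2) (iprodC J).
by rewrite -(iprodAK sK h1 hJ h2) (iprodAK sK hI h1 (iprod_ideal sK hJ h2)).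
Qed.
Lemma ipow_mem I x k : I x -> ipow K I k (x ^+ k).
Proof.
by move=> Ix; elim: k => [|k IH]; [rewrite expr0; exact: OK1 | rewrite exprS; apply: iprod_mul].
Qed.
Lemma OK_X x k : OK K x -> OK K (x ^+ k).
Proof. by move=> Ox; elim: k => [|k IH]; rewrite ?expr0 ?exprS; [exact: OK1 | exact: OK_mul]. Qed.

Lemma nm_ge1 x : OK K x -> x != 0 -> 1 <= \prod_i `|s i x|.
Proof. by move=> Ox x0; rewrite -normr_prod -(nmnE D) // ler1n (nmn_gt0 D). Qed.

(** The norm of x is at least 1 in absolute value, and the other conjugates are at most [b]. *)
Lemma conj_lower x (b : nat) i : OK K x -> x != 0 -> (0 < b)%N -> (forall i, `|s i x| <= b%:R) ->
  1 <= `|s i x| * (b ^ d)%:R.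
Proof.
move=> Ox x0 b0 hb; apply: le_trans (nm_ge1 Ox x0) _; rewrite (bigD1 i) //= ler_wpM2l //.
apply: (@le_trans _ _ (\prod_(j | j != i) (b%:R : algC))).
  by apply: ler_prod => j _; rewrite normr_ge0 hb.
rewrite prodr_const natrX ler_weXn2l ?ler1n // .
by rewrite -[X in (_ <= X)%N]card_ord max_card.
Qed.

Variables (l rD Y N M : nat) (Is : 'I_N -> cset) (As : 'I_M -> cset).
Hypotheses (l0 : (0 < l)%N) (r0 : (0 < rD)%N) (Y0 : (0 < Y)%N).
Hypothesis hrD : `|\det W| <= rD%:R.
Hypothesis hIs : forall j, nonzero_ideal K (Is j) /\ is_principal K (ipow K (Is j) l).
Hypothesis Isneq : forall i j, iequiv K (Is i) (Is j) -> i = j.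
Hypothesis hAs : forall i, nonzero_ideal K (As i) /\ (normI K (As i) <= Y)%N.
(** The relation says that b / b' generates the l-th power of A_i / A_i'. The factor 2 is the width
    of the dyadic intervals in which [class_map] records the conjugates. *)
Hypothesis sep : forall i i' b b', i <> i' -> OK K b -> OK K b' -> b != 0 -> b' != 0 ->
  iprod (principal K b) (ipow K (As i') l) = iprod (principal K b') (ipow K (As i) l) ->
  (forall v, `|s v b| <= 2 * `|s v b'|) -> False.

(** [B] bounds the norm of the cofactor ideal, hM^l the conjugates of x^l / a, and [E] their dyadic
    level after multiplication by (hM^l)^d, which makes them at least 1 by [conj_lower]. *)
Let B := (2 ^ d * (minkC d * rD))%N.
Let hM := (minkC d * rD * Y)%N.
Let E := trunc_log 2 (hM ^ l * (hM ^ l) ^ d).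

(** Minkowski in I_j A_i with the side at v proportional to the l-th root of |s_v a|, where (a) =
    I_j^l. These roots multiply to N(I_j), so the box has the right volume, and all conjugates of b
    = x^l / a become bounded independently of [a]. *)
Lemma class_step (j : 'I_N) (i : 'I_M) : exists x a b (BB : cset),
  [/\ OK K x /\ x != 0, OK K a /\ a != 0, ipow K (Is j) l = principal K a, OK K b /\ x ^+ l = a * b &
   [/\ nonzero_ideal K BB, (normI K BB <= B)%N, principal K x = iprod (iprod (Is j) (As i)) BB & forall v, `|s v b| <= (hM ^ l)%:R]].
Proof.
have [nI [a [Oa /cset_ext Ea]]] := hIs j; have [nA AY] := hAs i.
have a0 : a != 0.
  have [_ [x [Ix x0]]] := ipow_nz D l nI; move: Ix; rewrite Ea => -[r [_ Ex]].
  by apply: contraNneq x0 => a0; rewrite Ex a0 mul0r.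
have d0 := qdata_pos (nfdata_qdata D).
have nA0 := normI_gt0 D nA; have nI0 := normI_gt0 D nI.
have [|h [h0 hb hb1 hb2]] := @root_ceil d (minkC d * rD * normI K (As i)) d0.
  by rewrite muln_gt0 nA0 andbT muln_gt0 r0 andbT.
pose c v := l.-root `|s v a| * h%:R.
have c0 v : 0 < c v by rewrite mulr_gt0 ?ltr0n // rootC_gt0 // normr_gt0 fmorph_eq0.
have nJ := nz_iprod sK nI nA.
have EN : \prod_v l.-root `|s v a| = (normI K (Is j))%:R.
  apply/eqP; rewrite -(eqrXn2 l0) ?ler0n //; last by apply: prodr_ge0 => v _; rewrite rootC_ge0.
  rewrite -prodrXl -natrX; have -> : (normI K (Is j) ^ l)%N = nmn s a.
    rewrite -(normI_principal D) // -Ea; elim: (l) => [|k IH]; first by rewrite [ipow _ _ _]/= (normI_OK D).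
    by rewrite /ipow iterS -/(ipow K _ k) (normIM D nI (ipow_nz D k nI)) expnS IH.
  rewrite (nmnE D) // normr_prod; apply/eqP/eq_bigr => v _; by rewrite rootCK.
have [||x [Jx x0 hx]] := @minkowski K d s w D (iprod (Is j) (As i)) c nJ c0.
- move=> v v' hv; rewrite /c hv ?norm_conjC //; by case: Oa.
- rewrite /c big_split /= EN prodr_const card_ord (normIM D) //.
  rewrite [X in _ <= X]mulrC -natrX; apply: (@le_trans _ _ ((minkC d * rD * normI K (As i))%:R * (normI K (Is j))%:R)).
    rewrite !natrM; have -> : (minkC d)%:R * rD%:R * (normI K (As i))%:R * (normI K (Is j))%:R = (minkC d)%:R * ((normI K (Is j))%:R * (normI K (As i))%:R) * rD%:R :> algC by ring.
    by rewrite ler_wpM2l ?mulr_ge0 ?ler0n.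
  by rewrite ler_wpM2r ?ler0n // ler_nat.
have Ox := idsub nJ.1 Jx.
have [|BB [hBB EBB]] := ideal_dvd D nJ (principal_ideal sK Ox); first by move=> y; apply: principal_sub => //; exact: nJ.1.
have nBB : nonzero_ideal K BB.
  split => //; exists x; split => //; have := principal_mem sK x; rewrite EBB iprodC.
  by apply: (iprod_subl sK hBB nJ.1).
have [r [Or Er]] : principal K a (x ^+ l).
  rewrite -Ea; apply: ipow_mem; by apply: (iprod_subl sK nI.1 nA.1).
exists x, a, r, BB; split => //; split => //.
- have e1 : normI K (principal K x) = (normI K (iprod (Is j) (As i)) * normI K BB)%N by rewrite EBB (normIM D).
  have e2 : (nmn s x <= normI K (Is j) * h ^ d)%N.
    rewrite -(ler_nat algC) (nmnE D) // normr_prod natrM natrX -EN -[h%:R ^+ d](_ : \prod_(v < d) h%:R = _); last by rewrite prodr_const card_ord.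
    by rewrite -big_split; apply: ler_prod => v _; rewrite normr_ge0 hx.
  rewrite (normI_principal D) // (normIM D) // -mulnA in e1; rewrite e1 leq_pmul2l // in e2.
  rewrite -(leq_pmul2l nA0); apply: leq_trans e2 (leq_trans hb2 _).
  by rewrite /B !mulnA mulnC !mulnA.
- move=> v; have sa0 : 0 < `|s v a| by rewrite normr_gt0 fmorph_eq0.
  rewrite -(ler_pM2l sa0) -normrM -rmorphM /= -Er rmorphXn /= normrX natrX.
  apply: (@le_trans _ _ (c v ^+ l)); first by rewrite lerXn2r ?nnegrE ?hx // ltW.
  rewrite exprMn rootCK // ler_pM2l // lerXn2r ?nnegrE ?ler0n // ler_nat /hM.
  by apply: leq_trans hb _; rewrite leq_mul2l AY orbT.
Qed.

(* The code of (j, i) records the cofactor ideal of a small x in I_j A_i together with the dyadic sizes of the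
   conjugates of x^l / a_j: two pairs with the same code would
   contradict [sep] or the inequivalence of the I_j. *)
Lemma class_map : (N * M <= size (msets (normI K) (primesUpto K B) B) * E.+1 ^ d)%N.
Proof.
pose L := msets (normI K) (primesUpto K B) B.
have bM0 : (0 < hM ^ l)%N by rewrite expn_gt0 !muln_gt0 r0 Y0.
pose code (p : 'I_N * 'I_M) (q : 'I_(size L) * {ffun 'I_d -> 'I_E.+1}) :=
  exists x a b (BB : cset), [/\ OK K x /\ x != 0, OK K a /\ a != 0, ipow K (Is p.1) l = principal K a, OK K b /\ x ^+ l = a * b &
   [/\ nonzero_ideal K BB, BB = prodI K (nth [::] L q.1), principal K x = iprod (iprod (Is p.1) (As p.2)) BB &
     forall v, let t := Num.truncn (`|s v b| * ((hM ^ l) ^ d)%:R) in (0 < t)%N /\ q.2 v = trunc_log 2 t :> nat]].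
have [f Hf] : exists f, forall p, code p (f p).
  apply: (choice_fun (P := code)) => -[j i].
  have [x [a [b [BB [[Ox x0] [Oa a0] Ea [Ob Eb] [nB hB Ex hb]]]]]] := class_step j i.
  have [ll lin Ell] := ideals_upto D nB hB.
  have b0 : b != 0 by apply: contraNneq (expf_neq0 l x0) => b0; rewrite Eb b0 mulr0.
  have tpos v : (0 < Num.truncn (`|s v b| * ((hM ^ l) ^ d)%:R))%N.
    by rewrite Num.Theory.truncn_gt0; apply: conj_lower.
  have hE v : (trunc_log 2 (Num.truncn (`|s v b| * ((hM ^ l) ^ d)%:R)) < E.+1)%N.
    rewrite ltnS /E; apply: leq_trunc_log.
    rewrite -(ler_nat algC); apply: (@le_trans _ _ (`|s v b| * ((hM ^ l) ^ d)%:R)).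
      by rewrite Num.Theory.truncn_le mulr_ge0 ?ler0n.
    by rewrite natrM ler_wpM2r ?ler0n.
  have iL : (seq.index ll L < size L)%N by rewrite index_mem.
  exists (Ordinal iL, [ffun v => Ordinal (hE v)]); exists x, a, b, BB; split => //; split => //=.
    by rewrite nth_index.
  by move=> v; rewrite ffunE.
have fi : injective f.
  move=> [j i] [j' i'] Eff; have := Hf (j, i); have := Hf (j', i'); rewrite -Eff.
  move=> [x' [a' [b' [BB' [[Ox' x0'] [Oa' a0'] Ea' [Ob' Eb'] [nB' EB' Ex' hb']]]]]].
  move=> [x [a [b [BB [[Ox x0] [Oa a0] Ea [Ob Eb] [nB EB Ex hb]]]]]]; simpl in *.
  have EBB : BB' = BB by rewrite EB EB'.
  rewrite EBB in Ex'; clear nB' EB' EBB; have [nI _] := hIs j; have [nI' _] := hIs j'; have [nA _] := hAs i; have [nA' _] := hAs i'.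
  have b0 : b != 0 by apply: contraNneq (expf_neq0 l x0) => b0; rewrite Eb b0 mulr0.
  have b0' : b' != 0 by apply: contraNneq (expf_neq0 l x0') => b00; rewrite Eb' b00 mulr0.
  have hp M' : nonzero_ideal K M' -> is_ideal K (ipow K M' l) by move=> /(ipow_nz D l) [].
  (* The cofactor relation raised to the l-th power, after cancellation of J^l = (c). *)
  have key z c e (J A : cset) : OK K z -> OK K c -> OK K e -> c != 0 -> nonzero_ideal K J -> nonzero_ideal K A ->
     ipow K J l = principal K c -> z ^+ l = c * e -> principal K z = iprod (iprod J A) BB ->
     principal K e = iprod (ipow K A l) (ipow K BB l).
    move=> Oz Oc Oe c0 nJ nA1 EJ Ez Epz.
    apply: (@iprod_principal_inj K sK c); [exact: c0 | exact: principal_ideal | by apply: iprod_ideal => //; apply: hp |].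
    rewrite (principalM sK Oc Oe) -Ez -ipow_principal // Epz (ipowM _ (iprod_ideal sK nJ.1 nA1.1) nB.1) (ipowM _ nJ.1 nA1.1) EJ.
    by rewrite (iprodAK sK (principal_ideal sK Oc) (hp _ nA1) (hp _ nB)).
  have K1 := key x a b (Is j) (As i) Ox Oa Ob a0 nI nA Ea Eb Ex.
  have K2 := key x' a' b' (Is j') (As i') Ox' Oa' Ob' a0' nI' nA' Ea' Eb' Ex'.
  have ii : i = i'.
    apply: NNPP => nii; apply: (sep nii Ob Ob' b0 b0').
      rewrite K1 K2 -(iprodAK sK (hp _ nA) (hp _ nB) (hp _ nA')) iprodC (iprodC (ipow K BB l)).
      by [].
    move=> v; have [t0 e1] := hb v; have [t0' e2] := hb' v.
    set t := Num.truncn _ in t0 e1; set t' := Num.truncn _ in t0' e2.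
    have H0 : 0 < ((hM ^ l) ^ d)%:R :> algC by rewrite ltr0n expn_gt0 bM0.
    rewrite -(ler_pM2r H0) -mulrA.
    have le1 : `|s v b| * ((hM ^ l) ^ d)%:R <= t.+1%:R.
      by apply: ltW; have := @Num.Theory.truncn_itv _ (`|s v b| * ((hM ^ l) ^ d)%:R); rewrite mulr_ge0 ?ler0n // => /(_ isT) /andP[].
    have le2 : t'%:R <= `|s v b'| * ((hM ^ l) ^ d)%:R by rewrite Num.Theory.truncn_le mulr_ge0 ?ler0n.
    apply: le_trans le1 _; apply: le_trans (_ : 2 * t'%:R <= _); last by rewrite ler_pM2l.
    rewrite -natrM ler_nat; have := trunc_log_ltn t (isT : 1 < 2)%N; have := @trunc_logP 2 t' isT t0'.
    rewrite -e1 -e2 expnS => h1 h2; apply: leq_trans h2 _; by rewrite leq_mul2l.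
  (* With equal second components, (x') I_j and (x) I_j' are both I_j I_j' A_i BB, so I_j and I_j'
     are equivalent. *)
  subst i'; congr (_, _); apply: Isneq; exists x', x; split => //; split => //; split => //; split => //.
  move=> y; suff -> : iprod (principal K x') (Is j) = iprod (principal K x) (Is j') by [].
  have hAB := iprod_ideal sK nA.1 nB.1.
  rewrite Ex Ex' -(iprodAK sK nI'.1 nA.1 nB.1) -(iprodAK sK nI.1 nA.1 nB.1).
  rewrite iprodC (iprodAK sK nI.1 nI'.1 hAB) (iprodC (Is j)) -(iprodAK sK nI'.1 nI.1 hAB).
  exact: iprodC.
by have := leq_card f fi; rewrite !card_prod !card_ord card_ffun !card_ord.
Qed.
End ClassMap.

Lemma nf_Qadj t : number_field (Qadj t).
Proof.
have [d [s [D _]]] := Qadj_data t; split; first exact: Qadj_subfield.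
exists d, (fun k => t ^+ k); case: (D) => sK Kw spw _ _; split => //; split.
  move=> c Qc E.
  have [a Ha] : exists a : 'I_d -> rat, forall i, c i = ratr (a i).
    by apply: (choice_ord (P := fun i a => c i = ratr a)) => i; apply/CratP/Qc.
  have E' : \sum_i ratr (a i) * t ^+ i = 0 by rewrite -[RHS]E; apply: eq_bigr => i _; rewrite Ha.
  by move=> i; rewrite Ha (qdata_indep D E') rmorph0.
by move=> x /spw[c ->]; exists (fun i => ratr (c i)); split => // i; apply: Crat_rat.
Qed.

Lemma Qadj_self t : Qadj t t.
Proof. by exists 'X; rewrite map_polyX hornerX. Qed.

Lemma Qadj_min t E x : is_subfield E -> E t -> Qadj t x -> E x.
Proof. by move=> sE Et [p ->]; apply: sfhorner. Qed.

Lemma Qadj_agree t (nu mu : aut) x : nu t = mu t -> Qadj t x -> nu x = mu x.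
Proof. by move=> E [p ->]; rewrite !aut_QtoC E. Qed.

(** The last clause is the generation of C by A and B, in the form needed for Galois arguments: an
    automorphism is determined on C by its restrictions to A and B. *)
Lemma compositum A B : number_field A -> number_field B -> exists C,
  [/\ number_field C, Defs.subset A C, Defs.subset B C &
   forall nu mu : aut, (forall x, A x -> nu x = mu x) -> (forall x, B x -> nu x = mu x) -> forall x, C x -> nu x = mu x].
Proof.
move=> /number_field_Qadj[a _ ->] /number_field_Qadj[b _ ->].
have [z [c Dz] [ps Dps]] := algC_PET [:: a; b].
have sz := Qadj_subfield z.
have mem y : y \in [:: a; b] -> Qadj z y by rewrite Dps => /mapP[p _ ->]; exists p.
exists (Qadj z); split; first exact: nf_Qadj.
- by move=> x; apply: Qadj_min => //; apply: mem; rewrite mem_head.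
- by move=> x; apply: Qadj_min => //; apply: mem; rewrite inE mem_seq1 eqxx orbT.
move=> nu mu ha hb x; apply: Qadj_agree; rewrite Dz !rmorph_sum /=; apply: eq_bigr => i _.
rewrite !rmorphMn /=; congr (_ *+ _); have := @mem_nth _ 0 [:: a; b] i (ltn_ord i); move: (_`_i) => y.
by rewrite !inE => /orP[] /eqP ->; [apply: ha | apply: hb]; apply: Qadj_self.
Qed.

Lemma indep_rat d (v : 'I_d -> algC) : lin_indep QQ v <-> forall c : 'I_d -> rat, \sum_i ratr (c i) * v i = 0 -> forall i, c i = 0.
Proof.
split=> h c.
  move=> E i; apply/eqP; rewrite -(fmorph_eq0 (ratr : rat -> algC)); apply/eqP.
  by apply: (h (fun i => ratr (c i))) => // j; apply: Crat_rat.
move=> Qc E; have [a Ha] : exists a : 'I_d -> rat, forall i, c i = ratr (a i).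
  by apply: (choice_ord (P := fun i a => c i = ratr a)) => i; apply/CratP/Qc.
move=> i; rewrite Ha (h a) ?rmorph0 // -[RHS]E; by apply: eq_bigr => j _; rewrite Ha.
Qed.

Lemma indep_leq a b (w : 'I_a -> algC) (v : 'I_b -> algC) : lin_indep QQ w ->
  (forall i, exists c : 'I_b -> rat, w i = \sum_j ratr (c j) * v j) -> (a <= b)%N.
Proof.
move=> /indep_rat hw hv; have [C HC] := choice_ord (P := fun i (c : 'I_b -> rat) => w i = \sum_j ratr (c j) * v j) hv.
pose M : 'M[rat]_(a, b) := \matrix_(i, j) C i j.
suff : row_free M by move/eqP <-; apply: rank_leq_col.
apply/row_freeP; apply/row_freeP; rewrite -kermx_eq0; apply/eqP/row_matrixP => i; rewrite row0.
have : row i (kermx M) *m M = 0 by rewrite -row_mul mulmx_ker row0.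
move: (row i _) => u uM; apply/rowP => j; rewrite mxE.
apply: (hw (fun j => u 0 j)); under eq_bigr => k _ do rewrite HC mulr_sumr.
rewrite exchange_big big1 //= => k _; under eq_bigr => l _ do rewrite mulrA -rmorphM.
rewrite -mulr_suml -rmorph_sum; have := congr1 (fun N : 'rV_b => N 0 k) uM; rewrite !mxE => E.
rewrite (_ : \sum_(l < a) _ = 0) ?rmorph0 ?mul0r // -[RHS]E; by apply: eq_bigr => l _; rewrite mxE.
Qed.

(** * Cyclic extensions and Kummer theory *)

Section Degree.
Variables (K : cset) (d : nat) (s : 'I_d -> aut) (w : 'I_d -> algC) (D : qdata K s w).

Lemma qdata_leq a (v : 'I_a -> algC) : (forall i, K (v i)) -> lin_indep QQ v -> (a <= d)%N.
Proof. by move=> Kv hv; apply: (indep_leq hv (v := w)) => i; case: D => _ _ h _ _; apply: h. Qed.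

Lemma qdata_deg a (v : 'I_a -> algC) : is_basis QQ K v -> a = d.
Proof.
move=> [Kv [iv spv]]; apply/eqP; rewrite eqn_leq (qdata_leq Kv iv) /=.
apply: (@indep_leq _ _ w v); first by apply/indep_rat; apply: qdata_indep D.
move=> i; have [c [Qc ->]] := spv (w i) (let: And5 _ h _ _ _ := D in h i).
have [b Hb] : exists b : 'I_a -> rat, forall i, c i = ratr (b i).
  by apply: (choice_ord (P := fun i a => c i = ratr a)) => j; apply/CratP/Qc.
by exists b; apply: eq_bigr => j _; rewrite Hb.
Qed.

Lemma qdata_det (v : 'I_d -> algC) : (forall i, K (v i)) -> lin_indep QQ v -> \det (\matrix_(i, j) s i (v j)) != 0.
Proof.
move=> Kv /indep_rat hv; case: D => _ _ spw dW _.
have [C HC] := choice_ord (P := fun i (c : 'I_d -> rat) => v i = \sum_j ratr (c j) * w j) (fun i => spw _ (Kv i)).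
pose M : 'M[rat]_d := \matrix_(i, j) C j i.
have -> : \matrix_(i, j) s i (v j) = (\matrix_(i, j) s i (w j)) *m map_mx ratr M.
  apply/matrixP => i j; rewrite !mxE HC rmorph_sum /=; apply: eq_bigr => k _.
  by rewrite !mxE rmorphM /= fmorph_rat mulrC.
rewrite det_mulmx mulf_neq0 // det_map_mx fmorph_eq0 -det_tr; apply/det0P => -[u u0 uM].
have u0' : forall j, u 0 j = 0.
  apply: hv; under eq_bigr => k _ do rewrite HC mulr_sumr.
  rewrite exchange_big big1 //= => k _; under eq_bigr => l _ do rewrite mulrA -rmorphM.
  rewrite -mulr_suml -rmorph_sum; have := congr1 (fun N : 'rV_d => N 0 k) uM; rewrite !mxE => E.
  rewrite (_ : \sum_(l < d) _ = 0) ?rmorph0 ?mul0r // -[RHS]E; by apply: eq_bigr => l _; rewrite !mxE.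
by case/eqP: u0; apply/rowP => j; rewrite mxE u0'.
Qed.
End Degree.

Lemma lin_indep_fin F (T : finType) (w : T -> algC) (d : nat) (f : 'I_d -> T) (v : 'I_d -> algC) :
  bijective f -> (forall i, v i = w (f i)) ->
  (forall c : T -> algC, (forall t, F (c t)) -> \sum_t c t * w t = 0 -> forall t, c t = 0) -> lin_indep F v.
Proof.
move=> [g fK gK] hv hw c Fc E i; have := hw (fun t => c (g t)) (fun t => Fc _).
rewrite (reindex f); last by exists g => x _.
by under eq_bigr => j _ do rewrite fK -hv; rewrite E => /(_ erefl (f i)); rewrite fK.
Qed.

Definition unpair m n (k : 'I_(m * n)) : 'I_m * 'I_n := enum_val (cast_ord (esym (mxvec_cast m n)) k).
Lemma unpair_bij m n : bijective (@unpair m n).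
Proof.
exists (fun p => cast_ord (mxvec_cast m n) (enum_rank p)) => k.
  by rewrite /unpair enum_valK cast_ordKV.
by rewrite /unpair cast_ordK enum_rankK.
Qed.

Section Tower.
Variables (F K : cset) (m n : nat) (f : 'I_m -> algC) (v : 'I_n -> algC).
Hypotheses (sF : is_subfield F) (hf : is_basis QQ F f) (hv : is_basis F K v) (sK : is_subfield K) (FK : Defs.subset F K).
Definition prod_basis (k : 'I_(m * n)) := f (unpair k).1 * v (unpair k).2.

Lemma prod_indep : lin_indep F v -> lin_indep QQ prod_basis.
Proof.
move=> iv; case: hf => Ff [ifi _].
apply: (lin_indep_fin (w := fun p : 'I_m * 'I_n => f p.1 * v p.2) (unpair_bij m n)) => // c Qc E [i j].
have E' : \sum_j (\sum_i c (i, j) * f i) * v j = 0.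
  transitivity (\sum_i \sum_j c (i, j) * (f i * v j)); last by rewrite pair_bigA -[RHS]E; apply: eq_bigr => -[].
  rewrite exchange_big; apply: eq_bigr => k _.
  by rewrite mulr_suml; apply: eq_bigr => l _; rewrite mulrA.
apply: (ifi (fun i => c (i, j))) => [l|]; first exact: Qc.
apply: (iv _ _ E') => l; apply: sfsum => // k _; apply: sfM => //; apply: sfCrat => //; exact: Qc.
Qed.

Lemma prod_basisP : is_basis QQ K prod_basis.
Proof.
case: (hf) (hv) => Ff [ifi spf] [Kv [iv spv]]; split; first by move=> k; apply: sfM => //; apply: FK.
split; first exact: prod_indep.
move=> x /spv[c [Fc ->]].
have [C HC] := choice_ord (P := fun j (b : 'I_m -> algC) => (forall i, QQ (b i)) /\ c j = \sum_i b i * f i) (fun j => spf _ (Fc j)).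
exists (fun k => C (unpair k).2 (unpair k).1); split; first by move=> k; case: (HC (unpair k).2).
have [g fK gK] := unpair_bij m n.
rewrite [RHS](reindex g); last by exists (@unpair m n) => y _.
under [RHS]eq_bigr => p _ do rewrite /prod_basis gK.
rewrite -(pair_bigA _ (fun i j => C j i * (f i * v j))) exchange_big /=; apply: eq_bigr => k _.
by rewrite (HC k).2 mulr_suml; apply: eq_bigr => l _; rewrite mulrA.
Qed.
End Tower.

Fixpoint autX (nu : aut) k : aut := if k is k'.+1 then nu \o autX nu k' else idfun.
Lemma autXE nu k x : autX nu k x = iter k nu x.
Proof. by elim: k => //= k ->. Qed.
Lemma autXD nu k l x : autX nu (k + l) x = autX nu k (autX nu l x).
Proof. by rewrite !autXE iterD. Qed.

(** K is generated by one element t, whose image under s is a root of the minimal polynomial of t.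
    An automorphism of [algC] moving t to this root agrees with s on K. *)
Lemma ext_aut F K s : number_field K -> is_subfield F -> Defs.subset F K -> is_autom F K s ->
  exists nu : aut, forall x, K x -> nu x = s x.
Proof.
move=> /number_field_Qadj[t _ EK] sF FK [Ks [_ [sD [sM sfix]]]].
have sK : is_subfield K by rewrite EK; exact: Qadj_subfield.
have Kt : K t by rewrite EK; exact: Qadj_self.
have sQ (p : {poly rat}) : s (pQtoC p).[t] = (pQtoC p).[s t].
  elim/poly_ind: p => [|p c IH]; first by rewrite rmorph0 !horner0 sfix //; exact: sf0.
  rewrite rmorphD rmorphM /= map_polyX map_polyC /= !hornerD !hornerM !hornerX !hornerC.
  have Kp : K (pQtoC p).[t] by apply: sfhorner.
  by rewrite (sD _ _ (sfM sK Kp Kt) (sfrat sK _)) (sM _ _ Kp Kt) IH (sfix (ratr c)) //; exact: sfrat.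
have [m [Dm _] _] := minCpolyP t.
have [|nu Hnu] := @conjugate_aut t (s t).
  by rewrite Dm /root -sQ -Dm (rootP (root_minCpoly t)) sfix //; exact: sf0.
exists nu => x; rewrite EK => -[p ->]; by rewrite aut_QtoC Hnu sQ.
Qed.

Notation powers_distinct K n sg := (forall k, (0 < k < n)%N -> exists x, K x /\ autX sg k x != x).
Notation powers_exhaust F K n sg := (forall mu : {rmorphism algC -> algC}, (forall x, F x -> mu x = x) ->
  exists2 k, (k < n)%N & forall x, K x -> mu x = autX sg k x).
Notation generated_over F L z := (forall nu mu : {rmorphism algC -> algC}, (forall x, F x -> nu x = mu x) -> nu z = mu z ->
  forall x, L x -> nu x = mu x).
Notation unram_or_total F K n := (forall P, prime_ideal F P -> ~ idvd F P (principal F n%:R) ->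
  unramified K P \/ totally_ramified K n P).

Section Galois.
Variables (F K : cset) (n : nat).
Hypotheses (nF : number_field F) (n0 : (0 < n)%N) (G : cyclic_galois F K n).

Lemma galois_nf : number_field K.
Proof.
have [sF [m [f hf]]] := nF; case: G => sK [FK [[v hv] _]]; split => //.
by exists (m * n)%N, (prod_basis f v); apply: (prod_basisP sF hf hv sK FK).
Qed.

(** [cyclic_galois] speaks of automorphisms of K, whereas the sequel needs all automorphisms of
    [algC] over F. One that is no power of the generator on K would give n + 1 distinct embeddings
    of K over F; as [K : F] = n, a nontrivial linear relation would hold between them, against the
    independence expressed by the determinant of the embeddings. *)
Lemma galois_gen : exists nu : aut, [/\ forall x, F x -> nu x = x, forall x, K x -> K (nu x),
   powers_distinct K n nu,
   forall mu : aut, (forall x, F x -> mu x = x) -> exists2 k, (k < n)%N & forall x, K x -> mu x = autX nu k x &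
   forall x, K x -> autX nu n x = x].
Proof.
have sF := nF.1; case: (G) => sK [FK [[v [Kv [_ spv]]] [s [sA [sneq _]]]]].
have [nu Hnu] := ext_aut galois_nf sF FK sA; case: (sA) => Ks [_ [_ [_ sfix]]].
have fixF x : F x -> nu x = x by move=> Fx; rewrite Hnu ?sfix //; apply: FK.
have Knu x : K x -> K (nu x) by move=> Kx; rewrite Hnu //; apply: Ks.
have it k x : K x -> K (iter k s x) /\ autX nu k x = iter k s x.
  by move=> Kx; elim: k => //= k [K1 ->]; rewrite Hnu //; split => //; apply: Ks.
have neq k : (0 < k < n)%N -> exists x, K x /\ autX nu k x != x.
  by move=> /sneq[x [Kx h]]; exists x; rewrite (it k x Kx).2.
have fixX k x : F x -> autX nu k x = x by move=> Fx; elim: k => //= k ->; apply: fixF.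
have KX k x : K x -> K (autX nu k x) by move=> Kx; rewrite (it k x Kx).2; apply: (it k x Kx).1.
have [d [s' [w D]]] := nfdata_exists galois_nf; have Dq := nfdata_qdata D.
have [g Hg] := choice_ord (P := fun (k : 'I_n) (i : 'I_d) => forall x, K x -> autX nu k x = s' i x) (fun k => (let: And5 _ _ _ _ h := D in h) (autX nu k)).
have gI : injective g.
  suff H : forall k l : 'I_n, (k <= l)%N -> g k = g l -> k = l.
    by move=> k l E; case: (leqP k l) => [|/ltnW] h; [exact: H | symmetry; exact: H].
  move=> k l kl E; apply/val_inj/eqP; rewrite /= eqn_leq kl leqNgt; apply/negP => lk.
  have [|x [Kx /eqP[]]] := neq (l - k)%N; first by rewrite subn_gt0 lk /= (leq_ltn_trans (leq_subr _ _)).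
  apply: (fmorph_inj (autX nu k)); rewrite -autXD subnKC //.
  by rewrite (Hg k) // (Hg l) // E.
have cls (mu : aut) : (forall x, F x -> mu x = x) -> exists2 k, (k < n)%N & forall x, K x -> mu x = autX nu k x.
  move=> mufix; apply: NNPP => hn.
  have [i0 Hi0] := (let: And5 _ _ _ _ h := D in h) mu.
  pose h (k : 'I_n.+1) : 'I_d := oapp g i0 (unlift ord_max k).
  have hfix k x : F x -> s' (h k) x = x.
    move=> Fx; rewrite /h; case: unliftP => [j _|_] /=; first by rewrite -Hg ?fixX //; apply: FK.
    by rewrite -Hi0 ?mufix //; apply: FK.
  have gi0 k : g k <> i0.
    by move=> E; apply: hn; exists (k : nat); [exact: ltn_ord | move=> x Kx; rewrite Hi0 // -E Hg].
  have hI : injective h.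
    move=> k l; rewrite /h; case: unliftP => [j ->|->]; case: unliftP => [j' ->|->] //=.
    - by move/gI ->.
    - by move/gi0.
    - by move/esym/gi0.
  pose A : 'M[algC]_(n.+1, n) := \matrix_(k, j) s' (h k) (v j).
  have : kermx A != 0.
    rewrite -mxrank_eq0 mxrank_ker subn_eq0 -ltnNge ltnS; exact: rank_leq_col.
  case/rowV0Pn => a /sub_kermxP aA a0.
  have zero x : K x -> \sum_k a 0 k * s' (h k) x = 0.
    move=> /spv[c [Fc ->]]; under eq_bigr => k _ do rewrite rmorph_sum mulr_sumr.
    rewrite exchange_big big1 //= => j _.
    have := congr1 (fun N : 'rV_n => N 0 j) aA; rewrite !mxE => E.
    transitivity (c j * \sum_k a 0 k * A k j); last by rewrite E mulr0.
    rewrite mulr_sumr; apply: eq_bigr => k _; rewrite mxE rmorphM /= hfix //; ring.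
  pose b : 'rV[algC]_d := \row_i \sum_(k | h k == i) a 0 k.
  have bW : b *m (\matrix_(i, j) s' i (w j)) = 0.
    apply/rowP => j; rewrite !mxE -[RHS](zero (w j)); last by case: D => _ h' _ _ _; case: (h' j).
    rewrite [RHS](partition_big h predT) //=; apply: eq_bigr => i _; rewrite !mxE mulr_suml.
    by apply: eq_bigr => k /eqP ->.
  have b0 : b = 0.
    case: (D) => _ _ _ dW _; apply/eqP/negPn/negP => b0; case/negP: dW; apply/det0P; by exists b.
  case/eqP: a0; apply/rowP => k; have := congr1 (fun N : 'rV_d => N 0 (h k)) b0; rewrite !mxE.
  by rewrite (big_pred1 k) // => l; rewrite /= (inj_eq hI).
exists nu; split => //.
have [k kn Hk] := cls (autX nu n) (fun x Fx => fixX n x Fx).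
have [k0|k0] := posnP k; first by move=> x Kx; rewrite Hk // k0.
have [|x [Kx /eqP[]]] := neq (n - k)%N; first by rewrite subn_gt0 kn ltn_subrL k0 n0.
apply: (fmorph_inj (autX nu k)); rewrite -autXD subnKC ?(ltnW kn) //.
exact: Hk.
Qed.
End Galois.

Section CycloExt.
Variables (F : cset) (m n : nat).
Hypotheses (nF : number_field F) (dF : ext_degree QQ F m) (n1 : (1 < n)%N) (ld : lin_disjoint F (cyclo_field n)).

Lemma cyclo_pow_indep z : n.-primitive_root z -> lin_indep QQ (fun j : 'I_(totient n) => z ^+ j).
Proof.
move=> pz; apply/indep_rat => c E; pose q := \poly_(j < totient n) oapp c 0 (insub j).
have qz : root (pQtoC q) z.
  apply/rootP; rewrite -[RHS]E (@horner_coef_wide _ (totient n)); last by rewrite size_map_poly size_poly.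
  by apply: eq_bigr => j _; rewrite coef_map coef_poly ltn_ord insubT //= => ?; congr (ratr (c _) * _); apply: val_inj.
have [p [Dp mp] dp] := minCpolyP z.
have q0 : q = 0.
  apply/eqP/negPn/negP => q0; move: qz; rewrite dp => /(dvdp_leq q0).
  have -> : size p = (totient n).+1.
    by rewrite -(size_map_poly (ratr : {rmorphism rat -> algC})) -Dp (minCpoly_cyclotomic pz) size_cyclotomic.
  by rewrite ltnNge size_poly.
move=> j; have := congr1 (fun r : {poly rat} => r`_j) q0; rewrite coef_poly ltn_ord coef0 insubT //= => ?.
by move=> E'; rewrite -[RHS]E'; congr (c _); apply: val_inj.
Qed.

(** Linear disjointness gives [L : Q] >= m phi(n) for L = F(z). An embedding of L is determined by
    its restriction to F and by the exponent of the image of z, so equality holds and every pair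
    occurs; in particular every unit modulo n comes from an automorphism over F. *)
Lemma cyclo_ext : exists L z, [/\ number_field L, Defs.subset F L, L z, n.-primitive_root z &
  [/\ forall nu mu : aut, (forall x, F x -> nu x = mu x) -> nu z = mu z -> forall x, L x -> nu x = mu x,
   forall b, coprime b n -> exists nu : aut, (forall x, F x -> nu x = x) /\ nu z = z ^+ b &
   forall d s w, @nfdata L d s w -> d = (m * totient n)%N]].
Proof.
have n0 : (0 < n)%N by apply: ltnW.
have [z pz] := C_prim_root_exists n0.
have [L [nL FL zL agr]] := compositum nF (nf_Qadj z).
have Lz : L z by apply: zL; exact: Qadj_self.
have agr' (nu mu : aut) : (forall x, F x -> nu x = mu x) -> nu z = mu z -> forall x, L x -> nu x = mu x.
  by move=> h1 h2; apply: agr => // x; apply: Qadj_agree.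
have [d [s [w D]]] := nfdata_exists nL; have Dq := nfdata_qdata D.
have [e [sF' [wF DF]]] := nfdata_exists nF; have DqF := nfdata_qdata DF.
have [f hf] := dF; have me : m = e := qdata_deg DqF hf.
have h1 : (m * totient n <= d)%N.
  rewrite mulnC; apply: (qdata_leq Dq (v := prod_basis (fun j : 'I_(totient n) => z ^+ j) f)).
    by move=> k; apply: sfM; [exact: nL.1 | apply: sfX => //; exact: nL.1 | apply: FL; apply: hf.1].
  pose C := cyclo_field n; have sC : is_subfield C.
      split; first by move=> E sE _; exact: sf0.
      split; first by move=> E sE _; exact: sf1.
      split; first by move=> x y Cx Cy E sE h; apply: sfB => //; [apply: Cx | apply: Cy].
      split; first by move=> x y Cx Cy E sE h; apply: sfM => //; [apply: Cx | apply: Cy].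
      by move=> x Cx x0 E sE h; apply: sfV => //; apply: Cx.
    have Cz : C z by move=> E sE h; apply: h; apply: prim_expr_order.
    move=> c Qc E k; have [g gK fK] := unpair_bij (totient n) m.
    have E' : \sum_i (\sum_j c (g (j, i)) * z ^+ j) * f i = 0.
      rewrite -[RHS]E [RHS](reindex g); last by exists (@unpair (totient n) m) => y _.
      under [RHS]eq_bigr => p _ do rewrite /prod_basis fK.
      transitivity (\sum_j \sum_i c (g (j, i)) * (z ^+ j * f i)); last by rewrite pair_bigA; apply: eq_bigr => -[].
      rewrite exchange_big /=; apply: eq_bigr => i _.
      by rewrite mulr_suml; apply: eq_bigr => j _; rewrite mulrA.
    have := ld hf.1 hf.2.1 _ E'; move=> /(_ _ (unpair k).2) E2.
    have := cyclo_pow_indep pz (c := fun j => c (g (j, (unpair k).2))) => /(_ _ _ (unpair k).1).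
    rewrite -surjective_pairing gK; apply; first by move=> j; apply: Qc.
    apply: E2 => i; apply: (sfsum sC) => j _; apply: (sfM sC); last exact: (sfX sC).
    by apply: (sfCrat sC); apply: Qc.
have [g Hg] : exists g : 'I_d -> 'I_e * 'I_n, forall i, [/\ forall x, F x -> s i x = sF' (g i).1 x, s i z = z ^+ (g i).2 & coprime (g i).2 n].
  apply: (choice_ord (P := fun i (p : 'I_e * 'I_n) => [/\ forall x, F x -> s i x = sF' p.1 x, s i z = z ^+ p.2 & coprime p.2 n])) => i.
  have [j Hj] := (let: And5 _ _ _ _ h := DF in h) (s i).
  have [b [Eb cb]] : exists b : 'I_n, s i z = z ^+ b /\ coprime b n.
    have pz' : n.-primitive_root (s i z) by rewrite fmorph_primitive_root.
    have [b Eb] := prim_rootP pz (prim_expr_order pz'); exists b; split => //.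
    by move: pz'; rewrite Eb (prim_root_exp_coprime _ pz).
  by exists (j, b).
have gI : injective g.
  move=> i j Eij; apply: (qdata_inj Dq); apply: agr' => [x Fx|].
    by have [h2 _ _] := Hg i; have [h3 _ _] := Hg j; rewrite h2 // h3 // Eij.
  by have [_ -> _] := Hg i; have [_ -> _] := Hg j; rewrite Eij.
pose A := [set p : 'I_e * 'I_n | coprime p.2 n].
have cA : #|A| = (m * totient n)%N.
  have -> : A = setX [set: 'I_e] [set b : 'I_n | coprime b n] by apply/setP => p; rewrite !inE.
  rewrite cardsX cardsT card_ord me; congr (_ * _)%N; rewrite totient_count_coprime -sum1dep_card big_mkord.
  rewrite big_mkcond; apply: eq_bigr => b _; by rewrite coprime_sym; case: coprime.
have gA : g @: [set: 'I_d] = A.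
  apply/eqP; rewrite eqEcard; apply/andP; split.
    by apply/subsetP => p /imsetP[i _ ->]; rewrite inE; case: (Hg i).
  by rewrite card_imset // cardsT card_ord cA.
have dd : d = (m * totient n)%N by rewrite -cA -gA card_imset // cardsT card_ord.
exists L, z; split => //; split => //; last first.
  move=> d' s' w' D'; rewrite -dd; symmetry.
  have [_ [d2 [w2 b2]]] := nL.
  by rewrite -(qdata_deg Dq b2) -(qdata_deg (nfdata_qdata D') b2).
move=> b cb; have bn : (b %% n < n)%N by rewrite ltn_mod.
have : (idi DF, Ordinal bn) \in A by rewrite inE /= coprime_modl.
rewrite -gA => /imsetP[i _ Ei]; exists (s i); have [h2 h3 _] := Hg i; split.
  by move=> x Fx; rewrite h2 // -Ei /= idiP.
by rewrite h3 -Ei /= prim_expr_mod.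
Qed.
End CycloExt.

Lemma id_sum K I (T : Type) (r : seq T) (P : pred T) f : is_subfield K -> is_ideal K I ->
  (forall i, P i -> I (f i)) -> I (\sum_(i <- r | P i) f i).
Proof. by move=> sK hI; apply: (addcl_sum r (id_addcl sK hI)). Qed.

(** * Valuations, extension of ideals and inertia *)

Definition ve (K P : cset) (x : algC) : nat := vI K P (principal K x).

Section Valuation.
Variables (K : cset) (d : nat) (s : 'I_d -> aut) (w : 'I_d -> algC).
Hypothesis D : nfdata K s w.
Variable P : cset.
Hypothesis pP : prime_ideal K P.
Let sK := nfdata_sub D.

Lemma veM x y : OK K x -> OK K y -> x != 0 -> y != 0 -> ve K P (x * y) = (ve K P x + ve K P y)%N.
Proof. by move=> Ox Oy x0 y0; rewrite /ve -principalM // (vIM D) //; apply: principal_nz. Qed.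
Lemma veX x k : OK K x -> x != 0 -> ve K P (x ^+ k) = (k * ve K P x)%N.
Proof.
move=> Ox x0; elim: k => [|k IH]; first by rewrite expr0 /ve principal1 (vI_OK D).
by rewrite exprS (veM Ox (OK_X D k Ox) x0 (expf_neq0 k x0)) IH mulSn.
Qed.
Lemma ve_ge x k : OK K x -> x != 0 -> (k <= ve K P x)%N <-> ipow K P k x.
Proof.
move=> Ox x0; rewrite (vI_ge D _ pP (principal_nz sK Ox x0)); split; first by apply; exact: principal_mem.
by move=> Px y; apply: (principal_sub (ipow_nz D k (primeP_nz pP)).1).
Qed.
Lemma ipow1 I : is_ideal K I -> ipow K I 1 = I.
Proof. by move=> hI; rewrite /ipow /= iprod_OK. Qed.
Lemma ve_gt0 x : OK K x -> x != 0 -> (0 < ve K P x)%N <-> P x.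
Proof. by move=> Ox x0; rewrite (ve_ge 1 Ox x0) ipow1 //; exact: primeP_id. Qed.
Lemma ve_eq0 x : OK K x -> ~ P x -> ve K P x = 0%N.
Proof.
move=> Ox Px; have x0 : x != 0 by apply/eqP => x0; apply: Px; rewrite x0; case: (primeP_id pP) => _ [].
by apply/eqP; rewrite -leqn0 leqNgt; apply/negP => /(ve_gt0 Ox x0).
Qed.
Lemma ipow_ideal k : is_ideal K (ipow K P k).
Proof. exact: (ipow_nz D k (primeP_nz pP)).1. Qed.
Lemma ipow_le k l x : (k <= l)%N -> ipow K P l x -> ipow K P k x.
Proof.
move=> kl Px; have [->|x0] := eqVneq x 0; first by case: (ipow_ideal k) => _ [].
have Ox := idsub (ipow_ideal l) Px.
by apply/(ve_ge k Ox x0); apply: leq_trans kl _; apply/(ve_ge l Ox x0).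
Qed.
Lemma ipowD k l x y : ipow K P k x -> ipow K P l y -> ipow K P (k + l) (x * y).
Proof.
move=> Px Py; have [x0|x0] := eqVneq x 0; first by rewrite x0 mul0r; case: (ipow_ideal (k + l)) => _ [].
have [y0|y0] := eqVneq y 0; first by rewrite y0 mulr0; case: (ipow_ideal (k + l)) => _ [].
have Ox := idsub (ipow_ideal k) Px; have Oy := idsub (ipow_ideal l) Py.
apply/(ve_ge _ (OK_mul sK Ox Oy)); first by rewrite mulf_neq0.
by rewrite veM // leq_add //; [apply/(ve_ge k Ox x0) | apply/(ve_ge l Oy y0)].
Qed.
Lemma prime_X x k : OK K x -> P (x ^+ k) -> P x.
Proof.
move=> Ox; elim: k => [|k IH]; first by rewrite expr0 => /(proj1 (proj2 pP)).
by rewrite exprS => /(pP.2.2 _ _ Ox (OK_X D k Ox))[|/IH].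
Qed.
Lemma prime_X' x k : (0 < k)%N -> P x -> P (x ^+ k).
Proof.
case: k => // k _ Px; rewrite exprS mulrC; apply: (idmul (primeP_id pP)) => //.
by apply: (OK_X D); apply: idsub Px; exact: primeP_id.
Qed.
Lemma exists_unif : exists2 q, P q & ~ ipow K P 2 q.
Proof.
apply: NNPP => h; have : (2 <= vI K P P)%N.
  by apply/(vI_ge D 2 pP (primeP_nz pP)) => x Px; apply: NNPP => h'; apply: h; exists x.
by rewrite (vI_P D pP).
Qed.
Lemma val_inter x : OK K x -> (forall i, ipow K P i x) -> x = 0.
Proof.
move=> Ox h; apply/eqP/negPn/negP => x0; have /(ve_ge _ Ox x0) := h (ve K P x).+1.
by rewrite ltnn.
Qed.
(** Localisation at P without fractions. If (y) = P^k J and x lies in P^k, an element b of J outside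
    P puts x b into (y); equality of the valuations keeps the quotient a outside P. *)
Lemma unit_ratio x y : OK K x -> OK K y -> x != 0 -> y != 0 -> ve K P x = ve K P y ->
  exists a b, [/\ OK K a, OK K b, ~ P a, ~ P b & x * b = y * a].
Proof.
move=> Ox Oy x0 y0 E; set k := ve K P y in E.
have hk := ipow_ideal k; have nk := ipow_nz D k (primeP_nz pP).
have ny := principal_nz sK Oy y0; have nx := principal_nz sK Ox x0.
have [|J [hJ EJ]] := ideal_dvd D nk ny.1; first by apply/(vI_ge D k pP ny).
have [|I [hI EI]] := ideal_dvd D nk nx.1; first by apply/(vI_ge D k pP nx); rewrite -/(ve K P x) E.
have nJ : nonzero_ideal K J.
  split => //; exists y; split => //; have := principal_mem sK y; rewrite EJ iprodC.
  exact: (iprod_subl sK hJ hk).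
have vJ : vI K P J = 0%N.
  have : k = vI K P (principal K y) by [].
  rewrite EJ (vIM D P nk nJ) (vI_pow D P k (primeP_nz pP)) (vI_P D pP) muln1.
  by move=> /eqP; rewrite -{1}[k]addn0 eqn_add2l => /eqP.
have [b Jb Pb] : exists2 b, J b & ~ P b.
  apply: NNPP => h; have : (0 < vI K P J)%N.
    by apply/(vI_gt0 D pP nJ) => z Jz; apply: NNPP => h'; apply: h; exists z.
  by rewrite vJ.
have Ob := idsub hJ Jb.
have [a [Oa Ea]] : principal K y (x * b).
  rewrite EJ; apply: iprod_mul => //; have := principal_mem sK x; rewrite EI; exact: (iprod_subl sK hk hI).
exists a, b; split => //; move=> Pa.
have b0 : b != 0 by apply/eqP => b0; apply: Pb; rewrite b0; case: (primeP_id pP) => _ [].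
have a0 : a != 0 by apply: contraNneq (mulf_neq0 x0 b0) => a0; rewrite Ea a0 mulr0.
have : ve K P (x * b) = ve K P (y * a) by rewrite Ea.
rewrite !veM // E -/k => /eqP; rewrite eqn_add2l (ve_eq0 Ob Pb) eq_sym => /eqP va.
by have /(ve_gt0 Oa a0) := Pa; rewrite va.
Qed.
End Valuation.

Section Extension.
Variables (E : cset) (d : nat) (s : 'I_d -> aut) (w : 'I_d -> algC).
Variables (E' : cset) (d' : nat) (s' : 'I_d' -> aut) (w' : 'I_d' -> algC).
Hypotheses (D : nfdata E s w) (D' : nfdata E' s' w') (sub : Defs.subset E E').
Let sE := nfdata_sub D.
Let sE' : is_subfield E'. Proof. by case: D'. Qed.

Lemma ext_OK x : OK E x -> OK E' x. Proof. by case=> Ex Ax; split => //; apply: sub. Qed.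
Lemma ext_id I : is_ideal E I -> is_ideal E' (ext_ideal E' I).
Proof.
move=> hI; apply: mk_ideal => //.
- apply: iprod_min; first exact: OK_addcl.
  by move=> a b Ia Ob; apply: OK_mul => //; apply: ext_OK; apply: idsub Ia.
- by apply: iprod_addcl; apply: (id_addcl sE hI).
move=> r x Or [k [a [b [ab ->]]]]; exists k, a, (fun i => r * b i); split.
  by move=> i; have [? ?] := ab i; split => //; apply: OK_mul.
by rewrite mulr_sumr; apply: eq_bigr => i _; rewrite mulrCA.
Qed.
Lemma ext_mem I x : I x -> ext_ideal E' I x.
Proof. by move=> Ix; rewrite -[x]mulr1; apply: iprod_mul => //; exact: OK1. Qed.
Lemma ext_nz I : nonzero_ideal E I -> nonzero_ideal E' (ext_ideal E' I).
Proof. by move=> [hI [x [Ix x0]]]; split; [exact: ext_id | exists x; split => //; exact: ext_mem]. Qed.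
Lemma ext_min I J : is_ideal E' J -> (forall x, I x -> J x) -> forall x, ext_ideal E' I x -> J x.
Proof. by move=> hJ h; apply: iprod_min; [exact: (id_addcl sE' hJ) | move=> a b Ia Ob; apply: (idmulr hJ) => //; apply: h]. Qed.
Lemma ext_principal a : OK E a -> ext_ideal E' (principal E a) = principal E' a.
Proof.
move=> Oa; have Oa' := ext_OK Oa; apply: cset_ext => x; split.
  apply: ext_min; first exact: principal_ideal.
  by move=> y [r [Or ->]]; exists r; split => //; exact: ext_OK.
by move=> [r [Or ->]]; apply: iprod_mul => //; exact: principal_mem.
Qed.
Lemma extM I J : is_ideal E I -> is_ideal E J -> ext_ideal E' (iprod I J) = iprod (ext_ideal E' I) (ext_ideal E' J).
Proof.
move=> hI hJ; have h1 := ext_id hI; have h2 := ext_id hJ; apply: cset_ext => x; split.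
  apply: ext_min; first exact: iprod_ideal.
  apply: iprod_mono => y; exact: ext_mem.
have hIJ := ext_id (iprod_ideal sE hI hJ).
apply: iprod_min; first exact: (id_addcl sE' hIJ).
move=> a b [k [u [v [uv ->]]]] [l [u' [v' [uv' ->]]]].
rewrite mulr_suml; apply: (id_sum _ sE' hIJ) => i _.
rewrite mulr_sumr; apply: (id_sum _ sE' hIJ) => j _.
have [? ?] := uv i; have [? ?] := uv' j; rewrite mulrACA; apply: iprod_mul; last exact: OK_mul.
exact: iprod_mul.
Qed.
Lemma ext_OKE : ext_ideal E' (OK E) = OK E'.
Proof. by rewrite -(principal1 E) ext_principal ?principal1 //; exact: OK1. Qed.
Lemma ext_pow I k : is_ideal E I -> ext_ideal E' (ipow E I k) = ipow E' (ext_ideal E' I) k.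
Proof.
move=> hI; have hk j : is_ideal E (ipow E I j) by elim: j => [|j IH]; [exact: OK_ideal | exact: iprod_ideal].
elim: k => [|k IH]; first exact: ext_OKE.
by rewrite /ipow !iterS -/(ipow E I k) extM // IH.
Qed.
(** With I J = (c), the claim is transported to the principal ideal (c), where divisibility in the
    larger ring by an element of E descends to E. *)
Lemma ext_contract I x : nonzero_ideal E I -> E x -> ext_ideal E' I x -> I x.
Proof.
move=> nI Ex Ix; have [hI _] := nI; have [J [c [nJ c0 EIJ]]] := ideal_inv D nI; have [hJ _] := nJ.
have c0' : (c%:R : algC) != 0 by rewrite pnatr_eq0 -lt0n.
have Ox : OK E x by split => //; have := idsub (ext_id hI) Ix; case.
have sub1 y : iprod (principal E x) J y -> iprod I J y.
  move/(iprod_principal sE x y hJ) => [j [Jj ->]]; rewrite EIJ.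
  have [t [Ot Et]] : principal E' c%:R (x * j).
    move: Ix => [k [a [b [ab ->]]]].
    have h := principal_ideal sE' (OK_nat c sE'); rewrite mulr_suml.
    apply: (id_sum _ sE' h) => i _; have [Ia Ob] := ab i.
    rewrite mulrAC; apply: (idmulr h) => //.
    have [r [Or ->]] : principal E c%:R (a i * j) by rewrite -EIJ; apply: iprod_mul.
    by exists r; split => //; exact: ext_OK.
  exists t; split => //; case: Ot => _ At; split => //.
  have -> : t = x * j / c%:R by rewrite Et mulrC mulKf.
  by apply: (sfdiv sE); [apply: (sfM sE) => //; case: (idsub hJ Jj) | exact: sfnat].
have nIJ := nz_iprod sE nI nJ.
have [A [hA EA]] := ideal_dvd D nIJ (iprod_ideal sE (principal_ideal sE Ox) hJ) sub1.
have EE : principal E x = iprod I A.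
  apply: (ideal_cancel D nJ (principal_ideal sE Ox) (iprod_ideal sE hI hA)).
  by rewrite iprodC EA (iprodC I) (iprodAK sE hJ hI hA).
by have := principal_mem sE x; rewrite EE; apply: (iprod_subl sE hI hA).
Qed.
Lemma lies_over P : prime_ideal E P -> exists2 Q, prime_ideal E' Q & forall x, P x -> Q x.
Proof.
move=> pP; have nP := primeP_nz pP.
have [|Q pQ h] := prime_exists D' (ext_nz nP).
  by move/(ext_contract nP (sf1 sE)); case: pP => _ [].
by exists Q => // x Px; apply: h; exact: ext_mem.
Qed.
Definition contract (Q : cset) : cset := fun x => E x /\ Q x.
Lemma contract_prime Q : prime_ideal E' Q -> prime_ideal E (contract Q).
Proof.
move=> pQ; have hQ := primeP_id pQ; split; [split|split].
- apply: mk_ideal => //; first by move=> x [Ex /(idsub hQ)[_ Ax]].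
    split; first by split; [exact: sf0 | exact: (id_addcl sE' hQ).1].
    by move=> x y [Ex Qx] [Ey Qy]; split; [exact: sfB | exact: (id_addcl sE' hQ).2].
  by move=> r x Or [Ex Qx]; split; [apply: sfM => //; case: Or | apply: (idmul hQ) => //; exact: ext_OK].
- have [c c0 Qc] := nz_pos D' (primeP_nz pQ); exists c%:R; split; last by rewrite pnatr_eq0 -lt0n.
  by split => //; exact: sfnat.
- by case=> _; case: pQ => _ [].
move=> a b Oa Ob [_ Qab]; case: (pQ.2.2 a b (ext_OK Oa) (ext_OK Ob) Qab) => h; [left | right]; split => //.
  by case: Oa.
by case: Ob.
Qed.
Lemma contract_over P Q : prime_ideal E P -> prime_ideal E' Q -> (forall x, P x -> Q x) -> contract Q = P.
Proof.
move=> pP pQ PQ; have pC := contract_prime pQ.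
have [|//|E1] := prime_max D pP (primeP_id pC); first by move=> x Px; split; [case: (idsub (primeP_id pP) Px) | exact: PQ].
by case: (prime_neqOK D pC).
Qed.
(** P is the only prime of E under Q, so each factor P of I contributes the ramification index and
    every other factor contributes 0. *)
Lemma vI_ext P Q I : prime_ideal E P -> prime_ideal E' Q -> (forall x, P x -> Q x) -> nonzero_ideal E I ->
  vI E' Q (ext_ideal E' I) = (vI E' Q (ext_ideal E' P) * vI E P I)%N.
Proof.
move=> pP pQ PQ nI; have [l pl ->] := uf_exists D nI; rewrite (vI_prodI D) //.
elim: l pl => [|P' l IH] pl; first by rewrite /= ext_OKE (vI_OK D') muln0.
have [pP' pl'] := (primes_cons _ _ _).1 pl.
rewrite /= extM; [|exact: primeP_id | exact: (prodI_id D pl')].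
rewrite (vIM D' _ (ext_nz (primeP_nz pP')) (ext_nz (prodI_nz D pl'))) IH //.
rewrite mulnDr; congr addn; case: eqP => [->|ne]; first by rewrite muln1.
rewrite muln0; apply/eqP; rewrite -leqn0 leqNgt; apply/negP => /(vI_gt0 D' pQ (ext_nz (primeP_nz pP'))) h.
apply: ne; rewrite -(contract_over pP' pQ) ?(contract_over pP pQ) // => x Px.
by apply: h; apply: ext_mem.
Qed.
Lemma ve_ext P Q x : prime_ideal E P -> prime_ideal E' Q -> (forall x, P x -> Q x) -> OK E x -> x != 0 ->
  ve E' Q x = (vI E' Q (ext_ideal E' P) * ve E P x)%N.
Proof. by move=> pP pQ PQ Ox x0; rewrite /ve -(ext_principal Ox) (vI_ext pP pQ PQ) //; exact: principal_nz. Qed.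
Lemma ext_index_gt0 P Q : prime_ideal E P -> prime_ideal E' Q -> (forall x, P x -> Q x) -> (0 < vI E' Q (ext_ideal E' P))%N.
Proof. move=> pP pQ PQ; apply/(vI_gt0 D' pQ (ext_nz (primeP_nz pP))) => x; apply: ext_min => //; exact: primeP_id. Qed.
End Extension.

Lemma sum_shift (h : nat -> algC) n k : (forall i, h (i + n)%N = h i) -> \sum_(j < n) h (k + j)%N = \sum_(j < n) h j.
Proof.
move=> hp; elim: k => [|k IH]; first by apply: eq_bigr => j _; rewrite add0n.
rewrite -IH; case: n hp {IH} => [|n] hp; first by rewrite !big_ord0.
rewrite big_ord_recr [RHS]big_ord_recl /= addn0 addrC addSnnS hp; congr (_ + _).
by apply: eq_bigr => j _; rewrite /bump /= add1n addnS addSn.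
Qed.

Lemma root_sum n (z : algC) k : n.-primitive_root z -> (0 < k < n)%N -> \sum_(b < n) z ^+ (b * k) = 0.
Proof.
move=> pz /andP[k0 kn].
have zk : z ^+ k - 1 != 0.
  rewrite subr_eq0 -(expr0 z) (eq_prim_root_expr pz) mod0n modn_small //; by rewrite -lt0n.
apply: (mulfI zk); rewrite mulr0 (eq_bigr (fun b : 'I_n => (z ^+ k) ^+ b)); last by move=> b _; rewrite mulnC exprM.
by rewrite -subrX1 -exprM mulnC exprM (prim_expr_order pz) expr1n subrr.
Qed.

Section Artin.
Variables (K M : cset) (n : nat) (f : 'I_n -> algC -> algC) (Z : cset).
Hypotheses (sK : is_subfield K) (sM : is_subfield M) (hZ : is_ideal M Z).
Hypothesis Zp : forall a b, OK M a -> OK M b -> Z (a * b) -> Z a \/ Z b.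
Hypothesis fO : forall i x, OK K x -> OK M (f i x).
Hypothesis fM : forall i x y, OK K x -> OK K y -> f i (x * y) = f i x * f i y.
Hypothesis f1 : forall i, f i 1 = 1.

(** Artin's independence of characters modulo Z, by induction on the number of coefficients outside
    Z: the relation at u v minus f_j(v) times the relation at u kills the j-th coefficient. Z is
    used both as a prime ideal and as the zero ideal. *)
Lemma artin_indep (c : 'I_n -> algC) : (forall i, OK M (c i)) -> (exists i, ~ Z (c i)) ->
  (forall u, OK K u -> Z (\sum_i c i * f i u)) ->
  exists i j, [/\ i != j & forall u, OK K u -> Z (f i u - f j u)].
Proof.
move=> Oc [i0 ci0] rel; apply: NNPP => hn.
suff H : forall N c, (forall i, OK M (c i)) -> (#|[set i | ~~ (if excluded_middle_informative (Z (c i)) then true else false)]| <= N)%N ->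
    (forall u, OK K u -> Z (\sum_i c i * f i u)) -> forall i, Z (c i).
  exact: (ci0 (H _ c Oc (leqnn _) rel _)).
move=> {c Oc i0 ci0 rel}N; elim: N => [|N IH] c Oc hN rel j.
  apply: NNPP => cj; move: hN; rewrite leqn0 cards_eq0 => /eqP/setP/(_ j); rewrite !inE.
  by case: excluded_middle_informative.
apply: NNPP => cj.
have ci i : i != j -> Z (c i).
  move=> ij; have [v Ov Zv] : exists2 v, OK K v & ~ Z (f i v - f j v).
    by apply: NNPP => h; apply: hn; exists i, j; split => // v Ov; apply: NNPP => h'; apply: h; exists v.
  pose c' k := c k * (f k v - f j v).
  have Ofv k : OK M (f k v - f j v) by apply: OK_sub => //; apply: fO.
  have Oc' k : OK M (c' k) by apply: OK_mul.
  have : Z (c' i).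
    apply: IH => //.
      have jA : j \in [set i | ~~ (if excluded_middle_informative (Z (c i)) then true else false)].
        by rewrite inE; case: excluded_middle_informative.
      move: hN; rewrite (cardsD1 j) jA add1n ltnS; apply: leq_trans; apply: subset_leq_card.
      apply/subsetP => k; rewrite !inE; case: excluded_middle_informative => // ck _.
      case: eqP => [kj|_] /=; first by case: ck; rewrite /c' kj subrr mulr0; case: hZ => _ [].
      case: excluded_middle_informative => // Zck; case: ck; exact: (idmulr hZ).
    move=> u Ou.
    have -> : \sum_k c' k * f k u = \sum_k c k * f k (u * v) - (\sum_k c k * f k u) * f j v.
      rewrite mulr_suml -sumrB; apply: eq_bigr => k _; rewrite fM // /c'; ring.
    apply: (id_addcl sM hZ).2; first by apply: rel; apply: OK_mul.
    by apply: (idmulr hZ); [exact: fO | exact: rel].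
  by move/(Zp (Oc i) (Ofv i)); case.
have := rel 1 (OK1 sK); rewrite (bigD1 j) //= f1 mulr1 => h.
apply: cj; have -> : c j = c j + (\sum_(k | k != j) c k * f k 1) - (\sum_(k | k != j) c k * f k 1) by rewrite addrK.
apply: (id_addcl sM hZ).2 => //; apply: (id_sum _ sM hZ) => k kj; rewrite f1 mulr1; exact: ci.
Qed.
End Artin.

(** The factor [b] in the error term is what [inertia_trivial] needs: for b in Q^(i+1) and p in Q
    the error gains one more power of Q. *)
Lemma binom_split p (a b : algC) K : is_subfield K -> prime p -> OK K a -> OK K b ->
  exists2 c, OK K c & (a + b) ^+ p = a ^+ p + b ^+ p + p%:R * (b * c).
Proof.
move=> sK pp Oa Ob; case: p pp => // -[//|p] pp.
have OX x k : OK K x -> OK K (x ^+ k) by move=> Ox; elim: k => [|k IH]; rewrite ?expr0 ?exprS; [exact: OK1 | exact: OK_mul].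
exists (\sum_(i < p.+1) a ^+ (p - i).+1 * b ^+ i *+ ('C(p.+2, i.+1) %/ p.+2)).
  apply: (id_sum _ sK (OK_ideal sK)) => i _; rewrite -mulr_natr.
  by apply: OK_mul => //; [apply: OK_mul => //; exact: OX | exact: OK_nat].
rewrite exprDn big_ord_recl big_ord_recr /= bin0 subn0 expr0 mulr1 mulr1n /bump leq0n add1n binn subnn expr0 mul1r mulr1n.
rewrite (addrC _ (b ^+ _)) addrA; congr (_ + _).
rewrite !mulr_sumr; apply: eq_bigr => i _; rewrite leq0n add1n subSS.
have /divnK {1}<- : (p.+2 %| 'C(p.+2, i.+1))%N by apply: prime_dvd_bin => //; rewrite /= ltnS ltn_ord.
have -> : (p.+1 - i)%N = (p - i).+1 by rewrite subSn // -ltnS ltn_ord.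
rewrite (exprS b) -[LHS]mulr_natr natrM -(mulr_natr (a ^+ (p - i).+1 * b ^+ i)).
move: (_%:R) (_%:R) (_ ^+ _) (_ ^+ _) => A B C E; ring.
Qed.

Section Inertia.
Variables (K : cset) (d : nat) (s : 'I_d -> aut) (w : 'I_d -> algC).
Hypothesis D : nfdata K s w.
Let sK := nfdata_sub D.
Variables (Q : cset) (t : aut).
Hypotheses (pQ : prime_ideal K Q) (Kt : forall x, K x -> K (t x)).
Hypothesis tQ : forall x, OK K x -> Q (t x - x).

Lemma OK_aut x : OK K x -> OK K (t x).
Proof. by case=> Kx Ax; split; [exact: Kt | rewrite Aint_aut]. Qed.

Lemma inertia_pow k x : ipow K Q k x -> ipow K Q k (t x).
Proof.
elim: k x => [|k IH] x; first exact: OK_aut.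
move=> [l [a [b [ab ->]]]]; rewrite rmorph_sum.
apply: (id_sum _ sK (ipow_ideal D pQ k.+1)) => i _; have [Qa Qb] := ab i.
rewrite rmorphM; apply: iprod_mul; last exact: IH.
rewrite -[t (a i)](subrK (a i)); apply: (addclD (id_addcl sK (primeP_id pQ))) => //.
by apply: tQ; apply: idsub Qa; exact: primeP_id.
Qed.

(** The residue ring is finite and Frobenius is injective on it, hence onto. *)
Lemma frob_surj p : prime p -> Q p%:R -> forall x, OK K x -> exists2 y, OK K y & Q (x - y ^+ p).
Proof.
move=> pp Qp x Ox; have hQ := primeP_id pQ; have aQ := id_addcl sK hQ.
have [r [rO ru rc]] := normIP D (primeP_nz pQ).
have [g Hg] := choice_ord (P := fun i j => Q (r i ^+ p - r j)) (fun i => rc _ (OK_X D p (rO i))).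
have gI : injective g.
  move=> i j Eij; apply: ru.
  have Oij : OK K (r i - r j) by apply: OK_sub.
  have [c Oc E] := binom_split sK pp (rO j) Oij; rewrite addrC subrK in E.
  apply: (@prime_X K d s w D Q pQ _ p Oij).
  have -> : (r i - r j) ^+ p = (r i ^+ p - r (g i)) - (r j ^+ p - r (g j)) - p%:R * ((r i - r j) * c).
    by rewrite E Eij; ring.
  apply: aQ.2; first by apply: aQ.2; apply: Hg.
  by apply: (idmulr hQ) => //; apply: OK_mul.
have [j hj] := rc x Ox; have [g' gK' g'K] := injF_bij gI.
exists (r (g' j)) => //; rewrite -(subrKA (r j)); apply: (addclD aQ) => //.
by rewrite -opprB; apply: (addclN aQ); have := Hg (g' j); rewrite g'K.
Qed.

(** An element of the inertia group that fixes a uniformizer acts trivially modulo Q^(i+1) for every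
    i, by induction on i, hence trivially. Wild inertia is excluded here by the fixed
    uniformizer. *)
Lemma inertia_trivial q : Q q -> t q = q -> ~ ipow K Q 2 q -> forall x, OK K x -> t x = x.
Proof.
move=> Qq tq q2 x Ox; have hQ := primeP_id pQ; have Oq := idsub hQ Qq.
have aQ := id_addcl sK hQ; have [p pp Qp] := prime_char D pQ.
have q0 : q != 0 by apply/eqP => E; apply: q2; rewrite E; case: (ipow_ideal D pQ 2) => _ [].
have vq : ve K Q q = 1%N.
  apply/eqP; rewrite eqn_leq; apply/andP; split; last exact/(ve_gt0 D pQ Oq q0).
  by rewrite leqNgt; apply/negP => /(ve_ge D pQ 2 Oq q0).
apply/eqP; rewrite -subr_eq0; apply/eqP; apply: (val_inter D pQ); first by apply: OK_sub => //; apply: OK_aut.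
suff H i : forall y, OK K y -> ipow K Q i.+1 (t y - y) by case=> [|i]; [apply: OK_sub => //; exact: OK_aut | exact: H].
elim: i => [|i IH] y Oy; first by rewrite (ipow1 D hQ); exact: tQ.
have h2 := ipow_ideal D pQ i.+2; have a2 := id_addcl sK h2.
(* [q] has valuation one, so Q = (q) + Q^(i+2); on q r the automorphism acts through r alone, where
   the induction hypothesis is multiplied by q. *)
have dQ e : Q e -> ipow K Q i.+2 (t e - e).
  move=> Qe; have [r [e2 [Or He2 Ee]]] : exists r e2, [/\ OK K r, ipow K Q i.+2 e2 & e = q * r + e2].
    have hS := isum_ideal sK (principal_ideal sK Oq) h2.
    have nS : nonzero_ideal K (isum (principal K q) (ipow K Q i.+2)).
      by split => //; exists q; split => //; apply: (isuml sK h2); exact: (principal_mem sK).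
    have [A [hA EA]] := ideal_dvd D nS (ipow_ideal D pQ i.+2) (fun y h => isumr sK (principal_ideal sK Oq) h).
    have nA : nonzero_ideal K A.
      split => //; have [_ [z [Iz z0]]] := ipow_nz D i.+2 (primeP_nz pQ); exists z; split => //.
      by move: Iz; rewrite EA iprodC; apply: (iprod_subl sK hA hS).
    have ES : isum (principal K q) (ipow K Q i.+2) = Q.
      apply: (ideal_eq_vI D nS (primeP_nz pQ)) => P' pP'.
      have [->|ne] := classic (P' = Q).
        rewrite (vI_P D pQ); apply/eqP; rewrite eqn_leq; apply/andP; split.
          rewrite leqNgt; apply/negP => /(vI_ge D 2 pQ nS) h; apply: q2; apply: h.
          by apply: (isuml sK h2); exact: (principal_mem sK).
        apply/(vI_gt0 D pQ nS) => z [a [b [[r' [Or' ->]] Hb ->]]].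
        apply: (addclD aQ); first exact: (idmulr hQ).
        by have := ipow_le D pQ (isT : (1 <= i.+2)%N) Hb; rewrite (ipow1 D hQ).
      rewrite (vI_prime_neq D pQ ne); apply/eqP; rewrite -leqn0.
      apply: (@leq_trans (vI K P' (ipow K Q i.+2))); first by rewrite [X in (_ <= vI K P' X)%N]EA (vIM D P' nS nA) leq_addr.
      by rewrite (vI_pow D P' _ (primeP_nz pQ)) (vI_prime_neq D pQ ne) muln0.
    have : isum (principal K q) (ipow K Q i.+2) e by rewrite ES.
    by move=> [a [b [[r [Or ->]] Hb ->]]]; exists r, b.
  have -> : t e - e = q * (t r - r) + (t e2 - e2) by rewrite Ee rmorphD rmorphM /= tq; ring.
  apply: (addclD a2); last by apply: a2.2 => //; exact: inertia_pow.
  rewrite -[i.+2]add1n; apply: (ipowD D pQ); [by rewrite (ipow1 D hQ) | exact: IH].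
(* Up to an element of Q, already treated, y is a p-th power u^p. Expanding (u + (t u - u))^p puts t
   u^p - u^p into Q^(i+2). *)
have [u Ou Qu] := frob_surj pp Qp Oy.
have -> : t y - y = (t (y - u ^+ p) - (y - u ^+ p)) + (t u ^+ p - u ^+ p) by rewrite rmorphB rmorphXn /=; ring.
apply: (addclD a2); first exact: dQ.
have Od : OK K (t u - u) by apply: OK_sub => //; exact: OK_aut.
have [c Oc E] := binom_split sK pp Ou Od; rewrite addrC subrK in E.
have Hd := IH u Ou.
have -> : t u ^+ p - u ^+ p = (t u - u) ^+ p + p%:R * ((t u - u) * c) by rewrite E; ring.
apply: (addclD a2).
  have p2 := prime_gt1 pp; rewrite -(subnK p2) addn2 !exprS mulrA.
  apply: (idmulr h2); first exact: (OK_X D).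
  apply: (ipow_le D pQ (_ : i.+2 <= i.+1 + i.+1)%N); first by rewrite addSn ltnS addnS ltnS leq_addr.
  exact: (ipowD D pQ).
rewrite mulrA; apply: (idmulr h2) => //; rewrite -[i.+2]add1n.
by apply: (ipowD D pQ) => //; rewrite (ipow1 D hQ).
Qed.
End Inertia.

(** * Lagrange resolvents and the ramification of Kummer generators *)

Section Resolvent.
Variables (F K L M : cset) (n : nat) (z : algC) (sg : aut).
Variables (dF : nat) (sF : 'I_dF -> aut) (wF : 'I_dF -> algC) (DF : nfdata F sF wF).
Variables (dK : nat) (sK : 'I_dK -> aut) (wK : 'I_dK -> algC) (DK : nfdata K sK wK).
Variables (dL : nat) (sL : 'I_dL -> aut) (wL : 'I_dL -> algC) (DL : nfdata L sL wL).
Variables (dM : nat) (sM : 'I_dM -> aut) (wM : 'I_dM -> algC) (DM : nfdata M sM wM).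
Hypotheses (FK : Defs.subset F K) (FL : Defs.subset F L) (KM : Defs.subset K M) (LM : Defs.subset L M).
Hypotheses (n1 : (1 < n)%N) (pz : n.-primitive_root z) (Lz : L z).
Hypotheses (sgF : forall x, F x -> sg x = x) (sgK : forall x, K x -> K (sg x)).
Hypothesis sgneq : powers_distinct K n sg.
Hypothesis cls : powers_exhaust F K n sg.
Hypothesis sgn : forall x, K x -> autX sg n x = x.
Let fF := nfdata_sub DF.
Let fK := nfdata_sub DK.
Let fL := nfdata_sub DL.
Let fM := nfdata_sub DM.
Let n0 : (0 < n)%N. Proof. exact: ltnW. Qed.

Definition reso b u := \sum_(k < n) z ^+ (b * k) * autX sg k u.

Lemma zmul k : z ^+ (k * n) = 1.
Proof. by rewrite mulnC exprM (prim_expr_order pz) expr1n. Qed.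
Lemma sgX k x : K x -> K (autX sg k x).
Proof. by move=> Kx; elim: k => //= k IH; apply: sgK. Qed.
Lemma sgXF k x : F x -> autX sg k x = x.
Proof. by move=> Fx; elim: k => //= k ->; apply: sgF. Qed.
Lemma sgXn i k x : K x -> autX sg (i * n + k) x = autX sg k x.
Proof.
move=> Kx; elim: i => // i IH; rewrite mulSn -addnA addnC autXD sgn //; exact: sgX.
Qed.
Lemma OK_sg k x : OK K x -> OK K (autX sg k x).
Proof. by case=> Kx Ax; split; [exact: sgX | rewrite Aint_aut]. Qed.
Lemma OK_z k : OK L (z ^+ k).
Proof.
split; first by apply: sfX.
apply: rpredX; apply: (@Aint_prim_root n); exact: pz.
Qed.
Lemma reso_OK b u : OK K u -> OK M (reso b u).
Proof.
move=> Ou; apply: (id_sum _ fM (OK_ideal fM)) => k _; apply: OK_mul => //.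
  exact: (ext_OK LM (OK_z _)).
exact: (ext_OK KM (OK_sg k Ou)).
Qed.

(** [nu] acts on K as sg^k and on z as the c-th power, so it moves the character b to b c up to a
    root of unity. The same k serves all b and u, which lets these roots of unity cancel in
    products. *)
Lemma reso_act (nu : aut) c : (forall x, F x -> nu x = x) -> nu z = z ^+ c ->
  exists k, (k < n)%N /\ forall b u, K u -> nu (reso b u) * z ^+ (b * c * k) = reso (b * c) u.
Proof.
move=> nuF nuz; have [k kn Hk] := cls nuF; exists k; split => // b u Ku.
pose h i := z ^+ (b * c * i) * autX sg i u.
rewrite /reso -/(\sum_(j < n) h j) -(@sum_shift h n k); last first.
  move=> i; rewrite /h mulnDr exprD addnC -[(n + i)%N]/(n + i)%N -{2}[n]mul1n sgXn //.
  by rewrite zmul mulr1.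
rewrite rmorph_sum mulr_suml; apply: eq_bigr => j _.
rewrite rmorphM rmorphXn /= nuz Hk; last exact: sgX.
rewrite /h autXD mulnDr exprD -exprM; have -> : (c * (b * j) = b * c * j)%N by rewrite mulnCA mulnA.
ring.
Qed.

(** An automorphism trivial on L multiplies the two factors by inverse roots of unity. *)
Lemma reso_prod_L b u u' : (b <= n)%N -> OK K u -> OK K u' -> OK L (reso b u * reso 1 u' ^+ (n - b)).
Proof.
move=> bn Ou Ou'; have [Ku _] := Ou; have [Ku' _] := Ou'.
have [_ A] : OK M (reso b u * reso 1 u' ^+ (n - b)).
  by apply: OK_mul => //; [exact: reso_OK | apply: (OK_X DM); exact: reso_OK].
split => //; apply: (fixed_mem (nfdata_qdata DL)) => nu nuL.
have [|k [kn Hk]] := @reso_act nu 1 (fun x Fx => nuL x (FL Fx)); first by rewrite expr1 nuL.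
have := Hk b u Ku; have := Hk 1%N u' Ku'; rewrite !muln1 mul1n => E1 E2.
rewrite -{2}E1 -{2}E2 rmorphM rmorphXn /= exprMn -exprM mulrACA -exprD.
rewrite mulnBr (mulnC b k) subnKC ?leq_mul2l ?bn ?orbT // mulnC exprM (prim_expr_order pz) expr1n.
by rewrite mulr1.
Qed.

Lemma reso_sum u : \sum_(b < n) reso b u = n%:R * u.
Proof.
rewrite exchange_big /= (bigD1 (Ordinal n0)) //=.
rewrite (eq_bigr (fun _ => u)); last by move=> b _; rewrite muln0 expr0 mul1r.
rewrite sumr_const card_ord big1 ?addr0 ?mulr_natl // => k k0.
rewrite -mulr_suml (root_sum pz) ?mul0r // ltn_ord andbT lt0n; apply: contra k0 => /eqP E.
by apply/eqP/val_inj.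
Qed.

(* If the first resolvent always vanishes modulo Z, Dedekind independence makes two powers of sg agree modulo Z. *)
Lemma reso_vanish Z : is_ideal M Z -> (forall a b, OK M a -> OK M b -> Z (a * b) -> Z a \/ Z b) -> ~ Z 1 ->
  (forall u, OK K u -> Z (reso 1 u)) -> exists2 k, (0 < k < n)%N & forall u, OK K u -> Z (autX sg k u - u).
Proof.
move=> hZ Zp Z1 h.
have [||||||i [j [ij Hij]]] := @artin_indep K M n (fun k => autX sg k) Z fK fM hZ Zp _ _ _ (fun k => z ^+ k).
- by move=> k x Ox; apply: (ext_OK KM); apply: OK_sg.
- by move=> k x y _ _; rewrite rmorphM.
- by move=> k; rewrite rmorph1.
- by move=> k; apply: (ext_OK LM); apply: OK_z.
- by exists (Ordinal n0); rewrite expr0.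
- move=> u Ou; have := h u Ou; rewrite /reso.
  by under eq_bigr do rewrite mul1n.
have key (k l : 'I_n) : (k < l)%N -> (forall u, OK K u -> Z (autX sg k u - autX sg l u)) ->
   exists2 k, (0 < k < n)%N & forall u, OK K u -> Z (autX sg k u - u).
  move=> kl H; exists (l - k)%N; first by rewrite subn_gt0 kl (leq_ltn_trans (leq_subr _ _)).
  move=> u Ou; have [Ku _] := Ou; rewrite -opprB; apply: (addclN (id_addcl fM hZ)).
  have := H _ (OK_sg (n - k) Ou); rewrite -!autXD subnKC ?(ltnW (ltn_ord k)) // sgn //.
  suff -> : (l + (n - k) = 1 * n + (l - k))%N by rewrite sgXn.
  by rewrite mul1n addnBA ?(ltnW (ltn_ord k)) // addnBA ?(ltnW kl) // addnC.
have := ij; rewrite neq_ltn => /orP[lt|lt]; first exact: (key i j).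
apply: (key j i) => // u Ou; rewrite -opprB; apply: (addclN (id_addcl fM hZ)); exact: Hij.
Qed.

(** The case Z = 0 of [reso_vanish]: otherwise some sg^k with 0 < k < n would be trivial on K. *)
Lemma reso_nonzero : exists2 u, OK K u & reso 1 u != 0.
Proof.
apply: NNPP => h; pose Z : cset := fun x => x = 0.
have [|||u Ou|k kn Hk] := @reso_vanish Z.
- apply: mk_ideal => //.
  - by move=> x ->; exact: (OK_nat 0).
  - by split => // x y -> ->; rewrite /Z subr0.
  - by move=> r x _ ->; rewrite /Z mulr0.
- by move=> a b _ _ /eqP; rewrite mulf_eq0 => /orP[] /eqP; [left | right].
- by move/eqP; rewrite oner_eq0.
- by apply/eqP/negPn/negP => h'; apply: h; exists u.
have [x [Kx /eqP[]]] := sgneq kn; have [N N0 ON] := OK_scale fK Kx.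
have N0' : N%:R != 0 :> algC by rewrite pnatr_eq0 -lt0n.
apply: (mulfI N0'); have /eqP := Hk _ ON; rewrite subr_eq0 rmorphM rmorph_nat => /eqP; exact.
Qed.

(** If R were unramified, it would contain a uniformizer of Q. This element lies in F and is fixed
    by sg, so [inertia_trivial] would make sg^k trivial on K. *)
Lemma inertia_ramified R Q k : prime_ideal F R -> prime_ideal K Q -> (forall x, R x -> Q x) -> (0 < k < n)%N ->
  (forall u, OK K u -> Q (autX sg k u - u)) -> ~ unramified K R.
Proof.
move=> pR pQ RQ kn HQ un; apply: (un Q pQ).
have nQ2 := nz_iprod fK (primeP_nz pQ) (primeP_nz pQ).
have [r Rr Qr] : exists2 r, R r & ~ ipow K Q 2 r.
  apply: NNPP => h; apply: (un Q pQ).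
  have [J [hJ EJ]] : exists A, is_ideal K A /\ ext_ideal K R = iprod (iprod Q Q) A.
    apply: (ideal_dvd DK nQ2 (ext_id DF DK FK (primeP_id pR))) => x.
    have -> : iprod Q Q = ipow K Q 2 by rewrite /ipow /= iprod_OK //; exact: primeP_id.
    apply: (ext_min DK (ipow_ideal DK pQ 2)) => y Ry; apply: NNPP => h'; by apply: h; exists y.
  by exists J; split => //; rewrite EJ.
have triv := inertia_trivial DK pQ (fun x => @sgX k x) HQ (RQ _ Rr) (sgXF k _) Qr.
have [x [Kx /eqP[]]] := sgneq kn; have [N N0 ON] := OK_scale fK Kx.
have N0' : N%:R != 0 :> algC by rewrite pnatr_eq0 -lt0n.
apply: (mulfI N0'); have := triv _ _ ON; rewrite rmorphM rmorph_nat; apply.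
by case: (idsub (primeP_id pR) Rr).
Qed.

Variable u0 : algC.
Hypotheses (Ou0 : OK K u0) (y0 : reso 1 u0 != 0).
Definition kummer := reso 1 u0 ^+ n.
Lemma kummer_OK : OK L kummer.
Proof.
have := reso_prod_L (b := 1) (ltnW n1) Ou0 Ou0; rewrite -exprS subn1 prednK //.
Qed.
Lemma kummer_neq0 : kummer != 0. Proof. exact: expf_neq0. Qed.

Lemma reso_X_OK b u : OK K u -> OK L (reso b u ^+ n).
Proof.
move=> Ou; have [_ A] := OK_X DM n (reso_OK b Ou); have [Ku _] := Ou; split => //.
apply: (fixed_mem (nfdata_qdata DL)) => nu nuL.
have [|k [kn Hk]] := @reso_act nu 1 (fun x Fx => nuL x (FL Fx)); first by rewrite expr1 nuL.
have := Hk b u Ku; rewrite muln1 => E; rewrite -{2}E exprMn rmorphXn /= -exprM mulnC exprM.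
by rewrite (prim_expr_order pz) expr1n mulr1.
Qed.

(** The n-th power of the resolvent of index b is the b-th power of [kummer] up to n-th powers from
    L; its valuation is therefore b times that of [kummer] modulo n. The complement n - b keeps the
    relation within the naturals. *)
Lemma reso_ve P b u : prime_ideal L P -> OK K u -> reso b u != 0 -> (b <= n)%N ->
  exists l, (ve L P (reso b u ^+ n) + (n - b) * ve L P kummer = n * l)%N.
Proof.
move=> pP Ou yb bn; pose la := reso b u * reso 1 u0 ^+ (n - b).
have Ol : OK L la by exact: reso_prod_L.
have l0 : la != 0 by rewrite mulf_neq0 // expf_neq0.
exists (ve L P la); rewrite -(veX DL P n Ol l0) /la exprMn exprAC.
rewrite (veM DL P (reso_X_OK b Ou) (OK_X DL _ kummer_OK)) ?expf_neq0 //.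
by rewrite (veX DL P _ kummer_OK kummer_neq0).
Qed.

(** By [reso_ve] the n-th power of a nonzero first resolvent has the valuation of [kummer] modulo n,
    which is nonzero; so all first resolvents lie in a prime above P. Then [reso_vanish] produces a
    nontrivial element of inertia. *)
Lemma unram_kummer P : prime_ideal L P -> ~ (n %| ve L P kummer)%N -> ~ unramified K (contract F P).
Proof.
move=> pP nv; have [PP pPP hPP] := lies_over DL DM LM pP.
have pR := contract_prime DF DL FL pP; have pQ := contract_prime DK DM KM pPP.
have van u : OK K u -> PP (reso 1 u).
  move=> Ou; have [->|yu] := eqVneq (reso 1 u) 0; first by case: (primeP_id pPP) => _ [].
  have [l El] := reso_ve pP Ou yu (ltnW n1).
  have : P (reso 1 u ^+ n).
    apply/(ve_gt0 DL pP (reso_X_OK 1 Ou) (expf_neq0 _ yu)); rewrite lt0n; apply/eqP => v0.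
    apply: nv; move: El; rewrite v0 add0n mulnBl mul1n => E.
    have : (n %| n * ve L P kummer - ve L P kummer)%N by rewrite E dvdn_mulr.
    by rewrite dvdn_subr ?dvdn_mulr // leq_pmull.
  by move/hPP; apply: (prime_X DM pPP); exact: reso_OK.
have [k kn Hk] := reso_vanish (primeP_id pPP) pPP.2.2 pPP.2.1 van.
apply: (inertia_ramified pR pQ _ kn).
  by move=> x [Fx Px]; split; [exact: FK | exact: hPP].
by move=> u Ou; split; [apply: sfB => //; [apply: sgX|]; case: Ou | exact: Hk].
Qed.

(** Some resolvent of a uniformizer of the totally ramified prime has the same valuation as the
    uniformizer above P, so its n-th power, an element of L, has valuation exactly 1 at P. By
    [reso_ve] the valuation of [kummer] is then invertible modulo n. *)
Lemma totram_kummer P : prime_ideal L P -> ~ P n%:R -> vI L P (ext_ideal L (contract F P)) = 1%N ->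
  totally_ramified K n (contract F P) -> exists b, (b * ve L P kummer = 1 %[mod n])%N.
Proof.
move=> pP Pn vR [Q' [pQ' /cset_ext EQ]].
have [PP pPP hPP] := lies_over DL DM LM pP; have hPPi := primeP_id pPP.
have pR := contract_prime DF DL FL pP; have nR := primeP_nz pR.
have hR := primeP_id pR; have hQ := primeP_id pQ'.
have RM x : F x -> M x by move=> Fx; apply: LM; apply: FL.
have QR x : Q' x -> ext_ideal K (contract F P) (x ^+ n) by rewrite EQ => Qx; apply: (ipow_mem DK).
have extPP x : ext_ideal K (contract F P) x -> PP x.
  by move=> [k [a [b [ab ->]]]]; apply: (id_sum _ fM hPPi) => i _; have [[_ Pa] Ob] := ab i; apply: (idmulr hPPi); [exact: (ext_OK KM) | exact: hPP].
have QPP x : Q' x -> PP x.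
  move=> Qx; apply: (prime_X DM pPP (k := n)); first by apply: (ext_OK KM); apply: idsub Qx.
  by apply: extPP; apply: QR.
have Qsg k x : Q' x -> Q' (autX sg k x).
  move=> Qx; have Ox := idsub hQ Qx; apply: (prime_X DK pQ' (k := n)); first exact: OK_sg.
  rewrite -rmorphXn /=; have : ext_ideal K (contract F P) (autX sg k (x ^+ n)).
    have [m [a [b [ab ->]]]] := QR _ Qx; rewrite rmorph_sum.
    apply: (id_sum _ fK (ext_id DF DK FK hR)) => i _; have [Ra Ob] := ab i; rewrite rmorphM /= sgXF; last by case: Ra.
    by apply: iprod_mul => //; apply: OK_sg.
  by rewrite EQ; move/(ipow_le DK pQ' n0); rewrite (ipow1 DK).
set g := vI M PP (ext_ideal M Q'); set e := vI M PP (ext_ideal M P).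
have g0 : (0 < g)%N by apply: (ext_index_gt0 DK DM KM pQ' pPP QPP).
(* The ramification index of [PP] over F, computed through K as n g and through L as e; the latter
   uses that P is unramified over F. *)
have Ege : (n * g = e)%N.
  have e1 : vI M PP (ext_ideal M (ext_ideal K (contract F P))) = (n * g)%N.
    by rewrite EQ (ext_pow DK DM KM _ hQ) (vI_pow DM) //; apply: (ext_nz DK DM KM (primeP_nz pQ')).
  have e2 : vI M PP (ext_ideal M (ext_ideal L (contract F P))) = e.
    by rewrite (vI_ext DL DM LM pP pPP hPP (ext_nz DF DL FL nR)) vR muln1.
  rewrite -e1 -e2; congr vI.
  have tr E : Defs.subset F E -> Defs.subset E M -> (exists d s w, @nfdata E d s w) -> forall x, ext_ideal M (ext_ideal E (contract F P)) x -> ext_ideal M (contract F P) x.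
    move=> FE EM [d [s [w D]]]; apply: (ext_min DM (ext_id DF DM RM hR)) => y.
    move=> [k [a [b [ab ->]]]]; exists k, a, b; split => // i; have [? ?] := ab i; split => //; exact: (ext_OK EM).
  have tr' E : (exists d s w, @nfdata E d s w) -> forall x, ext_ideal M (contract F P) x -> ext_ideal M (ext_ideal E (contract F P)) x.
    by move=> [d [s [w D]]] x [k [a [b [ab ->]]]]; exists k, a, b; split => // i; have [? ?] := ab i; split => //; exact: (ext_mem D).
  have eK : exists d s w, @nfdata K d s w by exists dK, sK, wK.
  have eL : exists d s w, @nfdata L d s w by exists dL, sL, wL.
  by apply: cset_ext => x; split => [/(tr K FK KM eK) | /(tr L FL LM eL)]; exact: tr'.
have [q Qq q2] := exists_unif DK pQ'; have Oq := idsub hQ Qq.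
have q0 : q != 0 by apply/eqP => E; apply: q2; rewrite E; case: (ipow_ideal DK pQ' 2) => _ [].
have vq : ve M PP q = g.
  rewrite (ve_ext DK DM KM pQ' pPP QPP Oq q0) -/g [ve K Q' q](_ : _ = 1%N) ?muln1 //.
  apply/eqP; rewrite eqn_leq; apply/andP; split; last exact/(ve_gt0 DK pQ' Oq q0).
  by rewrite leqNgt; apply/negP => /(ve_ge DK pQ' 2 Oq q0).
have PPn : ~ PP n%:R.
  move=> h; apply: Pn; rewrite -(contract_over DL DM LM pP pPP hPP); split => //; exact: sfnat.
have nn0 : n%:R != 0 :> algC by rewrite pnatr_eq0 -lt0n.
have hg1 := ipow_ideal DM pPP g.+1.
(* The resolvents of q add up to n q, whose valuation is exactly g because n is a unit at [PP], so
   they cannot all have larger valuation. *)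
have [b Hb] : exists b : 'I_n, ~ ipow M PP g.+1 (reso b q).
  apply: NNPP => h; have : ipow M PP g.+1 (n%:R * q).
    rewrite -reso_sum; apply: (id_sum _ fM hg1) => b _; apply: NNPP => h'; apply: h; by exists b.
  move/(ve_ge DM pPP g.+1 (OK_mul fM (OK_nat n fM) (ext_OK KM Oq)) (mulf_neq0 nn0 q0)).
  rewrite (veM DM PP (OK_nat n fM) (ext_OK KM Oq) nn0 q0) vq (ve_eq0 DM pPP (OK_nat n fM) PPn).
  by rewrite add0n ltnn.
have yb0 : reso b q != 0 by apply/eqP => E; apply: Hb; rewrite E; case: hg1 => _ [].
have Oy := reso_OK b Oq.
have vy : ve M PP (reso b q) = g.
  apply/eqP; rewrite eqn_leq; apply/andP; split.
    by rewrite leqNgt; apply/negP => /(ve_ge DM pPP g.+1 Oy yb0).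
  apply/(ve_ge DM pPP g Oy yb0); apply: (id_sum _ fM (ipow_ideal DM pPP g)) => k _.
  apply: (idmul (ipow_ideal DM pPP g)); first exact: (ext_OK LM (OK_z _)).
  have Osq := OK_sg k Oq; have sq0 : autX sg k q != 0 by rewrite fmorph_eq0.
  apply/(ve_ge DM pPP g (ext_OK KM Osq) sq0).
  rewrite (ve_ext DK DM KM pQ' pPP QPP Osq sq0) leq_pmulr //; apply/(ve_gt0 DK pQ' Osq sq0); exact: Qsg.
have vyn : ve L P (reso b q ^+ n) = 1%N.
  have := ve_ext DL DM LM pP pPP hPP (reso_X_OK b Oq) (expf_neq0 n yb0).
  rewrite (veX DM PP n Oy yb0) vy Ege -/e -[in LHS](muln1 e) => /eqP.
  by rewrite eqn_mul2l -Ege muln_eq0 !eqn0Ngt n0 g0 /= => /eqP.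
have [l] := reso_ve pP Oq yb0 (ltnW (ltn_ord b)); rewrite vyn => El.
exists b; have : (b * ve L P kummer + n * l = 1 + n * ve L P kummer)%N.
  by rewrite -El mulnBl addnCA subnKC // leq_mul2r (ltnW (ltn_ord b)) orbT.
by move=> E; rewrite -(modnMDl l (b * _)) addnC (mulnC l) E addnC (mulnC n) modnMDl.
Qed.
End Resolvent.

Lemma unit_mod K d (s : 'I_d -> aut) w (D : nfdata K s w) P x : prime_ideal K P -> OK K x -> ~ P x ->
  exists2 u, OK K u & P (1 - x * u).
Proof.
move=> pP Ox Px; have sK : is_subfield K by case: D.
have hP := primeP_id pP; have hx := principal_ideal sK Ox.
have hS := isum_ideal sK hx hP.
have [E|E] := prime_max D pP hS (fun y h => isumr sK hx h).
  by case: Px; rewrite -E; apply: (isuml sK hP); exact: (principal_mem sK).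
have [a [b [[u [Ou ->]] Pb E1]]] : isum (principal K x) P 1 by rewrite E; exact: OK1.
by exists u => //; rewrite E1 addrC addKr.
Qed.

(** * The extension L of F, and images of ideals under automorphisms *)

Section Cyclotomic.
Variables (F L : cset) (n : nat) (z : algC).
Variables (dF : nat) (sF : 'I_dF -> aut) (wF : 'I_dF -> algC) (DF : nfdata F sF wF).
Variables (dL : nat) (sL : 'I_dL -> aut) (wL : 'I_dL -> algC) (DL : nfdata L sL wL).
Hypotheses (FL : Defs.subset F L) (n1 : (1 < n)%N) (pz : n.-primitive_root z) (Lz : L z).
Hypothesis agr : generated_over F L z.
Hypothesis htau : forall b, coprime b n -> exists nu : aut, (forall x, F x -> nu x = x) /\ nu z = z ^+ b.
Let fF := nfdata_sub DF.
Let fL := nfdata_sub DL.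

Definition tau_data (e : 'I_(totient n) -> 'I_n) (tau : 'I_(totient n) -> aut) :=
  [/\ injective e, forall i, coprime (e i) n, forall b : 'I_n, coprime b n -> exists i, e i = b,
      forall i x, F x -> tau i x = x & forall i, tau i z = z ^+ (e i)].

Lemma tau_exists : exists e tau, tau_data e tau.
Proof.
pose U := [set b : 'I_n | coprime b n].
have cU : totient n = #|U|.
  rewrite totient_count_coprime -sum1dep_card big_mkord [RHS]big_mkcond; apply: eq_bigr => b _.
  by rewrite coprime_sym; case: coprime.
pose e i : 'I_n := enum_val (cast_ord cU i).
have eU i : coprime (e i) n by have := enum_valP (cast_ord cU i); rewrite inE.
have [tau Ht] := choice_ord (P := fun i (nu : aut) => (forall x, F x -> nu x = x) /\ nu z = z ^+ (e i)) (fun i => htau (eU i)).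
exists e, tau; split => //; first by move=> i j /enum_val_inj /cast_ord_inj.
- move=> b cb; have bU : b \in U by rewrite inE.
  by exists (cast_ord (esym cU) (enum_rank_in bU b)); rewrite /e cast_ordKV enum_rankK_in.
- by move=> i; case: (Ht i).
by move=> i; case: (Ht i).
Qed.

Variables (e : 'I_(totient n) -> 'I_n) (tau : 'I_(totient n) -> aut).
Hypothesis T : tau_data e tau.

Lemma tau_L i x : L x -> L (tau i x).
Proof.
move=> Lx; apply: (fixed_mem (nfdata_qdata DL)) => nu nuL; case: T => _ _ _ tF tz.
apply: (agr (nu := nu \o tau i) (mu := tau i)) => //= [y Fy|]; first by rewrite tF // nuL //; exact: FL.
by rewrite tz rmorphXn /= nuL.
Qed.
Lemma tau_OK i x : OK L x -> OK L (tau i x).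
Proof. by case=> Lx Ax; split; [exact: tau_L | rewrite Aint_aut]. Qed.
Lemma tau_cover (nu : aut) : (forall x, F x -> nu x = x) -> exists i, forall x, L x -> nu x = tau i x.
Proof.
move=> nuF; have pz' : n.-primitive_root (nu z) by rewrite fmorph_primitive_root.
have [b Eb] := prim_rootP pz (prim_expr_order pz').
case: T => _ _ ecov tF tz; have [|i Ei] := ecov b; first by move: pz'; rewrite Eb (prim_root_exp_coprime _ pz).
exists i => x Lx; apply: agr => // [y Fy|]; first by rewrite nuF ?tF.
by rewrite tz Ei Eb.
Qed.
Lemma tau_inj i j : (forall x, L x -> tau i x = tau j x) -> i = j.
Proof.
case: T => ie ec _ _ tz /(_ z Lz); rewrite !tz => /eqP; rewrite (eq_prim_root_expr pz) !modn_small // => /eqP E.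
by apply: ie; apply: val_inj.
Qed.
Lemma tau_fixed x : L x -> (forall i, tau i x = x) -> F x.
Proof.
move=> Lx h; apply: (fixed_mem (nfdata_qdata DF)) => nu nuF; have [i Hi] := tau_cover nuF.
by rewrite Hi.
Qed.
Lemma tau_perm k : exists f : 'I_(totient n) -> 'I_(totient n), bijective f /\ forall i x, L x -> tau k (tau i x) = tau (f i) x.
Proof.
have tF i x : F x -> tau i x = x by case: T => _ _ _ h _; apply: h.
have [f Hf] : exists f : 'I_(totient n) -> 'I_(totient n), forall i x, L x -> tau k (tau i x) = tau (f i) x.
  apply: (choice_ord (P := fun i (j : 'I_(totient n)) => forall x, L x -> tau k (tau i x) = tau j x)) => i.
  have [|j Hj] := @tau_cover (tau k \o tau i); first by move=> x Fx /=; rewrite !tF.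
  by exists j => x /Hj.
exists f; split => //; apply: injF_bij => i j fij; apply: tau_inj => x Lx.
by apply: (fmorph_inj (tau k)); rewrite !Hf // fij.
Qed.
Lemma tau_id : exists i, forall x, L x -> tau i x = x.
Proof. by have [i Hi] := @tau_cover idfun (fun _ _ => erefl); exists i => x /Hi. Qed.

Definition Vz : 'M[algC]_(totient n) := \matrix_(i, j) tau i (z ^+ j).
Lemma detVz : \det Vz != 0.
Proof.
have -> : Vz = (Vandermonde (totient n) (\row_i tau i z))^T.
  by apply/matrixP => i j; rewrite !mxE rmorphXn.
rewrite det_tr det_Vandermonde; apply/prodf_neq0 => i _; apply/prodf_neq0 => j ij.
case: T => ie _ _ _ tz; rewrite !mxE subr_eq0 !tz (eq_prim_root_expr pz) !modn_small //.
by apply: contraTN ij => /eqP E; rewrite -leqNgt (ie i j) // ; apply: val_inj.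
Qed.
Lemma OKzk k : OK L (z ^+ k).
Proof. split; first exact: sfX. apply: rpredX; apply: (@Aint_prim_root n); exact: pz. Qed.
Lemma OK_det r (A : 'M[algC]_r) : (forall i j, OK L (A i j)) -> OK L (\det A).
Proof.
move=> OA; apply: (id_sum _ fL (OK_ideal fL)) => p _; apply: OK_mul => //.
  by case: (odd_perm p); rewrite ?expr0 ?expr1; [rewrite -[-1]sub0r; apply: OK_sub => //; [exact: (OK_nat 0) | exact: OK1] | exact: OK1].
by elim/big_ind: _ => [|x y|i _]; [exact: OK1 | exact: OK_mul | exact: OA].
Qed.
Lemma OK_adj i j : OK L (\adj Vz i j).
Proof.
rewrite mxE /cofactor; apply: OK_mul => //.
  by elim: (_ + _)%N => [|k IH]; rewrite ?expr0 ?exprS; [exact: OK1 | apply: OK_mul => //; rewrite -[-1]sub0r; apply: OK_sub => //; [exact: (OK_nat 0) | exact: OK1]].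
by apply: OK_det => k l; rewrite !mxE; apply: tau_OK; exact: OKzk.
Qed.

(** A positive integer divisible by the determinant of the conjugates of 1, z, ..., z^(phi(n)-1).
    Away from it these powers behave like an integral basis of L over F; it collects the primes
    excluded in [normI_ext_le] and [ext_unram]. *)
Definition Nz : nat := nmn sL (\det Vz).
Lemma OKdet : OK L (\det Vz).
Proof. by apply: OK_det => i j; rewrite mxE; apply: tau_OK; exact: OKzk. Qed.
Lemma Nz_gt0 : (0 < Nz)%N. Proof. by apply: (nmn_gt0 DL) detVz; exact: OKdet. Qed.
Lemma Nz_div : exists2 y, OK L y & Nz%:R = \det Vz * y.
Proof.
have [y [Oy ->]] := nmn_mem DL (principal_ideal fL OKdet) (principal_mem fL _); by exists y.
Qed.

(** Cramer's rule with the denominator det Vz replaced by [Nz]. The coordinates lie in F because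
    every tau_k permutes the equations of the system. *)
Lemma coords x : OK L x -> exists a : 'rV[algC]_(totient n), (forall j, OK F (a 0 j)) /\ Nz%:R * x = \sum_j a 0 j * z ^+ j.
Proof.
move=> Ox; have [Lx _] := Ox; have uV : Vz \in unitmx by rewrite unitmxE unitfE detVz.
pose c : 'cV_(totient n) := invmx Vz *m \col_i tau i x.
have Vc : Vz *m c = \col_i tau i x by rewrite mulKVmx.
have [y Oy Ey] := Nz_div.
have Nc j : OK L (Nz%:R * c j 0).
  have -> : Nz%:R * c j 0 = y * \sum_i \adj Vz j i * tau i x.
    have -> : c = (\det Vz)^-1 *: (\adj Vz *m \col_i tau i x) by rewrite /c /invmx uV scalemxAl.
    rewrite !mxE Ey mulrAC mulrA mulfV ?detVz // mul1r mulrC; congr (_ * _); apply: eq_bigr => i _; by rewrite !mxE.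
  apply: OK_mul => //; apply: (id_sum _ fL (OK_ideal fL)) => i _; apply: OK_mul => //; [exact: OK_adj | exact: tau_OK].
have fc k : map_mx (tau k) c = c.
  apply: (can_inj (mulKmx uV)); rewrite Vc; have [f [[g fK gK] Hf]] := tau_perm k.
  apply/matrixP => i l; rewrite !mxE -(gK i) -Hf //.
  have := congr1 (fun M : 'cV_(totient n) => tau k (M (g i) l)) Vc; rewrite !mxE => <-.
  rewrite rmorph_sum; apply: eq_bigr => j _; rewrite !mxE rmorphM /= Hf //; exact: sfX.
exists (\row_j (Nz%:R * c j 0)); split.
  move=> j; rewrite mxE; have [Lc Ac] := Nc j; split => //; apply: tau_fixed => // i.
  rewrite rmorphM rmorph_nat; congr (_ * _); have := congr1 (fun M : 'cV_(totient n) => M j 0) (fc i).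
  by rewrite mxE.
have [i0 Hi0] := tau_id; have := congr1 (fun M : 'cV_(totient n) => M i0 0) Vc; rewrite !mxE Hi0 // => <-.
rewrite mulr_sumr; apply: eq_bigr => j _; rewrite !mxE Hi0; last exact: sfX.
by rewrite mulrA [RHS]mulrAC.
Qed.

Lemma ext_unit_mod R y : prime_ideal F R -> ~ R Nz%:R -> OK L y -> ext_ideal L R (Nz%:R * y) -> ext_ideal L R y.
Proof.
move=> pR RN Oy h; have [u Ou Ru] := unit_mod DF pR (OK_nat _ fF) RN.
have hE := ext_id DF DL FL (primeP_id pR).
have -> : y = u * (Nz%:R * y) + y * (1 - Nz%:R * u) by ring.
apply: (addclD (id_addcl fL hE)); first by apply: (idmul hE) => //; exact: (ext_OK FL).
by apply: (idmul hE) => //; exact: (ext_mem DL).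
Qed.

(** Through [coords] the quotient of O_L by R O_L injects into phi(n) copies of O_F / R, as [Nz] is
    invertible modulo R. *)
Lemma normI_ext_le R : prime_ideal F R -> ~ R Nz%:R -> (normI L (ext_ideal L R) <= normI F R ^ totient n)%N.
Proof.
move=> pR RN; have hR := primeP_id pR; have aR := id_addcl fF hR.
have hE := ext_id DF DL FL hR; have aE := id_addcl fL hE.
pose G' (v : 'rV[algC]_(totient n)) := forall j, OK F (v 0 j).
pose A' (v : 'rV[algC]_(totient n)) := forall j, R (v 0 j).
have aA' : addcl A'.
  split; first by move=> j; rewrite mxE; exact: aR.1.
  by move=> v v' h h' j; rewrite !mxE; apply: aR.2.
have [r [rO ru rc]] := normIP DF (primeP_nz pR).
have iA' : idx G' A' (normI F R ^ totient n).
  have := @idx_fin _ {ffun 'I_(totient n) -> 'I_(normI F R)} (fun f => \row_j r (f j)) G' A'.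
  rewrite card_ffun !card_ord; apply.
  - by move=> f j; rewrite mxE.
  - by move=> f g h; apply/ffunP => j; apply: ru; have := h j; rewrite !mxE.
  move=> v Gv; have [f Hf] := choice_ord (P := fun j i => R (v 0 j - r i)) (fun j => rc _ (Gv j)).
  by exists [ffun j => f j] => j; rewrite !mxE ffunE.
have [f Hf] : exists f : algC -> 'rV[algC]_(totient n), forall x, OK L x -> G' (f x) /\ Nz%:R * x = \sum_j (f x) 0 j * z ^+ j.
  apply: (choice_fun (P := fun x (v : 'rV[algC]_(totient n)) => OK L x -> G' v /\ Nz%:R * x = \sum_j v 0 j * z ^+ j)) => x.
  have [Ox|nOx] := classic (OK L x); last by exists 0.
  by have [a [ha Ea]] := coords Ox; exists a.
apply: (@idx_le _ _ (OK L) (ext_ideal L R) G' A' _ _ f aA' _ iA').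
- exact: (normIP DL (ext_nz DF DL FL (primeP_nz pR))).
- by move=> x Ox; case: (Hf x Ox).
move=> x y Ox Oy h; apply: ext_unit_mod => //; first exact: OK_sub.
have [_ Ex] := Hf x Ox; have [_ Ey] := Hf y Oy.
rewrite mulrBr Ex Ey -sumrB; apply: (id_sum _ fL hE) => j _; rewrite -mulrBl.
by apply: iprod_mul; [have := h j; rewrite !mxE | exact: OKzk].
Qed.

(** If P^2 divided R O_L, with R below P, some y outside R O_L would have its square in R O_L. The
    conjugates of y z^j then lie in P and their sums, being in F, lie in R; solving the system with
    matrix Vz puts det(Vz) y, and hence y, into R O_L. *)
Lemma ext_unram P : prime_ideal L P -> ~ P Nz%:R -> vI L P (ext_ideal L (contract F P)) = 1%N.
Proof.
move=> pP PN; have hP := primeP_id pP; have pR := contract_prime DF DL FL pP; have nR := primeP_nz pR.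
set R := contract F P in pR nR *; have RP x : R x -> P x by case.
have nE := ext_nz DF DL FL nR; have hE := nE.1.
apply/eqP; rewrite eqn_leq (ext_index_gt0 DF DL FL pR pP RP) andbT leqNgt; apply/negP => v2.
have nP2 := ipow_nz DL 2 (primeP_nz pP).
have [J [hJ EJ]] := ideal_dvd DL nP2 hE ((vI_ge DL 2 pP nE).1 v2).
have nJ : nonzero_ideal L J.
  split => //; case: nE => _ [x [Ix x0]]; exists x; split => //; move: Ix; rewrite EJ iprodC.
  by apply: (iprod_subl fL hJ); exact: nP2.1.
have P2 : ipow L P 2 = iprod P P by rewrite /ipow /= iprod_OK.
have [y PJy Ey] : exists2 y, iprod P J y & ~ ext_ideal L R y.
  apply: NNPP => h; have : (vI L P (ext_ideal L R) <= vI L P (iprod P J))%N.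
    have sub1 y : iprod P J y -> ext_ideal L R y by move=> h1; apply: NNPP => h2; apply: h; exists y.
    have nPJ := nz_iprod fL (primeP_nz pP) nJ.
    have [A [hA EA]] := ideal_dvd DL nE nPJ.1 sub1.
    have nA : nonzero_ideal L A.
      split => //; case: nPJ => _ [x [Ix x0]]; exists x; split => //; move: Ix; rewrite EA iprodC.
      exact: (iprod_subl fL hA hE).
    by rewrite EA (vIM DL _ nE nA) leq_addr.
  rewrite EJ (vIM DL _ nP2 nJ) (vIM DL _ (primeP_nz pP) nJ) (vI_pow DL _ _ (primeP_nz pP)) (vI_P DL pP) muln1.
  by rewrite leq_add2r.
have Oy : OK L y := idsub (iprod_ideal fL hP hJ) PJy.
have Ey2 : ext_ideal L R (y * y).
  have : iprod (iprod P J) (iprod P J) (y * y) by apply: iprod_mul.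
  rewrite -(iprodAK fL hP hJ (iprod_ideal fL hP hJ)) (iprodAK fL hJ hP hJ) (iprodC J P).
  rewrite -(iprodAK fL hP hJ hJ) (iprodAK fL hP hP (iprod_ideal fL hJ hJ)) -P2 (iprodAK fL nP2.1 hJ hJ) -EJ.
  exact: (iprod_subl fL hE hJ).
have tE i x : ext_ideal L R x -> ext_ideal L R (tau i x).
  move=> [k [a [b [ab ->]]]]; rewrite rmorph_sum; apply: (id_sum _ fL hE) => l _; have [Ra Ob] := ab l.
  rewrite rmorphM /=; case: (T) => _ _ _ tF _; rewrite tF; last by case: Ra.
  by apply: iprod_mul => //; exact: tau_OK.
have extP x : ext_ideal L R x -> P x by apply: (ext_min DL hP).
pose c j := \sum_i tau i (y * z ^+ j).
have Oyz (j : 'I_(totient n)) : OK L (y * z ^+ j) by apply: OK_mul => //; exact: OKzk.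
have Rc (j : 'I_(totient n)) : R (c j).
  have Pc : P (c j).
    apply: (id_sum _ fL hP) => i _; apply: (prime_X DL pP (k := 2)); first exact: tau_OK.
    apply: extP; rewrite -rmorphXn /=; apply: tE; rewrite exprMn; apply: (idmulr hE) => //.
    by apply: (OK_X DL); exact: OKzk.
  split => //; have [Lc Ac] := idsub hP Pc; apply: tau_fixed => // k.
  have [f [bf Hf]] := tau_perm k; have [g fK gK] := bf; rewrite /c rmorph_sum /= [RHS](reindex f); last by exists g => x _.
  by apply: eq_bigr => i _; rewrite Hf //; case: (Oyz j).
have [i0 Hi0] := tau_id.
have key : ext_ideal L R (\det Vz * y).
  have E : (\row_i tau i y) *m Vz = \row_j c j.
    by apply/rowP => j; rewrite !mxE; apply: eq_bigr => i _; rewrite !mxE rmorphM.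
  have := congr1 (fun M : 'rV_(totient n) => (M *m \adj Vz) 0 i0) E; rewrite -mulmxA mul_mx_adj mul_mx_scalar !mxE Hi0; last by case: Oy.
  move=> ->; apply: (id_sum _ fL hE) => j _; rewrite mxE; apply: (idmulr hE); first exact: OK_adj.
  exact: (ext_mem DL).
have RN : ~ R Nz%:R by case.
apply: Ey; apply: (ext_unit_mod pR RN Oy); have [u Ou ->] := Nz_div.
by rewrite mulrAC; apply: (idmulr hE).
Qed.
End Cyclotomic.

Section Products.
Variables (K : cset) (d : nat) (s : 'I_d -> aut) (w : 'I_d -> algC) (D : nfdata K s w).
Let sK := nfdata_sub D.

Lemma nz_factor I A B : nonzero_ideal K I -> I = iprod A B -> is_ideal K A -> is_ideal K B -> nonzero_ideal K B.
Proof.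
move=> [hI [x [Ix x0]]] E hA hB; split => //; exists x; split => //; move: Ix; rewrite E iprodC.
exact: (iprod_subl sK hB hA).
Qed.

Lemma uniq_prodI_dvd l I : primes_of K l -> uniq l -> nonzero_ideal K I -> (forall P, P \in l -> forall x, I x -> P x) ->
  exists A, nonzero_ideal K A /\ I = iprod (prodI K l) A.
Proof.
elim: l => [|P l IH] pl; first by exists I; split => //; rewrite OK_iprod //; exact: H0.1.
have [pP pl'] := (primes_cons _ _ _).1 pl => /andP[Pl ul] nI hI.
have [|A [nA EA]] := IH pl' ul nI; first by move=> Q Ql; apply: hI; rewrite inE Ql orbT.
have nl := prodI_nz D pl'.
have : (0 < vI K P I)%N by apply/(vI_gt0 D pP nI); apply: hI; rewrite mem_head.
rewrite EA (vIM D P nl nA) (vI_prodI D _ pl') (count_memPn Pl) add0n => /(vI_gt0 D pP nA) AP.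
have [B [hB EB]] := ideal_dvd D (primeP_nz pP) nA.1 AP.
have nB := nz_factor nA EB (primeP_id pP) hB; exists B; split => //=.
by rewrite [in LHS]EB (iprodAK sK nl.1 (primeP_id pP) hB) (iprodC P).
Qed.

Lemma uniq_normI_le l I : primes_of K l -> uniq l -> nonzero_ideal K I -> (forall P, P \in l -> forall x, I x -> P x) ->
  (\prod_(P <- l) normI K P <= normI K I)%N.
Proof.
move=> pl ul nI hI; have [A [nA ->]] := uniq_prodI_dvd pl ul nI hI.
by rewrite (normIM D (prodI_nz D pl) nA) (normI_prodI D pl) leq_pmulr // (normI_gt0 D).
Qed.

Lemma uniq_prodI_mem l x : primes_of K l -> uniq l -> OK K x -> (forall P, P \in l -> P x) -> prodI K l x.
Proof.
move=> pl ul Ox h; have hl := prodI_id D pl; have [->|x0] := eqVneq x 0; first by case: hl => _ [].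
have [|A [nA EA]] := uniq_prodI_dvd pl ul (principal_nz sK Ox x0).
  by move=> P Pl y; apply: (principal_sub (primeP_id (pl _ Pl))); exact: h.
by have := principal_mem sK x; rewrite EA; apply: (iprod_subl sK hl); exact: nA.1.
Qed.
End Products.

(** The image nu(I), written as the preimage under the inverse so that membership unfolds
    directly. *)
Definition imI (nu : aut) (I : cset) : cset := fun x => I (aut_inv nu x).

Section Image.
Variables (K : cset) (d : nat) (s : 'I_d -> aut) (w : 'I_d -> algC) (D : nfdata K s w).
Let sK := nfdata_sub D.
Variable nu : aut.
Hypothesis Knu : forall x, K x -> K (nu x).

(** Two powers of [nu] agree on K by the pigeonhole principle over the embeddings; so [nu] has
    finite order on K, and its inverse preserves K as well. *)
Lemma aut_order : exists r, forall x, K x -> autX nu r.+1 x = x.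
Proof.
have [g Hg] : exists g : nat -> 'I_d, forall k, forall x, K x -> autX nu k x = s (g k) x.
  by apply: (choice_fun (P := fun k (i : 'I_d) => forall x, K x -> autX nu k x = s i x)) => k; case: D => _ _ _ _; apply.
have [i [j [ij Eij]]] : exists i j : 'I_d.+1, (i < j)%N /\ g i = g j.
  have /injectivePn[i [j ij E]] : ~~ injectiveb (fun i : 'I_d.+1 => g i).
    by apply/injectiveP => /leq_card; rewrite !card_ord ltnn.
  by have := ij; rewrite neq_ltn => /orP[h|h]; [exists i, j | exists j, i].
exists (j - i).-1 => x Kx; rewrite prednK ?subn_gt0 //; apply: (fmorph_inj (autX nu i)).
by rewrite -autXD subnKC ?(ltnW ij) // !Hg ?Eij.
Qed.
Lemma autX_K k x : K x -> K (autX nu k x).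
Proof. by move=> Kx; elim: k => //= k IH; apply: Knu. Qed.
Lemma inv_K x : K x -> K (aut_inv nu x).
Proof.
have [r Hr] := aut_order => Kx; have -> : aut_inv nu x = autX nu r x.
  by rewrite -{1}(Hr x Kx) /= autK.
exact: autX_K.
Qed.
Lemma inv_OK x : OK K x -> OK K (aut_inv nu x).
Proof. by case=> Kx Ax; split; [exact: inv_K | rewrite Aint_aut]. Qed.
Lemma nu_OK x : OK K x -> OK K (nu x).
Proof. by case=> Kx Ax; split; [exact: Knu | rewrite Aint_aut]. Qed.

Lemma imI_mem I x : imI nu I (nu x) <-> I x.
Proof. by rewrite /imI autK. Qed.
Lemma imI_id I : is_ideal K I -> is_ideal K (imI nu I).
Proof.
move=> hI; apply: mk_ideal => //.
- by move=> x /(idsub hI)/nu_OK; rewrite aut_invK.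
- split; first by rewrite /imI rmorph0; case: hI => _ [].
  by move=> x y Ix Iy; rewrite /imI rmorphB; apply: (id_addcl sK hI).2.
by move=> r x Or Ix; rewrite /imI rmorphM; apply: (idmul hI) => //; exact: inv_OK.
Qed.
Lemma imI_nz I : nonzero_ideal K I -> nonzero_ideal K (imI nu I).
Proof. by move=> [hI [x [Ix x0]]]; split; [exact: imI_id | exists (nu x); rewrite fmorph_eq0; split => //; apply/imI_mem]. Qed.
Lemma imI_prime P : prime_ideal K P -> prime_ideal K (imI nu P).
Proof.
move=> pP; split; first exact: imI_nz (primeP_nz pP).
split; first by rewrite /imI rmorph1; case: pP => _ [].
by move=> a b Oa Ob; rewrite /imI rmorphM; apply: pP.2.2; exact: inv_OK.
Qed.
Lemma imI_iprod I J : imI nu (iprod I J) = iprod (imI nu I) (imI nu J).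
Proof.
apply: cset_ext => x; split.
  move=> [k [a [b [ab E]]]]; exists k, (nu \o a), (nu \o b); split.
    by move=> i; have [? ?] := ab i; split; apply/imI_mem.
  by rewrite -(aut_invK nu x) E rmorph_sum; apply: eq_bigr => i _; rewrite rmorphM.
move=> [k [a [b [ab ->]]]]; exists k, (aut_inv nu \o a), (aut_inv nu \o b); split => //.
by rewrite rmorph_sum; apply: eq_bigr => i _; rewrite rmorphM.
Qed.
Lemma imI_OK : imI nu (OK K) = OK K.
Proof. by apply: cset_ext => x; split => [/nu_OK|/inv_OK //]; rewrite aut_invK. Qed.
Lemma imI_principal a : imI nu (principal K a) = principal K (nu a).
Proof.
apply: cset_ext => x; split => [[r [Or E]]|[r [Or ->]]].
  by exists (nu r); split; [exact: nu_OK | rewrite -rmorphM -E aut_invK].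
by exists (aut_inv nu r); split; [exact: inv_OK | rewrite rmorphM autK].
Qed.
Lemma imI_inj I J : imI nu I = imI nu J -> I = J.
Proof.
move=> E; apply: cset_ext => x; split => h; have : imI nu I (nu x) by [rewrite /imI autK | rewrite E /imI autK].
  by rewrite E /imI autK.
by rewrite /imI autK.
Qed.
Lemma imI_prodI l : imI nu (prodI K l) = prodI K (map (imI nu) l).
Proof. by elim: l => [|P l IH] /=; rewrite ?imI_OK // imI_iprod IH. Qed.
Lemma imI_normI I : nonzero_ideal K I -> normI K (imI nu I) = normI K I.
Proof.
move=> nI; apply: normI_uniq => //; first by apply: (id_addcl sK); apply: imI_id; exact: nI.1.
have [r [rO ru rc]] := normIP D nI; exists (nu \o r); split => /=.
- by move=> i; apply: nu_OK.
- by move=> i j; rewrite -rmorphB => /imI_mem/ru.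
by move=> x Ox; have [i Hi] := rc _ (inv_OK Ox); exists i; rewrite -(aut_invK nu x) -rmorphB; apply/imI_mem.
Qed.
Lemma imI_vI P I : prime_ideal K P -> nonzero_ideal K I -> vI K (imI nu P) (imI nu I) = vI K P I.
Proof.
move=> pP nI; have [l pl ->] := uf_exists D nI; rewrite imI_prodI !(vI_prodI D) //.
  by elim: l {pl} => //= Q l ->; congr (_ + _)%N; congr nat_of_bool; apply/eqP/eqP => [/imI_inj|->].
by move=> Q /mapP[Q' /pl pQ' ->]; apply: imI_prime.
Qed.
Lemma imI_ve P x : prime_ideal K P -> OK K x -> x != 0 -> ve K (imI nu P) (nu x) = ve K P x.
Proof. by move=> pP Ox x0; rewrite /ve -imI_principal imI_vI //; exact: principal_nz. Qed.
End Image.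

(** * Discriminants and the parametrization of the fields *)

Section DiscBound.
Variables (F K L M : cset) (n : nat) (z : algC) (sg : aut).
Variables (dF : nat) (sF : 'I_dF -> aut) (wF : 'I_dF -> algC) (DF : nfdata F sF wF).
Variables (dK : nat) (sK : 'I_dK -> aut) (wK : 'I_dK -> algC) (DK : nfdata K sK wK).
Variables (dL : nat) (sL : 'I_dL -> aut) (wL : 'I_dL -> algC) (DL : nfdata L sL wL).
Variables (dM : nat) (sM : 'I_dM -> aut) (wM : 'I_dM -> algC) (DM : nfdata M sM wM).
Hypotheses (FK : Defs.subset F K) (FL : Defs.subset F L) (KM : Defs.subset K M) (LM : Defs.subset L M).
Hypotheses (n1 : (1 < n)%N) (pz : n.-primitive_root z) (Lz : L z).
Hypotheses (sgF : forall x, F x -> sg x = x) (sgK : forall x, K x -> K (sg x)).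
Hypothesis sgneq : powers_distinct K n sg.
Hypothesis cls : powers_exhaust F K n sg.
Hypothesis sgn : forall x, K x -> autX sg n x = x.
Let fF := nfdata_sub DF.
Let fK := nfdata_sub DK.
Let fL := nfdata_sub DL.
Let fM := nfdata_sub DM.
Let n0 : (0 < n)%N. Proof. exact: ltnW. Qed.
Variables (Rs : seq cset) (Qs : cset -> cset).
Hypothesis uR : uniq Rs.
Hypothesis pRs : forall R, R \in Rs -> prime_ideal F R.
Hypothesis hQs : forall R, R \in Rs -> prime_ideal K (Qs R) /\ ext_ideal K R = ipow K (Qs R) n.
Let W := \matrix_(i, j) sK i (wK j).
Let rr := prodI K (map Qs Rs).

Lemma Qs_contract R x : R \in Rs -> F x -> Qs R x -> R x.
Proof.
move=> RR Fx Qx; have [pQ EQ] := hQs RR; have pR := pRs RR.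
suff : contract F (Qs R) = R by move=> <-.
apply: (contract_over DF DK FK pR pQ) => y Ry.
have : ipow K (Qs R) n y by rewrite -EQ; exact: (ext_mem DK).
by move/(ipow_le DK pQ n0); rewrite (ipow1 DK (primeP_id pQ)).
Qed.
Lemma Qs_sg R k x : R \in Rs -> Qs R x -> Qs R (autX sg k x).
Proof.
move=> RR Qx; have [pQ EQ] := hQs RR; have hR := primeP_id (pRs RR); have Ox := idsub (primeP_id pQ) Qx.
apply: (prime_X DK pQ (k := n)); first exact: (OK_sg sgK).
have : ipow K (Qs R) n (autX sg k x ^+ n).
  rewrite -rmorphXn -EQ; have : ext_ideal K R (x ^+ n) by rewrite EQ; exact: (ipow_mem DK).
  move=> [m [a [b [ab ->]]]]; rewrite rmorph_sum.
  apply: (id_sum _ fK (ext_id DF DK FK hR)) => i _; have [Ra Ob] := ab i.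
  rewrite rmorphM /= (sgXF sgF); last by case: (idsub hR Ra).
  by apply: iprod_mul => //; exact: (OK_sg sgK).
by move/(ipow_le DK pQ n0); rewrite (ipow1 DK (primeP_id pQ)).
Qed.
Lemma rr_primes : primes_of K (map Qs Rs).
Proof. by move=> Q /mapP[R RR ->]; case: (hQs RR). Qed.
Lemma rr_sub R x : R \in Rs -> rr x -> Qs R x.
Proof.
move=> RR; have : Qs R \in map Qs Rs by apply: map_f.
rewrite /rr => Qin; rewrite (prodI_perm DK (perm_to_rem Qin) rr_primes) /=.
have /primes_cons[pQ pr] := primes_of_perm (perm_to_rem Qin) rr_primes.
exact: (iprod_subl fK (primeP_id pQ) (prodI_id DK pr)).
Qed.
Lemma ext_prodRs : ext_ideal K (prodI F Rs) = ipow K rr n.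
Proof.
rewrite /rr; elim: Rs pRs hQs => [|R l IH] pl hl /=.
  rewrite (ext_OKE DF DK FK); elim: (n) => [|k IH]; first by [].
  by rewrite /ipow iterS -/(ipow K _ k) -IH OK_iprod //; exact: OK_ideal.
have pl' : primes_of F l by move=> P Pl; apply: pl; rewrite inE Pl orbT.
have hl' : forall R', R' \in l -> prime_ideal K (Qs R') /\ ext_ideal K R' = ipow K (Qs R') n by move=> R' h; apply: hl; rewrite inE h orbT.
have [pQ EQ] := hl R (mem_head _ _).
have pql : primes_of K (map Qs l) by move=> Q /mapP[R' R'l ->]; case: (hl' _ R'l).
rewrite (extM DF DK FK (primeP_id (pl _ (mem_head _ _))) (prodI_id DF pl')) EQ IH //.
by rewrite (ipowM DK n (primeP_id pQ) (prodI_id DK pql)).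
Qed.

(** A weak form of the statement that rr^(n-1) divides the different, rr being the product of the
    totally ramified primes. With (prod R) dd = (c), traces to F from J = rr dd are divisible by c;
    comparing the trace matrix of a basis of J against [wK] with c^dK = N(rr)^n N(dd O_K) gives the
    bound. *)
Lemma disc_bound : (normI K rr ^ n.-1)%:R <= n%:R ^+ dK * `|\det W| ^+ 2 :> algC.
Proof.
have nR := prodI_nz DF (pRs : primes_of F Rs); have nrr : nonzero_ideal K rr := prodI_nz DK rr_primes.
have [dd [c [nd c0 Ec]]] := ideal_inv DF nR; have ned := ext_nz DF DK FK nd.
pose J := iprod rr (ext_ideal K dd); have nJ : nonzero_ideal K J by apply: nz_iprod.
pose TrF x := \sum_(k < n) autX sg k x.
have TrFF x : K x -> F (TrF x).
  move=> Kx; apply: (fixed_mem (nfdata_qdata DF)) => nu nuF; have [k kn Hk] := cls nuF.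
  rewrite /TrF -[RHS](@sum_shift (fun i => autX sg i x) n k); last by move=> i; rewrite addnC autXD sgn //; apply: (sgX sgK).
  by rewrite rmorph_sum; apply: eq_bigr => j _; rewrite Hk ?autXD //; apply: (sgX sgK).
have TrOK x : OK K x -> OK F (TrF x).
  case=> Kx Ax; split; first exact: TrFF.
  by apply: rpred_sum => k _; rewrite Aint_aut.
(* sg preserves each totally ramified prime Q_R, and Q_R meets F in R; so the trace of an element of
   rr lies in every R. *)
have TrR x : rr x -> prodI F Rs (TrF x).
  move=> rx; have Ox := idsub nrr.1 rx; apply: (uniq_prodI_mem DF pRs uR (TrOK _ Ox)) => R RR.
  apply: (Qs_contract RR); first by case: (TrOK _ Ox).
  have [pQ _] := hQs RR; apply: (id_sum _ fK (primeP_id pQ)) => k _; apply: (Qs_sg _ RR); exact: (rr_sub RR).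
have TrJ x : J x -> exists2 f, OK F f & TrF x = c%:R * f.
  suff : (forall x, J x -> K x /\ principal F c%:R (TrF x)).
    by move=> h /h[_ [f [Of ->]]]; exists f.
  have hc := principal_ideal fF (OK_nat c fF).
  apply: iprod_min.
    split; first by split; [exact: sf0 | rewrite /TrF big1; [exact: (id_addcl fF hc).1 | by move=> k _; rewrite rmorph0]].
    move=> x' y [Kx hx] [Ky hy]; split; first exact: sfB.
    suff -> : TrF (x' - y) = TrF x' - TrF y by apply: (id_addcl fF hc).2.
    by rewrite /TrF -sumrB; apply: eq_bigr => k _; rewrite rmorphB.
  move=> r e' rr_r [m [a [b [ab ->]]]]; split.
    apply: sfM => //; first by case: (idsub nrr.1 rr_r).
    by apply: sfsum => // i _; have [da Ob] := ab i; apply: sfM => //; [apply: FK; case: (idsub nd.1 da) | case: Ob].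
  rewrite mulr_sumr.
  have -> : TrF (\sum_i r * (a i * b i)) = \sum_i a i * TrF (r * b i).
    rewrite /TrF; under eq_bigr => k _ do rewrite rmorph_sum /=.
    rewrite exchange_big; apply: eq_bigr => i _; rewrite mulr_sumr; apply: eq_bigr => k _.
    have [da _] := ab i; have Fa : F (a i) by case: (idsub nd.1 da).
    rewrite !rmorphM /= (sgXF sgF k Fa).
    ring.
  apply: (id_sum _ fF hc) => i _; have [da Ob] := ab i; rewrite -Ec mulrC; apply: iprod_mul => //.
  by apply: TrR; apply: (idmulr nrr.1).
have TrQ k x : K x -> \sum_i sK i (autX sg k x) = \sum_i sK i x.
  have [f Hf] := choice_ord (P := fun i (j : 'I_dK) => forall x, K x -> sK i (autX sg k x) = sK j x)
     (fun i => let: And5 _ _ _ _ h := DK in h (sK i \o autX sg k)).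
  move=> Kx; have fI : injective f.
    move=> i j fij; apply: (qdata_inj (nfdata_qdata DK)) => y Ky.
    have Ky' := inv_K DK (fun x => @sgX K sg sgK k x) Ky.
    by rewrite -(aut_invK (autX sg k) y) !Hf // fij.
  by rewrite [RHS](reindex_inj fI); apply: eq_bigr => i _; rewrite Hf.
have [B [dB HB hidx]] := ideal_basis DK nJ.
have nB : normI K J = `|\det B|%N by apply: (normI_uniq _ hidx); apply: (id_addcl fK); case: nJ.
pose b l := ev wK (row l B).
have bJ l : J (b l) by apply/HB; exists (delta_mx 0 l); rewrite -rowE.
(* The absolute trace of the trace to F is n times the absolute trace; this factor n is the origin
   of n^dK in the bound. *)
have [Z HZ] : exists Z : 'I_dK * 'I_dK -> int, forall p, n%:R * \sum_i sK i (b p.1 * wK p.2) = c%:R * (Z p)%:~R.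
  apply: (choice_fun (P := fun p (t : int) => n%:R * \sum_i sK i (b p.1 * wK p.2) = c%:R * t%:~R)) => -[l j] /=.
  have Jx : J (b l * wK j) by apply: (idmulr nJ.1) => //; case: DK => _ h _ _ _; apply: h.
  have Kx : K (b l * wK j) by case: (idsub nJ.1 Jx).
  have [f [Ff Af] Ef] := TrJ _ Jx.
  have rat : \sum_i sK i f \in Crat.
    apply: fixed_rat => nu; rewrite rmorph_sum; have [g [[g' gK g'K] Hg]] := qdata_perm (nfdata_qdata DK) nu.
    rewrite [RHS](reindex g); last by exists g' => x _.
    by apply: eq_bigr => i _; rewrite Hg //; apply: FK.
  have [q Eq] := CratP _ rat; have : ratr q \in Aint by rewrite -Eq; apply: rpred_sum => i _; rewrite Aint_aut.
  move/rat_Aint_int => [t Et]; exists t; rewrite intr_rat -Et -Eq [RHS]mulr_sumr.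
  transitivity (\sum_i sK i (TrF (b l * wK j))); last by apply: eq_bigr => i _; rewrite Ef rmorphM rmorph_nat.
  rewrite mulr_natl -[X in _ *+ X]card_ord -sumr_const.
  under [RHS]eq_bigr => i _ do rewrite /TrF rmorph_sum.
  by rewrite [RHS]exchange_big; apply: eq_big => [//|k _]; rewrite TrQ.
pose Zm : 'M[int]_dK := \matrix_(l, j) Z (l, j).
have E : n%:R *: (map_mx intr B *m (W^T *m W)) = c%:R *: map_mx intr Zm.
  apply/matrixP => l j; rewrite !mxE -(HZ (l, j)) /=; congr (_ * _).
  under eq_bigr => k _ do rewrite !mxE mulr_sumr.
  rewrite exchange_big; apply: eq_bigr => i _; rewrite rmorphM /= /b sEv mulr_suml.
  by apply: eq_bigr => k _; rewrite !mxE mulrA.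
have := congr1 (fun A : 'M[algC]_dK => `|\det A|) E; rewrite !detZ !det_mulmx det_tr !det_map_mx !normrM !normrX !normr_nat -expr2.
have dZ : \det Zm != 0.
  apply: contraTneq isT => dZ0; move: E => /(congr1 determinant)/eqP; rewrite !detZ !det_mulmx det_tr !det_map_mx dZ0 mulr0.
  have dW : \det W != 0 by case: DK.
  rewrite !mulf_eq0 expf_eq0 pnatr_eq0 (negPf dW) intr_eq0 (negPf dB) /= orbF andbC.
  by rewrite -[n]prednK.
have Z1 : 1 <= `|(\det Zm)%:~R| :> algC by rewrite -intr_norm ler1z -gtz0_ge1 normr_gt0.
have hB : `|(\det B)%:~R| = (normI K J)%:R :> algC by rewrite nB -intr_norm -abszE.
have cK : (c ^ dK = normI K rr ^ n * normI K (ext_ideal K dd))%N.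
  rewrite -(normI_nat DK c0) -(ext_principal DF DK FK (OK_nat c fF)) -Ec (extM DF DK FK nR.1 nd.1) ext_prodRs.
  rewrite (normIM DK (ipow_nz DK n nrr) ned); congr (_ * _)%N.
  elim: (n) => [|k IH]; first exact: (normI_OK DK).
  by rewrite /ipow iterS -/(ipow K _ k) (normIM DK nrr (ipow_nz DK k nrr)) expnS IH.
rewrite hB (normIM DK nrr ned) => E2.
have h0 : (0 : algC) < (normI K rr * normI K (ext_ideal K dd))%:R by rewrite ltr0n muln_gt0 !(normI_gt0 DK).
rewrite -(ler_pM2l h0) [leRHS]mulrCA.
have -> : (normI K rr * normI K (ext_ideal K dd))%:R * (normI K rr ^ n.-1)%:R = c%:R ^+ dK :> algC.
  by rewrite -natrM -natrX cK -{2}[n]prednK // expnS; congr (_%:R); rewrite mulnAC.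
apply: le_trans (_ : c%:R ^+ dK * `|(\det Zm)%:~R| <= _); first by rewrite ler_peMr // exprn_ge0 // ler0n.
by rewrite -E2.
Qed.
End DiscBound.

Definition pb (P : Prop) : bool := if excluded_middle_informative P then true else false.
Lemma pbP P : reflect P (pb P).
Proof. by rewrite /pb; case: excluded_middle_informative => h; constructor. Qed.

Lemma prod_classes (U V : eqType) (h : U -> V) (f : U -> nat) (b : V -> nat) l :
  (forall R, R \in map h l -> (\prod_(P <- l | h P == R) f P <= b R)%N) ->
  (\prod_(P <- l) f P <= \prod_(R <- undup (map h l)) b R)%N.
Proof.
move=> hb; have -> : (\prod_(P <- l) f P = \prod_(R <- undup (map h l)) \prod_(P <- l | h P == R) f P)%N.
  rewrite (exchange_big_dep predT) //= !big_seq; apply: eq_bigr => P Pl.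
  rewrite big_const_seq -(@eq_count _ (pred1 (h P))); last by move=> R /=; rewrite eq_sym.
  by rewrite (count_uniq_mem _ (undup_uniq _)) mem_undup map_f //= muln1.
rewrite !big_seq; apply: leq_prod => R; rewrite mem_undup; exact: hb.
Qed.

Section Conductor.
Variables (F K L M : cset) (n : nat) (z : algC) (sg : aut).
Variables (dF : nat) (sF : 'I_dF -> aut) (wF : 'I_dF -> algC) (DF : nfdata F sF wF).
Variables (dK : nat) (sK : 'I_dK -> aut) (wK : 'I_dK -> algC) (DK : nfdata K sK wK).
Variables (dL : nat) (sL : 'I_dL -> aut) (wL : 'I_dL -> algC) (DL : nfdata L sL wL).
Variables (dM : nat) (sM : 'I_dM -> aut) (wM : 'I_dM -> algC) (DM : nfdata M sM wM).
Hypotheses (FK : Defs.subset F K) (FL : Defs.subset F L) (KM : Defs.subset K M) (LM : Defs.subset L M).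
Hypotheses (n1 : (1 < n)%N) (pz : n.-primitive_root z) (Lz : L z).
Hypotheses (sgF : forall x, F x -> sg x = x) (sgK : forall x, K x -> K (sg x)).
Hypothesis sgneq : powers_distinct K n sg.
Hypothesis cls : powers_exhaust F K n sg.
Hypothesis sgn : forall x, K x -> autX sg n x = x.
Let fF := nfdata_sub DF.
Let fK := nfdata_sub DK.
Let fL := nfdata_sub DL.
Let fM := nfdata_sub DM.
Let n0 : (0 < n)%N. Proof. exact: ltnW. Qed.
Hypothesis agr : generated_over F L z.
Variables (e : 'I_(totient n) -> 'I_n) (tau : 'I_(totient n) -> aut).
Hypothesis T : tau_data F z e tau.
Variable u0 : algC.
Hypotheses (Ou0 : OK K u0) (y0 : reso n z sg 1 u0 != 0).
Hypothesis hT : unram_or_total F K n.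
Let al := kummer n z sg u0.
Let Oal : OK L al := kummer_OK DL DM FL KM LM n1 pz Lz sgK cls sgn Ou0.
Let al0 : al != 0 := kummer_neq0 y0.
Let N0 := (n * Nz z sL tau)%N.
Let tL i x : L x -> L (tau i x). Proof. exact: (tau_L DL FL Lz agr T). Qed.

(** The class-1 part of the conductor: tame primes of L at which the Kummer generator has valuation
    1 modulo n. The other ramified tame primes are their conjugates over F. *)
Definition condl : seq cset := [seq P <- undup (fac L (principal L al)) | ~~ pb (P N0%:R) && (ve L P al %% n == 1)%N].

Lemma condlP P : P \in condl <-> [/\ prime_ideal L P, ~ P N0%:R & (ve L P al = 1 %[mod n])%N].
Proof.
have nal := principal_nz fL Oal al0; have [pf _] := facP DL nal.
rewrite mem_filter mem_undup (modn_small n1); split.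
  by move=> /andP[/andP[/pbP PN /eqP v1] Pf]; split => //; apply: pf.
move=> [pP PN v1]; apply/andP; split; first by apply/andP; split; [apply/pbP | rewrite v1].
rewrite -has_pred1 has_count -/(vI L P _) -/(ve L P al) lt0n; apply/eqP => E.
by move: v1; rewrite E mod0n.
Qed.

Lemma kummer_tau i : tau i al = reso n z sg (e i) u0 ^+ n.
Proof.
case: (T) => _ _ _ tF tz; have [k [kn Hk]] := reso_act pz sgK cls sgn (tF i) (tz i).
have Ku0 : K u0 by case: Ou0.
have := Hk 1%N u0 Ku0; rewrite !mul1n => <-.
by rewrite exprMn -exprM (mulnC _ n) exprM (prim_expr_order pz) expr1n mulr1 rmorphXn.
Qed.

(** By [kummer_tau] the conjugate of the Kummer generator is the n-th power of the resolvent of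
    index e_i, to which [reso_ve] applies. *)
Lemma ve_tau P i : prime_ideal L P -> (ve L P (tau i al) = e i * ve L P al %[mod n])%N.
Proof.
move=> pP; have ei := ltn_ord (e i).
have yi : reso n z sg (e i) u0 != 0.
  by apply: contraNneq al0 => E; rewrite -(fmorph_eq0 (tau i)) kummer_tau E expr0n eqn0Ngt n0.
have [l] := reso_ve DL DM FL KM LM n1 pz Lz sgK cls sgn Ou0 y0 pP Ou0 yi (ltnW ei).
rewrite -kummer_tau -/al mulnBl => El; apply/eqP; rewrite -(eqn_modDr (n * ve L P al - e i * ve L P al)) El.
by rewrite subnKC ?leq_mul2r ?(ltnW ei) ?orbT // !modnMr.
Qed.

(** For a class-1 prime P the valuation of the Kummer generator at tau_i P is the inverse of e_i
    modulo n, so this prime determines i. *)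
Lemma condl_disj P P' i j : P \in condl -> P' \in condl -> imI (tau i) P = imI (tau j) P' -> i = j /\ P = P'.
Proof.
move=> /condlP[pP _ v1] /condlP[pP' _ v1'] E.
have pQ := imI_prime DL (tL i) pP; have ij : i = j.
  have h1 := ve_tau i pQ; rewrite (imI_ve DL (tL i) pP Oal al0) v1 in h1.
  have h2 := ve_tau j pQ; rewrite {1}E (imI_ve DL (tL j) pP' Oal al0) v1' in h2.
  case: T => ie _ _ _ _; apply: ie; apply: val_inj => /=.
  rewrite -(modn_small (ltn_ord (e i))) -(modn_small (ltn_ord (e j))).
  set v := ve L _ al in h1 h2.
  have e1 : (e i * (e j * v) = e i %[mod n])%N by rewrite -modnMmr -h2 modnMmr muln1.
  have e2 : (e j * (e i * v) = e j %[mod n])%N by rewrite -modnMmr -h1 modnMmr muln1.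
  by rewrite -e1 -e2 mulnCA.
by split => //; apply: (@imI_inj (tau i)); rewrite E ij.
Qed.

Lemma condl_contract P : P \in condl -> prime_ideal F (contract F P) /\ ~ contract F P N0%:R.
Proof. by move=> /condlP[pP PN _]; split; [exact: (contract_prime DF DL FL pP) | case]. Qed.

Lemma contract_Nz P : P \in condl -> ~ contract F P (Nz z sL tau)%:R.
Proof.
move=> Pc [_ h]; have /condlP[pP PN _] := Pc; apply: PN; rewrite natrM.
by apply: (idmul (primeP_id pP)) => //; exact: OK_nat.
Qed.

(** All conjugates tau_i P of the class-1 primes over R are distinct and divide R O_L; hence the
    phi(n)-th power of the product of norms is at most N(R O_L) <= N(R)^phi(n). *)
Lemma condl_class R : R \in map (contract F) condl -> (\prod_(P <- condl | contract F P == R) normI L P <= normI F R)%N.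
Proof.
move=> /mapP[P0 P0c ER]; have [pR _] := condl_contract P0c; have RN := contract_Nz P0c; rewrite -ER in pR RN.
rewrite -big_filter; set S := [seq P <- condl | contract F P == R].
have SP P : P \in S -> P \in condl /\ contract F P = R by rewrite mem_filter => /andP[/eqP ? ?].
have [c0 c0n] : exists c, (0 < c)%N /\ c = totient n by exists (totient n); rewrite totient_gt0.
rewrite -(@leq_exp2r _ _ (totient n)) ?totient_gt0 //.
apply: leq_trans (normI_ext_le DF DL FL pz Lz agr T pR RN).
pose l := [seq imI (tau i) P | i <- enum 'I_(totient n), P <- S].
have <- : (\prod_(P <- l) normI L P = (\prod_(P <- S) normI L P) ^ totient n)%N.
  rewrite /l big_allpairs_dep big_enum /= -[in RHS](card_ord (totient n)) -prod_nat_const.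
  apply: eq_big => // i _; rewrite [RHS]big_seq [LHS]big_seq; apply: eq_bigr => P /SP[/condlP[pP _ _] _].
  exact: (imI_normI DL (tL i) (primeP_nz pP)).
apply: (uniq_normI_le DL).
- by move=> Q /allpairsP[[i P] /= [_ /SP[/condlP[pP _ _] _] ->]]; apply: (imI_prime DL (tL i)).
- apply: allpairs_uniq; first exact: enum_uniq.
    by rewrite filter_uniq // filter_uniq // undup_uniq.
  move=> [i P] [j P'] /allpairsP[[i' Q] /= [_ /SP[QS _] [-> ->]]] /allpairsP[[j' Q'] /= [_ /SP[QS' _] [-> ->]]] /=.
  by move=> E; have [-> ->] := condl_disj QS QS' E.
- exact: (ext_nz DF DL FL (primeP_nz pR)).
move=> Q /allpairsP[[i P] /= [_ /SP[/condlP[pP _ _] EP] ->]].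
apply: (ext_min DL (imI_id DL (tL i) (primeP_id pP))) => x Rx.
case: (T) => _ _ _ tF _; have Fx : F x by case: (idsub (primeP_id pR) Rx).
by rewrite -(tF i x Fx); apply/imI_mem; rewrite -EP in Rx; case: Rx.
Qed.

(** A class-1 prime lies over a prime R of F that is ramified by [unram_kummer], hence totally
    ramified by the hypothesis on K. By [condl_class] the class-1 norms over R multiply to at most
    N(R), which is at most the norm of the prime of K above R, and [disc_bound] applies. *)
Lemma cond_bound : ((\prod_(P <- condl) normI L P) ^ n.-1)%:R <= n%:R ^+ dK * `|\det (\matrix_(i, j) sK i (wK j))| ^+ 2 :> algC.
Proof.
pose Rs := undup (map (contract F) condl).
have RsP R : R \in Rs -> exists2 P, P \in condl & R = contract F P by rewrite mem_undup => /mapP.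
have hQ R : exists Q, R \in Rs -> prime_ideal K Q /\ ext_ideal K R = ipow K Q n.
  case RR : (R \in Rs); last by exists (OK K).
  have [P Pc ER] := RsP R RR; have [pR RN] := condl_contract Pc; rewrite -ER in pR RN.
  have /condlP[pP _ v1] := Pc.
  case: (hT pR) => [[J [hJ /cset_ext EJ]]|un|[Q [pQ /cset_ext EQ]]].
  - case: RN; rewrite natrM; apply: (idmulr (primeP_id pR)); first exact: OK_nat.
    have := principal_mem fF n%:R; rewrite EJ; exact: (iprod_subl fF (primeP_id pR) hJ).
  - case: (@unram_kummer F K L M n z sg _ _ _ DF _ _ _ DK _ _ _ DL _ _ _ DM FK FL KM LM n1 pz Lz sgF sgK sgneq cls sgn u0 Ou0 y0 P pP).
      by rewrite /dvdn -/al v1 (modn_small n1).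
    by rewrite -ER.
  by exists Q.
have [Qs HQs] := choice_fun hQ.
have pRs R : R \in Rs -> prime_ideal F R by move=> /RsP[P /condl_contract[pR _] ->].
apply: le_trans (disc_bound DF DK FK n1 sgF sgK cls sgn (undup_uniq _) pRs HQs).
rewrite ler_nat leq_exp2r; last by rewrite -subn1 subn_gt0.
apply: leq_trans (prod_classes condl_class) _.
rewrite (normI_prodI DK); last by move=> Q /mapP[R RR ->]; case: (HQs R RR).
rewrite big_map !big_seq; apply: leq_prod => R RR.
have [pQ EQ] := HQs R RR.
apply: (@idx_le _ _ (OK F) R (OK K) (Qs R) _ _ id (id_addcl fK (primeP_id pQ)) (normIP DF (primeP_nz (pRs R RR))) (normIP DK (primeP_nz pQ))).
  by move=> x; exact: (ext_OK FK).
move=> x y [Fx _] [Fy _]; apply: (Qs_contract DF DK FK n1 pRs HQs RR); exact: sfB.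
Qed.
End Conductor.

(** * Finiteness modulo n-th powers, and the codes of the fields *)

Section Reduce.
Variables (K : cset) (d : nat) (s : 'I_d -> aut) (w : 'I_d -> algC) (D : nfdata K s w).
Let sK := nfdata_sub D.
Let W := \matrix_(i, j) s i (w j).

Lemma coord_bound : exists C : nat, forall (v : 'rV[int]_d) (B : nat), (forall i, `|s i (ev w v)| <= B%:R) -> forall j, (`|v ord0 j| <= C * B)%N.
Proof.
have uW : W \in unitmx by case: D => _ _ _ dW _; rewrite unitmxE unitfE.
have [C [_ hC]] := norm_ub (fun j => \sum_i `|invmx W j i|); exists C => v B hB j.
have E : W *m (\col_k (v 0 k)%:~R) = \col_i s i (ev w v).
  by apply/matrixP => i k; rewrite !mxE sEv; apply: eq_bigr => l _; rewrite !mxE mulrC.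
have := congr1 (fun A : 'cV_d => (invmx W *m A) j 0) E; rewrite mulKmx // !mxE => Ej.
rewrite -(ler_nat algC) -[X in X <= _](_ : `|(v 0 j)%:~R| = _); last by rewrite -intr_norm -abszE.
rewrite Ej; apply: le_trans (ler_norm_sum _ _ _) _.
apply: le_trans (_ : (\sum_i `|invmx W j i|) * B%:R <= _).
  rewrite mulr_suml; apply: ler_sum => i _; rewrite !mxE normrM ler_wpM2l //.
by rewrite natrM ler_wpM2r ?ler0n //; have := hC j; rewrite ger0_norm // sumr_ge0.
Qed.

Definition box (A : nat) : seq algC := [seq ev w (\row_j ((f j)%:Z - A%:Z)) | f : {ffun 'I_d -> 'I_(A + A).+1}].
Lemma size_box A : size (box A) = ((A + A).+1 ^ d)%N.
Proof. by rewrite size_map -cardE card_ffun !card_ord. Qed.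
Lemma box_OK A x : x \in box A -> OK K x.
Proof. by move=> /mapP[f _ ->]; exact: (evK D). Qed.
Lemma mem_box A (v : 'rV[int]_d) : (forall j, (`|v ord0 j| <= A)%N) -> ev w v \in box A.
Proof.
move=> h; have hb j : (`|(v ord0 j + A%:Z)%R| < (A + A).+1)%N by rewrite ltnS; have := h j; lia.
apply/mapP; exists [ffun j => Ordinal (hb j)]; first by rewrite mem_enum.
congr (ev w _); apply/rowP => j; rewrite mxE ffunE /=; have := h j.
have -> : v 0 j = v ord0 j by congr (v _ j); apply: val_inj.
by move: (v ord0 j) => t; lia.
Qed.

Lemma northcott (B : nat) : exists Bs : seq algC, forall x, OK K x -> (forall i, `|s i x| <= B%:R) -> x \in Bs.
Proof.
have [C HC] := coord_bound; exists (box (C * B)) => x /(OK_ev D)[v ->] h; apply: mem_box; exact: HC.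
Qed.

Lemma nth_split n I : (0 < n)%N -> nonzero_ideal K I -> exists b f, [/\ nonzero_ideal K b, nonzero_ideal K f, I = iprod (ipow K b n) f &
  forall P, prime_ideal K P -> vI K P f = (vI K P I %% n)%N].
Proof.
move=> n0; move: {2}(normI K I) (leqnn (normI K I)) => N; elim: N I => [|N IH] I le nI.
  by move: le; rewrite leqNgt (normI_gt0 D).
case: (classic (exists2 P, prime_ideal K P & (n <= vI K P I)%N)) => [[P pP nv]|h].
  have nPn := ipow_nz D n (primeP_nz pP).
  have [I' [hI' EI]] := ideal_dvd D nPn nI.1 ((vI_ge D n pP nI).1 nv).
  have nI' := nz_factor D nI EI nPn.1 hI'.
  have vPn Q : vI K Q (ipow K P n) = (n * vI K Q P)%N by rewrite (vI_pow D _ _ (primeP_nz pP)).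
  have [|b [f [nb nf Ef hf]]] := IH I' _ nI'.
    rewrite -ltnS; apply: leq_trans le; rewrite EI (normIM D nPn nI') ltn_Pmull ?(normI_gt0 D) //.
    case: (n) n0 => // k _; rewrite /ipow iterS -/(ipow K P k) (normIM D (primeP_nz pP) (ipow_nz D k (primeP_nz pP))).
    by apply: leq_trans (pideal_gt1 D pP) _; rewrite leq_pmulr // (normI_gt0 D (ipow_nz D k (primeP_nz pP))).
  exists (iprod P b), f; split => //; first by apply: nz_iprod => //; exact: primeP_nz.
    rewrite EI Ef (ipowM D n (primeP_id pP) nb.1) (iprodAK sK nPn.1) //; [exact: (ipow_nz D n nb).1 | exact: nf.1].
  by move=> Q pQ; rewrite hf // EI (vIM D _ nPn nI') vPn mulnC modnMDl.
exists (OK K), I; split => //; first exact: nz_OK.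
  have -> : ipow K (OK K) n = OK K.
    by elim: (n) => [//|k IHk]; rewrite /ipow iterS -/(ipow K _ k) IHk OK_iprod //; exact: OK_ideal.
  by rewrite OK_iprod //; exact: nI.1.
move=> P pP; rewrite modn_small // ltnNge; apply/negP => nv; apply: h; by exists P.
Qed.

Lemma vI_le_dvd I J : nonzero_ideal K I -> nonzero_ideal K J -> (forall P, prime_ideal K P -> (vI K P I <= vI K P J)%N) ->
  exists A, nonzero_ideal K A /\ J = iprod I A.
Proof.
move=> nI nJ; have [l pl ->] := uf_exists D nI; elim: l pl J nJ => [|P l IH] pl J nJ h.
  by exists J; split => //; rewrite OK_iprod //; exact: nJ.1.
have [pP pl'] := (primes_cons _ _ _).1 pl; have nl := prodI_nz D pl'.
have : (0 < vI K P J)%N by apply: leq_trans (h P pP); rewrite (vI_prodI D _ pl) /= eqxx.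
move/(vI_gt0 D pP nJ) => JP; have [J' [hJ' EJ]] := ideal_dvd D (primeP_nz pP) nJ.1 JP.
have nJ' := nz_factor D nJ EJ (primeP_id pP) hJ'.
have [|A [nA EA]] := IH pl' J' nJ'.
  move=> Q pQ; have := h Q pQ; rewrite (vI_prodI D _ pl) (vI_prodI D _ pl') EJ (vIM D _ (primeP_nz pP) nJ') /=.
  case: eqP => [->|ne]; first by rewrite (vI_P D pQ) leq_add2l.
  by rewrite (vI_prime_neq D pP) ?add0n // => E; apply: ne.
by exists A; split => //=; rewrite EJ EA (iprodAK sK (primeP_id pP) nl.1 nA.1).
Qed.

(** Elements whose ideal is an n-th power away from H fall into finitely many classes modulo n-th
    powers. The ideal of [a] is b^n f with f dividing H^n, and Minkowski in an ideal b' with b b' =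
    (c) yields y such that a y^n / c^n is an integer with bounded conjugates, to which [northcott]
    applies. *)
Lemma nth_reduce n H : (0 < n)%N -> (0 < H)%N -> exists Bs : seq algC, (forall b, b \in Bs -> OK K b /\ b != 0) /\
  forall a, OK K a -> a != 0 -> (forall P, prime_ideal K P -> ~ P H%:R -> (n %| ve K P a)%N) ->
  exists y c b, [/\ OK K y, y != 0, OK K c, c != 0 & b \in Bs /\ a * y ^+ n = b * c ^+ n].
Proof.
move=> n0 H0; pose rD := (Num.truncn `|\det W|).+1.
have hrD : `|\det W| <= rD%:R := trunc_ub (normr_ge0 _).
(* Large enough for Minkowski whatever f may be, since N(f) <= H^(n d). *)
pose h := (minkC d * H ^ (n * d) * rD)%N.
have h0 : (0 < h)%N by rewrite !muln_gt0 expn_gt0 H0.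
have d0 := qdata_pos (nfdata_qdata D).
have [Bs hBs] := northcott (h ^ n).
exists [seq b <- Bs | pb (OK K b /\ b != 0)]; split; first by move=> b; rewrite mem_filter => /andP[/pbP].
move=> a Oa a0 hP; have na := principal_nz sK Oa a0.
have [b [f [nb nf Ea hf]]] := nth_split n0 na.
have [b' [c [nb' c0 Ec]]] := ideal_inv D nb.
have nHn := principal_nz sK (OK_nat (H ^ n) sK) (_ : (H ^ n)%:R != 0).
have {}nHn : nonzero_ideal K (principal K (H ^ n)%:R) by apply: nHn; rewrite pnatr_eq0 -lt0n expn_gt0 H0.
have fle : (normI K f <= H ^ (n * d))%N.
  have [|A [nA EA]] := vI_le_dvd nf nHn.
    move=> P pP; rewrite hf //; case: (classic (P H%:R)) => [PH|PH]; last first.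
      by have /eqP := hP P pP PH; rewrite /ve => ->.
    apply: leq_trans (ltnW (ltn_pmod _ n0)) _.
    have H0' : H%:R != 0 :> algC by rewrite pnatr_eq0 -lt0n.
    rewrite -/(ve K P (H ^ n)%:R) natrX (veX D P n (OK_nat H sK) H0') leq_pmulr //.
    by apply/(ve_gt0 D pP (OK_nat H sK) H0').
  have := normI_nat D (_ : 0 < H ^ n)%N; rewrite expn_gt0 H0 => /(_ isT).
  by rewrite EA (normIM D nf nA) -expnM => <-; rewrite leq_pmulr // (normI_gt0 D).
(* Sides inversely proportional to the n-th roots of |s_v a| make every conjugate of a y^n / c^n at
   most h^n. *)
pose C v := c%:R * h%:R / n.-root `|s v a|.
have ra v : 0 < n.-root `|s v a| by rewrite rootC_gt0 // normr_gt0 fmorph_eq0.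
have C0 v : 0 < C v by rewrite divr_gt0 // mulr_gt0 // ltr0n.
have nmE : \prod_v `|s v a| = (normI K b ^ n * normI K f)%:R :> algC.
  rewrite -normr_prod -/(nm s a) -(nmnE D Oa) -(normI_principal D Oa a0) Ea (normIM D (ipow_nz D n nb) nf).
  congr (_ * _)%:R; elim: (n) => [|k IH]; first exact: (normI_OK D).
  by rewrite /ipow iterS -/(ipow K _ k) (normIM D nb (ipow_nz D k nb)) expnS IH.
have rootE : \prod_v n.-root `|s v a| <= (normI K b * normI K f)%:R.
  rewrite -(ler_pXn2r n0) ?nnegrE ?ler0n ?prodr_ge0 // => [|v _]; last exact: ltW.
  rewrite -prodrXl (eq_bigr (fun v => `|s v a|)); last by move=> v _; rewrite rootCK.
  rewrite nmE -natrX ler_nat expnMn leq_mul2l; apply/orP; right.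
  by rewrite -{1}[normI K f]expn1 leq_pexp2l // (normI_gt0 D).
have [||y [by' y0 hy]] := minkowski D nb' C0.
- by move=> i j hij; rewrite /C hij ?norm_conjC //; case: Oa.
- rewrite /C prodf_div !prodr_const card_ord.
  rewrite ler_pdivlMr; last by apply: prodr_gt0.
  apply: le_trans (_ : (minkC d)%:R * (normI K b')%:R * rD%:R * (normI K b * normI K f)%:R <= _).
    apply: ler_pM => //; [by rewrite !mulr_ge0 ?ler0n | by apply: prodr_ge0 => v _; exact: ltW|].
    by rewrite ler_wpM2l // mulr_ge0 ?ler0n.
  rewrite -[c%:R * h%:R]natrM -natrX -!natrM ler_nat expnMn.
  have -> : (c ^ d = normI K b * normI K b')%N by rewrite -(normI_nat D c0) -Ec (normIM D nb nb').
  have hd : (minkC d * normI K f * rD <= h ^ d)%N.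
    apply: leq_trans (_ : h <= _)%N; first by rewrite /h leq_mul2r leq_mul2l fle !orbT.
    by rewrite -{1}[h]expn1 leq_pexp2l.
  apply: leq_trans (leq_mul (leqnn (normI K b * normI K b')) hd).
  by rewrite !mulnA; apply: eq_leq; ring.
have Oy := idsub nb'.1 by'.
have [r [Or Er]] : principal K (c%:R ^+ n) (a * y ^+ n).
  rewrite -(ipow_principal D n (OK_nat c sK)) -Ec (ipowM D n nb.1 nb'.1); apply: iprod_mul; last exact: (ipow_mem D).
  by have := principal_mem sK a; rewrite Ea; apply: (iprod_subl sK); [exact: (ipow_nz D n nb).1 | exact: nf.1].
have cn0 : c%:R != 0 :> algC by rewrite pnatr_eq0 -lt0n.
have r0 : r != 0 by apply: contraNneq (mulf_neq0 a0 (expf_neq0 n y0)) => r0; rewrite Er r0 mulr0.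
exists y, c%:R, r; split => //; first exact: OK_nat.
split; last by rewrite Er mulrC.
rewrite mem_filter; apply/andP; split; first by apply/pbP.
apply: hBs => // v; have cpos : 0 < c%:R ^+ n :> algC by rewrite exprn_gt0 // ltr0n.
rewrite -(ler_pM2l cpos); apply: le_trans (_ : `|s v a| * `|s v y| ^+ n <= _).
  have := congr1 (fun x => `|s v x|) Er; rewrite !rmorphM !rmorphXn /= rmorph_nat !normrM !normrX normr_nat => ->.
  exact: lexx.
apply: le_trans (_ : `|s v a| * C v ^+ n <= _).
  by rewrite ler_wpM2l // lerXn2r ?nnegrE ?hy // ltW.
by rewrite /C expr_div_n rootCK // mulrC divfK ?normr_eq0 ?fmorph_eq0 // exprMn natrX.
Qed.
End Reduce.

(** Each such K lies in C = L(r), of degree at most n d, and is the fixed field in C of the set of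
    embeddings trivial on K. So there are no more fields than subsets of embeddings. *)
Lemma fields_of L n z (r : algC) d (s : 'I_d -> aut) w : nfdata L s w -> (0 < n)%N -> n.-primitive_root z -> L z -> L (r ^+ n) -> r != 0 ->
  exists Ks : seq cset, (size Ks <= 2 ^ (n * d))%N /\ forall K, number_field K ->
    (forall nu : aut, (forall x, L x -> nu x = x) -> nu r = r -> forall u, K u -> nu u = u) -> K \in Ks.
Proof.
move=> D n0 pz Lz Lr r0; have nL : number_field L.
  split; first by case: D.
  have Dq := nfdata_qdata D; exists d, w; split; first by case: Dq.
  split; first by apply/indep_rat; apply: qdata_indep Dq.
  case: Dq => _ _ sp _ _ x /sp[c ->]; exists (fun i => ratr (c i)); split => // i; exact: Crat_rat.
have [C [nC LC rC agr]] := compositum nL (nf_Qadj r).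
have Cr : C r by apply: rC; exact: Qadj_self.
have agr' (nu mu : aut) : (forall x, L x -> nu x = mu x) -> nu r = mu r -> forall x, C x -> nu x = mu x.
  by move=> h1 h2; apply: agr => // x; apply: Qadj_agree.
have [e [t [v DC]]] := nfdata_exists nC.
have le_e : (e <= n * d)%N.
  have [g Hg] : exists g : 'I_e -> 'I_n * 'I_d, forall i, (forall x, L x -> t i x = s (g i).2 x) /\ t i r = n.-root (s (g i).2 (r ^+ n)) * z ^+ (g i).1.
    apply: (choice_ord (P := fun i (p : 'I_n * 'I_d) => (forall x, L x -> t i x = s p.2 x) /\ t i r = n.-root (s p.2 (r ^+ n)) * z ^+ p.1)) => i.
    have [j Hj] := (let: And5 _ _ _ _ h := D in h) (t i).
    have q0 : n.-root (s j (r ^+ n)) != 0 by rewrite rootC_eq0 // fmorph_eq0 expf_neq0.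
    have [|k Ek] := prim_rootP pz (x := t i r / n.-root (s j (r ^+ n))).
      by rewrite expr_div_n rootCK // -rmorphXn /= Hj // divff // fmorph_eq0 expf_neq0.
    by exists (k, j); split => //=; rewrite -Ek mulrC divfK.
  have gI : injective g.
    move=> i j Eij; apply: (qdata_inj (nfdata_qdata DC)); apply: agr' => [x Lx|].
      by have [h2 _] := Hg i; have [h3 _] := Hg j; rewrite h2 // h3 // Eij.
    by have [_ ->] := Hg i; have [_ ->] := Hg j; rewrite Eij.
  by have := leq_card g gI; rewrite card_prod !card_ord.
pose fld (S : {set 'I_e}) : cset := fun y => C y /\ forall i, i \in S -> t i y = y.
exists [seq fld SS | SS : {set 'I_e}]; split.
  by rewrite size_map -cardE -cardsT -powersetT card_powerset cardsT card_ord leq_exp2l.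
move=> K nK hK; pose S := [set i | pb (forall u, K u -> t i u = u)].
have -> : K = fld S.
  apply: cset_ext => y; split.
    move=> Ky; split; last by move=> i; rewrite inE => /pbP; apply.
    apply: (fixed_mem (nfdata_qdata DC)) => nu nuC; apply: (hK nu) => //; last exact: nuC.
    by move=> x Lx; apply: nuC; exact: LC.
  move=> [Cy hy]; have [e' [t' [v' DK]]] := nfdata_exists nK.
  apply: (fixed_mem (nfdata_qdata DK)) => nu nuK.
  have [i Hi] := (let: And5 _ _ _ _ h := DC in h) nu; rewrite Hi //; apply: hy; rewrite inE; apply/pbP => u Ku.
  rewrite -Hi ?nuK //; apply: (fixed_mem (nfdata_qdata DC)) => mu muC; apply: (hK mu) => //; last exact: muC.
  by move=> x Lx; apply: muC; exact: LC.
by apply: map_f; rewrite mem_enum.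
Qed.

Lemma ve_prod K d (s : 'I_d -> aut) w (D : nfdata K s w) P r (f : 'I_r -> algC) : (forall i, OK K (f i)) -> (forall i, f i != 0) ->
  ve K P (\prod_i f i) = (\sum_i ve K P (f i))%N.
Proof.
have sK : is_subfield K by case: D.
move=> Of f0; suff H (l : seq 'I_r) : [/\ OK K (\prod_(i <- l) f i), \prod_(i <- l) f i != 0 & ve K P (\prod_(i <- l) f i) = (\sum_(i <- l) ve K P (f i))%N].
  by have [_ _] := H (index_enum 'I_r).
elim: l => [|i l [O1 n1 E1]]; first by rewrite !big_nil; split; [exact: OK1 | exact: oner_neq0 | rewrite /ve principal1 (vI_OK D)].
rewrite !big_cons; split; [exact: OK_mul | exact: mulf_neq0 |].
by rewrite (veM D P (Of i) O1 (f0 i) n1) E1.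
Qed.

Lemma vI_norm_mem K d (s : 'I_d -> aut) w (D : nfdata K s w) Q I : prime_ideal K Q -> nonzero_ideal K I -> (0 < vI K Q I)%N -> Q (normI K I)%:R.
Proof.
have sK : is_subfield K by case: D.
move=> pQ nI v0; have [p pp Qp] := prime_char D pQ.
have dv J A : nonzero_ideal K J -> is_ideal K A -> nonzero_ideal K (iprod J A) -> (normI K J %| normI K (iprod J A))%N.
  move=> nJ hA nJA; rewrite (normIM D nJ (nz_factor D nJA erefl nJ.1 hA)) dvdn_mulr //.
have [J [hJ EJ]] := ideal_dvd D (primeP_nz pQ) nI.1 ((vI_gt0 D pQ nI).1 v0).
have d1 : (normI K Q %| normI K I)%N by rewrite EJ dv // ?EJ -?EJ //; exact: primeP_nz.
have np := nat_nz D (prime_gt0 pp).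
have [J2 [hJ2 EJ2]] := ideal_dvd D (primeP_nz pQ) np.1 (fun x => @principal_sub K Q p%:R x (primeP_id pQ) Qp).
have d2 : (normI K Q %| p ^ d)%N by rewrite -(normI_nat D (prime_gt0 pp)) EJ2 dv // -?EJ2 //; exact: primeP_nz.
have := pideal_gt1 D pQ; have /(dvdn_pfactor _ _ pp)[k _ Ek] := d2; rewrite Ek.
case: k Ek => [|k Ek _]; first by rewrite expn0.
have /dvdnP[q Eq] : (p %| normI K I)%N by apply: dvdn_trans d1; rewrite Ek expnS dvdn_mulr.
by rewrite Eq natrM; apply: (idmul (primeP_id pQ)) => //; exact: OK_nat.
Qed.

(* Stickelberger-like element: tau_b Theta(x) is Theta(x)^b up to n-th powers, as for a Kummer generator of a field
   that is abelian over F. *)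
Definition Theta n (ie : 'I_(totient n) -> nat) (tau : 'I_(totient n) -> aut) x := \prod_i tau i x ^+ ie i.

Section Param.
Variables (F K L M : cset) (n : nat) (z : algC) (sg : aut).
Variables (dF : nat) (sF : 'I_dF -> aut) (wF : 'I_dF -> algC) (DF : nfdata F sF wF).
Variables (dK : nat) (sK : 'I_dK -> aut) (wK : 'I_dK -> algC) (DK : nfdata K sK wK).
Variables (dL : nat) (sL : 'I_dL -> aut) (wL : 'I_dL -> algC) (DL : nfdata L sL wL).
Variables (dM : nat) (sM : 'I_dM -> aut) (wM : 'I_dM -> algC) (DM : nfdata M sM wM).
Hypotheses (FK : Defs.subset F K) (FL : Defs.subset F L) (KM : Defs.subset K M) (LM : Defs.subset L M).
Hypotheses (n1 : (1 < n)%N) (pz : n.-primitive_root z) (Lz : L z).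
Hypotheses (sgF : forall x, F x -> sg x = x) (sgK : forall x, K x -> K (sg x)).
Hypothesis sgneq : powers_distinct K n sg.
Hypothesis cls : powers_exhaust F K n sg.
Hypothesis sgn : forall x, K x -> autX sg n x = x.
Let fF := nfdata_sub DF.
Let fK := nfdata_sub DK.
Let fL := nfdata_sub DL.
Let fM := nfdata_sub DM.
Let n0 : (0 < n)%N. Proof. exact: ltnW. Qed.
Hypothesis agr : generated_over F L z.
Variables (e : 'I_(totient n) -> 'I_n) (tau : 'I_(totient n) -> aut).
Hypothesis T : tau_data F z e tau.
Variable u0 : algC.
Hypotheses (Ou0 : OK K u0) (y0 : reso n z sg 1 u0 != 0).
Hypothesis hT : unram_or_total F K n.
Variable ie : 'I_(totient n) -> nat.
Hypothesis hie : forall i, (ie i * e i = 1 %[mod n])%N.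
Let al := kummer n z sg u0.
Let Oal : OK L al := kummer_OK DL DM FL KM LM n1 pz Lz sgK cls sgn Ou0.
Let al0 : al != 0 := kummer_neq0 y0.
Let N0 := (n * Nz z sL tau)%N.
Let tL i x : L x -> L (tau i x). Proof. exact: (tau_L DL FL Lz agr T). Qed.
Let cl := condl L z sg sL tau u0.
Let clP P : P \in cl <-> [/\ prime_ideal L P, ~ P N0%:R & (ve L P al = 1 %[mod n])%N].
Proof. exact: (condlP DL DM FL KM LM n1 pz Lz sgK cls sgn tau Ou0 y0). Qed.
Variable rL : nat.
Hypotheses (rL0 : (0 < rL)%N) (hrL : `|\det (\matrix_(i, j) sL i (wL j))| <= rL%:R).

Lemma Theta_OK x : OK L x -> OK L (Theta ie tau x).
Proof.
move=> Ox; apply: (big_ind (OK L)) => [|a b Oa Ob|i _]; [exact: OK1 | exact: OK_mul|].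
by apply: (OK_X DL); exact: (nu_OK (tL i)).
Qed.
Lemma Theta_neq0 x : x != 0 -> Theta ie tau x != 0.
Proof. by move=> x0; apply/prodf_neq0 => i _; rewrite expf_neq0 // fmorph_eq0. Qed.

(** This is where the condition defining the family enters: a tame prime at which the valuation is
    not 0 modulo n is ramified, hence totally ramified, and [totram_kummer] makes the valuation a
    unit modulo n. *)
Lemma kummer_class P : prime_ideal L P -> ~ P N0%:R -> ~ (n %| ve L P al)%N -> exists i, (e i * ve L P al = 1 %[mod n])%N.
Proof.
move=> pP PN nv; have pR := contract_prime DF DL FL pP.
have Pn : ~ P n%:R by move=> h; apply: PN; rewrite natrM; apply: (idmulr (primeP_id pP)) => //; exact: OK_nat.
have PNz : ~ P (Nz z sL tau)%:R by move=> h; apply: PN; rewrite natrM; apply: (idmul (primeP_id pP)) => //; exact: OK_nat.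
have vR := ext_unram DF DL FL pz Lz agr T pP PNz.
case: (hT pR) => [[J [hJ /cset_ext EJ]]|un|tr].
- case: Pn; have := principal_mem fF n%:R; rewrite EJ => /(iprod_subl fF (primeP_id pR) hJ); by case.
- by case: (unram_kummer DF DK DL DM FK FL KM LM n1 pz Lz sgF sgK sgneq cls sgn Ou0 y0 pP nv).
have [b Hb] := totram_kummer DF DK DL DM FK FL KM LM n1 pz Lz sgF sgK cls sgn Ou0 y0 pP Pn vR tr.
have cb : coprime (b %% n) n.
  rewrite coprime_modl /coprime -dvdn1.
  have : (gcdn b n %| b * ve L P al)%N by apply: dvdn_mulr; exact: dvdn_gcdl.
  by rewrite (divn_eq (b * ve L P al) n) Hb (modn_small n1) dvdn_addr // dvdn_mull // dvdn_gcdr.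
case: (T) => _ _ ecov _ _; have [|i Ei] := ecov (Ordinal (ltn_pmod b n0)); first exact: cb.
by exists i; rewrite Ei /= modnMml.
Qed.

(* Minkowski in the ideal of ramified primes of class 1: the ideal of al * Theta(x)^(n-1) is an n-th power outside a
   fixed finite set of primes, while x has size about D^(1/((n-1) d_L)). *)
Lemma param : exists x (h : nat), [/\ OK L x, x != 0, forall i, `|sL i x| <= h%:R,
   (h ^ dL <= 2 ^ dL * (minkC dL * rL) * \prod_(P <- cl) normI L P)%N &
   forall P, prime_ideal L P -> ~ P (N0 * (2 ^ dL * (minkC dL * rL))`!)%:R -> (n %| ve L P (al * Theta ie tau x ^+ n.-1)%R)%N].
Proof.
set CH := (2 ^ dL * (minkC dL * rL))%N; have d0 := qdata_pos (nfdata_qdata DL).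
have pcl : primes_of L cl by move=> P /clP[].
have ncl := prodI_nz DL pcl; have Ncl := normI_prodI DL pcl.
have Nc0 : (0 < \prod_(P <- cl) normI L P)%N by rewrite -Ncl (normI_gt0 DL).
have [|h [h0 hb hb1 hb2]] := @root_ceil dL (minkC dL * rL * \prod_(P <- cl) normI L P) d0.
  by rewrite !muln_gt0 rL0.
have [|||x [gx x0 hx]] := @minkowski L dL sL wL DL (prodI L cl) (fun _ => h%:R) ncl.
- by move=> i; rewrite ltr0n.
- by [].
- rewrite prodr_const card_ord Ncl; apply: le_trans (_ : (minkC dL * rL * \prod_(P <- cl) normI L P)%:R <= _).
    by rewrite !natrM mulrAC ler_wpM2r ?ler0n // ler_wpM2l ?ler0n.
  by rewrite -natrX ler_nat.
have Ox := idsub ncl.1 gx.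
have [|hh [hhh Ehh]] := ideal_dvd DL ncl (principal_ideal fL Ox); first by move=> y; apply: principal_sub => //; exact: ncl.1.
have nx := principal_nz fL Ox x0; have nhh := nz_factor DL nx Ehh ncl.1 hhh.
have Nhh : (normI L hh <= CH)%N.
  rewrite -(leq_pmul2l Nc0) -{1}Ncl -(normIM DL ncl nhh) -Ehh (normI_principal DL Ox x0).
  rewrite mulnC /CH -mulnA; apply: leq_trans hb2.
  rewrite -(ler_nat algC) (nmnE DL Ox) normr_prod natrX -[h%:R ^+ dL](_ : \prod_(v < dL) h%:R = _); last by rewrite prodr_const card_ord.
  by apply: ler_prod => v _; rewrite normr_ge0 hx.
exists x, h; split => //; first by rewrite /CH -mulnA.
move=> P pP PH; have PN : ~ P N0%:R.
  by move=> h'; apply: PH; rewrite natrM; apply: (idmulr (primeP_id pP)) => //; exact: OK_nat.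
have PhN : ~ P (normI L hh)%:R.
  move=> h'; apply: PH; have /dvdnP[q ->] : (normI L hh %| CH`!)%N by apply: dvdn_fact; rewrite (normI_gt0 DL).
  by rewrite mulnA natrM; apply: (idmul (primeP_id pP)) => //; exact: OK_nat.
set v := ve L P al.
(* The valuation of tau_i x at P is that of x at Q = tau_i^(-1) P. The cofactor hh is prime to Q, as
   its norm divides CH!, so the value is 1 if Q is a class-1 prime and 0 otherwise. *)
have key i : ve L P (tau i x) = (e i * v == 1 %[mod n])%N.
  pose Q : cset := fun y => P (tau i y).
  have EQ : imI (aut_inv (tau i)) P = Q.
    apply: cset_ext => y; rewrite /imI /Q; suff -> : aut_inv (aut_inv (tau i)) y = tau i y by [].
    by rewrite -{1}(autK (tau i) y) autK.
  have pQ : prime_ideal L Q by rewrite -EQ; apply: (imI_prime DL (inv_K DL (tL i))).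
  have EP : imI (tau i) Q = P by apply: cset_ext => y; rewrite /imI /Q aut_invK.
  have v1 y : OK L y -> y != 0 -> ve L P (tau i y) = ve L Q y.
    by move=> Oy y00; rewrite -{1}EP (imI_ve DL (tL i) pQ).
  rewrite v1 // /ve Ehh (vIM DL Q ncl nhh) (vI_prodI DL Q pcl).
  have -> : vI L Q hh = 0%N.
    apply/eqP; rewrite -leqn0 leqNgt; apply/negP => /(vI_norm_mem DL pQ nhh); by rewrite /Q rmorph_nat.
  have hQ : (ve L Q al = e i * v %[mod n])%N.
    by rewrite -v1 // (ve_tau DL DM FL KM LM n1 pz Lz sgK cls sgn T Ou0 y0).
  rewrite addn0 count_uniq_mem; last by rewrite filter_uniq // undup_uniq.
  congr nat_of_bool; apply/idP/eqP => [/clP[_ _ <-] //|E]; apply/clP; split => //; last by rewrite hQ.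
  by rewrite /Q rmorph_nat.
have vT : ve L P (Theta ie tau x) = (\sum_i ie i * (e i * v == 1 %[mod n]))%N.
  rewrite (ve_prod DL) => [|i|i]; last 2 first.
  - by apply: (OK_X DL); exact: (nu_OK (tL i)).
  - by rewrite expf_neq0 // fmorph_eq0.
  by apply: eq_bigr => i _; rewrite (veX DL) ?key ?fmorph_eq0 //; exact: (nu_OK (tL i)).
have OT := Theta_OK Ox; have T0 := Theta_neq0 x0.
rewrite (veM DL P Oal (OK_X DL _ OT) al0 (expf_neq0 _ T0)) (veX DL P _ OT T0) vT -/v.
case: (classic (exists i, (e i * v = 1 %[mod n])%N)) => [[i Hi]|hn].
  have -> : (\sum_i ie i * (e i * v == 1 %[mod n]) = ie i)%N.
    rewrite (bigD1 i) //= Hi eqxx muln1 big1 ?addn0 // => j ji.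
    case: eqP => [Hj|_]; last by rewrite muln0.
    case/eqP: ji; case: (T) => ieq _ _ _ _; apply: ieq; apply: val_inj => /=.
    rewrite -(modn_small (ltn_ord (e i))) -(modn_small (ltn_ord (e j))).
    have e1 : (e i * (e j * v) = e i %[mod n])%N by rewrite -modnMmr Hj modnMmr muln1.
    have e2 : (e j * (e i * v) = e j %[mod n])%N by rewrite -modnMmr Hi modnMmr muln1.
    by rewrite -e1 -e2 mulnCA.
  have Ev : (v = ie i %[mod n])%N.
    have e1 : (ie i * (e i * v) = ie i %[mod n])%N by rewrite -modnMmr Hi modnMmr muln1.
    by rewrite -e1 mulnA -modnMml hie modnMml mul1n.
  (* The total valuation is v + (n - 1) ie_i, that is n ie_i modulo n. *)
  rewrite /dvdn -modnDml Ev modnDml -mulSn prednK // modnMr //.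
rewrite big1 ?muln0 ?addn0; last first.
  by move=> i _; case: eqP => [Hi|_]; [case: hn; exists i | rewrite muln0].
by apply: NNPP => nv; apply: hn; apply: kummer_class.
Qed.

(* The fields K attached to a fixed class Theta(x) beta all lie inside the field generated over L by one n-th root. *)
Lemma param_fixes x y c b r : OK L x -> x != 0 -> L y -> y != 0 -> L c -> c != 0 -> al * Theta ie tau x ^+ n.-1 * y ^+ n = b * c ^+ n ->
  r ^+ n = Theta ie tau x * b -> forall nu : aut, (forall u, L u -> nu u = u) -> nu r = r -> forall u, K u -> nu u = u.
Proof.
move=> Ox x0 Ly yn0 Lc c0 Eb Er nu nuL nur.
have T0 := Theta_neq0 x0; have [LT _] := Theta_OK Ox.
(* [r'] is an n-th root of Theta(x) b lying in L(y1), hence a root of unity times [r]; fixing L and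
   [r] thus fixes the resolvent y1. *)
pose y1 := reso n z sg 1 u0; pose r' := y1 * (Theta ie tau x * y / c).
have Er' : r' ^+ n = Theta ie tau x * b.
  rewrite /r' !exprMn exprVn; apply: (mulIf (expf_neq0 n c0)).
  rewrite -[RHS]mulrA -Eb; have -> : Theta ie tau x ^+ n = Theta ie tau x * Theta ie tau x ^+ n.-1 by rewrite -exprS prednK.
  rewrite /al /kummer -/y1; have cn0 := expf_neq0 n c0.
  by field.
have L0 : Theta ie tau x * y / c != 0 by rewrite !mulf_neq0 // invr_eq0.
have r'0 : r' != 0 by rewrite mulf_neq0.
have nur' : nu r' = r'.
  have r0 : r != 0 by apply: contraNneq (expf_neq0 n r'0) => r0; rewrite Er' -Er r0 expr0n eqn0Ngt n0.
  have [|k Ek] := prim_rootP pz (x := r' / r); first by rewrite expr_div_n Er' -Er divff // expf_neq0.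
  have -> : r' = r * z ^+ k by rewrite -Ek mulrC divfK.
  by rewrite rmorphM nur rmorphXn /= nuL.
have nuy : nu y1 = y1.
  apply: (mulIf L0); rewrite -/r' -[RHS]nur' /r' rmorphM /=; congr (_ * _); rewrite nuL //.
  by apply: (sfdiv fL) => //; apply: sfM.
move=> u Ku; have [N N0' ON] := OK_scale fK Ku.
have nb (b' : 'I_n) : nu (reso n z sg b' (N%:R * u)) = reso n z sg b' (N%:R * u).
  have [Lb _] := reso_prod_L DL DM FL KM LM pz Lz sgK cls sgn (ltnW (ltn_ord b')) ON Ou0.
  have y10 : y1 ^+ (n - b') != 0 by rewrite expf_neq0.
  by apply: (mulIf y10); rewrite -[RHS](nuL _ Lb) rmorphM rmorphXn /= -/y1 nuy.
have nN0 : (n * N)%:R != 0 :> algC by rewrite pnatr_eq0 -lt0n muln_gt0 n0.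
apply: (mulfI nN0); rewrite -[LHS](_ : nu ((n * N)%:R * u) = _); last by rewrite rmorphM rmorph_nat.
rewrite natrM -mulrA -(reso_sum sg n1 pz) rmorph_sum; apply: eq_bigr => b' _; exact: nb.
Qed.
End Param.

(** The factorisation of X^p - X over the field with p elements, lifted to the integers. It shows in
    [frob_nat] that an element fixed by Frobenius modulo a prime is congruent to a rational
    integer. *)
Lemma prod_X_nat (p : nat) (K : cset) (u : algC) : prime p -> is_subfield K -> OK K u ->
  exists2 c, OK K c & u ^+ p - u = \prod_(a < p) (u - a%:R) + p%:R * c.
Proof.
move=> pp sK Ou; pose q : {poly int} := 'X^p - 'X - \prod_(a < p) ('X - a%:R%:P).
have pc := pchar_Fp pp.
have q0 : map_poly (intr : int -> 'F_p) q = 0.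
  rewrite !rmorphB /= map_polyXn map_polyX rmorph_prod /=.
  have := finField_genPoly 'F_p; rewrite card_Fp // => ->; apply/eqP; rewrite subr_eq0; apply/eqP.
  have e0 := Fp_cast pp; pose h (a : 'I_p) : 'F_p := cast_ord (esym e0) a.
  rewrite (reindex h); last by exists (cast_ord e0) => x _; apply: val_inj.
  apply: eq_bigr => a _; rewrite rmorphB /= map_polyX map_polyC /=; congr (_ - _%:P).
  by rewrite rmorph_nat; apply: ord_inj; rewrite val_Fp_nat // modn_small.
have dv i : exists c : int, q`_i = p%:Z * c.
  have : (q`_i)%:~R = 0 :> 'F_p by have := congr1 (fun r : {poly 'F_p} => r`_i) q0; rewrite coef_map coef0.
  move/eqP; have [k [-> | ->]] : exists k : nat, q`_i = k%:Z \/ q`_i = - k%:Z.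
      case: (q`_i) => k; first by exists k; left.
      by exists k.+1; right; rewrite NegzE.
    rewrite -pmulrn -(dvdn_pcharf pc) => /dvdnP[c ->]; exists c%:Z; by rewrite PoszM mulrC.
  rewrite mulrNz oppr_eq0 -pmulrn -(dvdn_pcharf pc) => /dvdnP[c ->]; exists (- c%:Z); by rewrite PoszM mulrN mulrC.
have [c Hc] := choice_fun dv.
exists (\sum_(i < size q) (c i)%:~R * u ^+ i).
  apply: (id_sum _ sK (OK_ideal sK)) => i _; apply: OK_mul => //; first exact: OK_int.
  by elim: (nat_of_ord i) => [|k IH]; rewrite ?expr0 ?exprS; [exact: OK1 | exact: OK_mul].
have : (map_poly (intr : int -> algC) q).[u] = p%:R * \sum_(i < size q) (c i)%:~R * u ^+ i.
  rewrite (@horner_coef_wide _ (size q)); last exact: size_poly.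
  rewrite mulr_sumr; apply: eq_bigr => i _; rewrite coef_map /= Hc intrM mulrA; congr (_ * _ * _).
rewrite !rmorphB /= map_polyXn map_polyX rmorph_prod /= !hornerD !hornerN hornerXn hornerX horner_prod => E.
have Ep : \prod_(a < p) (u - a%:R) = \prod_(i < p) (map_poly intr ('X - (i%:R)%:P : {poly int})).[u].
  by apply: eq_bigr => a _; rewrite rmorphB /= map_polyX map_polyC /= !hornerE rmorph_nat.
by rewrite -E Ep [RHS]addrC subrK.
Qed.

(** * Primes of degree one that split in K *)

Section DegreeOne.
Variables (K : cset) (d : nat) (s : 'I_d -> aut) (w : 'I_d -> algC) (D : nfdata K s w).
Let sK := nfdata_sub D.
Variables (P : cset) (p : nat).
Hypotheses (pP : prime_ideal K P) (pp : prime p) (Pp : P p%:R).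
Let hP := primeP_id pP.
Let aP := id_addcl sK hP.

Lemma nat_inP a : P a%:R <-> (p %| a)%N.
Proof.
split; last by move=> /dvdnP[q ->]; rewrite natrM; apply: (idmul hP) => //; exact: OK_nat.
move=> Pa; apply: contraT; rewrite -prime_coprime // => cpa.
have [u v Euv _] := egcdnP a (prime_gt0 pp).
move: cpa; rewrite /coprime => /eqP cpa; rewrite cpa in Euv.
case: (pP.2.1); have -> : 1 = u%:R * p%:R - v%:R * a%:R :> algC.
  by rewrite -!natrM Euv natrD addrAC subrr add0r.
by apply: aP.2; apply: (idmul hP) => //; exact: OK_nat.
Qed.
Lemma modn_inP a b : (a = b %[mod p])%N -> P (a%:R - b%:R).
Proof.
move=> E; rewrite (divn_eq a p) (divn_eq b p) E !natrD !natrM.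
have -> : (a %/ p)%:R * p%:R + (b %% p)%:R - ((b %/ p)%:R * p%:R + (b %% p)%:R) = ((a %/ p)%:R - (b %/ p)%:R) * p%:R :> algC by ring.
by apply: (idmul hP) => //; apply: OK_sub => //; exact: OK_nat.
Qed.
Lemma frob_sum (T : Type) (r : seq T) (f : T -> algC) : (forall i, OK K (f i)) ->
  P ((\sum_(i <- r) f i) ^+ p - \sum_(i <- r) f i ^+ p).
Proof.
move=> Of; elim: r => [|i r IH]; first by rewrite !big_nil expr0n eqn0Ngt prime_gt0 // subrr; exact: aP.1.
have Os : OK K (\sum_(i <- r) f i) by apply: (id_sum _ sK (OK_ideal sK)).
rewrite !big_cons; have [c Oc ->] := binom_split sK pp (Of i) Os.
set S := \sum_(j <- r) f j in IH Os *; set S' := \sum_(j <- r) _ in IH *.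
have -> : f i ^+ p + S ^+ p + p%:R * (S * c) - (f i ^+ p + S') = (S ^+ p - S') + p%:R * (S * c) by ring.
by apply: (addclD aP) => //; apply: (idmulr hP) => //; apply: OK_mul.
Qed.
Lemma P_subX k x y : OK K x -> OK K y -> P (x - y) -> P (x ^+ k - y ^+ k).
Proof.
move=> Ox Oy h; rewrite subrXX; apply: (idmulr hP) => //; apply: (id_sum _ sK (OK_ideal sK)) => i _.
by apply: OK_mul => //; exact: (OK_X D).
Qed.
Lemma P_trans x y t : P (x - y) -> P (y - t) -> P (x - t).
Proof. by move=> h1 h2; have := addclD aP h1 h2; rewrite addrA subrK. Qed.
Lemma P_sym x y : P (x - y) -> P (y - x).
Proof. by move=> h; rewrite -opprB; exact: addclN. Qed.
Lemma P_cancel a x y : OK K a -> OK K x -> OK K y -> ~ P a -> P (a * x - a * y) -> P (x - y).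
Proof. by move=> Oa Ox Oy Pa; rewrite -mulrBr => /(pP.2.2 _ _ Oa (OK_sub sK Ox Oy))[]. Qed.
Lemma frob_nat x : OK K x -> P (x ^+ p - x) -> exists a : nat, P (x - a%:R).
Proof.
move=> Ox h; have [c Oc E] := prod_X_nat pp sK Ox.
have : P (\prod_(a < p) (x - a%:R)).
  have -> : \prod_(a < p) (x - a%:R) = x ^+ p - x - p%:R * c by rewrite E addrK.
  by apply: aP.2 => //; apply: (idmulr hP).
have Oxa (a : 'I_p) : OK K (x - a%:R) by apply: OK_sub => //; exact: OK_nat.
elim: (index_enum _) => [|a l IH]; first by rewrite big_nil => h1; case: (pP.2.1).
rewrite big_cons => /(pP.2.2 _ _ (Oxa a) _)[|h1|]; last exact: IH.
  by apply: (big_ind (OK K)) => [|x1 y1 O1 O2|i _]; [exact: OK1 | exact: OK_mul | exact: Oxa].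
by exists a.
Qed.

Hypothesis P1 : forall x, OK K x -> exists a : nat, P (x - a%:R).
Lemma frob_id x : OK K x -> P (x ^+ p - x).
Proof.
move=> Ox; have [a Pa] := P1 Ox; have Oa := OK_nat a sK.
apply: (P_trans (P_subX p Ox Oa Pa)); apply: P_trans (P_sym Pa).
by rewrite -natrX; apply: modn_inP; exact: fermat_little.
Qed.
Lemma fermatP x : OK K x -> ~ P x -> P (x ^+ p.-1 - 1).
Proof.
move=> Ox Px; apply: (P_cancel Ox (OK_X D _ Ox) (OK1 sK) Px).
by rewrite -exprS prednK ?prime_gt0 // mulr1; exact: frob_id.
Qed.
Lemma deg1_norm : normI K P = p.
Proof.
apply: normI_uniq; first exact: aP.
exists (fun i : 'I_p => (i : nat)%:R); split; first by move=> i; exact: OK_nat.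
  suff H (i j : 'I_p) : (i <= j)%N -> P (j%:R - i%:R) -> i = j.
    by move=> i j h; case: (leqP i j) => [|/ltnW] ij; [apply: H => //; exact: P_sym | symmetry; exact: H].
  move=> ij; rewrite -natrB // => /nat_inP dv; apply/val_inj/eqP; rewrite /= eqn_leq ij.
  rewrite -subn_eq0; apply/negPn/negP; rewrite -lt0n => gt; have := dvdn_leq gt dv.
  by rewrite leqNgt (leq_ltn_trans (leq_subr _ _)).
move=> x Ox; have [a Pa] := P1 Ox; exists (Ordinal (ltn_pmod a (prime_gt0 pp))) => /=.
by apply: (P_trans Pa); apply: modn_inP; rewrite modn_mod.
Qed.

Variables (n : nat) (z : algC).
Hypotheses (n1 : (1 < n)%N) (pz : n.-primitive_root z) (Kz : K z) (Pn : ~ P n%:R).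
Let n0 : (0 < n)%N := ltnW n1.
Lemma OKz k : OK K (z ^+ k).
Proof. split; first exact: sfX. apply: rpredX; apply: (@Aint_prim_root n); exact: pz. Qed.
(** If z^k were 1 modulo P, every term of n = sum_b (1 - z^(b k)) would lie in P. *)
Lemma zk_unit k : (0 < k < n)%N -> ~ P (z ^+ k - 1).
Proof.
move=> /andP[k0 kn] h; apply: Pn.
have -> : n%:R = \sum_(b < n) (1 - z ^+ (b * k)).
  by rewrite sumrB (root_sum pz) ?k0 // subr0 sumr_const card_ord.
apply: (id_sum _ sK hP) => b _; apply: P_sym; rewrite mulnC exprM -(expr1n _ b).
exact: (P_subX b (OKz k) (OK1 sK) h).
Qed.

Lemma p_mod_n : (n %| p.-1)%N.
Proof.
have Oz : OK K z by have := OKz 1; rewrite expr1.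
have Pz : ~ P z.
  by move=> h; apply: (pP.2.1); rewrite -(prim_expr_order pz); apply: (prime_X' D pP n0).
have h : P (z ^+ (p.-1 %% n) - 1).
  by have := fermatP Oz Pz; rewrite {1}(divn_eq p.-1 n) exprD mulnC exprM (prim_expr_order pz) expr1n mul1r.
rewrite /dvdn; apply: contraT; rewrite -lt0n => r0; case: (@zk_unit (p.-1 %% n)) => //.
by rewrite r0 ltn_mod.
Qed.

Definition kk := (p.-1 %/ n)%N.
Lemma kkn : (kk * n = p.-1)%N. Proof. by rewrite /kk divnK // p_mod_n. Qed.

Lemma chi_exists y : OK K y -> ~ P y -> exists i : 'I_n, P (y ^+ kk - z ^+ i).
Proof.
move=> Oy Py; have : P (\prod_(0 <= i < n) (y ^+ kk - z ^+ i)).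
  have := congr1 (fun q : {poly algC} => q.[y ^+ kk]) (factor_Xn_sub_1 pz).
  rewrite horner_prod hornerD hornerN hornerXn hornerC -exprM kkn => E.
  rewrite (eq_bigr (fun i => ('X - (z ^+ i)%:P).[y ^+ kk])) ?E; last by move=> i _; rewrite !hornerE.
  exact: fermatP.
rewrite big_mkord; have Of (i : 'I_n) : OK K (y ^+ kk - z ^+ i) by apply: OK_sub => //; [exact: (OK_X D) | exact: OKz].
elim: (index_enum _) => [|a l IH]; first by rewrite big_nil => h1; case: (pP.2.1).
rewrite big_cons => /(pP.2.2 _ _ (Of a) _)[|h1|]; last exact: IH.
  by apply: (big_ind (OK K)) => [|x1 y1 O1 O2|i _]; [exact: OK1 | exact: OK_mul | exact: Of].
by exists a.
Qed.

Lemma zk_inj (i j : 'I_n) : P (z ^+ i - z ^+ j) -> i = j.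
Proof.
suff H (i' j' : 'I_n) : (i' <= j')%N -> P (z ^+ j' - z ^+ i') -> i' = j'.
  by move=> h; case: (leqP i j) => [|/ltnW] ij; [apply: H => //; exact: P_sym | symmetry; exact: H].
move=> ij h; apply/val_inj/eqP; rewrite /= eqn_leq ij -subn_eq0; apply/negPn/negP; rewrite -lt0n => gt.
have lt : (0 < j' - i' < n)%N by rewrite gt (leq_ltn_trans (leq_subr _ _)).
have E : z ^+ j' - z ^+ i' = z ^+ i' * (z ^+ (j' - i') - 1) by rewrite mulrBr -exprD subnKC // mulr1.
move: h; rewrite E => /(pP.2.2 _ _ (OKz _) (OK_sub sK (OKz _) (OK1 sK)))[h|]; last exact: zk_unit.
case: (pP.2.1).
by rewrite -(prim_expr_order pz) -(subnKC (ltnW (ltn_ord i'))) exprD; apply: (idmulr hP) => //; exact: OKz.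
Qed.

(** The n-th power residue symbol at a degree-one prime: the root of unity congruent to y^((p-1)/n),
    and 0 on P. The exponent picked by [epsilon] is unique by [zk_inj]. *)
Definition chi (y : algC) : algC :=
  if excluded_middle_informative (P y) then 0
  else z ^+ epsilon (inhabits (Ordinal n0)) (fun i : 'I_n => P (y ^+ kk - z ^+ i)).

Lemma chi0 y : P y -> chi y = 0.
Proof. by rewrite /chi; case: excluded_middle_informative. Qed.
Lemma chiP y : OK K y -> ~ P y -> exists2 i : 'I_n, chi y = z ^+ i & P (y ^+ kk - chi y).
Proof.
move=> Oy Py; rewrite /chi; case: excluded_middle_informative => [//|nPy].
have := epsilon_spec (inhabits (Ordinal n0)) (fun i : 'I_n => P (y ^+ kk - z ^+ i)) (chi_exists Oy Py).
by set i := epsilon _ _ => h; exists i.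
Qed.
Lemma chi_eq y (i : 'I_n) : OK K y -> ~ P y -> P (y ^+ kk - z ^+ i) -> chi y = z ^+ i.
Proof.
move=> Oy Py h; have [j -> hj] := chiP Oy Py; congr (z ^+ _); congr nat_of_ord; apply: zk_inj.
exact: (P_trans (P_sym hj)).
Qed.
Lemma chi_one y : OK K y -> chi y = 1 -> ~ P y /\ P (y ^+ kk - 1).
Proof.
move=> Oy E; case: (classic (P y)) => Py; first by move/eqP: E; rewrite chi0 // eq_sym oner_eq0.
by have [i _] := chiP Oy Py; rewrite E.
Qed.
Lemma chiM x y : OK K x -> OK K y -> chi (x * y) = chi x * chi y.
Proof.
move=> Ox Oy; case: (classic (P x)) => Px; first by rewrite (chi0 Px) mul0r chi0 //; exact: (idmulr hP).
case: (classic (P y)) => Py; first by rewrite (chi0 Py) mulr0 chi0 //; exact: (idmul hP).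
have [i Ei hi] := chiP Ox Px; have [j Ej hj] := chiP Oy Py.
have Pxy : ~ P (x * y) by move=> /(pP.2.2 _ _ Ox Oy)[].
have Em : z ^+ i * z ^+ j = z ^+ Ordinal (ltn_pmod (i + j) n0) by rewrite -exprD /= (prim_expr_mod pz).
rewrite Ei Ej Em; apply: chi_eq => //; first exact: OK_mul.
rewrite -Em exprMn -(subrK (z ^+ i * y ^+ kk) (x ^+ kk * y ^+ kk)) -addrA -mulrBl -mulrBr.
rewrite -Ei -Ej; apply: (addclD aP).
  by apply: (idmulr hP) => //; exact: (OK_X D).
by apply: (idmul hP) => //; rewrite Ei; exact: OKz.
Qed.
Lemma chi_mod x y : OK K x -> OK K y -> P (x - y) -> chi x = chi y.
Proof.
move=> Ox Oy h; case: (classic (P y)) => Py.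
  by rewrite !chi0 // -(subrK y x); exact: (addclD aP).
have Px : ~ P x by move=> Px; apply: Py; rewrite -(subKr x y); exact: aP.2.
have [j Ej hj] := chiP Oy Py; rewrite Ej; apply: chi_eq => //; rewrite -Ej.
exact: (P_trans (P_subX kk Ox Oy h)).
Qed.
Lemma chi_root y : OK K y -> ~ P y -> chi y ^+ n = 1.
Proof. by move=> Oy Py; have [i -> _] := chiP Oy Py; rewrite -exprM mulnC exprM (prim_expr_order pz) expr1n. Qed.
Lemma chi_norm y : OK K y -> `|chi y| <= 1.
Proof.
move=> Oy; case: (classic (P y)) => Py; first by rewrite chi0 // normr0 ler01.
by rewrite -(@ler_pXn2r _ n) ?nnegrE ?ler01 // -normrX chi_root // normr1 expr1n.
Qed.
Lemma chi1 : chi 1 = 1.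
Proof. by apply: (chi_eq (i := Ordinal n0)); [exact: OK1 | exact: (pP.2.1) | rewrite expr1n expr0 subrr; exact: aP.1]. Qed.
Lemma chiX y k : OK K y -> chi (y ^+ k) = chi y ^+ k.
Proof.
by move=> Oy; elim: k => [|k IH]; [rewrite !expr0 chi1 | rewrite !exprS chiM ?IH //; exact: (OK_X D)].
Qed.

(** X^(kk j) - 1 has degree below p - 1, so it cannot vanish at all of 1, ..., p - 1. A rational
    integer u has the advantage of being fixed by every tau_i. *)
Lemma chi_nontrivial j : (0 < j < n)%N -> exists u : nat, ~ P u%:R /\ chi u%:R ^+ j != 1.
Proof.
move=> /andP[j0 jn]; have p1 := prime_gt1 pp; have pc := pchar_Fp pp.
have kk0 : (0 < kk)%N.
  rewrite lt0n; apply/eqP => E; have := kkn; rewrite E mul0n; by move: p1; case: (p) => [|[|]].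
pose q : {poly 'F_p} := 'X^(kk * j) - 1.
have qs : size q = (kk * j).+1.
  by rewrite /q size_polyDl ?size_polyXn // size_polyN size_poly1 ltnS muln_gt0 kk0.
have q0 : q != 0 by rewrite -size_poly_eq0 qs.
have [u Hu] : exists u : 'I_p.-1, ~~ root q (u.+1)%:R.
  apply: NNPP => h; pose f (u : 'I_p.-1) : 'F_p := (u.+1)%:R; pose rs := map f (enum 'I_p.-1).
  have : (size rs < size q)%N.
    apply: max_poly_roots => //.
      by apply/allP => y /mapP[u _ ->]; apply/negPn/negP => h'; apply: h; exists u.
    rewrite map_inj_uniq ?enum_uniq // => u v /(congr1 (@nat_of_ord _)); rewrite /f !val_Fp_nat //.
    have lt (t : 'I_p.-1) : (t.+1 < p)%N by rewrite -[ltnRHS]prednK ?ltnS ?ltn_ord // ltnW.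
    by rewrite !modn_small // => -[] E; apply: val_inj.
  by rewrite size_map size_enum_ord qs ltnS -kkn leq_pmul2l // leqNgt jn.
have lt : (u.+1 < p)%N by rewrite -[ltnRHS]prednK ?ltnS ?ltn_ord // ltnW.
have Pu : ~ P (u.+1)%:R by move/nat_inP; rewrite gtnNdvd.
exists u.+1; split => //; have Ou := OK_nat u.+1 sK; have [i Ei hi] := chiP Ou Pu.
apply: contra Hu => /eqP E; rewrite /root /q hornerD hornerN hornerXn hornerC subr_eq0.
have : P ((u.+1 ^ (kk * j))%N%:R - 1).
  have Oc : OK K (chi (u.+1)%:R) by rewrite Ei; exact: OKz.
  by rewrite natrX exprM -[X in _ - X]E; apply: P_subX => //; exact: (OK_X D).
have up : (0 < u.+1 ^ (kk * j))%N by rewrite expn_gt0.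
have -> : (u.+1 ^ (kk * j))%:R - 1 = (u.+1 ^ (kk * j) - 1)%:R :> algC by rewrite natrB.
by move/nat_inP; rewrite (dvdn_pcharf pc) natrB // subr_eq0 natrX.
Qed.
End DegreeOne.

(** The last clause makes the n conjugates over F distinct: [pi] lies above a degree-one prime of F
    that splits completely in K. *)
Definition good_prime (K : cset) (n : nat) (sg : aut) (p : nat) (pi : cset) :=
  [/\ prime_ideal K pi, pi p%:R, normI K pi = p & forall k, (0 < k < n)%N -> imI (autX sg k) pi <> pi].

Section Splitting.
Variables (F K L M : cset) (n : nat) (z : algC) (sg : aut).
Variables (dF : nat) (sF : 'I_dF -> aut) (wF : 'I_dF -> algC) (DF : nfdata F sF wF).
Variables (dK : nat) (sK : 'I_dK -> aut) (wK : 'I_dK -> algC) (DK : nfdata K sK wK).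
Variables (dL : nat) (sL : 'I_dL -> aut) (wL : 'I_dL -> algC) (DL : nfdata L sL wL).
Variables (dM : nat) (sM : 'I_dM -> aut) (wM : 'I_dM -> algC) (DM : nfdata M sM wM).
Hypotheses (FK : Defs.subset F K) (FL : Defs.subset F L) (KM : Defs.subset K M) (LM : Defs.subset L M).
Hypotheses (n1 : (1 < n)%N) (pz : n.-primitive_root z) (Lz : L z).
Hypotheses (sgF : forall x, F x -> sg x = x) (sgK : forall x, K x -> K (sg x)).
Hypothesis sgneq : powers_distinct K n sg.
Hypothesis cls : powers_exhaust F K n sg.
Hypothesis sgn : forall x, K x -> autX sg n x = x.
Let fF := nfdata_sub DF.
Let fK := nfdata_sub DK.
Let fL := nfdata_sub DL.
Let fM := nfdata_sub DM.
Let n0 : (0 < n)%N. Proof. exact: ltnW. Qed.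
Hypothesis agr : generated_over F L z.
Variables (e : 'I_(totient n) -> 'I_n) (tau : 'I_(totient n) -> aut).
Hypothesis T : tau_data F z e tau.
Variable u0 : algC.
Hypotheses (Ou0 : OK K u0) (y0 : reso n z sg 1 u0 != 0).
Hypothesis hT : unram_or_total F K n.
Let al := kummer n z sg u0.
Let Oal : OK L al := kummer_OK DL DM FL KM LM n1 pz Lz sgK cls sgn Ou0.
Let al0 : al != 0 := kummer_neq0 y0.
Let N0 := (n * Nz z sL tau)%N.
Variables (P : cset) (p : nat).
Hypotheses (pP : prime_ideal L P) (pp : prime p) (Pp : P p%:R) (PN : ~ P N0%:R).
Hypothesis P1 : forall x, OK L x -> exists a : nat, P (x - a%:R).
Variables (g x y : algC).
Hypotheses (Og : OK L g) (Ox : OK L x) (Oy : OK L y) (x0 : x != 0) (yn0 : y != 0).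
Hypotheses (Eg : al * x ^+ n = g * y ^+ n) (chig : chi P p z n1 g = 1).

Let Pn : ~ P n%:R.
Proof. by move=> h; apply: PN; rewrite natrM; apply: (idmulr (primeP_id pP)) => //; exact: OK_nat. Qed.

(** The symbol value 1 makes the Kummer generator an n-th power modulo P up to n-th powers, so
    Frobenius fixes all resolvents modulo a prime [PP] of M above P. As n u is the sum of the
    resolvents of u, the prime of K below [PP] has residue field of p elements. An sg^j fixing this
    prime would act trivially on that residue field, that is, lie in inertia, which is trivial
    here. *)
Lemma splitting : exists pi, good_prime K n sg p pi.
Proof.
have [Pg Hg] := chi_one DL pP pp Pp P1 pz Lz Pn Og chig.
have g0 : g != 0 by apply/eqP => E; apply: Pg; rewrite E; case: (primeP_id pP) => _ [].
have vg := ve_eq0 DL pP Og Pg.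
have nv : (n %| ve L P al)%N.
  have : ve L P (al * x ^+ n) = ve L P (g * y ^+ n) by rewrite Eg.
  rewrite (veM DL P Oal (OK_X DL _ Ox) al0 (expf_neq0 _ x0)) (veM DL P Og (OK_X DL _ Oy) g0 (expf_neq0 _ yn0)).
  rewrite (veX DL P _ Ox x0) (veX DL P _ Oy yn0) vg add0n => E.
  have : (n %| ve L P al + n * ve L P x)%N by rewrite E dvdn_mulr.
  by rewrite dvdn_addl // dvdn_mulr.
have pR := contract_prime DF DL FL pP.
have PNz : ~ P (Nz z sL tau)%:R by move=> h; apply: PN; rewrite natrM; apply: (idmul (primeP_id pP)) => //; exact: OK_nat.
have vR := ext_unram DF DL FL pz Lz agr T pP PNz.
have un : unramified K (contract F P).
  case: (hT pR) => [[J [hJ /cset_ext EJ]]|//|tr].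
    case: Pn; have := principal_mem fF n%:R; rewrite EJ => /(iprod_subl fF (primeP_id pR) hJ); by case.
  have [b] := totram_kummer DF DK DL DM FK FL KM LM n1 pz Lz sgF sgK cls sgn Ou0 y0 pP Pn vR tr.
  by have /dvdnP[q ->] := nv; rewrite mulnA modnMl modn_small.
have [PP pPP hPP] := lies_over DL DM LM pP; have hPPi := primeP_id pPP.
have pQ := contract_prime DK DM KM pPP.
have RQ t : contract F P t -> contract K PP t by case=> Ft Pt; split; [exact: FK | exact: hPP].
have inert k : (0 < k < n)%N -> ~ (forall u, OK K u -> contract K PP (autX sg k u - u)).
  by move=> kn h; apply: (inertia_ramified DF DK FK sgF sgK sgneq pR pQ RQ kn h).
(* Inertia is trivial, so by [reso_vanish] some first resolvent is a unit at [PP]; it replaces that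
   of [u0], which may not be one. *)
have [u1 Ou1 Py] : exists2 u1, OK K u1 & ~ PP (reso n z sg 1 u1).
  apply: NNPP => h; have [|k kn Hk] := reso_vanish DK DL DM KM LM n1 pz Lz sgK sgn hPPi pPP.2.2 pPP.2.1.
    by move=> u Ou; apply: NNPP => h'; apply: h; exists u.
  apply: (inert k kn) => u Ou; split; last exact: Hk.
  by apply: sfB => //; [apply: (sgX sgK)|]; case: Ou.
set Y := reso n z sg 1 u1 in Py *; pose a1 := Y ^+ n.
have OY : OK M Y := reso_OK DL DM KM LM pz Lz sgK 1 Ou1.
have Y0 : Y != 0 by apply/eqP => E; apply: Py; rewrite E; case: hPPi => _ [].
have Oa1 : OK L a1 by exact: (reso_X_OK DL DM FL KM LM pz Lz sgK cls sgn 1 Ou1).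
have Pa1 : ~ P a1 by move/hPP/(prime_X DM pPP OY).
have a10 : a1 != 0 by rewrite expf_neq0.
pose la := Y * reso n z sg 1 u0 ^+ (n - 1).
have Ola : OK L la by exact: (reso_prod_L DL DM FL KM LM pz Lz sgK cls sgn (ltnW n1) Ou1 Ou0).
have la0 : la != 0 by rewrite mulf_neq0 // expf_neq0.
have Ela : la ^+ n * al = a1 * al ^+ n.
  rewrite /la exprMn exprAC -/al -/(kummer n z sg u0) -/al -/a1 -mulrA -exprSr.
  by rewrite subn1 prednK.
clearbody la.
have Oe1 : OK L (al * x) by apply: OK_mul.
have Oe2 : OK L (la * y) by apply: OK_mul.
have e10 : al * x != 0 by rewrite mulf_neq0.
have e20 : la * y != 0 by rewrite mulf_neq0.
have E1 : a1 * (al * x) ^+ n = g * (la * y) ^+ n.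
  by rewrite !exprMn mulrA -Ela -mulrA Eg mulrCA.
have Ev : ve L P (al * x) = ve L P (la * y).
  have : ve L P (a1 * (al * x) ^+ n) = ve L P (g * (la * y) ^+ n) by rewrite E1.
  rewrite (veM DL P Oa1 (OK_X DL _ Oe1) a10 (expf_neq0 _ e10)) (veM DL P Og (OK_X DL _ Oe2) g0 (expf_neq0 _ e20)).
  rewrite (veX DL P _ Oe1 e10) (veX DL P _ Oe2 e20) vg (ve_eq0 DL pP Oa1 Pa1) !add0n => /eqP.
  by rewrite eqn_pmul2l // => /eqP.
have [a [b [Oa Ob Pa Pb Eab]]] := unit_ratio DL pP Oe1 Oe2 e10 e20 Ev.
have E2 : a1 * a ^+ n = g * b ^+ n.
  apply: (mulfI (expf_neq0 n e20)); by rewrite mulrCA -exprMn -Eab exprMn mulrA E1 -mulrA mulrCA.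
set k := kk p n in Hg.
have kn : (k * n = p.-1)%N := kkn DL pP pp Pp P1 n1 pz Lz Pn.
have aP := id_addcl fL (primeP_id pP).
(* [a1] and [g] differ by the n-th power of a quotient of units at P, and the symbol does not see
   n-th powers. *)
have Ha1 : P (a1 ^+ k - 1).
  have Oak := OK_X DL k Oa1; have Ogk := OK_X DL k Og.
  have E3 : a1 ^+ k * a ^+ p.-1 = g ^+ k * b ^+ p.-1.
    have ek c : c ^+ p.-1 = (c ^+ n) ^+ k by rewrite -exprM mulnC kn.
    by rewrite !ek -[LHS]exprMn -[RHS]exprMn E2.
  have h1 := fermatP DL pP pp Pp P1 Oa Pa; have h2 := fermatP DL pP pp Pp P1 Ob Pb.
  have -> : a1 ^+ k - 1 = (g ^+ k - 1) + g ^+ k * (b ^+ p.-1 - 1) - a1 ^+ k * (a ^+ p.-1 - 1).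
    by rewrite !mulrBr E3; ring.
  apply: aP.2; first by apply: (addclD aP) => //; apply: (idmul (primeP_id pP)).
  by apply: (idmul (primeP_id pP)).
have PPp : PP p%:R := hPP _ Pp.
have aPP := id_addcl fM hPPi.
have HY : PP (Y ^+ p - Y).
  have -> : Y ^+ p - Y = Y * (a1 ^+ k - 1).
    by rewrite /a1 -exprM mulnC kn mulrBr mulr1 -exprS prednK ?prime_gt0.
  by apply: (idmul hPPi) => //; exact: hPP.
(* c Y^(n - b') lies in L, where Frobenius is trivial modulo P, and Y is fixed by Frobenius modulo
   [PP]; cancelling the unit Y^(n - b') leaves c. *)
have Hb (b' : 'I_n) u : OK K u -> PP (reso n z sg b' u ^+ p - reso n z sg b' u).
  move=> Ou; have Ob' := reso_OK DL DM KM LM pz Lz sgK b' Ou.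
  have Olb := reso_prod_L DL DM FL KM LM pz Lz sgK cls sgn (ltnW (ltn_ord b')) Ou Ou1.
  set c := reso n z sg b' u in Ob' Olb *; rewrite -/Y in Olb; set m := (n - b')%N in Olb.
  have h1 : PP ((c * Y ^+ m) ^+ p - c * Y ^+ m) by apply: hPP; apply: (frob_id DL pP pp Pp P1).
  have h2 : PP ((Y ^+ m) ^+ p - Y ^+ m) by rewrite exprAC; apply: (P_subX DM pPP) => //; exact: (OK_X DM).
  have OYm := OK_X DM m OY; have Ocp := OK_X DM p Ob'.
  have PYm : ~ PP (Y ^+ m) by move/(prime_X DM pPP OY).
  apply: (P_cancel DM pPP OYm Ocp Ob' PYm).
  have -> : Y ^+ m * c ^+ p - Y ^+ m * c = ((c * Y ^+ m) ^+ p - c * Y ^+ m) - c ^+ p * ((Y ^+ m) ^+ p - Y ^+ m).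
    by rewrite exprMn; ring.
  by apply: aPP.2 => //; apply: (idmul hPPi).
have PPn : ~ PP n%:R.
  move=> h; apply: Pn; rewrite -(contract_over DL DM LM pP pPP hPP); split => //; exact: sfnat.
have HK u : OK K u -> PP (u ^+ p - u).
  move=> Ou; have OuM := ext_OK KM Ou; have Onu : OK M (n%:R * u) by apply: OK_mul => //; exact: OK_nat.
  have h1 : PP ((n%:R * u) ^+ p - n%:R * u).
    rewrite -(reso_sum sg n1 pz).
    apply: (P_trans DM pPP (y := \sum_(b' < n) reso n z sg b' u ^+ p)).
      by apply: (frob_sum DM pPP pp PPp) => b'; exact: (reso_OK DL DM KM LM pz Lz sgK b' Ou).
    by rewrite -sumrB; apply: (id_sum _ fM hPPi) => b' _; exact: Hb.
  have h2 : PP (n%:R ^+ p - n%:R) by rewrite -natrX; apply: (modn_inP DM pPP PPp); exact: fermat_little.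
  have Oup := OK_X DM p OuM.
  apply: (P_cancel DM pPP (OK_nat n fM) Oup OuM PPn).
  have -> : n%:R * u ^+ p - n%:R * u = ((n%:R * u) ^+ p - n%:R * u) - (n%:R ^+ p - n%:R) * u ^+ p.
    by rewrite exprMn; ring.
  by apply: aPP.2 => //; apply: (idmulr hPPi).
have Q1 u : OK K u -> exists a : nat, contract K PP (u - a%:R).
  move=> Ou; apply: (frob_nat DK pQ pp) => //; first by split => //; exact: sfnat.
  by split; [apply: sfB => //; [apply: sfX => //|]; case: Ou | exact: HK].
have Qp : contract K PP p%:R by split => //; exact: sfnat.
exists (contract K PP); split => //; first exact: (deg1_norm DK pQ pp Qp Q1).
move=> j jn Ej; apply: (inert j jn) => u Ou; have [c Qc] := Q1 u Ou.
have aQ := id_addcl fK (primeP_id pQ).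
have -> : autX sg j u - u = autX sg j (u - c%:R) - (u - c%:R) by rewrite rmorphB rmorph_nat; ring.
apply: aQ.2 => //; rewrite -Ej; apply/imI_mem; exact: Qc.
Qed.
End Splitting.

Lemma expn_mono a b k : (a <= b)%N -> (a ^ k <= b ^ k)%N.
Proof. by case: k => // k ab; rewrite leq_exp2r. Qed.

Lemma det_le d (A : 'M[algC]_d) (B : algC) : (forall i j, `|A i j| <= B) -> `|\det A| <= d`!%:R * B ^+ d.
Proof.
move=> hB; apply: le_trans (ler_norm_sum _ _ _) _.
apply: le_trans (_ : \sum_(p : 'S_d) B ^+ d <= _).
  apply: ler_sum => p _; rewrite normrM normrX normrN1 expr1n mul1r normr_prod.
  rewrite -[X in B ^+ X](card_ord d) -prodr_const; by apply: ler_prod => i _; rewrite normr_ge0 hB.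
by rewrite sumr_const card_Sn mulr_natl.
Qed.

(** * Separation of auxiliary ideals *)

Section Separation.
Variables (F K : cset) (n : nat) (sg : aut).
Variables (dF : nat) (sF : 'I_dF -> aut) (wF : 'I_dF -> algC) (DF : nfdata F sF wF).
Notation dK := (dF * n)%N.
Variables (sK : 'I_dK -> aut) (wK : 'I_dK -> algC) (DK : nfdata K sK wK).
Hypotheses (FK : Defs.subset F K) (n1 : (1 < n)%N).
Hypotheses (sgF : forall x, F x -> sg x = x) (sgK : forall x, K x -> K (sg x)).
Let fF := nfdata_sub DF.
Let fK := nfdata_sub DK.
Let n0 : (0 < n)%N. Proof. exact: ltnW. Qed.
Let W := \matrix_(i, j) sK i (wK j).

Lemma basisF : is_basis QQ F wF.
Proof.
have Dq := nfdata_qdata DF; split; first by case: Dq.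
split; first by apply/indep_rat; apply: qdata_indep Dq.
case: Dq => _ _ sp _ _ x /sp[c ->]; exists (fun i => ratr (c i)); split => // i; exact: Crat_rat.
Qed.

(** A polynomial over F of degree below n that vanishes at [ga] vanishes at its n distinct
    conjugates. *)
Lemma pow_indep (ga : algC) : K ga -> (forall k, (0 < k < n)%N -> autX sg k ga != ga) -> lin_indep F (fun k : 'I_n => ga ^+ k).
Proof.
move=> Kga hneq c Fc E; pose q := \poly_(k < n) oapp c 0 (insub k).
have qn : (size q <= n)%N by exact: size_poly.
have hq (j : 'I_n) : root q (autX sg j ga).
  apply/rootP; rewrite (@horner_coef_wide _ n) // -[RHS](rmorph0 (autX sg j)) -[in RHS]E rmorph_sum.
  apply: eq_bigr => k _; rewrite coef_poly ltn_ord insubT //= => hk; rewrite rmorphM rmorphXn /=; congr (_ * _).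
  by rewrite (sgXF sgF) //; congr (c _); apply: val_inj.
have q0 : q = 0.
  apply/eqP/negPn/negP => q0; pose f (j : 'I_n) := autX sg j ga; pose rs := map f (enum 'I_n).
  have : (size rs < size q)%N.
    apply: max_poly_roots => //; first by apply/allP => y /mapP[j _ ->]; exact: hq.
    rewrite map_inj_uniq ?enum_uniq // => i j; rewrite /f.
    suff H (i' j' : 'I_n) : (i' <= j')%N -> autX sg i' ga = autX sg j' ga -> i' = j'.
      by move=> h; case: (leqP i j) => [|/ltnW] ij; [apply: H | symmetry; apply: H].
    move=> ij h; apply/val_inj/eqP; rewrite /= eqn_leq ij leqNgt; apply/negP => lt.
    have /negP[] : autX sg (j' - i') ga != ga by apply: hneq; rewrite subn_gt0 lt (leq_ltn_trans (leq_subr _ _)).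
    by apply/eqP; apply: (fmorph_inj (autX sg i')); rewrite -autXD subnKC.
  by rewrite size_map size_enum_ord ltnNge qn.
move=> k; have := congr1 (fun r : {poly algC} => r`_k) q0; rewrite coef_poly ltn_ord coef0 insubT //= => hk.
by move=> E'; rewrite -[RHS]E'; congr (c _); apply: val_inj.
Qed.

(** The h_j span a sublattice of I of full rank, whose covolume is a positive integral multiple of
    that of I. *)
Lemma lattice_det I (h : 'I_dK -> algC) : nonzero_ideal K I -> (forall j, I (h j)) -> \det (\matrix_(i, j) sK i (h j)) != 0 ->
  (normI K I)%:R * `|\det W| <= `|\det (\matrix_(i, j) sK i (h j))|.
Proof.
move=> nI hI d0; have [B [dB HB hidx]] := ideal_basis DK nI.
have nB : normI K I = `|\det B|%N by apply: (normI_uniq _ hidx); apply: (id_addcl fK); case: nI.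
have [C HC] := choice_ord (P := fun j (c : 'rV[int]_dK) => h j = ev wK (c *m B)) (fun j => (HB _).1 (hI j)).
pose Cm : 'M[int]_dK := \matrix_(j, k) C j 0 k.
have E : \matrix_(i, j) sK i (h j) = W *m (map_mx intr (Cm *m B))^T.
  apply/matrixP => i j; rewrite !mxE HC sEv; apply: eq_bigr => k _; rewrite !mxE mulrC; congr (_ * _%:~R).
  by apply: eq_bigr => l _; rewrite mxE.
move: d0; rewrite E det_mulmx det_tr det_map_mx det_mulmx mulf_eq0 negb_or => /andP[_].
rewrite intr_eq0 mulf_eq0 negb_or => /andP[c0 _].
have -> : `|\det W * (\det Cm * \det B)%:~R| = `|\det W| * (`|\det Cm| * `|\det B|)%N%:R.
  by rewrite normrM -intr_norm normrM -!abszE -PoszM -pmulrn.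
by rewrite mulrC ler_wpM2l // ler_nat nB leq_pmull // absz_gt0.
Qed.

(* Ellenberg-Venkatesh: with ga = b / b' of distinct conjugates over F, the small elements ga^k w_i span a
   lattice of full rank, whose covolume bounds the discriminant of K. *)
Lemma separation l A A' b b' (Cf : nat) : nonzero_ideal K A -> nonzero_ideal K A' -> OK K b -> OK K b' -> b != 0 -> b' != 0 ->
  iprod (principal K b) (ipow K A' l) = iprod (principal K b') (ipow K A l) ->
  (forall v, `|sK v b| <= 2 * `|sK v b'|) -> (forall v i, `|sK v (wF i)| <= Cf%:R) ->
  (forall k, (0 < k < n)%N -> autX sg k b * b' != b * autX sg k b') ->
  `|\det W| <= (normI K A' ^ (l * n.-1) * (dK`! * (2 ^ n * Cf) ^ dK))%:R.
Proof.
move=> nA nA' Ob Ob' b0 b0' Eb hb hC hneq.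
pose ga := b / b'; have Kb : K b by case: Ob.
have Kb' : K b' by case: Ob'.
have Kga : K ga by apply: (sfdiv fK).
have gaX k : (0 < k < n)%N -> autX sg k ga != ga.
  move=> kn; apply: contraNneq (hneq k kn) => E; have sb0 : autX sg k b' != 0 by rewrite fmorph_eq0.
  have := congr1 (fun x => x * (autX sg k b' * b')) E; rewrite /ga fmorph_div /=.
  have -> : autX sg k b / autX sg k b' * (autX sg k b' * b') = autX sg k b * b' by field.
  have -> : b / b' * (autX sg k b' * b') = b * autX sg k b' by field.
  by move=> ->.
(* [ga] generates the l-th power of A / A', so ga^k with k < n maps bb = A'^(l (n-1)) into O_K. With
   bb bc = (c) this means that c ga^k lies in bc. *)
pose bb := ipow K A' (l * n.-1); have nbb : nonzero_ideal K bb by exact: (ipow_nz DK).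
have [bc [c [nbc c0 Ec]]] := ideal_inv DK nbb.
have cn0 : c%:R != 0 :> algC by rewrite pnatr_eq0 -lt0n.
pose h j := c%:R * prod_basis wF (fun k : 'I_n => ga ^+ k) j.
have gin (k : nat) : (k < n)%N -> bc (c%:R * ga ^+ k).
  move=> kn; have b'k : b' ^+ k != 0 by rewrite expf_neq0.
  have n1A := ipow_nz DK l nA; have n1A' := ipow_nz DK l nA'.
  have Ek : iprod (principal K (b ^+ k)) (ipow K (ipow K A' l) k) = iprod (principal K (b' ^+ k)) (ipow K (ipow K A l) k).
    have := congr1 (fun I => ipow K I k) Eb.
    rewrite (ipowM DK k (principal_ideal fK Ob) n1A'.1) (ipowM DK k (principal_ideal fK Ob') n1A.1).
    by rewrite !(ipow_principal DK).
  have nAk := ipow_nz DK k n1A; have nAk' := ipow_nz DK k n1A'.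
  have Obk := OK_X DK k Ob; have Obk' := OK_X DK k Ob'.
  have ipowE I a : nonzero_ideal K I -> forall j, ipow K I (a + j) = iprod (ipow K I a) (ipow K I j).
    move=> nI j; elim: a => [|a IH]; first by rewrite add0n OK_iprod //; exact: (ipow_nz DK j nI).1.
    by rewrite addSn /ipow !iterS -!/(ipow K I _) IH (iprodAK fK nI.1 (ipow_nz DK a nI).1 (ipow_nz DK j nI).1).
  have ipowX I a : nonzero_ideal K I -> forall j, ipow K (ipow K I a) j = ipow K I (j * a).
    move=> nI; elim=> [|j IH]; first by rewrite mul0n.
    by rewrite /ipow iterS -!/(ipow K _ _) IH mulSn ipowE.
  have key y : bb y -> OK K (ga ^+ k * y).
    have -> : bb = iprod (ipow K (ipow K A' l) k) (ipow K A' ((n.-1 - k) * l)).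
      by rewrite ipowX // -ipowE // -mulnDl subnKC 1?mulnC // -ltnS prednK.
    move=> Yy; have : iprod (principal K (b' ^+ k)) (OK K) (b ^+ k * y).
      have h1 : iprod (principal K (b ^+ k)) (iprod (ipow K (ipow K A' l) k) (ipow K A' ((n.-1 - k) * l))) (b ^+ k * y).
        by apply: iprod_mul => //; exact: (principal_mem fK).
      move: h1; rewrite (iprodAK fK (principal_ideal fK Obk) nAk'.1 (ipow_nz DK _ nA').1) Ek.
      rewrite -(iprodAK fK (principal_ideal fK Obk') nAk.1 (ipow_nz DK _ nA').1); apply: iprod_mono => // t.
      exact: (idsub (iprod_ideal fK nAk.1 (ipow_nz DK _ nA').1)).
    move/(iprod_principal fK _ _ (OK_ideal fK)) => [t [Ot Et]].
    suff -> : ga ^+ k * y = t by [].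
    by apply: (mulfI b'k); rewrite -Et /ga expr_div_n mulrA mulrCA mulfV // mulr1.
  have h2 y : iprod (principal K (c%:R)) (principal K 1) y -> bc (ga ^+ k * y).
    have h3 : iprod bb bc y -> bc (ga ^+ k * y).
      have ha := id_addcl fK nbc.1.
      move: y; apply: (@iprod_min bb bc (fun y => bc (ga ^+ k * y))).
        by split; [rewrite mulr0; exact: ha.1 | move=> s t hs ht; rewrite mulrBr; exact: ha.2].
      by move=> s t bs bct; rewrite mulrA; apply: (idmul nbc.1) => //; exact: key.
    by rewrite (principalM fK (OK_nat c fK) (OK1 fK)) mulr1 -Ec.
  rewrite mulrC; apply: h2; rewrite (principalM fK (OK_nat c fK) (OK1 fK)) mulr1; exact: (principal_mem fK).
have hin j : bc (h j).
  rewrite /h /prod_basis mulrCA; apply: (idmul nbc.1); last exact: gin.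
  by apply: (ext_OK FK); case: DF => _ h' _ _ _; apply: h'.
have hind : \det (\matrix_(i, j) sK i (h j)) != 0.
  apply: (qdata_det (nfdata_qdata DK)); first by move=> j; case: (idsub nbc.1 (hin j)).
  have := prod_indep fF basisF (pow_indep Kga gaX) => hp e Qe Ee; apply: (hp e Qe).
  by apply: (mulfI cn0); rewrite mulr0 -[RHS]Ee mulr_sumr; apply: eq_bigr => j _; rewrite /h mulrCA.
have le1 := lattice_det nbc hin hind.
have le2 : `|\det (\matrix_(i, j) sK i (h j))| <= dK`!%:R * (c * (2 ^ n * Cf))%:R ^+ dK.
  apply: (@det_le _ _ (c * (2 ^ n * Cf))%:R) => i j; rewrite mxE /h /prod_basis !rmorphM rmorphXn /= rmorph_nat !normrM normr_nat normrX ler_wpM2l ?ler0n //.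
  rewrite mulrC; apply: ler_pM => //; first by rewrite exprn_ge0.
  have le3 : `|sK i ga| <= 2.
    rewrite /ga fmorph_div normf_div /= ler_pdivrMr ?normr_gt0 ?fmorph_eq0 //; exact: hb.
  apply: le_trans (_ : 2 ^+ (unpair j).2 <= _); first by rewrite lerXn2r ?nnegrE // ler0n.
  by rewrite natrX ler_weXn2l ?ler1n // ltnW.
have := le_trans le1 le2; rewrite natrM exprMn mulrCA -natrX.
have -> : (c ^ dK = normI K bb * normI K bc)%N by rewrite -(normI_nat DK c0) -Ec (normIM DK nbb nbc).
have -> : normI K bb = (normI K A' ^ (l * n.-1))%N.
  rewrite /bb; elim: (l * n.-1)%N => [|k IH]; first exact: (normI_OK DK).
  by rewrite /ipow iterS -/(ipow K A' k) (normIM DK nA' (ipow_nz DK k nA')) expnS IH.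
set N1 := (_ ^ _)%N; have b0c : (0 : algC) < (normI K bc)%:R by rewrite ltr0n (normI_gt0 DK).
rewrite natrM (mulrC N1%:R) -!mulrA ler_pM2l // !natrM natrX => h'.
by rewrite !natrX !natrM !natrX in h' *; apply: le_trans h' _; rewrite mulrCA.
Qed.

Section GoodIdeals.
Variables (pi : nat -> cset) (l : nat).
Hypothesis l0 : (0 < l)%N.
Definition good_list (ps : seq nat) := uniq ps /\ forall p, p \in ps -> good_prime K n sg p (pi p).
Definition gideal ps := prodI K (map pi ps).

Lemma good_primes ps : good_list ps -> primes_of K (map pi ps).
Proof. by move=> [_ h] P /mapP[p /h[pP _ _ _] ->]. Qed.
Lemma gideal_norm ps : good_list ps -> normI K (gideal ps) = \prod_(p <- ps) p.
Proof.
move=> gp; rewrite /gideal (normI_prodI DK (good_primes gp)) big_map !big_seq; apply: eq_bigr => p ps'.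
by case: (gp.2 p ps').
Qed.
Lemma gideal_vI ps ps' p : good_list ps -> good_list ps' -> p \in ps' -> vI K (pi p) (gideal ps) = (p \in ps).
Proof.
move=> gp gp' pp'; rewrite /gideal (vI_prodI DK _ (good_primes gp)) count_map.
rewrite -(count_uniq_mem p gp.1); apply: eq_in_count => q qp /=; apply/eqP/eqP => [E|-> //].
by have [_ _ <- _] := gp.2 q qp; have [_ _ <- _] := gp'.2 p pp'; rewrite E.
Qed.
Lemma gideal_im ps ps' p k : good_list ps -> good_list ps' -> p \in ps' -> (0 < k < n)%N -> vI K (pi p) (imI (autX sg k) (gideal ps)) = 0%N.
Proof.
move=> gp gp' pp' kn; have hk x : K x -> K (autX sg k x) by move=> Kx; exact: (sgX sgK).
rewrite /gideal (imI_prodI DK hk) (vI_prodI DK).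
  apply/count_memPn/negP; rewrite -map_comp => /mapP[q qp E].
  have [pQ _ nq hq] := gp.2 q qp; have [_ _ np _] := gp'.2 p pp'.
  have pq : p = q by rewrite -np -nq E /= (imI_normI DK hk (primeP_nz pQ)).
  by apply: (hq k kn); rewrite -pq in E *; rewrite [RHS]E.
move=> P; rewrite -map_comp => /mapP[q qp ->] /=; apply: (imI_prime DK hk); by have [] := gp.2 q qp.
Qed.

(** The conjugates of b / b' are distinct, as seen at the chosen prime above p, which divides the
    first ideal and not the second: b / b' has valuation l there, while its image under sg^k has
    valuation 0 because no conjugate of a chosen prime is again a chosen prime. So [separation]
    applies and contradicts the size of the discriminant. *)
Lemma good_sep ps ps' p b b' (Cf Y : nat) : good_list ps -> good_list ps' -> p \in ps -> p \notin ps' ->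
  (\prod_(p <- ps') p <= Y)%N -> (forall v i, `|sK v (wF i)| <= Cf%:R) ->
  (Y ^ (l * n.-1) * (dK`! * (2 ^ n * Cf) ^ dK))%:R < `|\det W| ->
  OK K b -> OK K b' -> b != 0 -> b' != 0 ->
  iprod (principal K b) (ipow K (gideal ps') l) = iprod (principal K b') (ipow K (gideal ps) l) ->
  (forall v, `|sK v b| <= 2 * `|sK v b'|) -> False.
Proof.
move=> gp gp' pp pp' hY hC hW Ob Ob' b0 b0' Eb hb.
have nA := prodI_nz DK (good_primes gp); have nA' := prodI_nz DK (good_primes gp').
have := separation nA nA' Ob Ob' b0 b0' Eb hb hC; set X := (normI K _ ^ _ * _)%N => H.
have hX : X%:R < `|\det W|.
  apply: le_lt_trans hW; rewrite ler_nat /X leq_mul2r; apply/orP; right; apply: expn_mono.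
  by rewrite -/(gideal ps') gideal_norm.
have /negP[] : ~~ (`|\det W| <= X%:R) by rewrite -real_ltNge // ?realn //; exact: normr_real.
apply: H => k kn; apply/eqP => E.
have hk x : K x -> K (autX sg k x) by move=> Kx; exact: (sgX sgK).
have [pP _ _ _] := gp.2 p pp.
pose v I := vI K (pi p) I.
have e1 : (v (principal K b) + l * v (gideal ps') = v (principal K b') + l * v (gideal ps))%N.
  have := congr1 v Eb; rewrite /v (vIM DK _ (principal_nz fK Ob b0) (ipow_nz DK l nA')).
  by rewrite (vIM DK _ (principal_nz fK Ob' b0') (ipow_nz DK l nA)) !(vI_pow DK).
have Osb : OK K (autX sg k b) := OK_sg sgK k Ob; have Osb' : OK K (autX sg k b') := OK_sg sgK k Ob'.
have sb0 : autX sg k b != 0 by rewrite fmorph_eq0.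
have sb0' : autX sg k b' != 0 by rewrite fmorph_eq0.
have impow I j : nonzero_ideal K I -> imI (autX sg k) (ipow K I j) = ipow K (imI (autX sg k) I) j.
  move=> nI; elim: j => [|j IH]; first exact: (imI_OK DK hk).
  by rewrite /ipow !iterS -!/(ipow K _ j) imI_iprod IH.
have e2 : (v (principal K (autX sg k b)) = v (principal K (autX sg k b')))%N.
  have := congr1 (fun I => v (imI (autX sg k) I)) Eb; rewrite !imI_iprod !(imI_principal DK hk) !impow //.
  rewrite /v (vIM DK _ (principal_nz fK Osb sb0) (ipow_nz DK l (imI_nz DK hk nA'))).
  rewrite (vIM DK _ (principal_nz fK Osb' sb0') (ipow_nz DK l (imI_nz DK hk nA))) !(vI_pow DK) //; try exact: (imI_nz DK hk).
  by rewrite (gideal_im gp' gp pp kn) (gideal_im gp gp pp kn) !muln0 !addn0.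
have e3 : (v (principal K (autX sg k b)) + v (principal K b') = v (principal K b) + v (principal K (autX sg k b')))%N.
  rewrite /v -!/(ve K (pi p) _) -(veM DK (pi p) Osb Ob' sb0 b0') E.
  by rewrite (veM DK (pi p) Ob Osb' b0 sb0').
move: e1; rewrite /v (gideal_vI gp gp pp) pp (gideal_vI gp' gp pp) (negPf pp') muln0 muln1 addn0 => e1.
by move: e3 e1 l0; rewrite e2 /v; lia.
Qed.
End GoodIdeals.
End Separation.

Lemma sum_sub (s s' : seq algC) (f : algC -> algC) : uniq s -> uniq s' -> {subset s' <= s} -> (forall x, x \in s -> `|f x| <= 1) ->
  `|\sum_(x <- s) f x - \sum_(x <- s') f x| <= (size s - size s')%:R.
Proof.
move=> us us' sub hf; have p : perm_eq s (s' ++ [seq x <- s | x \notin s']).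
  apply: uniq_perm => //.
    rewrite cat_uniq us' filter_uniq // andbT; apply/hasPn => x; rewrite mem_filter => /andP[] //.
  move=> x; rewrite mem_cat mem_filter; case: (boolP (x \in s')) => //= xs'; exact: sub.
rewrite (perm_big _ p) big_cat /= addrAC subrr add0r (perm_size p) size_cat addKn.
apply: le_trans (ler_norm_sum _ _ _) _; rewrite -sum1_size natr_sum !big_seq.
by apply: ler_sum => x; rewrite mem_filter => /andP[_ xs]; exact: hf.
Qed.

Lemma expn_diff a b d : (b <= a)%N -> (a ^ d - b ^ d <= d * (a - b) * a ^ d.-1)%N.
Proof.
move=> ba; case: d => [|d]; first by rewrite subnn.
rewrite subn_exp [X in (_ <= X * _)%N]mulnC -mulnA leq_mul2l; apply/orP; right.
rewrite /= -[X in (_ <= X * _)%N](card_ord d.+1) -sum_nat_const; apply: leq_sum => i _.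
rewrite -[X in (_ <= a ^ X)%N](subnK (_ : i <= d)%N); last by rewrite -ltnS ltn_ord.
by rewrite expnD leq_mul2l expn_mono ?orbT.
Qed.

(** * Moments of power residue symbols *)

Section CharSum.
Variables (L : cset) (d : nat) (s : 'I_d -> aut) (w : 'I_d -> algC) (D : nfdata L s w).
Let sL := nfdata_sub D.

Lemma box_uniq A : uniq (box w A).
Proof.
rewrite map_inj_uniq ?enum_uniq // => f g /(ev_inj D) E; apply/ffunP => j; apply: ord_inj.
by have := congr1 (fun v : 'rV[int]_d => v 0 j) E; rewrite !mxE => /addIr [].
Qed.
Lemma box_coord A x : x \in box w A -> exists2 v : 'rV[int]_d, x = ev w v & forall j, (`|v ord0 j| <= A)%N.
Proof.
move=> /mapP[f _ ->]; exists (\row_j ((f j)%:Z - A%:Z)) => // j; rewrite mxE.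
by have := ltn_ord (f j); move: (nat_of_ord (f j)) => t; lia.
Qed.
Lemma box_add A B x y : x \in box w A -> y \in box w B -> x + y \in box w (A + B).
Proof.
move=> /box_coord[v -> hv] /box_coord[v' -> hv'].
have -> : ev w v + ev w v' = ev w (v + v').
  by rewrite -big_split; apply: eq_bigr => j _; rewrite mxE rmorphD mulrDl.
apply: mem_box => j; rewrite mxE; have := hv j; have := hv' j.
by move: (v ord0 j) (v' ord0 j) => a b; lia.
Qed.

(** Minkowski gives z0 in I with conjugates of order N(I)^(1/d), and every class modulo I is reduced
    modulo z0. The constant C does not depend on I. *)
Lemma small_reps : exists C : nat, (0 < C)%N /\ forall I, nonzero_ideal L I -> exists h (r : 'I_(normI L I) -> algC),
  [/\ (h ^ d <= C * normI L I)%N, forall i, r i \in box w h, forall i j, I (r i - r j) -> i = j &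
   forall x, OK L x -> exists i, I (x - r i)].
Proof.
pose W := \matrix_(i, j) s i (w j); pose rD := (Num.truncn `|\det W|).+1.
have hrD : `|\det W| <= rD%:R := trunc_ub (normr_ge0 _).
have d0 := qdata_pos (nfdata_qdata D); have [C1 HC1] := coord_bound D.
have [C3 [_ hC3']] := norm_ub (fun i => \sum_j `|s i (w j)|).
have hC3 i : \sum_j `|s i (w j)| <= C3%:R by have := hC3' i; rewrite ger0_norm // sumr_ge0.
exists (((C1 * C3) ^ d * (2 ^ d * (minkC d * rD))).+1); split => // I nI; have NI := normI_gt0 D nI.
have [|h0 [h00 hb hb1 hb2]] := @root_ceil d (minkC d * rD * normI L I) d0; first by rewrite !muln_gt0.
have [|||z0 [Iz z00 hz]] := @minkowski L d s w D I (fun _ => h0%:R) nI.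
- by move=> i; rewrite ltr0n.
- by [].
- rewrite prodr_const card_ord; apply: le_trans (_ : (minkC d * rD * normI L I)%:R <= _).
    by rewrite !natrM mulrAC ler_wpM2r ?ler0n // ler_wpM2l ?ler0n.
  by rewrite -natrX ler_nat.
have Oz := idsub nI.1 Iz.
(* Subtracting z0 times the integral part of y / z0, taken coordinatewise, leaves z0 times a vector
   with coordinates in [0, 1). *)
have red y : OK L y -> exists2 y', y' \in box w (C1 * C3 * h0) & I (y - y').
  move=> Oy; have Lyz : L (y / z0) by apply: (sfdiv sL); [case: Oy | case: Oz].
  have [q Eq] := (let: And5 _ _ h _ _ := nfdata_qdata D in h) _ Lyz.
  pose t := \sum_i (Num.floor (q i))%:~R * w i.
  have Ot : OK L t by apply: (id_sum _ sL (OK_ideal sL)) => i _; apply: OK_mul => //; [exact: OK_int | case: D => _ h _ _ _; apply: h].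
  pose y' := y - z0 * t; have Oy' : OK L y' by apply: OK_sub => //; apply: OK_mul.
  have Ey' : y' = z0 * \sum_i ratr (q i - (Num.floor (q i))%:~R) * w i.
    rewrite /y' -{1}(divfK z00 y) mulrC -mulrBr Eq -sumrB; congr (_ * _); apply: eq_bigr => i _.
    by rewrite -mulrBl rmorphB /= rmorph_int.
  exists y'; last by rewrite /y' opprB addrC subrK; apply: (idmulr nI.1).
  have [v Ev] := (OK_ev D y').1 Oy'; rewrite Ev; apply: mem_box => j.
  rewrite -mulnA; apply: HC1 => i; rewrite -Ev Ey' rmorphM normrM natrM [leRHS]mulrC.
  apply: ler_pM; rewrite ?normr_ge0 //.
  apply: le_trans (hC3 i); rewrite rmorph_sum; apply: le_trans (ler_norm_sum _ _ _) _.
  apply: ler_sum => k _; rewrite rmorphM normrM fmorph_rat; apply: ler_piMl => //.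
  have fl := Num.Theory.floor_itv (q k).
  rewrite ger0_norm ?ler0q; last by rewrite subr_ge0; case/andP: fl.
  rewrite -(rmorph1 (ratr : rat -> algC)) ler_rat lerBlDl; case/andP: fl => _ /ltW.
  by rewrite intrD.
have [r [rO ru rc]] := normIP D nI.
have [r' Hr'] := choice_ord (P := fun i y' => y' \in box w (C1 * C3 * h0) /\ I (r i - y')) (fun i => let: ex_intro2 y' a b := red _ (rO i) in ex_intro _ y' (conj a b)).
have aI := id_addcl sL nI.1.
exists (C1 * C3 * h0)%N, r'; split.
- rewrite expnMn mulSn; apply: leq_trans (leq_addl _ _); rewrite -!mulnA leq_mul2l; apply/orP; right.
  by move: hb2; rewrite !mulnA.
- by move=> i; case: (Hr' i).
- move=> i j h; apply: ru; have [_ hi] := Hr' i; have [_ hj] := Hr' j.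
  have -> : r i - r j = (r i - r' i) + (r' i - r' j) - (r j - r' j) by ring.
  by apply: aI.2 => //; apply: (addclD aI).
move=> x Ox; have [i hi] := rc x Ox; exists i; have [_ hri] := Hr' i.
by rewrite -(subrKA (r i)); apply: (addclD aI).
Qed.

(** Multiplication by u permutes the classes modulo I and multiplies f by c, so f sums to 0 over
    every full residue system. The box is compared with the translates by r_i of a smaller box;
    summing over i, only boundary layers of width h remain. *)
Lemma char_sum I h (r : 'I_(normI L I) -> algC) (f : algC -> algC) (u c : algC) (A : nat) : nonzero_ideal L I ->
  (forall i, r i \in box w h) -> (forall i j, I (r i - r j) -> i = j) -> (forall x, OK L x -> exists i, I (x - r i)) ->
  (forall x, OK L x -> `|f x| <= 1) -> (forall x y, OK L x -> OK L y -> I (x - y) -> f x = f y) ->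
  OK L u -> (forall x, OK L x -> I (u * x) -> I x) -> (forall x, OK L x -> f (u * x) = c * f x) -> c != 1 ->
  `|\sum_(x <- box w A) f x| <= (d * (2 * h) * (A + A).+1 ^ d.-1)%:R.
Proof.
move=> nI rb ru rc f1 fI Ou Iu fu c1; have aI := id_addcl sL nI.1; have NI := normI_gt0 D nI.
have rO i : OK L (r i) := box_OK D (rb i).
have sys (rho : 'I_(normI L I) -> algC) : (forall i, OK L (rho i)) -> (forall i j, I (rho i - rho j) -> i = j) ->
   \sum_i f (rho i) = \sum_i f (r i).
  move=> Or rr; have [g Hg] := choice_ord (P := fun i j => I (rho i - r j)) (fun i => rc _ (Or i)).
  have gI : injective g.
    move=> i j E; apply: rr; have -> : rho i - rho j = (rho i - r (g i)) - (rho j - r (g j)) by rewrite E; ring.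
    exact: aI.2.
  rewrite [RHS](reindex_inj gI); apply: eq_bigr => i _; exact: fI.
have zero x : OK L x -> \sum_i f (x + r i) = 0.
  move=> Ox; pose rho i := x + r i; have Orho i : OK L (rho i) by apply: OK_add.
  have rr i j : I (rho i - rho j) -> i = j by move=> h'; apply: ru; move: h'; rewrite /rho; have -> // : x + r i - (x + r j) = r i - r j by ring.
  have E : \sum_i f (u * rho i) = \sum_i f (rho i).
    rewrite (sys rho) // (sys (fun i => u * rho i)) //; first by move=> i; apply: OK_mul.
    by move=> i j; rewrite -mulrBr => /Iu h'; apply: rr; apply: h'; apply: OK_sub.
  have : (c - 1) * \sum_i f (rho i) = 0.
    by rewrite mulrBl mul1r mulr_sumr -[X in _ - X]E; apply/eqP; rewrite subr_eq0; apply/eqP/eq_bigr => i _; rewrite fu.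
  by move/eqP; rewrite mulf_eq0 subr_eq0 (negPf c1) => /eqP.
pose A' := (A - h)%N.
have [hA|hA] := leqP h A; last first.
  apply: le_trans (_ : ((A + A).+1 ^ d)%:R <= _).
    apply: le_trans (ler_norm_sum _ _ _) _; rewrite -(size_box w) -sum1_size natr_sum big_seq [leRHS]big_seq.
    by apply: ler_sum => x xb; apply: f1; exact: (box_OK D xb).
  have d0 := qdata_pos (nfdata_qdata D); rewrite ler_nat -{1}(prednK d0) expnS leq_mul2r; apply/orP; right.
  apply: leq_trans (_ : 2 * h <= _)%N; last by rewrite leq_pmull.
  by rewrite mul2n -addnn ltn_addr // ltnW // ltn_add2l || (move: hA; clear; lia).
have S0 : \sum_(i < normI L I) \sum_(y <- [seq x + r i | x <- box w A']) f y = 0.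
  rewrite (eq_bigr (fun i => \sum_(x <- box w A') f (x + r i))); last by move=> i _; rewrite big_map.
  rewrite exchange_big big_seq big1 //= => x xb; apply: zero; exact: (box_OK D xb).
have key i : `|\sum_(x <- box w A) f x - \sum_(y <- [seq x + r i | x <- box w A']) f y| <= (d * (2 * h) * (A + A).+1 ^ d.-1)%:R.
  apply: le_trans (sum_sub (box_uniq A) _ _ _) _.
  - by rewrite map_inj_uniq ?box_uniq //; exact: addIr.
  - by move=> y /mapP[x xb ->]; rewrite -(subnK hA); exact: box_add.
  - by move=> x xb; apply: f1; exact: (box_OK D xb).
  rewrite ler_nat [X in (_ - X)%N]size_map !size_box.
  have le : ((A' + A').+1 <= (A + A).+1)%N by rewrite ltnS leq_add // leq_subr.
  apply: leq_trans (expn_diff d le) _; rewrite leq_mul2r; apply/orP; right; rewrite leq_mul2l; apply/orP; right.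
  by rewrite /A'; move: hA; clear; lia.
have N0 : (normI L I)%:R != 0 :> algC by rewrite pnatr_eq0 -lt0n.
have E : (normI L I)%:R * \sum_(x <- box w A) f x =
    \sum_(i < normI L I) (\sum_(x <- box w A) f x - \sum_(y <- [seq x + r i | x <- box w A']) f y).
  by rewrite sumrB S0 subr0 sumr_const card_ord mulr_natl.
have N0' : (0 : algC) < (normI L I)%:R by rewrite ltr0n.
rewrite -(ler_pM2l N0') -[X in X * `|_|]normr_nat -normrM E; apply: le_trans (ler_norm_sum _ _ _) _.
apply: le_trans (ler_sum _ (fun i _ => key i)) _.
by rewrite sumr_const card_ord mulr_natl.
Qed.
End CharSum.

Lemma imI_invP nu (I : cset) x : imI (aut_inv nu) I x <-> I (nu x).
Proof. by rewrite -{1}(autK nu x); apply: imI_mem. Qed.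

(** A 2k-tuple in which no value occurs exactly once has at most k distinct values, so it factors
    through a set of k elements. *)
Lemma card_no_single k r : (0 < k)%N ->
  (#|[set ph : {ffun 'I_(k + k) -> 'I_r} | [forall q, #|[set t | ph t == q]| != 1%N]]| <= r ^ k * k ^ (k + k))%N.
Proof.
case: k => // k' _; set k := k'.+1.
pose cmp (gh : {ffun 'I_k -> 'I_r} * {ffun 'I_(k + k) -> 'I_k}) : {ffun 'I_(k + k) -> 'I_r} := [ffun t => gh.1 (gh.2 t)].
suff sub : [set ph : {ffun 'I_(k + k) -> 'I_r} | [forall q, #|[set t | ph t == q]| != 1%N]] \subset cmp @: setT.
  apply: leq_trans (subset_leq_card sub) _; apply: leq_trans (leq_imset_card _ _) _.
  by rewrite cardsT card_prod !card_ffun !card_ord.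
apply/subsetP => ph; rewrite inE => /forallP nh; pose im := undup (codom ph).
have t0 : 'I_(k + k) by exact: ord0.
have sz : (size im <= k)%N.
  have E : (\sum_(q <- im) #|[set t | ph t == q]| = k + k)%N.
    rewrite big_uniq ?undup_uniq //=.
    transitivity (\sum_(t < k + k) 1)%N; last by rewrite sum_nat_const card_ord muln1.
    rewrite (partition_big (fun t => ph t) (mem im)) /=; last by move=> t _; rewrite mem_undup codom_f.
    by apply: eq_bigr => q _; rewrite sum1dep_card; apply: eq_card => t; rewrite !inE.
  have : (\sum_(q <- im) 2 <= k + k)%N.
    rewrite -E big_seq [leqRHS]big_seq; apply: leq_sum => q; rewrite mem_undup => /codomP[t ->].
    rewrite ltn_neqAle eq_sym nh card_gt0; apply/set0Pn; exists t; by rewrite inE.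
  by rewrite big_const_seq count_predT iter_addn addn0 mul2n -addnn; lia.
apply/imsetP; exists ([ffun a : 'I_k => nth (ph t0) im a], [ffun t => inord (index (ph t) im)]) => //.
apply/ffunP => t; rewrite !ffunE /= inordK.
  by rewrite nth_index // mem_undup codom_f.
by apply: leq_trans sz; rewrite index_mem mem_undup codom_f.
Qed.

Lemma prodI_sub K d (s : 'I_d -> aut) w (D : nfdata K s w) l Q x : primes_of K l -> Q \in l -> prodI K l x -> Q x.
Proof.
move=> lP Ql; have [] := vI_gt0 D (lP _ Ql) (prodI_nz D lP).
by rewrite (vI_prodI D _ lP) => h _; apply: h; rewrite -has_count has_pred1.
Qed.

Section Moment.
Variables (F L : cset) (n : nat) (z : algC).
Variables (d : nat) (s : 'I_d -> aut) (w : 'I_d -> algC) (D : nfdata L s w).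
Hypotheses (FL : Defs.subset F L) (n1 : (1 < n)%N) (pz : n.-primitive_root z) (Lz : L z).
Hypothesis agr : generated_over F L z.
Variables (e : 'I_(totient n) -> 'I_n) (tau : 'I_(totient n) -> aut).
Hypothesis T : tau_data F z e tau.
Variable ie : 'I_(totient n) -> nat.
Hypothesis hie : forall i, (ie i * e i = 1 %[mod n])%N.
Let sL := nfdata_sub D.
Let n0 : (0 < n)%N. Proof. exact: ltnW. Qed.
Let tO i x : OK L x -> OK L (tau i x) := tau_OK D FL Lz agr T i (x := x).
Let tL i x : L x -> L (tau i x) := tau_L D FL Lz agr T i (x := x).
Let Th := Theta ie tau.

Lemma Theta_OK' x : OK L x -> OK L (Th x).
Proof.
move=> Ox; rewrite /Th /Theta; apply: (big_ind (OK L)); [exact: OK1 | by move=> a b; exact: OK_mul |].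
by move=> i _; apply: (OK_X D); apply: tO.
Qed.
Lemma ThetaM x y : Th (x * y) = Th x * Th y.
Proof. by rewrite /Th /Theta -big_split; apply: eq_bigr => i _; rewrite rmorphM exprMn. Qed.
Lemma Theta_nz x : x != 0 -> Th x != 0.
Proof. by move=> x0; apply/prodf_neq0 => i _; rewrite expf_neq0 // fmorph_eq0. Qed.

Lemma Theta_bound b : OK L b -> exists C : nat, (0 < C)%N /\ forall A x, (0 < A)%N -> x \in box w A ->
  (nmn s (Th x * b)%R <= C * A ^ (d * \sum_i ie i))%N.
Proof.
move=> Ob; have [c [c0 hc']] := norm_ub (fun ij : 'I_d * 'I_(totient n) => \sum_k `|s ij.1 (tau ij.2 (w k))|).
have hc i j : \sum_k `|s i (tau j (w k))| <= c%:R by have := hc' (i, j); rewrite ger0_norm // sumr_ge0.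
have [bb [bb0 hb]] := norm_ub (fun i => s i b).
set E := (\sum_i ie i)%N; exists (((c ^ E) * bb) ^ d)%N; split; first by rewrite expn_gt0 muln_gt0 expn_gt0 c0 bb0.
move=> A x A0 xb; have Ox := box_OK D xb; have [v Ex hv] := box_coord xb.
have hx i j : `|s i (tau j x)| <= (c * A)%:R.
  rewrite Ex /ev !rmorph_sum; apply: le_trans (ler_norm_sum _ _ _) _.
  apply: le_trans (_ : \sum_k A%:R * `|s i (tau j (w k))| <= _).
    apply: ler_sum => k _; rewrite !rmorphM !rmorph_int normrM ler_wpM2r //.
    by rewrite -intr_norm -natr_absz ler_nat; exact: hv.
  by rewrite -mulr_sumr natrM mulrC ler_wpM2r.
rewrite -(ler_nat algC) (nmnE D); last by apply: OK_mul => //; exact: Theta_OK'.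
rewrite /nm normr_prod; apply: le_trans (_ : \prod_(i < d) (((c * A) ^ E * bb)%:R : algC) <= _).
  apply: ler_prod => i _; rewrite normr_ge0 /= rmorphM normrM natrM ler_pM // /Th /Theta rmorph_prod normr_prod.
  rewrite natrX expr_sum; apply: ler_prod => j _; rewrite normr_ge0 /= rmorphXn normrX.
  by apply: lerXn2r; rewrite ?nnegrE.
by rewrite prodr_const card_ord -natrX ler_nat (mulnC d) expnM -expnMn mulnAC -expnMn.
Qed.

Variables (r B : nat) (P : 'I_r -> cset) (p : 'I_r -> nat).
Hypothesis pP : forall q, prime_ideal L (P q).
Hypothesis pp : forall q, prime (p q).
Hypothesis Pp : forall q, P q (p q)%:R.
Hypothesis Pn : forall q, ~ P q n%:R.
Hypothesis P1 : forall q x, OK L x -> exists a : nat, P q (x - a%:R).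
Hypothesis pinj : injective p.
Hypothesis pB : forall q, (p q <= B)%N.

Let ch q := chi (P q) (p q) z n1.
Let cM q := chiM D (pP q) (pp q) (Pp q) (@P1 q) n1 pz Lz (@Pn q).
Let cX q := chiX D (pP q) (pp q) (Pp q) (@P1 q) n1 pz Lz (@Pn q).
Let cmod q := chi_mod D (pP q) (pp q) (Pp q) (@P1 q) n1 pz Lz (@Pn q).
Let croot q := chi_root D (pP q) (pp q) (Pp q) (@P1 q) n1 pz Lz (@Pn q).
Let c1 q := chi1 D (pP q) (pp q) (Pp q) (@P1 q) n1 pz Lz (@Pn q).
(** The prime tau_i^(-1)(P_q). The symbol of Theta(x) at P_q depends on x modulo all [Ti q i], a
    modulus of norm p_q^phi(n). *)
Let Ti q i := imI (aut_inv (tau i)) (P q).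

Lemma Ti_prime q i : prime_ideal L (Ti q i).
Proof. by apply: (imI_prime D) => // x; apply: (inv_K D); apply: tL. Qed.
Lemma Ti_mem q i x : Ti q i x <-> P q (tau i x).
Proof. exact: imI_invP. Qed.
Lemma Ti_norm q i : normI L (Ti q i) = p q.
Proof.
rewrite (imI_normI D); [exact: (deg1_norm D (pP q) (pp q) (Pp q) (@P1 q)) | by move=> x; apply: (inv_K D); apply: tL | exact: primeP_nz].
Qed.
(** The norm recovers q. For equal q, z is congruent to a rational integer modulo P_q since the
    degree is one; if the primes for i and i' coincided, z and its power of exponent e_i / e_i'
    would be congruent modulo P_q, which forces e_i = e_i'. *)
Lemma Ti_inj q i q' i' : Ti q i = Ti q' i' -> q = q' /\ i = i'.
Proof.
move=> E; have Eq : q = q' by apply: pinj; rewrite -(Ti_norm q i) E Ti_norm.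
split=> //; subst q'; have [a0 Ha] := P1 q (OKz D pz Lz 1); rewrite expr1 in Ha.
have [ei _ _ _ tz] := T.
pose x i'' := aut_inv (tau i'') z.
have h i'' : P q (tau i'' (x i'' - a0%:R)) by rewrite rmorphB rmorph_nat /x aut_invK; exact: Ha.
have Ox i'' : OK L (x i'') by apply: (inv_OK D) => //; [exact: tL | have := OKz D pz Lz 1; rewrite expr1].
have hc := P_sym D (pP q) Ha; have h' : P q (tau i (x i' - a0%:R)).
  by apply/Ti_mem; rewrite E; apply/Ti_mem.
have xz : exists f : nat, (f * e i' = 1 %[mod n])%N /\ x i' = z ^+ f.
  exists (ie i'); split=> //; rewrite /x; apply: (fmorph_inj (tau i')); rewrite aut_invK rmorphXn tz -exprM.
  by rewrite -(prim_expr_mod pz) mulnC hie (prim_expr_mod pz) expr1.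
have [f [Ef xf]] := xz; have := h'; rewrite xf rmorphB rmorph_nat rmorphXn tz -exprM => h2.
have h3 : P q (z ^+ (e i * f) - z) by apply: (P_trans D (pP q) h2).
have E1 : Ordinal (ltn_pmod (e i * f) n0) = Ordinal n1.
  by apply: (zk_inj D (pP q) pz Lz (@Pn q)); rewrite /= (prim_expr_mod pz) expr1.
have E2 : (e i * f = 1 %[mod n])%N by have := congr1 (@nat_of_ord n) E1; rewrite /= => ->; rewrite modn_small.
apply: ei; apply: val_inj => /=; rewrite -(modn_small (ltn_ord (e i))) -(modn_small (ltn_ord (e i'))).
by rewrite -[X in (X %% _)%N]muln1 -modnMmr -Ef modnMmr mulnA -modnMml E2 modnMml mul1n.
Qed.

Lemma chi_Theta_mod q x y : OK L x -> OK L y -> (forall i, Ti q i (x - y)) -> P q (Th x - Th y).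
Proof.
move=> Ox Oy h; have hP := primeP_id (pP q); have aP := id_addcl sL hP; rewrite /Th /Theta.
elim: (index_enum _) => [|i l IH]; first by rewrite !big_nil subrr; exact: aP.1.
have Op (t : algC) : OK L t -> OK L (\prod_(j <- l) tau j t ^+ ie j).
  move=> Ot; apply: (big_ind (OK L)); [exact: OK1 | by move=> a b; exact: OK_mul |].
  by move=> j _; apply: (OK_X D); apply: tO.
rewrite !big_cons; set a := tau i x ^+ _; set b := tau i y ^+ _; set X := \prod_(j <- l) _ in IH *; set Y := \prod_(j <- l) _ in IH *.
have -> : a * X - b * Y = (a - b) * X + b * (X - Y) by ring.
apply: (addclD aP); first apply: (idmulr hP); rewrite ?/X; try exact: Op.
  apply: (P_subX D (pP q)); [exact: tO | exact: tO |]; rewrite -rmorphB; by apply/Ti_mem.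
by apply: (idmul hP) => //; apply: (OK_X D); apply: tO.
Qed.

Variables (C H k A : nat).
Hypothesis hC : forall I, nonzero_ideal L I -> exists h (rr : 'I_(normI L I) -> algC),
  [/\ (h ^ d <= C * normI L I)%N, forall i, rr i \in box w h, forall i j, I (rr i - rr j) -> i = j &
   forall x, OK L x -> exists i, I (x - rr i)].
Hypotheses (k0 : (0 < k)%N) (B0 : (0 < B)%N) (hH : (C * B ^ (totient n * (k + k)) <= H ^ d)%N).
Variable b : algC.
Hypotheses (Ob : OK L b).
Let f q x := ch q (Th x * b).

Lemma f_norm q x : OK L x -> `|f q x| <= 1.
Proof. by move=> Ox; apply: (chi_norm D (pP q) (pp q) (Pp q) (@P1 q) n1 pz Lz (@Pn q)); apply: OK_mul => //; exact: Theta_OK'. Qed.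

(** The factor in position t of the expansion of S^k times the conjugate of S^k: the first k
    positions carry the symbol, the last k its conjugate. *)
Let gt j (t : 'I_(k + k)) q x := if (t < k)%N then f q x ^+ j else (f q x ^+ j)^*.

(* A prime q0 occurring once contributes a nontrivial character, so the sum over full residue systems vanishes and only
   the boundary of the box remains. *)
Lemma slot_sum j (ph : {ffun 'I_(k + k) -> 'I_r}) q0 : (0 < j < n)%N -> #|[set t | ph t == q0]| = 1%N ->
  `|\sum_(x <- box w A) \prod_t gt j t (ph t) x| <= (d * (2 * H) * (A + A).+1 ^ d.-1)%:R.
Proof.
move=> jn /eqP/cards1P[t0 Et0].
have pt0 : ph t0 = q0 by have := set11 t0; rewrite -Et0 inE => /eqP.
have ptn t : t != t0 -> ph t != q0 by move=> tt; rewrite -in_set1 -Et0 inE in tt.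
pose l := undup [seq Ti (ph t) i | t <- enum 'I_(k + k), i <- enum 'I_(totient n)].
have lP : primes_of L l by move=> Q; rewrite mem_undup => /allpairsP[[t i] /= [_ _ ->]]; exact: Ti_prime.
have lin t i : Ti (ph t) i \in l by rewrite mem_undup; apply/allpairsP; exists (t, i); rewrite !mem_enum.
have ul : uniq l := undup_uniq _.
set I := prodI L l; have nI : nonzero_ideal L I := prodI_nz D lP.
have NI : (normI L I <= B ^ (totient n * (k + k)))%N.
  have -> : normI L I = (\prod_(Q <- l) normI L Q)%N by rewrite (normI_prodI D lP).
  apply: leq_trans (_ : \prod_(Q <- l) B <= _)%N.
    rewrite !big_seq; apply: leq_prod => Q; rewrite mem_undup => /allpairsP[[t i] /= [_ _ ->]].
    by rewrite Ti_norm.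
  rewrite big_const_seq count_predT iter_muln muln1; apply: leq_pexp2l => //.
  by apply: leq_trans (size_undup _) _; rewrite size_allpairs !size_enum_ord mulnC.
have [h [rr [hh rb ru rc]]] := hC nI.
have hH' : (h <= H)%N.
  rewrite -(leq_exp2r _ _ (qdata_pos (nfdata_qdata D))); apply: leq_trans hh _; apply: leq_trans hH.
  by rewrite leq_mul2l NI orbT.
have [i0 _] := tau_id pz agr T.
(* The i0-th factor of Theta raises to the power ie_i0, a unit modulo n, so the character seen at
   [Ti q0 i0] is still nontrivial. *)
pose j' := ((ie i0 * j) %% n)%N.
have jn' : (0 < j' < n)%N.
  rewrite ltn_mod n0 andbT lt0n; apply/eqP => E; have := hie i0 => E2.
  have : (j %% n = 0)%N.
    rewrite -[X in (X %% _)%N]mul1n -modnMml -E2 modnMml mulnAC.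
    by rewrite -modnMml -/j' E mul0n mod0n.
  by case/andP: jn => j0 jn; rewrite modn_small //; case: (j) j0.
have [v [Pv vj]] := chi_nontrivial D (pP q0) (pp q0) (Pp q0) (@P1 q0) n1 pz Lz (@Pn q0) jn'.
pose Q0 := Ti q0 i0; have pQ0 : prime_ideal L Q0 := Ti_prime q0 i0.
pose l' := [seq Q <- l | Q != Q0].
have lP' : primes_of L l' by move=> Q; rewrite mem_filter => /andP[_ /lP].
have [w' w'l w'Q] : exists2 w', prodI L l' w' & ~ Q0 w'.
  apply: NNPP => nh; have : Q0 \in l'.
    by apply: (prime_prodI D pQ0 lP') => x hx; apply: NNPP => nx; apply: nh; exists x.
  by rewrite mem_filter eqxx.
have Ow' : OK L w' := idsub (prodI_id D lP') w'l.
have [t' Ot' ht'] := unit_mod D pQ0 Ow' w'Q.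
have Ov := OK_nat v sL; have O1 := OK1 sL.
(* Chinese remainder: u is v modulo Q0 and 1 modulo all other primes of the modulus, so
   multiplication by u changes only the position t0. *)
pose u := 1 + w' * t' * (v%:R - 1).
have Owt : OK L (w' * t') by apply: OK_mul.
have Ovm : OK L (v%:R - 1) by apply: OK_sub.
have Ou : OK L u by apply: OK_add => //; apply: OK_mul.
have uQ0 : Q0 (u - v%:R).
  have -> : u - v%:R = (1 - w' * t') * (1 - v%:R) by rewrite /u; ring.
  by apply: (idmulr (primeP_id pQ0)) => //; apply: OK_sub.
have uQ Q : Q \in l -> Q != Q0 -> Q (u - 1).
  move=> Ql QQ; have Ql' : Q \in l' by rewrite mem_filter QQ.
  have -> : u - 1 = w' * (t' * (v%:R - 1)) by rewrite /u; ring.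
  have hQ := primeP_id (lP _ Ql); apply: (idmulr hQ); first by apply: OK_mul.
  exact: (prodI_sub D lP' Ql').
have uno Q : Q \in l -> ~ Q u.
  move=> Ql; have pQ := lP _ Ql; have aQ := id_addcl sL (primeP_id pQ); case: (eqVneq Q Q0) => [->|QQ] Qu.
    have : Q0 (v%:R) by have := (id_addcl sL (primeP_id pQ0)).2 _ _ Qu uQ0; rewrite subKr.
    by move/Ti_mem; rewrite rmorph_nat.
  by apply: pQ.2.1; have := aQ.2 _ _ Qu (uQ _ Ql QQ); rewrite subKr.
have chu1 t : t != t0 -> ch (ph t) (Th u) = 1.
  move=> tt; rewrite -(c1 (ph t)).
  apply: cmod => //; [exact: Theta_OK' |].
  have -> : 1 = Th 1 by rewrite /Th /Theta big1 // => i _; rewrite rmorph1 expr1n.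
  apply: chi_Theta_mod => // i; apply: uQ => //; apply/eqP => /Ti_inj[E _].
  by move: (ptn _ tt); rewrite E eqxx.
pose c0 := ch q0 (Th u).
have Ec0 : c0 = ch q0 v%:R ^+ ie i0.
  rewrite /c0 -(cX q0 _ Ov).
  apply: cmod => //; [exact: Theta_OK' | exact: (OK_X D) |].
  have hP := primeP_id (pP q0); have aP := id_addcl sL hP.
  pose X := \prod_(i | i != i0) tau i u ^+ ie i.
  have OX : OK L X.
    apply: (big_ind (OK L)); [exact: OK1 | by move=> a c; exact: OK_mul |].
    by move=> i _; apply: (OK_X D); apply: tO.
  have hX : P q0 (X - 1).
    suff [] : P q0 (X - 1) /\ OK L X by [].
    apply: (big_ind (fun t => P q0 (t - 1) /\ OK L t)) => [|x y [hx Ox] [hy Oy]|i ii].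
    - by split => //; rewrite subrr; exact: aP.1.
    - split; last exact: OK_mul.
      have -> : x * y - 1 = (x - 1) * y + (y - 1) by ring.
      by apply: (addclD aP) => //; apply: (idmulr hP).
    - split; last by apply: (OK_X D); apply: tO.
      rewrite -(expr1n _ (ie i)); apply: (P_subX D (pP q0)) => //; first exact: tO.
      rewrite -(rmorph1 (tau i)) -rmorphB; apply/Ti_mem; rewrite -pt0; apply: uQ => //.
      by apply/eqP; rewrite pt0 => /Ti_inj[_ E]; rewrite E eqxx in ii.
  rewrite /Th /Theta (bigD1 i0) //= -/X.
  have h0 : P q0 (tau i0 u ^+ ie i0 - v%:R ^+ ie i0).
    apply: (P_subX D (pP q0)) => //; first exact: tO.
    by rewrite -(rmorph_nat (tau i0) v) -rmorphB; apply/Ti_mem.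
  have -> : tau i0 u ^+ ie i0 * X - v%:R ^+ ie i0 = (tau i0 u ^+ ie i0 - v%:R ^+ ie i0) + tau i0 u ^+ ie i0 * (X - 1) by ring.
  by apply: (addclD aP) => //; apply: (idmul hP) => //; apply: (OK_X D); apply: tO.
have c0j : c0 ^+ j != 1.
  rewrite Ec0 -exprM; have := croot Ov Pv => Er.
  by rewrite (divn_eq (ie i0 * j) n) exprD mulnC exprM Er expr1n mul1r.
pose c := if (t0 < k)%N then c0 ^+ j else (c0 ^+ j)^*.
have cn1 : c != 1.
  rewrite /c; case: ifP => // _; apply: contra c0j => /eqP E; apply/eqP.
  by rewrite -[LHS]conjCK E rmorph1.
have OTh x : OK L x -> OK L (Th x * b) by move=> Ox; apply: OK_mul => //; exact: Theta_OK'.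
apply: le_trans (char_sum D A nI rb ru rc (f := fun x => \prod_t gt j t (ph t) x) (u := u) (c := c) _ _ Ou _ _ cn1) _.
- move=> x Ox; rewrite normr_prod; apply: prodr_ile1 => t _; rewrite normr_ge0 /= /gt.
  by case: ifP => _; rewrite ?norm_conjC normrX exprn_ile1 // f_norm.
- move=> x y Ox Oy hxy; apply: eq_bigr => t _; suff E : f (ph t) x = f (ph t) y by rewrite /gt E.
  apply: cmod => //; [exact: OTh | exact: OTh |]; rewrite -mulrBl; apply: (idmulr (primeP_id (pP _))) => //.
  apply: chi_Theta_mod => // i.
  exact: (prodI_sub D lP (lin t i)).
- move=> x Ox hux; apply: (uniq_prodI_mem D) => // Q Ql; have pQ := lP _ Ql.
  have : Q (u * x) by exact: (prodI_sub D lP Ql).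
  by case/(pQ.2.2 _ _ Ou Ox) => // /(uno _ Ql).
- move=> x Ox; rewrite (bigD1 t0) //= [in RHS](bigD1 t0) //= mulrA; congr (_ * _).
    rewrite pt0 /gt /c /f ThetaM -mulrA /ch cM //; [|exact: Theta_OK'|exact: OTh].
    by case: ifP => _; rewrite exprMn ?rmorphM.
  apply: eq_bigr => t tt; rewrite /gt /f ThetaM -mulrA /ch cM //; [|exact: Theta_OK'|exact: OTh].
  by rewrite -/(ch _ _) chu1 // mul1r.
by rewrite ler_nat leq_mul2r leq_mul2l leq_mul2l hH' !orbT.
Qed.

(** The 2k-th power expands into 2k-tuples of primes. Tuples in which no prime occurs exactly once
    are few by [card_no_single] and are bounded trivially; to every other tuple [slot_sum]
    applies. *)
Lemma moment j : (0 < j < n)%N -> \sum_(x <- box w A) `|\sum_q f q x ^+ j| ^+ (k + k) <=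
  (r ^ k * k ^ (k + k) * (A + A).+1 ^ d + r ^ (k + k) * (d * (2 * H) * (A + A).+1 ^ d.-1))%:R.
Proof.
move=> jn; have Ex x : `|\sum_q f q x ^+ j| ^+ (k + k) = \sum_(ph : {ffun 'I_(k + k) -> 'I_r}) \prod_t gt j t (ph t) x.
  rewrite -(bigA_distr_bigA (fun t q => gt j t q x)) big_split_ord /=.
  rewrite addnn -mul2n exprM normCK exprMn; congr (_ * _).
    transitivity (\prod_(i < k) \sum_q f q x ^+ j); first by rewrite prodr_const card_ord.
    apply: eq_bigr; by move=> t _; apply: eq_bigr => q _; rewrite /gt /= ltn_ord.
  transitivity (\prod_(i < k) (\sum_q f q x ^+ j)^*); first by rewrite prodr_const card_ord.
  apply: eq_bigr; by move=> t _; rewrite rmorph_sum; apply: eq_bigr => q _; rewrite /gt /= ltnNge leq_addr.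
rewrite (eq_bigr _ (fun x _ => Ex x)) exchange_big /=.
have real0 : \sum_(ph : {ffun 'I_(k + k) -> 'I_r}) \sum_(x <- box w A) \prod_t gt j t (ph t) x = `|\sum_(ph : {ffun 'I_(k + k) -> 'I_r}) \sum_(x <- box w A) \prod_t gt j t (ph t) x|.
  by rewrite ger0_norm // exchange_big /=; apply: sumr_ge0 => x _; rewrite -Ex exprn_ge0.
rewrite real0; apply: le_trans (ler_norm_sum _ _ _) _.
pose A0 := [set ph : {ffun 'I_(k + k) -> 'I_r} | [forall q, #|[set t | ph t == q]| != 1%N]].
rewrite (bigID (mem A0)) /= natrD; apply: lerD.
  apply: le_trans (_ : \sum_(ph in A0) ((A + A).+1 ^ d)%:R <= _).
    apply: ler_sum => ph _; apply: le_trans (ler_norm_sum _ _ _) _.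
    rewrite -(size_box w) -sum1_size natr_sum !big_seq; apply: ler_sum => x /(box_OK D) Ox.
    rewrite normr_prod; apply: prodr_ile1 => t _; rewrite normr_ge0 /= /gt.
    by case: ifP => _; rewrite ?norm_conjC normrX exprn_ile1 // f_norm.
  rewrite sumr_const -mulrnA ler_nat mulnC leq_mul2r; apply/orP; right.
  exact: card_no_single.
apply: le_trans (_ : \sum_(ph in ~: A0) (d * (2 * H) * (A + A).+1 ^ d.-1)%:R <= _).
  rewrite (eq_bigl (mem (~: A0))); last by move=> ph; rewrite !inE.
  apply: ler_sum => ph; rewrite !inE => /forallPn[q /negPn/eqP hq]; exact: slot_sum jn hq.
rewrite sumr_const -mulrnA ler_nat mulnC leq_mul2r; apply/orP; right.
by apply: leq_trans (max_card _) _; rewrite card_ffun !card_ord.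
Qed.

Definition bad_list := [seq x <- box w A | has (fun j => r%:R <= (2 * n)%:R * `|\sum_q f q x ^+ j|) (iota 1 n.-1)].

(** Markov's inequality for each exponent 0 < j < n, the threshold r / (2 n) being raised to the
    power 2k. *)
Lemma bad_size : (size bad_list * r ^ (k + k) <= n * ((2 * n) ^ (k + k) * (r ^ k * k ^ (k + k) * (A + A).+1 ^ d + r ^ (k + k) * (d * (2 * H) * (A + A).+1 ^ d.-1))))%N.
Proof.
set RH := (r ^ k * _ * _ + _)%N.
have st j : (0 < j < n)%N -> (count (fun x => r%:R <= (2 * n)%:R * `|\sum_q f q x ^+ j|)%R (box w A) * r ^ (k + k) <= (2 * n) ^ (k + k) * RH)%N.
  move=> jn; rewrite -(ler_nat algC) [leRHS]natrM; apply: le_trans (ler_wpM2l _ (moment jn)); last by rewrite ler0n.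
  rewrite -sum1_count natrM natr_sum mulr_suml mulr_sumr [leLHS]big_mkcond /=; apply: ler_sum => x _.
  case: ifP => h; last by rewrite mulr_ge0 ?ler0n // exprn_ge0.
  by rewrite mul1r !natrX -exprMn; apply: lerXn2r => //; rewrite nnegrE ?mulr_ge0.
apply: leq_trans (_ : \sum_(j <- iota 1 n.-1) (2 * n) ^ (k + k) * RH <= _)%N; last first.
  by rewrite big_const_seq count_predT iter_addn addn0 size_iota mulnC leq_mul2r leq_pred orbT.
apply: leq_trans (_ : \sum_(j <- iota 1 n.-1) count (fun x => r%:R <= (2 * n)%:R * `|\sum_q f q x ^+ j|)%R (box w A) * r ^ (k + k) <= _)%N; last first.
  rewrite big_seq [leqRHS]big_seq; apply: leq_sum => j; rewrite mem_iota => jn; apply: st.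
  by move: jn n0; clear; lia.
rewrite -big_distrl /= leq_mul2r; apply/orP; right; rewrite size_filter.
elim: (iota 1 n.-1) => [|j js IH]; first by rewrite big_nil; rewrite (eq_count (a2 := pred0)) ?count_pred0.
rewrite big_cons; apply: leq_trans (leq_add (leqnn _) IH); rewrite -count_predUI.
exact: leq_trans (leq_addr _ _).
Qed.

(** Orthogonality: the powers of a symbol with exponents 0 <= j < n add up to n at the value 1, to 1
    at the value 0, and to 0 otherwise. Off the bad list the exponents j > 0 contribute less than r
    / 2 together, and the value 0 occurs at most r / 4 times, so n G >= r / 4. *)
Lemma good_count x : x \in box w A -> x \notin bad_list -> (4 * #|[set q | ch q (Th x * b)%R == 0%R]| <= r)%N ->
  (r <= 4 * n * #|[set q | ch q (Th x * b)%R == 1%R]|)%N.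
Proof.
move=> xb; rewrite mem_filter xb andbT -all_predC => /allP nb hZ; have Ox := box_OK D xb.
set Z := #|_| in hZ; set G := #|_|.
have Oy : OK L (Th x * b) by apply: OK_mul => //; exact: Theta_OK'.
have id1 q : \sum_(j < n) f q x ^+ j = (n * (f q x == 1))%:R + (f q x == 0)%:R.
  case: (eqVneq (f q x) 0) => [->|f0].
    rewrite eq_sym oner_eq0 muln0 add0r -(prednK n0) big_ord_recl expr0 big1 ?addr0 // => i _.
    by rewrite expr0n.
  rewrite addr0; case: (eqVneq (f q x) 1) => [->|f1].
    by rewrite muln1 (eq_bigr (fun=> 1)) ?sumr_const ?card_ord // => i _; rewrite expr1n.
  rewrite muln0; have Pq : ~ P q (Th x * b) by move=> h; move/eqP: f0; apply; exact: chi0.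
  have fn : f q x ^+ n = 1 by apply: croot.
  have := subrX1 (f q x) n; rewrite fn subrr => /esym/eqP; rewrite mulf_eq0 subr_eq0 (negPf f1) => /eqP //.
have id2 : r%:R = (n * G + Z)%:R - \sum_(j <- iota 1 n.-1) \sum_q f q x ^+ j.
  have : \sum_q \sum_(j < n) f q x ^+ j = (n * G + Z)%:R.
    rewrite (eq_bigr _ (fun q _ => id1 q)) big_split /= -!natr_sum -big_distrr /= natrD; congr (_ %:R + _%:R).
      by congr (_ * _)%N; rewrite /G -sum1_card [RHS]big_mkcond; apply: eq_bigr => q _; rewrite inE; case: eqP.
    by rewrite /Z -sum1_card [RHS]big_mkcond; apply: eq_bigr => q _; rewrite inE; case: eqP.
  move=> <-; rewrite exchange_big /= -(big_mkord xpredT (fun j => \sum_q f q x ^+ j)) /index_iota subn0.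
  rewrite -{1}(prednK n0) /= big_cons (eq_bigr (fun=> 1)); last by move=> q _; rewrite expr0.
  by rewrite sumr_const card_ord addrK.
have le1 : (2 * n)%:R * `|\sum_(j <- iota 1 n.-1) \sum_q f q x ^+ j| <= (n.-1 * r)%:R.
  apply: le_trans (ler_wpM2l _ (ler_norm_sum _ _ _)) _; first by rewrite ler0n.
  rewrite mulr_sumr [leRHS]natrM; have -> : n.-1%:R = \sum_(j <- iota 1 n.-1) (1 : algC) by rewrite big_const_seq count_predT size_iota iter_addr_0.
  rewrite mulr_suml !big_seq.
  apply: ler_sum => j /nb /= h; rewrite mul1r; apply: ltW; rewrite real_ltNge ?realn //.
  by rewrite realM ?realn ?normr_real.
have : (2 * n * r)%:R <= (2 * n * (n * G + Z) + n.-1 * r)%:R :> algC.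
  rewrite -[leLHS]normr_nat natrM id2 mulrBr; apply: le_trans (ler_normB _ _) _.
  by rewrite [leRHS]natrD; apply: lerD; [rewrite -natrM normr_nat | rewrite normrM normr_nat].
rewrite ler_nat => h; have h2 : (r <= 2 * (n * G + Z))%N.
  have : (n * r <= 2 * n * (n * G + Z))%N.
    have E1 : (2 * n * r = n * r + n * r)%N by rewrite -mulnA mul2n addnn.
    have E2 : (n * r = n.-1 * r + r)%N by rewrite -{1}(prednK n0) mulSn addnC.
    move: h E1 E2; clear; move: (n.-1 * r)%N (n * r)%N (2 * n * r)%N (2 * n * _)%N => ????.
    by lia.
  by rewrite [X in (_ <= X * _)%N]mulnC -mulnA leq_pmul2l.
by move: hZ h2; clear; rewrite -mulnA; move: (n * G)%N => t; lia.
Qed.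

(** The primes with symbol 0 are distinct divisors of Theta(x) b, each of norm at least 2. *)
Lemma zero_count x E : x \in box w A -> x != 0 -> b != 0 -> (nmn s (Th x * b)%R < 2 ^ E)%N ->
  (#|[set q | ch q (Th x * b)%R == 0%R]| <= E)%N.
Proof.
move=> xb x0 b0 hE; have Ox := box_OK D xb; set Zs := [set q | _].
have Oy : OK L (Th x * b) by apply: OK_mul => //; exact: Theta_OK'.
have y0 : Th x * b != 0 by rewrite mulf_neq0 // Theta_nz.
have Pinj : injective P.
  by move=> q q' E'; apply: pinj; rewrite -(deg1_norm D (pP q) (pp q) (Pp q) (@P1 q)) E' (deg1_norm D (pP q') (pp q') (Pp q') (@P1 q')).
pose l := [seq P q | q <- enum Zs].
have lP : primes_of L l by move=> Q /mapP[q _ ->].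
have ul : uniq l by rewrite map_inj_uniq ?enum_uniq.
have : (\prod_(Q <- l) normI L Q <= normI L (principal L (Th x * b)%R))%N.
  apply: (uniq_normI_le D) => //; first exact: (principal_nz sL).
  move=> Q /mapP[q]; rewrite mem_enum inE => /eqP hq -> t ht.
  apply: (principal_sub (primeP_id (pP q)) _ ht).
  apply: NNPP => nP; have [i Ei _] := chiP D (pP q) (pp q) (Pp q) (@P1 q) n1 pz Lz (@Pn q) Oy nP.
  have := croot Oy nP; rewrite -/(ch q _) hq expr0n.
  by case: (n) n0 => // m _ /eqP; rewrite eq_sym oner_eq0.
rewrite (normI_principal D) // => h; have : (2 ^ #|Zs| < 2 ^ E)%N.
  apply: leq_ltn_trans hE; apply: leq_trans h; rewrite big_map cardE.
  elim: (enum Zs) => [|q qs IH]; first by rewrite big_nil.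
  by rewrite big_cons /= expnS; apply: leq_mul => //; exact: (pideal_gt1 D (pP q)).
by rewrite ltn_exp2l // => /ltnW.
Qed.
End Moment.

Section Supply.
Variables (L : cset) (d : nat) (s : 'I_d -> aut) (w : 'I_d -> algC) (D : nfdata L s w).
Let sL := nfdata_sub D.

Lemma norm_eq_deg1 P p : prime_ideal L P -> prime p -> P p%:R -> normI L P = p ->
  forall x, OK L x -> exists a : nat, P (x - a%:R).
Proof.
move=> pP pp Pp E x Ox; have hP := primeP_id pP; have aP := id_addcl sL hP.
have [r [rO ru rc]] := normIP D (primeP_nz pP).
have [g Hg] := choice_ord (P := fun (i : 'I_p) j => P ((i : nat)%:R - r j)) (fun i => rc _ (OK_nat i sL)).
have gI : injective g.
  move=> i j Eg; apply/eqP; have : P ((i : nat)%:R - (j : nat)%:R).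
    have -> : (i : nat)%:R - (j : nat)%:R = ((i : nat)%:R - r (g i)) - ((j : nat)%:R - r (g j)) by rewrite Eg; ring.
    exact: aP.2.
  wlog ij : i j Eg / (j <= i)%N.
    move=> W h; case: (leqP j i) => [|/ltnW] ji; first exact: W.
    by rewrite eq_sym; apply: W => //; rewrite -opprB; apply: (addclN aP).
  rewrite -natrB // => /(nat_inP D pP pp Pp) dv; rewrite -val_eqE eqn_leq ij andbT -subn_eq0.
  apply: contraT; rewrite -lt0n => h; have := dvdn_leq h dv.
  by rewrite leqNgt (leq_ltn_trans (leq_subr _ _) (ltn_ord i)).
have [j Hj] := rc x Ox.
have [i Ei] : exists i, g i = j.
  have /codomP[i ->] : j \in codom g by apply: inj_card_onto => //; rewrite !card_ord E.
  by exists i.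
exists i; have -> : x - (i : nat)%:R = (x - r j) - ((i : nat)%:R - r (g i)) by rewrite Ei; ring.
exact: aP.2.
Qed.

Lemma norm_ge_sq P p : prime_ideal L P -> prime p -> P p%:R -> normI L P <> p -> (p ^ 2 <= normI L P)%N.
Proof.
move=> pP pp Pp ne; have p0 := prime_gt0 pp.
have [A [nA EA]] : exists A, nonzero_ideal L A /\ principal L p%:R = iprod P A.
  have sub x : principal L p%:R x -> P x by exact: (principal_sub (primeP_id pP) Pp).
  have nz := nat_nz D p0; have [A [hA E]] := ideal_dvd D (primeP_nz pP) nz.1 sub.
  by exists A; split => //; exact: (nz_factor D nz E (primeP_id pP) hA).
have : (normI L P %| p ^ d)%N.
  by rewrite -(normI_nat D p0) EA (normIM D (primeP_nz pP) nA) dvdn_mulr.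
case/(dvdn_pfactor _ _ pp) => f _ E; have := pideal_gt1 D pP; move: ne; rewrite E; have p1 := prime_gt1 pp.
case: f {E} => [|[|f]] ne h; [by rewrite expn0 in h | by rewrite expn1 in ne |].
by rewrite leq_exp2l.
Qed.

(** Elements with all conjugates of size about a generate principal ideals of norm O(a^d); two of
    them generating the same ideal differ by a unit with conjugates at most 3, of which there are
    finitely many. *)
Lemma ideals_lower : exists c : nat, (0 < c)%N /\ forall a, (0 < a)%N ->
  (a ^ d <= c * size (msets (normI L) (primesUpto L (c * a ^ d)) (c * a ^ d)))%N.
Proof.
have [C3 [C30 hC3']] := norm_ub (fun i => \sum_j `|s i (w j)|).
have hC3 i : \sum_j `|s i (w j)| <= C3%:R by have := hC3' i; rewrite ger0_norm // sumr_ge0.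
have [Bs HBs] := northcott D 3; pose c := ((3 * C3) ^ d + size Bs)%N.
exists c; split; first by rewrite ltn_addr // expn_gt0 muln_gt0 C30.
move=> a a0; set Q := (c * a ^ d)%N; set ms := msets _ _ _.
have hQ : ((3 * C3 * a) ^ d <= Q)%N by rewrite expnMn leq_mul2r leq_addr orbT.
(* The elements of the box have conjugates at most C3 a; the shift by 2 C3 a places all conjugates
   between C3 a and 3 C3 a, whence the ratio 3. *)
pose X := [seq (2 * C3 * a)%:R + t | t <- box w a].
have uX : uniq X by rewrite map_inj_uniq ?(box_uniq D) //; exact: addrI.
have bx x : x \in X -> OK L x /\ forall i, (C3 * a)%:R <= `|s i x| <= (3 * C3 * a)%:R.
  move=> /mapP[t tb ->]; have Ot := box_OK D tb; split; first by apply: OK_add => //; exact: OK_nat.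
  move=> i; have ht : `|s i t| <= (C3 * a)%:R.
    have [v -> hv] := box_coord tb; rewrite /ev rmorph_sum; apply: le_trans (ler_norm_sum _ _ _) _.
    apply: le_trans (_ : \sum_j a%:R * `|s i (w j)| <= _).
      apply: ler_sum => j _; rewrite rmorphM rmorph_int normrM ler_wpM2r //.
      by rewrite -intr_norm -natr_absz ler_nat; exact: hv.
    by rewrite -mulr_sumr natrM mulrC ler_wpM2r.
  have -> : s i ((2 * C3 * a)%:R + t) = (2 * C3 * a)%:R + s i t by rewrite raddfD /= rmorph_nat.
  apply/andP; split.
    have -> : (C3 * a)%:R = `|(2 * C3 * a)%:R| - (C3 * a)%:R :> algC.
      by rewrite normr_nat -natrB; [congr (_%:R); rewrite -mulnA mul2n -addnn addnK | rewrite -mulnA leq_pmull].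
    rewrite lerBlDr; apply: le_trans (_ : `|(2 * C3 * a)%:R + s i t| + `|s i t| <= _); last by rewrite lerD2l.
    by rewrite -[X in `|X| <= _](addrK (s i t)); exact: ler_normB.
  apply: le_trans (ler_normD _ _) _; rewrite normr_nat.
  have -> : (3 * C3 * a = 2 * C3 * a + C3 * a)%N by rewrite -!mulnA; lia.
  by rewrite natrD lerD2l.
have x0 x : x \in X -> x != 0.
  move=> /bx[_ h]; have := h (Ordinal (qdata_pos (nfdata_qdata D))); apply: contraTneq => ->.
  by rewrite rmorph0 normr0 negb_and; apply/orP; left; rewrite lern0 -lt0n muln_gt0 C30 a0.
pose rep l := epsilon (inhabits 0) (fun x => x \in X /\ prodI L l = principal L x).
have sub : {subset X <= [seq u * rep l | l <- ms, u <- Bs]}.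
  move=> x xX; have [Ox hx] := bx _ xX; have xn := x0 _ xX.
  have nx := principal_nz sL Ox xn.
  have [|l lm El] := ideals_upto D (B := Q) nx.
    rewrite (normI_principal D) //; apply: leq_trans hQ; rewrite -(ler_nat algC) (nmnE D) // /nm normr_prod natrX.
    rewrite -[X in _ ^+ X](card_ord d) -prodr_const; apply: ler_prod => i _; rewrite normr_ge0 /=.
    by case/andP: (hx i).
  have [rX rE] : rep l \in X /\ prodI L l = principal L (rep l).
    by apply: (epsilon_spec (inhabits 0) (fun x => x \in X /\ prodI L l = principal L x)); exists x.
  have [Or hr] := bx _ rX; have rn := x0 _ rX.
  have [u [Ou Eu]] : principal L (rep l) x by rewrite -rE -El; exact: (principal_mem sL).
  apply/allpairsP; exists (l, u) => /=; split => //; last by rewrite mulrC.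
  apply: HBs => // i; have [/andP[lo _] /andP[_ hi]] := (hr i, hx i).
  have p0 : (0 : algC) < (C3 * a)%:R by rewrite ltr0n muln_gt0 C30.
  rewrite -(ler_pM2r p0) -natrM mulnA; apply: le_trans hi.
  have -> : s i x = s i u * s i (rep l) by rewrite Eu rmorphM mulrC.
  by rewrite normrM ler_wpM2l.
have := uniq_leq_size uX sub; rewrite size_allpairs size_map size_box => h.
apply: leq_trans (_ : (a + a).+1 ^ d <= _)%N; first by apply: expn_mono; rewrite leqW // leq_addr.
by apply: leq_trans h _; rewrite mulnC leq_mul2r leq_addl orbT.
Qed.
End Supply.

(** The matrix W of embeddings diagonalises multiplication by w_i w_j, so its trace is the sum of
    the conjugates and the trace matrix is the transpose of W times W. *)
Lemma absdisc_data K d0 (s0 : 'I_d0 -> aut) w0 Dd : nfdata K s0 w0 -> absdisc K Dd ->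
  exists (s w : 'I_d0 -> _), nfdata K s w /\ `|\det (\matrix_(i, j) s i (w j))| ^+ 2 = Dd%:R.
Proof.
move=> D0 [d [w [T [[Ow [li sp]] [tr ED]]]]]; have q0 := nfdata_qdata D0; have sK : is_subfield K by case: D0.
have bas : is_basis QQ K w.
  split; first by move=> i; case: (Ow i).
  split=> // x Kx; have [N N0 ON] := OK_scale sK Kx; have [c [cZ Ex]] := sp _ ON.
  have N0' : N%:R != 0 :> algC by rewrite pnatr_eq0 -lt0n.
  exists (fun i => c i / N%:R); split.
    by move=> i; rewrite /QQ rpred_div ?rpred_nat //; have /intrP[a ->] := cZ i; exact: rpred_int.
  rewrite -[LHS](mulKf N0') Ex mulr_sumr; apply: eq_bigr => i _; by rewrite mulrA [_^-1 * _]mulrC.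
have Ed := qdata_deg q0 bas; subst d0; pose W := \matrix_(i, j) s0 i (w j).
have dW : \det W != 0 by apply: (qdata_det q0) => // i; case: (Ow i).
exists s0, w; split.
  split=> //; last by case: D0.
  move=> x Ox; have [c [cZ Ex]] := sp _ Ox; exists (fun i => Num.floor (c i)).
  by rewrite Ex; apply: eq_bigr => i _; rewrite floorK.
have -> : Dd%:R = `|\det (W^T *m W)|.
  rewrite ED; congr `|\det _|; apply/matrixP => i j; have [c [cQ [Ec ->]]] := tr i j.
  pose dg := diag_mx (\row_v s0 v (w i * w j)).
  have E : dg *m W = W *m c.
    apply/matrixP => v k; rewrite mul_diag_mx !mxE -rmorphM Ec rmorph_sum; apply: eq_bigr => l _.
    rewrite !mxE rmorphM mulrC; congr (_ * _); have /CratP[a ->] := cQ l k; exact: fmorph_rat.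
  have W1 : W \in unitmx by rewrite unitmxE unitfE.
  have -> : c = invmx W *m (dg *m W) by rewrite E mulKmx.
  rewrite mxtrace_mulC mulmxK // mxtrace_diag mxE; apply: eq_bigr => v _; by rewrite !mxE rmorphM.
by rewrite det_mulmx det_tr normrM.
Qed.

(** * The exceptional fields *)

Section Code.
Variables (F K L M : cset) (n : nat) (z : algC) (sg : aut).
Variables (dF : nat) (sF : 'I_dF -> aut) (wF : 'I_dF -> algC) (DF : nfdata F sF wF).
Variables (dK : nat) (sK : 'I_dK -> aut) (wK : 'I_dK -> algC) (DK : nfdata K sK wK).
Variables (dL : nat) (sL : 'I_dL -> aut) (wL : 'I_dL -> algC) (DL : nfdata L sL wL).
Variables (dM : nat) (sM : 'I_dM -> aut) (wM : 'I_dM -> algC) (DM : nfdata M sM wM).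
Hypotheses (FK : Defs.subset F K) (FL : Defs.subset F L) (KM : Defs.subset K M) (LM : Defs.subset L M).
Hypotheses (n1 : (1 < n)%N) (pz : n.-primitive_root z) (Lz : L z).
Hypotheses (sgF : forall x, F x -> sg x = x) (sgK : forall x, K x -> K (sg x)).
Hypothesis sgneq : powers_distinct K n sg.
Hypothesis cls : powers_exhaust F K n sg.
Hypothesis sgn : forall x, K x -> autX sg n x = x.
Let fF := nfdata_sub DF.
Let fK := nfdata_sub DK.
Let fL := nfdata_sub DL.
Let fM := nfdata_sub DM.
Let n0 : (0 < n)%N. Proof. exact: ltnW. Qed.
Hypothesis agr : generated_over F L z.
Variables (e : 'I_(totient n) -> 'I_n) (tau : 'I_(totient n) -> aut).
Hypothesis T : tau_data F z e tau.
Variable u0 : algC.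
Hypotheses (Ou0 : OK K u0) (y0 : reso n z sg 1 u0 != 0).
Hypothesis hT : unram_or_total F K n.
Variable ie : 'I_(totient n) -> nat.
Hypothesis hie : forall i, (ie i * e i = 1 %[mod n])%N.
Let al := kummer n z sg u0.
Let Oal : OK L al := kummer_OK DL DM FL KM LM n1 pz Lz sgK cls sgn Ou0.
Let al0 : al != 0 := kummer_neq0 y0.
Let N0 := (n * Nz z sL tau)%N.
Variables (rL C1 A Dd : nat) (Bs : seq algC).
Hypotheses (rL0 : (0 < rL)%N) (hrL : `|\det (\matrix_(i, j) sL i (wL j))| <= rL%:R).
Hypothesis HC1 : forall (v : 'rV[int]_dL) (B : nat), (forall i, `|sL i (ev wL v)| <= B%:R) -> forall j, (`|v ord0 j| <= C1 * B)%N.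
Hypothesis HB0 : forall b, b \in Bs -> OK L b /\ b != 0.
Hypothesis HBs : forall a, OK L a -> a != 0 -> (forall P, prime_ideal L P -> ~ P (N0 * (2 ^ dL * (minkC dL * rL))`!)%:R -> (n %| ve L P a)%N) ->
  exists y c b, [/\ OK L y, y != 0, OK L c, c != 0 & b \in Bs /\ a * y ^+ n = b * c ^+ n].
Hypothesis hD : `|\det (\matrix_(i, j) sK i (wK j))| ^+ 2 = Dd%:R.
Hypothesis hA : (C1 ^ (dL * n.-1) * ((2 ^ dL * (minkC dL * rL)) ^ n.-1 * (n ^ dK * Dd)) <= A ^ (dL * n.-1))%N.

(** The pair (x, b) is the code of K. The first property says that K lies in the field generated
    over L by any n-th root of Theta(x) b, which limits the fields with a given code; the second
    turns the symbol value 1 into a split prime of K. The hypothesis [hA] makes the box large enough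
    for the x of [param], through [cond_bound]. *)
Lemma kummer_code : exists x b, [/\ x \in box wL A, x != 0, b \in Bs,
  forall r, r ^+ n = Theta ie tau x * b -> forall nu : aut, (forall u, L u -> nu u = u) -> nu r = r -> forall u, K u -> nu u = u &
  forall P p, prime_ideal L P -> prime p -> P p%:R -> normI L P = p -> ~ P N0%:R -> chi P p z n1 (Theta ie tau x * b) = 1 ->
    exists pi, good_prime K n sg p pi].
Proof.
have [x [h [Ox x0 hx hh nx]]] := param DF DK DL DM FK FL KM LM n1 pz Lz sgF sgK sgneq cls sgn agr T Ou0 y0 hT hie rL0 hrL.
have OT := Theta_OK DL FL Lz agr T ie Ox; have T0 : Theta ie tau x != 0 by apply: Theta_nz.
have [||y [c [b [Oy yn0 Oc c0 [bB Eb]]]]] := HBs (a := al * Theta ie tau x ^+ n.-1) _ _ nx.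
- by apply: OK_mul => //; apply: (OK_X DL).
- by rewrite mulf_neq0 // expf_neq0.
have [Ob b0] := HB0 bB; exists x, b; split => //.
- have [v Ev] := (OK_ev DL x).1 Ox; rewrite Ev; apply: mem_box => j.
  have n10 : (0 < n.-1)%N by rewrite -ltnS prednK.
  have hv i : `|sL i (ev wL v)| <= h%:R by rewrite -Ev.
  apply: leq_trans (HC1 hv j) _; rewrite -(@leq_exp2r _ _ (dL * n.-1)); last by rewrite muln_gt0 (qdata_pos (nfdata_qdata DL)).
  apply: leq_trans hA; rewrite expnMn leq_mul2l; apply/orP; right; rewrite expnM.
  apply: leq_trans (expn_mono _ hh) _; rewrite expnMn leq_mul2l; apply/orP; right.
  have := cond_bound DF DK DL DM FK FL KM LM n1 pz Lz sgF sgK sgneq cls sgn agr T Ou0 y0 hT.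
  by rewrite hD -natrX -natrM ler_nat.
- move=> r Er; exact: (param_fixes DK DL DM FL KM LM n1 pz Lz sgK cls sgn agr T Ou0 y0 Ox x0 Oy.1 yn0 Oc.1 c0 Eb Er).
move=> P p pP pp Pp NP PN hc; have P1 := norm_eq_deg1 DL pP pp Pp NP.
apply: (splitting DF DK DL DM FK FL KM LM pz Lz sgF sgK sgneq cls sgn agr T Ou0 y0 hT pP pp Pp PN P1
  (g := Theta ie tau x * b) (x := Theta ie tau x * y) (y := c) _ _ Oc _ c0 _ hc).
- by apply: OK_mul.
- by apply: OK_mul.
- by rewrite mulf_neq0.
have E : Theta ie tau x ^+ n = Theta ie tau x * Theta ie tau x ^+ n.-1 by rewrite -exprS prednK.
rewrite -[RHS]mulrA -Eb exprMn E.
rewrite -/al.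
move: (Theta ie tau x ^+ n.-1) (Theta ie tau x) (y ^+ n) al => a1 a2 a3 a4.
ring.
Qed.
End Code.

Definition slot (L : cset) (N0 p : nat) (P : cset) := [/\ prime_ideal L P, prime p, P p%:R, normI L P = p & ~ P N0%:R].

(** The conclusion of [class_map] kept in the naturals until [class_count] estimates it; X stands
    for the number of pairs of a torsion class and an auxiliary ideal of norm at most Y. *)
Definition class_ineq (K : cset) (d l Dd Y X : nat) := exists (s : 'I_d -> aut) (w : 'I_d -> algC) (rD : nat),
  [/\ nfdata K s w, (0 < rD)%N, (rD ^ 2 <= 4 * Dd)%N & (X <= size (msets (normI K) (primesUpto K (2 ^ d * (minkC d * rD))) (2 ^ d * (minkC d * rD))) *
    (trunc_log 2 ((minkC d * rD * Y) ^ l * ((minkC d * rD * Y) ^ l) ^ d)).+1 ^ d)%N].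

Lemma field_data F m n K Dd : number_field F -> ext_degree QQ F m -> (1 < n)%N -> cyclic_galois F K n -> absdisc K Dd ->
  exists (s w : 'I_(m * n) -> _) rD, [/\ nfdata K s w, `|\det (\matrix_(i, j) s i (w j))| ^+ 2 = Dd%:R, (0 < Dd)%N, (0 < rD)%N &
    (rD ^ 2 <= 4 * Dd)%N /\ `|\det (\matrix_(i, j) s i (w j))| <= rD%:R].
Proof.
move=> nF [f hf] n1 G hD; have nK := galois_nf nF G; have [d [s0 [w0 D0]]] := nfdata_exists nK.
have [s [w [D ED]]] := absdisc_data D0 hD.
have [sK [FK [[v hv] _]]] := G; have E : (m * n = d)%N by apply: (qdata_deg (nfdata_qdata D) (prod_basisP nF.1 hf hv sK FK)).
subst d; have Dd0 : (0 < Dd)%N.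
  by rewrite lt0n -(pnatr_eq0 algC) -ED expf_eq0 normr_eq0 /=; case: D.
have [//|h [h0 _ h1 h2]] := @root_ceil 2 Dd isT.
exists s, w, h; split => //; split => //; rewrite -(@ler_pXn2r _ 2) ?nnegrE // ED -natrX ler_nat //.
Qed.

(** The single auxiliary ideal O_K needs no separation and leads to the trivial bound D^(1/2 +
    e). *)
Lemma class_bound F m n K Dd l N : number_field F -> ext_degree QQ F m -> (1 < n)%N -> cyclic_galois F K n -> absdisc K Dd ->
  (0 < l)%N -> cl_tors_card K l N -> class_ineq K (m * n) l Dd 1 N.
Proof.
move=> nF eF n1 G hD l0 [Is [hI [hneq _]]]; have [s [w [rD [D ED D0 r0 [h1 h2]]]]] := field_data nF eF n1 G hD.
exists s, w, rD; split => //; rewrite -[X in (X <= _)%N]muln1.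
apply: (class_map D (As := fun _ : 'I_1 => OK K) l0 r0 (ltn0Sn 0) h2 hI hneq) => [i|i i' b b' ne].
  by rewrite (normI_OK D); split => //; apply: nz_OK; case: D.
by case: ne; rewrite !ord1.
Qed.

Lemma inv_mod n a : (1 < n)%N -> coprime a n -> exists b, (b * a = 1 %[mod n])%N.
Proof.
move=> n1; case: a => [|a] cop; first by move: cop; rewrite /coprime gcd0n; case: (n) n1 => [|[]].
have [u v E _] := egcdnP n (ltn0Sn a); exists u; move: cop; rewrite /coprime => /eqP cop.
by rewrite E cop modnMDl.
Qed.

(* [Ks] collects the fields whose code (x, beta) has an abnormally large character sum; for the others, at least
   r / 4n of the given primes split in K. *)
Theorem dichotomy F m n : number_field F -> ext_degree QQ F m -> (1 < n)%N -> lin_disjoint F (cyclo_field n) ->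
  exists (L : cset) (d : nat) (s : 'I_d -> aut) (w : 'I_d -> algC) (N0 c : nat), [/\ nfdata L s w, d = (m * totient n)%N, (0 < N0)%N, (0 < c)%N &
  forall (r B : nat) (P : 'I_r -> cset) (p : 'I_r -> nat) (k A H E : nat),
    (forall q, slot L N0 (p q) (P q)) -> injective p -> (forall q, (p q <= B)%N) -> (0 < k)%N -> (0 < B)%N -> (0 < A)%N ->
    (c * B ^ (totient n * (k + k)) <= H ^ d)%N -> (c * A ^ c < 2 ^ E)%N -> (4 * E <= r)%N ->
  exists Ks : seq cset, (size Ks * r ^ (k + k) <= c * (2 * n) ^ (k + k) * (r ^ k * k ^ (k + k) * (A + A).+1 ^ d + r ^ (k + k) * (H * (A + A).+1 ^ d.-1)))%N /\
  forall K Dd l N, in_T F n K -> absdisc K Dd -> cl_tors_card K l N -> (0 < l)%N -> (c * Dd <= A ^ (d * n.-1))%N ->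
    ((B ^ (k * (l * n.-1)) * c) ^ 2 < Dd)%N -> ~ K \in Ks ->
  exists2 G, (r <= 4 * n * G)%N & class_ineq K (m * n) l Dd (B ^ k) (N * 'C(G, k))].
Proof.
move=> nF eF n1 ld; have n0 := ltnW n1.
have [L [z [nL FL Lz pz [agr htau hdL]]]] := cyclo_ext nF eF n1 ld.
have [dF [sF [wF DF]]] := nfdata_exists nF.
have EF : m = dF by case: eF => f hf; exact: (qdata_deg (nfdata_qdata DF) hf).
subst dF; have [d [s [w D]]] := nfdata_exists nL.
have [e [tau T]] := tau_exists htau.
have [ie hie] := choice_ord (P := fun i b => (b * e i = 1 %[mod n])%N) (fun i => inv_mod n1 (let: And5 _ h _ _ _ := T in h i)).
pose rL := (Num.truncn `|\det (\matrix_(i, j) s i (w j))|).+1.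
have hrL : `|\det (\matrix_(i, j) s i (w j))| <= rL%:R := trunc_ub (normr_ge0 _).
have [C1 HC1] := coord_bound D.
pose N0 := (n * Nz z s tau)%N; have N00 : (0 < N0)%N by rewrite muln_gt0 n0 (Nz_gt0 D FL pz Lz agr T).
have [|Bs [HB0 HBs]] := nth_reduce D n0 (H := N0 * (2 ^ d * (minkC d * rL))`!); first by rewrite muln_gt0 N00 fact_gt0.
have [C2 [C20 HC2]] := small_reps D.
have sL : is_subfield L by case: D.
pose Th := Theta ie tau.
have [Cb HCb] : exists Cb, forall b A x, b \in Bs -> (0 < A)%N -> x \in box w A -> (nmn s (Th x * b)%R <= Cb * A ^ (d * \sum_i ie i))%N.
  have [g Hg] := choice_fun (P := fun b (C : nat) => OK L b -> forall A x, (0 < A)%N -> x \in box w A -> (nmn s (Th x * b)%R <= C * A ^ (d * \sum_i ie i))%N)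
    (fun b => match classic (OK L b) with or_introl h => let: ex_intro C (conj _ h') := Theta_bound D FL Lz agr T ie h in ex_intro _ C (fun=> h')
              | or_intror h => ex_intro _ 0%N (fun h' => False_ind _ (h h')) end).
  exists (\sum_(b <- Bs) g b)%N => b A x bB A0 xb; apply: leq_trans (Hg b (HB0 _ bB).1 A x A0 xb) _.
  by rewrite leq_mul2r (big_rem b bB) /= leq_addr orbT.
have [Cf [_ hCf']] := norm_ub (fun ij : 'I_m * 'I_m => sF ij.1 (wF ij.2)).
have hCf i j : `|sF i (wF j)| <= Cf%:R := hCf' (i, j).
(* One constant per use: [cA] for the box containing x, [C2] for the residue systems, [cT] for the
   norm of Theta(x) b, [cK] for the number of fields with bad codes, [cS] for the separation of
   ideals. *)
pose cA := (C1 ^ (d * n.-1) * ((2 ^ d * (minkC d * rL)) ^ n.-1 * n ^ (m * n)))%N.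
pose cT := (Cb + d * \sum_i ie i)%N.
pose cK := (size Bs * 2 ^ (n * d) * n * (1 + 2 * d))%N.
pose cS := ((m * n)`! * (2 ^ n * Cf) ^ (m * n))%N.
pose c := (cA + C2 + cT + cK + cS)%N.
exists L, d, s, w, N0, c; split => //; [exact: hdL D | by rewrite /c; move: C20; clear; lia |].
move=> r B P p k A H E hs pinj pB k0 B0 A0 hH hE hr.
have pP q : prime_ideal L (P q) by case: (hs q).
have pp q : prime (p q) by case: (hs q).
have Pp q : P q (p q)%:R by case: (hs q).
have PN q : ~ P q N0%:R by case: (hs q).
have Pn q : ~ P q n%:R.
  by move=> h; apply: (PN q); rewrite natrM; apply: (idmulr (primeP_id (pP q))) => //; exact: OK_nat.
have P1 q x : OK L x -> exists a : nat, P q (x - a%:R).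
  by apply: (norm_eq_deg1 D (pP q) (pp q) (Pp q)); case: (hs q).
have [fld Hfld] : exists fld : algC * algC -> seq cset, forall bx, (size (fld bx) <= 2 ^ (n * d))%N /\
    (OK L bx.1 -> bx.1 != 0 -> OK L bx.2 -> bx.2 != 0 -> forall K, number_field K ->
      (forall rt, rt ^+ n = Th bx.2 * bx.1 -> forall nu : aut, (forall u, L u -> nu u = u) -> nu rt = rt -> forall u, K u -> nu u = u) -> K \in fld bx).
  apply: (choice_fun (P := fun bx Ks => (size Ks <= 2 ^ (n * d))%N /\ (OK L bx.1 -> bx.1 != 0 -> OK L bx.2 -> bx.2 != 0 -> forall K, number_field K ->
      (forall rt, rt ^+ n = Th bx.2 * bx.1 -> forall nu : aut, (forall u, L u -> nu u = u) -> nu rt = rt -> forall u, K u -> nu u = u) -> K \in Ks))).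
  move=> [b x] /=; case: (classic [/\ OK L b, b != 0, OK L x & x != 0]) => [[Ob b0 Ox x0]|h].
    pose rt := n.-root (Th x * b); have Ert : rt ^+ n = Th x * b by apply: rootCK.
    have OT := Theta_OK' D FL Lz agr T ie Ox.
    have rt0 : rt != 0 by have := expf_eq0 rt n; rewrite n0 /= => <-; rewrite Ert mulf_neq0 // Theta_nz.
    have [|Ks [sz hK]] := fields_of D n0 pz Lz (r := rt) _ rt0; first by rewrite Ert; apply: sfM => //; [case: OT | case: Ob].
    by exists Ks; split => // _ _ _ _ K nK h; apply: hK => //; exact: h.
  by exists [::]; split => // Ob b0 Ox x0; case: h.
pose bad b := bad_list z w n1 tau ie P p A b.
exists (flatten [seq flatten [seq fld (b, x) | x <- bad b] | b <- Bs]); split.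
  have hbad b : b \in Bs -> (size (bad b) * r ^ (k + k) <= n * ((2 * n) ^ (k + k) * (r ^ k * k ^ (k + k) * (A + A).+1 ^ d + r ^ (k + k) * (d * (2 * H) * (A + A).+1 ^ d.-1))))%N.
    move=> bB; apply: (bad_size D FL n1 pz Lz agr T hie pP pp Pp Pn P1 pinj pB A HC2 k0 B0 _ (HB0 _ bB).1).
    by apply: leq_trans hH; rewrite leq_mul2r /c; apply/orP; right; clear; lia.
  rewrite size_flatten /shape -map_comp sumnE big_map big_distrl /=.
  apply: leq_trans (_ : \sum_(b <- Bs) 2 ^ (n * d) * (n * ((2 * n) ^ (k + k) * (r ^ k * k ^ (k + k) * (A + A).+1 ^ d + r ^ (k + k) * (d * (2 * H) * (A + A).+1 ^ d.-1)))) <= _)%N.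
    rewrite !big_seq; apply: leq_sum => b bB; apply: leq_trans (leq_mul (leqnn _) (hbad b bB)).
    rewrite mulnA leq_mul2r; apply/orP; right; rewrite size_flatten /shape -map_comp sumnE big_map.
    apply: leq_trans (_ : \sum_(x <- bad b) 2 ^ (n * d) <= _)%N; first by apply: leq_sum => x _; case: (Hfld (b, x)).
    by rewrite big_const_seq count_predT iter_addn addn0.
  rewrite big_const_seq count_predT iter_addn addn0.
  set X1 := (r ^ k * _ * _)%N; set X2 := (_ ^ d.-1)%N; set X3 := (r ^ (k + k))%N; set X4 := ((2 * n) ^ _)%N.
  apply: leq_trans (_ : cK * X4 * (X1 + X3 * (H * X2)) <= _)%N; last first.
    by rewrite !leq_mul2r; apply/orP; right; apply/orP; right; rewrite /c; clear; lia.
  rewrite /cK; apply: leq_trans (_ : 2 ^ (n * d) * (n * (X4 * ((1 + 2 * d) * (X1 + X3 * (H * X2))))) * size Bs <= _)%N; last by rewrite leq_eqVlt; apply/orP; left; apply/eqP; ring.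
  rewrite leq_mul2r; apply/orP; right; do 3!(rewrite leq_mul2l; apply/orP; right).
  have -> : (X3 * (d * (2 * H) * X2) = 2 * d * (X3 * (H * X2)))%N by ring.
  rewrite mulnDl mul1n mulnDr; move: (X3 * _)%N (2 * d)%N => a b; clear; nia.
move=> K Dd l N [GK hT] hD [Is [hI [hneq _]]] l0 hDA hsep hKs.
have nK := galois_nf nF GK; have [sg [sgF sgK sgneq cls sgn]] := galois_gen nF n0 GK.
have [sK [wK [rD [DK ED Dd0 rD0 [hrD hdet]]]]] := field_data nF eF n1 GK hD.
have FK : Defs.subset F K by case: GK => _ [].
have [M [nM KM LM _]] := compositum nK nL; have [dM [sM [wM DM]]] := nfdata_exists nM.
have [u0 Ou0 y0] := reso_nonzero DK D DM KM LM n1 pz Lz sgK sgneq sgn.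
have hA : (C1 ^ (d * n.-1) * ((2 ^ d * (minkC d * rL)) ^ n.-1 * (n ^ (m * n) * Dd)) <= A ^ (d * n.-1))%N.
  apply: leq_trans hDA; rewrite !mulnA leq_mul2r; apply/orP; right; rewrite /c /cA !mulnA; clear; lia.
have [x [b [xb x0 bB hcode hgood]]] := kummer_code DF DK D DM FK FL KM LM n1 pz Lz sgF sgK sgneq cls sgn agr T Ou0 y0 hT hie
  (ltn0Sn _ : (0 < rL)%N) hrL HC1 HB0 HBs ED hA.
have Ox := box_OK D xb; have [Ob b0] := HB0 _ bB.
have nb : x \notin bad b.
  apply/negP => xbad; apply: hKs; apply/flattenP; exists (flatten [seq fld (b, x) | x <- bad b]); first by apply: map_f.
  apply/flattenP; exists (fld (b, x)); first by apply: map_f.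
  by case: (Hfld (b, x)) => _ /= h; apply: h.
pose Gs := [set q | chi (P q) (p q) z n1 (Th x * b)%R == 1%R].
have hZ : (4 * #|[set q | chi (P q) (p q) z n1 (Th x * b)%R == 0%R]| <= r)%N.
  apply: leq_trans hr; rewrite leq_mul2l /=.
  apply: (zero_count D FL n1 pz Lz agr T pP pp Pp Pn P1 pinj Ob xb x0 b0); apply: leq_ltn_trans hE.
  apply: leq_trans (HCb _ _ _ bB A0 xb) _; apply: leq_mul; first by rewrite /c /cT; clear; lia.
  by apply: leq_pexp2l => //; rewrite /c /cT; clear; lia.
exists #|Gs|; first exact: (good_count D FL pz Lz agr T pP pp Pp Pn P1 Ob xb nb hZ).
exists sK, wK, rD; split => //.
pose pi (p0 : nat) := epsilon (inhabits (OK K)) (fun Q => good_prime K n sg p0 Q).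
have hpi q : q \in Gs -> good_prime K n sg (p q) (pi (p q)).
  rewrite inE => /eqP hq; apply: (epsilon_spec (inhabits (OK K)) (fun Q => good_prime K n sg (p q) Q)).
  by case: (hs q) => h1 h2 h3 h4 h5; exact: (hgood (P q) (p q)).
(* Auxiliary ideals are products of chosen primes over the k-subsets of Gs: their norms are at most
   B^k, and two distinct subsets of equal size always leave a prime occurring in the first only, as
   [good_sep] requires. *)
pose Ss := [set S0 : {set 'I_r} | S0 \subset Gs & #|S0| == k].
rewrite -(cards_draws Gs k) -/Ss.
pose V (i : 'I_#|Ss|) : {set 'I_r} := enum_val i.
pose ps (i : 'I_#|Ss|) := [seq p q | q <- enum (V i)].
have Sin i : V i \subset Gs /\ #|V i| = k by have := enum_valP i; rewrite -/(V i) inE => /andP[h /eqP].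
have gl i : good_list K n sg pi (ps i).
  split; first by rewrite map_inj_uniq ?enum_uniq.
  by move=> p0 /mapP[q]; rewrite mem_enum => qi ->; apply: hpi; apply: (subsetP (Sin i).1).
have pY i : (\prod_(p0 <- ps i) p0 <= B ^ k)%N.
  rewrite big_map -(Sin i).2 cardE -[leqRHS]muln1 -iter_muln -(count_predT (enum _)) -big_const_seq.
  by apply: leq_prod => q _.
apply: (class_map DK (As := fun i => gideal K pi (ps i)) l0 rD0 _ hdet hI hneq) => [|i|i i' b1 b2 ne Ob1 Ob2 b10 b20].
- by rewrite expn_gt0 B0.
- rewrite (gideal_norm DK (gl i)); split; last exact: pY.
  by apply: (prodI_nz DK); exact: (good_primes (gl i)).
have [q qi qi'] : exists2 q, q \in V i & q \notin V i'.
  apply/subsetPn; apply/negP => sub; apply: ne; apply: enum_val_inj; apply/eqP.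
  by rewrite eqEcard sub (Sin i).2 (Sin i').2 leqnn.
apply: (good_sep DF DK FK n1 sgF sgK l0 (gl i) (gl i') (p := p q) (Cf := Cf) (Y := B ^ k) _ _ (pY i')) => //.
- by apply: map_f; rewrite mem_enum.
- by apply/mapP => -[q']; rewrite mem_enum => h /pinj E'; rewrite E' h in qi'.
- move=> v i''; have [j hj] := (let: And5 _ _ _ _ h := nfdata_qdata DF in h) (sK v).
  by rewrite hj //; case: DF => _ h _ _ _; case: (h i'').
rewrite -(@ltr_pXn2r _ 2) ?nnegrE // ED -natrX ltr_nat; apply: leq_ltn_trans hsep.
by apply: expn_mono; rewrite -expnM leq_mul2l; apply/orP; right; rewrite -/cS /c; clear; lia.
Qed.

(* Rankin's trick and sums over primes *)
From Stdlib Require Import Reals Lra.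
Delimit Scope nat_scope with N.
Local Notation "m ^ n" := (expn m n) : nat_scope.
Local Close Scope ring_scope.
Local Open Scope R_scope.
Ltac rlra := Lra.lra.
Ltac rnra := Lra.nra.

Fixpoint rsum (T : Type) (f : T -> R) (l : seq T) : R := if l is x :: l' then f x + rsum f l' else 0.

Lemma rsum_cat (T : Type) (f : T -> R) l l' : rsum f (l ++ l') = rsum f l + rsum f l'.
Proof. by elim: l => [|x l IH] /=; rewrite ?IH; rlra. Qed.
Lemma rsum_le (T : eqType) (f g : T -> R) l : (forall x, x \in l -> f x <= g x) -> rsum f l <= rsum g l.
Proof.
elim: l => [|x l IH] h /=; first rlra.
have := h x (mem_head x l); have := IH (fun y hy => h y (mem_behead (hy : y \in behead (x :: l)))); rlra.
Qed.
Lemma rsum_flatten (T S' : Type) (f : S' -> R) (g : T -> seq S') l : rsum f (flatten [seq g x | x <- l]) = rsum (fun x => rsum f (g x)) l.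
Proof. by elim: l => //= x l IH; rewrite rsum_cat IH. Qed.
Lemma rsum_scale (T : Type) (f : T -> R) c l : rsum (fun x => c * f x) l = c * rsum f l.
Proof. by elim: l => [|x l IH] /=; rewrite ?IH; rlra. Qed.
Lemma rsum_const (T : Type) c (l : seq T) : rsum (fun=> c) l = INR (size l) * c.
Proof. elim: l => [|x l IH]; first by rewrite /=; rlra. have -> : size (x :: l) = (size l).+1 by [].
by rewrite S_INR; rewrite -[rsum _ (x :: l)]/(c + rsum (fun=> c) l) IH; rlra. Qed.
Lemma rsum_filter (T : Type) (f : T -> R) (a : pred T) l : rsum f [seq x <- l | a x] = rsum (fun x => if a x then f x else 0) l.
Proof. by elim: l => //= x l IH; case: ifP => h /=; rewrite IH; rlra. Qed.
Lemma rsum_ge0 (T : Type) (f : T -> R) l : (forall x, 0 <= f x) -> 0 <= rsum f l.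
Proof. move=> h; elim: l => [|x l IH] /=; have := h; [rlra | move=> /(_ x); rlra]. Qed.
Lemma INR_flatten (T S' : Type) (g : T -> seq S') l : INR (size (flatten [seq g x | x <- l])) = rsum (fun x => INR (size (g x))) l.
Proof. by elim: l => //= x l IH; rewrite size_cat plus_INR IH. Qed.
Lemma leq_INR m n : (m <= n)%N -> INR m <= INR n.
Proof. by move=> h; apply: le_INR; apply/ssrnat.leP. Qed.
Lemma INR_M m n : INR (m * n)%N = INR m * INR n.
Proof. exact: mult_INR. Qed.
Lemma INR_X m k : INR (m ^ k)%N = INR m ^ k.
Proof. by elim: k => [|k IH]; [rewrite expn0 | rewrite expnS INR_M IH]. Qed.
Lemma INR_ge0 m : 0 <= INR m. Proof. exact: pos_INR. Qed.
Lemma INR_gt0 m : (0 < m)%N -> 0 < INR m.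
Proof. by move=> h; apply: lt_0_INR; apply/ssrnat.ltP. Qed.
Lemma INR_ge1 m : (0 < m)%N -> 1 <= INR m.
Proof. by move/leq_INR. Qed.
Lemma Rpow_pos x y : 0 < Rpower x y. Proof. exact: exp_pos. Qed.
Lemma Rpow_ge0 x y : 0 <= Rpower x y. Proof. exact: Rlt_le (exp_pos _). Qed.
Lemma Rpow_mono x y a : 0 < x <= y -> 0 <= a -> Rpower x a <= Rpower y a.
Proof. by move=> h a0; apply: Rle_Rpower_l. Qed.
Lemma Rpow_ge1 x a : 1 <= x -> 0 <= a -> 1 <= Rpower x a.
Proof. by move=> h a0; rewrite -(Rpower_O x); [apply: Rle_Rpower; rlra | rlra]. Qed.
Lemma Rpow_anti x y a : 0 < x <= y -> 0 <= a -> Rpower y (- a) <= Rpower x (- a).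
Proof.
move=> h a0; rewrite !Rpower_Ropp; apply: Rinv_le_contravar; first exact: Rpow_pos.
exact: Rpow_mono.
Qed.
Lemma Rpow_pow x a k : Rpower x a ^ k = Rpower x (INR k * a).
Proof.
elim: k => [|k IH]; first by rewrite /= Rmult_0_l /Rpower Rmult_0_l exp_0.
by rewrite S_INR /= IH -Rpower_plus; congr Rpower; ring.
Qed.

(* [(1 - u) (1 + 2 u)^2 >= 1] when [u^2 <= 1/2]. *)
Lemma geom_exp u : 0 <= u -> u * u <= 1 / 2 -> 1 <= (1 - u) * exp (4 * u).
Proof.
move=> u0 u2; have -> : 4 * u = 2 * u + 2 * u by ring.
rewrite exp_plus; have h := exp_ineq1_le (2 * u); set e := exp _ in h *.
have u1 : u < 1 by rnra.
have : (1 + 2 * u) * (1 + 2 * u) <= e * e by rnra.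
rnra.
Qed.
Lemma geom_sum u m k : (1 - u) * rsum (fun e => u ^ e) (iota m k) = u ^ m - u ^ (m + k)%N.
Proof.
elim: k m => [|k IH] m /=; first by rewrite addn0; rlra.
rewrite Rmult_plus_distr_l IH addSnnS /=; ring.
Qed.

(** The count is at most B^sg times the product of the geometric series in u = N(P)^(-sg). Since
    N(P) >= 2 and sg >= 1/2 one has u^2 <= 1/2, so [geom_exp] bounds each series by exp(4 u). *)
Lemma rankin (T : eqType) (nrm : T -> nat) Ps B sg : (forall P, P \in Ps -> (1 < nrm P)%N) -> 1 / 2 <= sg ->
  INR (size (msets nrm Ps B)) <= Rpower (INR B) sg * exp (4 * rsum (fun P => Rpower (INR (nrm P)) (- sg)) Ps).
Proof.
move=> hP s0; elim: Ps hP B => [|P Ps IH] hP B.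
  rewrite /= Rmult_0_r exp_0; case: B => [|B] /=; first by have := Rpow_pos 0 sg; rlra.
  by rewrite Rmult_1_r; apply: Rpow_ge1; [exact: (INR_ge1 (ltn0Sn B)) | rlra].
have hP' Q : Q \in Ps -> (1 < nrm Q)%N by move=> h; apply: hP; rewrite inE h orbT.
have n2 : 2 <= INR (nrm P) by exact: (leq_INR (hP P (mem_head _ _))).
set S0 := rsum _ Ps in IH *; set u := Rpower (INR (nrm P)) (- sg).
have u0 : 0 < u by exact: Rpow_pos.
have u2 : u * u <= 1 / 2.
  have -> : u * u = Rpower (INR (nrm P)) (- (2 * sg)) by rewrite -Rpower_plus; congr Rpower; ring.
  have : Rpower (INR (nrm P)) (- (2 * sg)) <= Rpower (INR (nrm P)) (- 1) by apply: Rle_Rpower; rlra.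
  rewrite (Rpower_Ropp _ 1) Rpower_1; last rlra.
  have : / INR (nrm P) <= / 2 by apply: Rinv_le_contravar; rlra.
  rlra.
have -> : rsum (fun P0 => Rpower (INR (nrm P0)) (- sg)) (P :: Ps) = u + S0 by [].
rewrite -[msets _ _ _]/(flatten [seq [seq nseq e P ++ l | l <- msets nrm Ps (B %/ nrm P ^ e)] | e <- iota 0 B.+1]) INR_flatten.
apply: Rle_trans (_ : rsum (fun e => Rpower (INR B) sg * exp (4 * S0) * u ^ e) (iota 0 B.+1) <= _).
  apply: rsum_le => e _; rewrite size_map; case: (posnP (B %/ nrm P ^ e)) => [E|q0].
    have -> : size (msets nrm Ps (B %/ nrm P ^ e)) = 0%N.
      by rewrite E; elim: (Ps) => //= Q Qs; rewrite div0n size_cat size_map => ->.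
    by apply: Rlt_le; apply: Rmult_lt_0_compat; [apply: Rmult_lt_0_compat; [exact: Rpow_pos | exact: exp_pos] | exact: pow_lt].
  apply: Rle_trans (IH hP' _) _; rewrite Rmult_assoc [_ * u ^ e]Rmult_comm -Rmult_assoc.
  apply: Rmult_le_compat_r; first exact: Rlt_le (exp_pos _).
  have ne : 0 < INR (nrm P ^ e)%N by apply: INR_gt0; rewrite expn_gt0 (ltnW (hP P (mem_head _ _))).
  have -> : u ^ e = Rpower (INR (nrm P ^ e)%N) (- sg).
    rewrite Rpow_pow INR_X -Rpower_pow; last rlra.
    by rewrite Rpower_mult; congr Rpower; ring.
  have qp : 0 < INR (B %/ nrm P ^ e)%N by apply: lt_0_INR; apply/ssrnat.ltP.
  have hB : INR (B %/ nrm P ^ e)%N * INR (nrm P ^ e)%N <= INR B by rewrite -INR_M; apply: leq_INR; exact: leq_trunc_div.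
  apply: Rle_trans (_ : Rpower (INR (B %/ nrm P ^ e)%N * INR (nrm P ^ e)%N) sg * Rpower (INR (nrm P ^ e)%N) (- sg) <= _).
    by rewrite -Rpower_mult_distr // Rmult_assoc -Rpower_plus Rplus_opp_r Rpower_O // Rmult_1_r; apply: Rle_refl.
  apply: Rmult_le_compat_r; first exact: Rpow_ge0.
  apply: Rpow_mono; last rlra.
  by split => //; apply: Rmult_lt_0_compat.
rewrite rsum_scale Rmult_plus_distr_l exp_plus [exp _ * exp _]Rmult_comm -!Rmult_assoc.
apply: Rmult_le_compat_l.
  by apply: Rmult_le_pos; apply: Rlt_le; [exact: Rpow_pos | exact: exp_pos].
have := geom_sum u 0 B.+1; have := geom_exp (Rlt_le _ _ u0) u2; rewrite add0n /=.
set Z := _ + rsum _ _; have := pow_lt u B.+1 u0; rewrite /=; set X := u * u ^ B; set Y := exp _ => h1 h2 h3.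
have u1 : u < 1 by rnra.
apply: (Rmult_le_reg_l (1 - u)); rlra.
Qed.

Lemma Rln_le x y : 0 < x -> x <= y -> ln x <= ln y.
Proof. by move=> h [/(ln_increasing _ _ h)/Rlt_le|->] //; apply: Rle_refl. Qed.

(* [ln (1 + 1/j) >= 1/(j+1)] makes the series telescope. *)
Lemma zeta_step (a : R) j : 0 < a -> (0 < j)%N ->
  a * Rpower (INR j.+1) (- (1 + a)) <= Rpower (INR j) (- a) - Rpower (INR j.+1) (- a).
Proof.
move=> a0 j0; have J := INR_ge1 j0; have EJ : INR j.+1 = INR j + 1 by rewrite S_INR.
have P0 := Rpow_pos (INR j.+1) (- a).
have -> : Rpower (INR j.+1) (- (1 + a)) = Rpower (INR j.+1) (- a) * / INR j.+1.
  have -> : - (1 + a) = - a + - (1) by ring.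
  by rewrite Rpower_plus (Rpower_Ropp _ 1) Rpower_1 //; rlra.
have -> : Rpower (INR j) (- a) = Rpower (INR j.+1) (- a) * exp (a * (ln (INR j.+1) - ln (INR j))).
  by rewrite /Rpower -exp_plus; congr exp; ring.
have l1 : / INR j.+1 <= ln (INR j.+1) - ln (INR j).
  have h := exp_ineq1_le (- / INR j.+1).
  have e1 : INR j / INR j.+1 <= exp (- / INR j.+1).
    by have -> : INR j / INR j.+1 = 1 + - / INR j.+1 by rewrite EJ; field; rlra.
  have : ln (INR j / INR j.+1) <= ln (exp (- / INR j.+1)).
    by apply: Rln_le => //; apply: Rdiv_lt_0_compat; rlra.
  by rewrite ln_exp /Rdiv ln_mult ?ln_Rinv; try rlra; apply: Rinv_0_lt_compat; rlra.
have h := exp_ineq1_le (a * (ln (INR j.+1) - ln (INR j))).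
have : a * / INR j.+1 <= a * (ln (INR j.+1) - ln (INR j)) by apply: Rmult_le_compat_l; rlra.
rnra.
Qed.
Lemma zeta_bound (a : R) k : 0 < a -> rsum (fun j => Rpower (INR j) (- (1 + a))) (iota 1 k) <= 1 + / a.
Proof.
move=> a0; have ia := Rinv_0_lt_compat _ a0.
case: k => [|k]; first by rewrite /=; rlra.
have h m j : (0 < j)%N -> a * rsum (fun j => Rpower (INR j) (- (1 + a))) (iota j.+1 m) <= Rpower (INR j) (- a) - Rpower (INR (j + m)%N) (- a).
  elim: m j => [|m IH] j j0; first by rewrite /= addn0; rlra.
  rewrite -[rsum _ _]/(Rpower (INR j.+1) (- (1 + a)) + rsum (fun j => Rpower (INR j) (- (1 + a))) (iota j.+2 m)).
  by have := zeta_step a0 j0; have := IH j.+1 isT; rewrite addSnnS; rlra.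
rewrite -[rsum _ _]/(Rpower 1 (- (1 + a)) + rsum (fun j => Rpower (INR j) (- (1 + a))) (iota 2 k)); have := h k 1%N isT; have := Rpow_pos (INR (1 + k)%N) (- a).
have p1 b : Rpower 1 b = 1 by rewrite /Rpower ln_1 Rmult_0_r exp_0.
rewrite [INR 1]/= !p1; set Z := rsum _ _ => h1 h2.
have : Z <= / a by apply: (Rmult_le_reg_l a) => //; rewrite Rinv_r; rlra.
rlra.
Qed.

Lemma Rexp_le x y : x <= y -> exp x <= exp y.
Proof. by case => [/exp_increasing/Rlt_le|->] //; apply: Rle_refl. Qed.
(** Used to absorb quantities logarithmic in D or X, such as a number of dyadic levels, into an
    arbitrarily small power. *)
Lemma lin_exp E y : 0 <= E -> 0 < y -> 1 + E <= (1 + / (y * ln 2)) * Rpower 2 (E * y).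
Proof.
move=> E0 y0; have l2 := ln_lt_2; have h := exp_ineq1_le (E * y * ln 2).
have a0 : 0 < y * ln 2 by apply: Rmult_lt_0_compat; rlra.
have ia := Rinv_0_lt_compat _ a0; rewrite /Rpower.
have E1 : (1 + / (y * ln 2)) * (1 + E * y * ln 2) = 1 + E * y * ln 2 + / (y * ln 2) + E by field; rlra.
have : (1 + / (y * ln 2)) * (1 + E * y * ln 2) <= (1 + / (y * ln 2)) * exp (E * y * ln 2).
  by apply: Rmult_le_compat_l; rlra.
have : 0 <= E * (y * ln 2) by apply: Rmult_le_pos; rlra.
rlra.
Qed.

Lemma sum_le_size (T : eqType) (f : T -> R) (l : seq T) M k : (size l <= k)%N -> 0 <= M -> (forall x, x \in l -> f x <= M) -> rsum f l <= INR k * M.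
Proof.
move=> sz M0 h; apply: Rle_trans (rsum_le h) _; rewrite rsum_const; apply: Rmult_le_compat_r => //; exact: leq_INR.
Qed.

Section PrimeSums.
Variables (K : cset) (d : nat) (s : 'I_d -> aut) (w : 'I_d -> algC) (D : nfdata K s w).

Lemma primes_sum (f : cset -> R) (g : nat -> R) B : (forall p, 0 <= g p) -> (forall p, prime p -> rsum f (primesOver K p) <= g p) ->
  rsum f (primesUpto K B) <= rsum g (iota 1 B).
Proof.
move=> g0 h; rewrite rsum_flatten rsum_filter -[rsum _ (iota 0 B.+1)]/(0 + rsum _ (iota 1 B)) Rplus_0_l.
by apply: rsum_le => p _; case: ifP => // pp; exact: h.
Qed.

(** At most d primes of K lie above p, each of norm at least p, so the sum is compared with d times
    the zeta sum. *)
Lemma primes_zeta a B : 0 < a -> rsum (fun P => Rpower (INR (normI K P)) (- (1 + a))) (primesUpto K B) <= INR d * (1 + / a).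
Proof.
move=> a0; apply: Rle_trans (_ : rsum (fun p => INR d * Rpower (INR p) (- (1 + a))) (iota 1 B) <= _).
  apply: primes_sum => [p|p pp]; first by apply: Rmult_le_pos; [exact: INR_ge0 | exact: Rpow_ge0].
  apply: sum_le_size; [exact: (size_primesOver D) | exact: Rpow_ge0 |].
  move=> P /(primesOverP D P pp)[pP Pp]; apply: Rpow_anti; last rlra.
  split; first by apply: INR_gt0; exact: prime_gt0.
  apply: leq_INR; exact: (prime_norm_ge D pP pp Pp).
rewrite rsum_scale; apply: Rmult_le_compat_l; [exact: INR_ge0 | exact: zeta_bound].
Qed.
End PrimeSums.

(** Rankin's trick with exponent 1 + eta counts the cofactor ideals, of norm O(D^(1/2)), by O(D^((1
    + eta)/2)); the dyadic levels cost O(D^eta). The constant depends on neither K nor the auxiliary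
    ideals. *)
Lemma class_count d l eps : 0 < eps -> exists C, 0 < C /\ forall K Dd Y X, class_ineq K d l Dd Y X -> (0 < Y <= Dd)%N ->
  INR X <= C * Rpower (INR Dd) (1 / 2 + eps).
Proof.
move=> e0; set eta := eps / 2; have eta0 : 0 < eta by rewrite /eta; rlra.
set c1 := INR (2 ^ d * minkC d)%N; have c10 : 0 < c1 by apply: INR_gt0; rewrite muln_gt0 expn_gt0.
set q := (l * d.+1)%N; set c2 := INR (minkC d).
have c20 : 1 <= c2 by exact: INR_ge1.
set et := eta / (INR d + 1); have d0 := INR_ge0 d; have et0 : 0 < et by apply: Rdiv_lt_0_compat; rlra.
(* 2^E is at most a constant times D^(2 q), so its y-th power costs less than D^et; the d levels
   together then cost less than D^eta. *)
set y := et / (2 * INR q + 1); have q0 := INR_ge0 q; have y0 : 0 < y by apply: Rdiv_lt_0_compat; rlra.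
set c3 := 1 + / (y * ln 2); have l2 := ln_lt_2.
have c30 : 0 < c3.
  have : 0 < / (y * ln 2) by apply: Rinv_0_lt_compat; apply: Rmult_lt_0_compat; rlra.
  by rewrite /c3; rlra.
set c4 := c3 * Rpower (Rpower (2 * c2) (INR q)) y.
have c40 : 0 < c4 by apply: Rmult_lt_0_compat => //; exact: Rpow_pos.
set Cs := Rpower (2 * c1) (1 + eta) * exp (4 * (INR d * (1 + / eta))).
have Cs0 : 0 < Cs by apply: Rmult_lt_0_compat; [exact: Rpow_pos | exact: exp_pos].
exists (Cs * c4 ^ d); split; first by apply: Rmult_lt_0_compat => //; exact: pow_lt.
move=> K Dd Y X [s [w [rD [D rD0 hrD hX]]]] /andP[Y0 YD].
have D1 : 1 <= INR Dd by apply: INR_ge1; exact: leq_trans YD.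
have r1 : 1 <= INR rD by exact: INR_ge1.
set sq := Rpower (INR Dd) (1 / 2).
have sq1 : 1 <= sq by apply: Rpow_ge1; rlra.
have sqq : sq * sq = INR Dd.
  rewrite /sq -Rpower_plus; have -> : 1 / 2 + 1 / 2 = 1 by field.
  by rewrite Rpower_1; rlra.
have rsq : INR rD <= 2 * sq.
  have : INR rD * INR rD <= 4 * (sq * sq).
    by rewrite sqq -INR_M; apply: Rle_trans (leq_INR _) (_ : INR (4 * Dd)%N <= _); [rewrite mulnn; exact: hrD | rewrite INR_M /=; rlra].
  by move=> h; apply: Rnot_lt_le => h'; rnra.
apply: Rle_trans (leq_INR hX) _; rewrite INR_M INR_X.
set BB := (2 ^ d * (minkC d * rD))%N; set E := trunc_log 2 _.
have part1 : INR (size (msets (normI K) (primesUpto K BB) BB)) <= Cs * Rpower (INR Dd) ((1 + eta) / 2).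
  apply: Rle_trans (rankin (sg := 1 + eta) _ _ _) _; [by move=> P /(primesUpto_prime D) /(pideal_gt1 D) | rlra |].
  have B1 : INR BB <= 2 * c1 * sq.
    by rewrite /BB mulnA INR_M -/c1; have : c1 * INR rD <= c1 * (2 * sq) by [apply: Rmult_le_compat_l; rlra]; rlra.
  have B0 : 0 < INR BB by apply: INR_gt0; rewrite !muln_gt0 expn_gt0 rD0.
  have h1 : Rpower (INR BB) (1 + eta) <= Rpower (2 * c1) (1 + eta) * Rpower (INR Dd) ((1 + eta) / 2).
    have -> : Rpower (INR Dd) ((1 + eta) / 2) = Rpower sq (1 + eta) by rewrite Rpower_mult; congr Rpower; field.
    rewrite Rpower_mult_distr; [apply: Rpow_mono; rlra | rlra | rlra].
  have h2 : exp (4 * rsum (fun P => Rpower (INR (normI K P)) (- (1 + eta))) (primesUpto K BB)) <= exp (4 * (INR d * (1 + / eta))).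
    have := primes_zeta D BB eta0; set S0 := rsum _ _; move=> hS.
    by apply: Rexp_le; rlra.
  apply: Rle_trans (Rmult_le_compat _ _ _ _ (Rlt_le _ _ (Rpow_pos _ _)) (Rlt_le _ _ (exp_pos _)) h1 h2) _.
  by rewrite /Cs; apply: Req_le; ring.
have part2 : INR E.+1 <= c4 * Rpower (INR Dd) et.
  rewrite S_INR; apply: Rle_trans (_ : 1 + INR E <= _); first rlra.
  apply: Rle_trans (lin_exp (INR_ge0 E) y0) _; rewrite -/c3 /c4 Rmult_assoc; apply: Rmult_le_compat_l; first rlra.
  have h2 : Rpower 2 (INR E) <= Rpower (2 * c2) (INR q) * Rpower (INR Dd) (2 * INR q).
    have hM : INR (minkC d * rD * Y)%N <= 2 * c2 * Rpower (INR Dd) 2.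
      have -> : Rpower (INR Dd) 2 = INR Dd * INR Dd.
        by have -> : 2 = 1 + 1 by []; rewrite Rpower_plus Rpower_1; rlra.
      have YD' := leq_INR YD; have Y1 := INR_ge1 Y0; rewrite !INR_M -/c2.
      have sqD : sq <= INR Dd by rewrite -sqq; rnra.
      have : INR rD * INR Y <= 2 * INR Dd * INR Dd by apply: Rmult_le_compat; rlra.
      by move=> h; have := Rmult_le_compat_l c2 _ _ ltac:(rlra) h; rlra.
    have hM0 : 0 < INR (minkC d * rD * Y)%N by apply: INR_gt0; rewrite !muln_gt0 rD0.
    have e1 : INR (2 ^ E)%N <= INR ((minkC d * rD * Y) ^ q)%N.
      apply: leq_INR; rewrite /E /q expnM expnS.
      by apply: trunc_logP; rewrite // muln_gt0 !expn_gt0 !muln_gt0 rD0 Y0.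
    move: e1; rewrite !INR_X -!Rpower_pow //; last exact: (lt_0_INR 2 ltac:(lia)).
    have -> : INR 2 = 2 by rewrite /=; rlra.
    move=> e1; apply: Rle_trans e1 _.
    rewrite -(Rpower_mult (INR Dd) 2) Rpower_mult_distr; [|rlra|exact: Rpow_pos].
    by apply: Rpow_mono; rlra.
  rewrite -Rpower_mult; apply: Rle_trans (Rpow_mono _ (Rlt_le _ _ y0)) _; first by split; [exact: Rpow_pos | exact: h2].
  rewrite -Rpower_mult_distr; try exact: Rpow_pos.
  apply: Rmult_le_compat_l; first exact: Rpow_ge0.
  rewrite Rpower_mult; apply: Rle_Rpower => //.
  have -> : et = (2 * INR q + 1) * y by rewrite /y; field; rlra.
  rnra.
have part3 : INR E.+1 ^ d <= c4 ^ d * Rpower (INR Dd) eta.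
  apply: Rle_trans (pow_incr _ _ d (conj (INR_ge0 _) part2)) _.
  rewrite Rpow_mult_distr Rpow_pow; apply: Rmult_le_compat_l; first exact: pow_le (Rlt_le _ _ c40).
  apply: Rle_Rpower => //; have -> : eta = et * (INR d + 1) by rewrite /et; field; rlra.
  rnra.
apply: Rle_trans (Rmult_le_compat _ _ _ _ (INR_ge0 _) (pow_le _ _ (INR_ge0 _)) part1 part3) _.
have -> : Cs * Rpower (INR Dd) ((1 + eta) / 2) * (c4 ^ d * Rpower (INR Dd) eta) = Cs * c4 ^ d * (Rpower (INR Dd) ((1 + eta) / 2) * Rpower (INR Dd) eta) by ring.
apply: Rmult_le_compat_l; first by apply: Rmult_le_pos; [rlra | exact: pow_le (Rlt_le _ _ c40)].
by rewrite -Rpower_plus; apply: Rle_Rpower => //; rewrite /eta; rlra.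
Qed.

Section Supply.
Variables (L : cset) (d : nat) (s : 'I_d -> aut) (w : 'I_d -> algC) (D : nfdata L s w).
Variables (N0 : nat) (N00 : (0 < N0)%N).
Let sL := nfdata_sub D.

Definition slotb (p : nat) : bool := pb (exists P, slot L N0 p P).
Definition slots i := [seq p <- iota (2 ^ i) (2 ^ i) | slotb p].

Lemma slots_data i : exists (P : 'I_(size (slots i)) -> cset) (p : 'I_(size (slots i)) -> nat),
  [/\ forall q, slot L N0 (p q) (P q), injective p & forall q, (p q <= 2 ^ i.+1)%N].
Proof.
have hp (q : 'I_(size (slots i))) : exists P, slot L N0 (nth 0%N (slots i) q) P.
  by have := mem_nth 0%N (ltn_ord q); rewrite mem_filter => /andP[/pbP].
have [P hP] := choice_ord hp; exists P, (fun q => nth 0%N (slots i) q); split => //.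
  move=> q q' /eqP; rewrite nth_uniq ?ltn_ord //; first by move/eqP/val_inj.
  by apply: filter_uniq; exact: iota_uniq.
move=> q; have := mem_nth 0%N (ltn_ord q); rewrite mem_filter mem_iota => /andP[_ /andP[_ /ltnW h]].
by rewrite expnS mul2n -addnn.
Qed.

(** A prime above p has norm at least p^2, or contains N0, which forces p <= N0, or makes p a slot;
    the three terms account for these cases. *)
Lemma over_sum sg p : 1 / 2 <= sg -> prime p -> rsum (fun P => Rpower (INR (normI L P)) (- sg)) (primesOver L p) <=
  INR d * (Rpower (INR p) (- (2 * sg)) + (if (p <= N0)%N then 1 else 0) + (if slotb p then Rpower (INR p) (- sg) else 0)).
Proof.
move=> s0 pp; have p0 : 0 < INR p by apply: INR_gt0; exact: prime_gt0.
have p1 : 1 <= INR p by apply: INR_ge1; exact: prime_gt0.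
have h1 := Rpow_pos (INR p) (- (2 * sg)); have h2 := Rpow_pos (INR p) (- sg).
apply: sum_le_size; [exact: (size_primesOver D) | by case: ifP => _; case: ifP => _; rlra |].
move=> P /(primesOverP D P pp)[pP Pp]; have ge : INR p <= INR (normI L P) by apply: leq_INR; exact: (prime_norm_ge D pP pp Pp).
have le1 : Rpower (INR (normI L P)) (- sg) <= Rpower (INR p) (- sg) by apply: Rpow_anti; rlra.
case: (boolP (slotb p)) => [_|/pbP ns]; first by case: ifP => _; rlra.
case: (leqP p N0) => [_|lt].
  have : Rpower (INR p) (- sg) <= 1.
    by rewrite -(Rpower_O (INR p)) //; apply: Rle_Rpower; rlra.
  rlra.
have NP : normI L P <> p.
  move=> E; apply: ns; exists P; split => // /(nat_inP D pP pp Pp) dv.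
  by have := dvdn_leq N00 dv; rewrite leqNgt lt.
have := leq_INR (norm_ge_sq D pP pp Pp NP); rewrite INR_X => sq.
have -> : Rpower (INR p) (- (2 * sg)) = Rpower (INR p ^ 2) (- sg).
  rewrite -Rpower_pow // Rpower_mult; congr Rpower; rewrite /=; ring.
have : Rpower (INR (normI L P)) (- sg) <= Rpower (INR p ^ 2) (- sg).
  by apply: Rpow_anti; [split => //; apply: pow_lt | rlra].
rlra.
Qed.

(* Rankin's trick against [ideals_lower]: too few primes in every dyadic range would give too few ideals. *)
Lemma supply e1 : 0 < e1 <= 1 -> exists C, 0 < C /\ forall I0 I1 : nat, C * (1 + Rpower 2 (INR I0 * (e1 / 2))) <= INR I1 ->
  exists i, (I0 <= i < I1)%N /\ Rpower 2 (INR i * (1 - e1)) <= INR (size (slots i)).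
Proof.
move=> e10; have [c [c0 hc]] := ideals_lower D; have d0 := qdata_pos (nfdata_qdata D).
(* With this [sg] the primes of norm at least p^2 are summed at 2 sg > 1, giving Z1, and a dyadic
   block with fewer than 2^(i (1 - e1)) slots contributes at most 2^(i (1 - e1 - sg)) = u^i. *)
set sg := 1 - e1 / 4; set Z1 := 1 + / (1 - e1 / 2); set Z2 := 1 + / (e1 / 4); set u := Rpower 2 (- (3 * e1 / 4)).
have l2 := ln_lt_2; have u1 : u < 1.
  by rewrite -(Rpower_O 2); [apply: Rpower_lt; rlra | rlra].
have u0 : 0 < u by exact: Rpow_pos.
set G := / (1 - u); have G0 : 0 < G by apply: Rinv_0_lt_compat; rlra.
have Z10 : 0 < Z1 by have : 0 < / (1 - e1 / 2) by [apply: Rinv_0_lt_compat; rlra]; rewrite /Z1; rlra.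
have Z20 : 0 < Z2 by have : 0 < / (e1 / 4) by [apply: Rinv_0_lt_compat; rlra]; rewrite /Z2; rlra.
have c1 : 1 <= INR c by exact: INR_ge1.
have lc : 0 <= ln (INR c) by rewrite -ln_1; apply: Rln_le; rlra.
have dd := INR_ge0 d; have NN := INR_ge0 N0.
(* [KK] gathers the terms that do not grow with I1; the quantity a = (1 - sg) ln 2 is what the lower
   bound for ideals gains over Rankin's upper bound per unit of the exponent. *)
set KK := 2 * ln (INR c) + 4 * (INR d * (Z1 + INR N0 + G + Z2)) + 1.
have KK0 : 0 < KK.
  have : 0 <= INR d * (Z1 + INR N0 + G + Z2) by apply: Rmult_le_pos; rlra.
  by rewrite /KK; rlra.
set a := e1 / 4 * ln 2; have a0 : 0 < a by apply: Rmult_lt_0_compat; rlra.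
have KA : 0 < KK / a by apply: Rdiv_lt_0_compat.
exists (KK / a + INR c + INR d); split; first rlra.
move=> I0 I1 hI; apply: NNPP => none; set X := Rpower 2 (INR I0 * (e1 / 2)) in hI.
have X0 : 0 < X by exact: Rpow_pos.
have cnt i : (I0 <= i < I1)%N -> INR (size (slots i)) < Rpower 2 (INR i * (1 - e1)).
  by move=> h; apply: Rnot_le_lt => h'; apply: none; exists i.
pose h p := if slotb p then Rpower (INR p) (- sg) else 0.
have h0 p : 0 <= h p by rewrite /h; case: ifP => _; [exact: Rpow_ge0 | rlra].
have p2 i : INR (2 ^ i)%N = Rpower 2 (INR i) by rewrite INR_X -Rpower_pow //=; rlra.
(* Below 2^I0 nothing is known about the slots: the sum is compared with the zeta sum at 1 + e1 / 4,
   at the cost of X = 2^(I0 e1 / 2). From I0 on, the assumed scarcity gives a geometric series. *)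
have blocks k : (I0 + k <= I1)%N -> rsum h (iota 1 (2 ^ (I0 + k)).-1) <= X * Z2 + rsum (fun e => u ^ e) (iota I0 k).
  elim: k => [|k IH] hk.
    rewrite addn0 /= Rplus_0_r; apply: Rle_trans (_ : rsum (fun p => X * Rpower (INR p) (- (1 + e1 / 4))) (iota 1 (2 ^ I0).-1) <= _).
      apply: rsum_le => p; rewrite mem_iota => /andP[p1 pI]; have P1 := INR_ge1 p1.
      have pX : Rpower (INR p) (e1 / 2) <= X.
        have -> : X = Rpower (INR (2 ^ I0)%N) (e1 / 2) by rewrite p2 Rpower_mult.
        apply: Rpow_mono; last rlra; split; first rlra; apply: leq_INR.
        by move: pI; rewrite add1n prednK ?expn_gt0 // => /ltnW.
      have E : Rpower (INR p) (- sg) = Rpower (INR p) (e1 / 2) * Rpower (INR p) (- (1 + e1 / 4)).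
        by rewrite -Rpower_plus; congr Rpower; rewrite /sg; field.
      have P2 := Rpow_pos (INR p) (- (1 + e1 / 4)).
      have : Rpower (INR p) (- sg) <= X * Rpower (INR p) (- (1 + e1 / 4)) by rewrite E; apply: Rmult_le_compat_r; rlra.
      by rewrite /h; case: ifP => // _ _; apply: Rmult_le_pos; rlra.
    rewrite rsum_scale; apply: Rmult_le_compat_l; first rlra.
    by apply: zeta_bound; rlra.
  have E1 : ((2 ^ (I0 + k.+1)).-1 = (2 ^ (I0 + k)).-1 + 2 ^ (I0 + k))%N.
    by rewrite addnS expnS; have := expn_gt0 2 (I0 + k); move: (2 ^ (I0 + k))%N => t; lia.
  rewrite E1 iotaD rsum_cat add1n prednK ?expn_gt0 // -[X in iota I0 X]addn1 iotaD rsum_cat.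
  rewrite -[rsum _ (iota (I0 + k) 1)]/(u ^ (I0 + k) + 0).
  have IH' := IH (leq_trans (leq_add (leqnn I0) (leqnSn k)) hk).
  suff : rsum h (iota (2 ^ (I0 + k)) (2 ^ (I0 + k))) <= u ^ (I0 + k) by rlra.
  rewrite -rsum_filter -/(slots (I0 + k)).
  have hi : (I0 <= I0 + k < I1)%N by rewrite leq_addr -addnS.
  have hc' := cnt _ hi; set i := (I0 + k)%N in hc' *.
  apply: Rle_trans (sum_le_size (leqnn _) (Rlt_le _ _ (Rpow_pos (INR (2 ^ i)%N) (- sg))) _) _.
    move=> p; rewrite mem_filter mem_iota => /andP[_ /andP[pi _]].
    apply: Rpow_anti; last by rewrite /sg; rlra.
    by split; [apply: INR_gt0; rewrite expn_gt0 | exact: leq_INR].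
  rewrite p2 Rpower_mult.
  apply: Rle_trans (Rmult_le_compat_r _ _ _ (Rlt_le _ _ (Rpow_pos _ _)) (Rlt_le _ _ hc')) _.
  rewrite -Rpower_plus Rpow_pow; apply: Req_le; congr Rpower; rewrite /sg; field.
have tot : (I0 <= I1)%N -> rsum h (iota 1 (2 ^ I1).-1) <= X * Z2 + G.
  move=> hI'; have := blocks (I1 - I0)%N; rewrite subnKC // => /(_ (leqnn _)).
  have := geom_sum u I0 (I1 - I0); set Y := rsum _ (iota I0 _) => gs hb.
  have : Y <= G.
    apply: (Rmult_le_reg_l (1 - u)); first rlra; rewrite gs /G Rinv_r; last rlra.
    have := pow_lt u (I0 + (I1 - I0)) u0; have : u ^ I0 <= 1.
      by have := pow_incr u 1 I0 (conj (Rlt_le _ _ u0) (Rlt_le _ _ u1)); rewrite pow1.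
    rlra.
  rlra.
have hI2 : INR c + INR d <= INR I1.
  have : 0 <= (KK / a + INR c + INR d) * X by apply: Rmult_le_pos; rlra.
  rlra.
have I01 : (I0 <= I1)%N.
  rewrite leqNgt; apply/negP => lt.
  have h1 : INR I1 <= INR I0 by apply: leq_INR; exact: ltnW.
  have : INR I0 <= KK / a * X.
    have : 1 + INR I0 * (e1 / 2 * ln 2) <= X.
      by rewrite /X /Rpower; have := exp_ineq1_le (INR I0 * (e1 / 2) * ln 2); rlra.
    have := INR_ge0 I0; set y := INR I0 => y0 hy.
    have aE : e1 / 2 * ln 2 = 2 * a by rewrite /a; field.
    have K1 : 1 <= KK by have : 0 <= INR d * (Z1 + INR N0 + G + Z2) by [apply: Rmult_le_pos; rlra]; rewrite /KK; rlra.
    have -> : KK / a * X = KK * X / a by rewrite /Rdiv; ring.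
    apply: (Rmult_le_reg_r a) => //; have -> : KK * X / a * a = KK * X by field; rlra.
    rnra.
  have : 0 <= (INR c + INR d) * (1 + X) by apply: Rmult_le_pos; rlra.
  rlra.
have {}tot := tot I01.
(* Q is a bound of the shape occurring in [ideals_lower] that stays below 2^I1, at a loss of at most
   c + d in the exponent. *)
pose j := ((I1 - c) %/ d)%N; set Q := (c * (2 ^ j) ^ d)%N.
have cI : (c + d <= I1)%N.
  by apply/ssrnat.leP; apply: INR_le; rewrite plus_INR.
have jd : (j * d <= I1 - c)%N by exact: leq_trunc_div.
have jd2 : (I1 <= j * d + c + d)%N.
  have := ltn_ceil (I1 - c) d0; rewrite -/j mulSn; move: jd cI; move: (j * d)%N => t; lia.
have hQ : (Q <= (2 ^ I1).-1)%N.
  rewrite -ltnS prednK ?expn_gt0 // /Q -expnM; apply: (@leq_ltn_trans (c * 2 ^ (I1 - c))%N).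
    by rewrite leq_mul2l leq_exp2l // jd orbT.
  have cI' : (c <= I1)%N by apply: leq_trans cI; exact: leq_addr.
  rewrite -[X in (_ < 2 ^ X)%N](subnKC cI') expnD ltn_pmul2r ?expn_gt0 //; exact: ltn_expl.
have q0 : (0 < 2 ^ j)%N by rewrite expn_gt0.
have main := leq_INR (hc _ q0); rewrite -/Q INR_M in main.
have sg12 : 1 / 2 <= sg by rewrite /sg; rlra.
have rk := @rankin _ (normI L) (primesUpto L Q) Q sg (fun P hP => pideal_gt1 D (primesUpto_prime D hP)) sg12.
have sm : rsum (fun P => Rpower (INR (normI L P)) (- sg)) (primesUpto L Q) <= INR d * (Z1 + INR N0 + (X * Z2 + G)).
  apply: Rle_trans (@primes_sum L (fun P => Rpower (INR (normI L P)) (- sg)) (fun p => INR d * (Rpower (INR p) (- (2 * sg)) + (if (p <= N0)%N then 1 else 0) + h p)) Q _ _) _.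
  - move=> p; have := h0 p; have := Rpow_pos (INR p) (- (2 * sg)).
    by move=> h1 h2; apply: Rmult_le_pos => //; case: ifP => _; rlra.
  - by move=> p pp; exact: over_sum.
  rewrite rsum_scale; apply: Rmult_le_compat_l => //.
  have ad (f g : nat -> R) l : rsum (fun p => f p + g p) l = rsum f l + rsum g l by elim: l => [|x l IH] /=; rewrite ?IH; rlra.
  rewrite !ad; apply: Rplus_le_compat; first apply: Rplus_le_compat.
  - have := zeta_bound Q (ltac:(rlra) : 0 < 1 - e1 / 2); rewrite -/Z1.
    by have -> : 1 + (1 - e1 / 2) = 2 * sg by rewrite /sg; field.
  - have : rsum (fun p => if (p <= N0)%N then 1 else 0) (iota 1 Q) <= INR (minn Q N0).
      elim: (Q) => [|Q' IH]; first by rewrite min0n /=; rlra.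
      rewrite -[X in iota 1 X]addn1 iotaD rsum_cat add1n -[rsum _ (iota _ 1)]/((if (Q'.+1 <= N0)%N then 1 else 0) + 0).
      case: (leqP Q'.+1 N0) => hQ'; first by rewrite (minn_idPl (ltnW hQ')) in IH; rewrite S_INR; rlra.
      by rewrite (minn_idPr (hQ' : (N0 <= Q')%N)) in IH; rlra.
    by have := leq_INR (geq_minr Q N0); rlra.
  apply: Rle_trans tot; rewrite -(subnKC hQ) iotaD rsum_cat; have := rsum_ge0 (iota (1 + Q) ((2 ^ I1).-1 - Q)) h0; rlra.
have Q0 : 0 < INR Q by apply: INR_gt0; rewrite muln_gt0 c0 expn_gt0 q0.
have main2 : INR ((2 ^ j) ^ d)%N <= INR c * (Rpower (INR Q) sg * exp (4 * (INR d * (Z1 + INR N0 + (X * Z2 + G))))).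
  apply: Rle_trans main _; apply: Rmult_le_compat_l; first rlra; apply: Rle_trans rk _; apply: Rmult_le_compat_l; first exact: Rpow_ge0.
  by apply: Rexp_le; apply: Rmult_le_compat_l; [rlra | exact: sm].
have lq : ln (INR ((2 ^ j) ^ d)%N) = INR (j * d) * ln 2.
  by rewrite -expnM p2 /Rpower ln_exp.
have lQ : ln (INR Q) = ln (INR c) + INR (j * d) * ln 2.
  by rewrite /Q INR_M ln_mult ?lq //; [rlra | apply: INR_gt0; rewrite expn_gt0 q0].
have lt0 : 0 < INR ((2 ^ j) ^ d)%N by apply: INR_gt0; rewrite expn_gt0 q0.
(* In logarithms, the number of ideals is bounded below by j d ln 2 and above by sg j d ln 2, up to
   terms in X and constants. *)
have := Rln_le lt0 main2; rewrite lq ln_mult; [|rlra|by apply: Rmult_lt_0_compat; [exact: Rpow_pos | exact: exp_pos]].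
rewrite ln_mult; [|exact: Rpow_pos|exact: exp_pos]; rewrite ln_exp {1}/Rpower ln_exp lQ.
have jd3 : INR I1 <= INR (j * d) + INR c + INR d by rewrite -!plus_INR; exact: leq_INR.
have jd0 := INR_ge0 (j * d); set y := INR (j * d) in jd3 jd0 *; set lg := ln (INR c) in lc *; move=> fin.
have f1 : a * y <= 2 * lg + 4 * (INR d * (Z1 + INR N0 + (X * Z2 + G))).
  have : sg * lg <= 1 * lg by apply: Rmult_le_compat_r => //; rewrite /sg; rlra.
  have -> : a * y = y * ln 2 - sg * (y * ln 2) by rewrite /a /sg; field.
  rlra.
have f2 : KK * (1 + X) <= a * y.
  have h1 : KK / a * (1 + X) <= y.
    have : 0 <= (INR c + INR d) * X by apply: Rmult_le_pos; rlra.
    rlra.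
  have := Rmult_le_compat_l a _ _ (Rlt_le _ _ a0) h1.
  by have -> : a * (KK / a * (1 + X)) = KK * (1 + X) by field; rlra.
have f3 : 4 * (INR d * (X * Z2)) <= 4 * (INR d * (Z1 + INR N0 + G + Z2)) * X.
  have : INR d * (X * Z2) <= INR d * ((Z1 + INR N0 + G + Z2) * X) by apply: Rmult_le_compat_l => //; rnra.
  rlra.
have f4 : 0 <= INR d * Z2 by apply: Rmult_le_pos; rlra.
have f5 : 0 <= lg * X by apply: Rmult_le_pos; rlra.
move: f1 f2 f3 f4 f5; rewrite /KK -/lg; move: (ln 2) l2 => ? ?; clear -X0; rnra.
Qed.
End Supply.

(** * Choice of the parameters and summation over dyadic ranges *)

Lemma bin_lower G k : (k <= G)%N -> ((G - k) ^ k <= 'C(G, k) * k ^ k)%N.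
Proof.
move=> kG; apply: (@leq_trans (G ^_ k)).
  rewrite ffact_prod -[X in ((G - k) ^ X)%N](card_ord k) -prod_nat_const; apply: leq_prod => i _.
  by apply: leq_sub2l; apply: ltnW.
rewrite -bin_ffact leq_mul2l; apply/orP; right.
rewrite fact_prod -[X in (k ^ X)%N]subn0 -[X in (_ <= X)%N]prod_nat_const_nat big_add1 /= !big_mkord.
by apply: leq_prod => i _.
Qed.

Lemma nat_floor x : 0 <= x -> exists k : nat, INR k <= x < INR k + 1.
Proof.
move=> x0; have [h1 h2] := base_Int_part x; exists (Z.to_nat (Int_part x)).
have z0 : (0 <= Int_part x)%Z.
  have [//|h] := BinInt.Z.le_gt_cases 0 (Int_part x); have h3 : (Int_part x + 1 <= 0)%Z by lia.
  by have := IZR_le _ _ h3; rewrite plus_IZR; rlra.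
by rewrite INR_IZR_INZ Znat.Z2Nat.id //; rlra.
Qed.

Lemma mem_In (T : eqType) (x : T) l : x \in l -> List.In x l.
Proof. by elim: l => //= y l IH; rewrite inE => /orP[/eqP->|/IH]; [left | right]. Qed.

Definition p2 x := Rpower 2 x.
Lemma p2D x y : p2 (x + y) = p2 x * p2 y. Proof. exact: Rpower_plus. Qed.
Lemma p2_pos x : 0 < p2 x. Proof. exact: Rpow_pos. Qed.
Lemma p2_le x y : x <= y -> p2 x <= p2 y. Proof. by move=> h; apply: Rle_Rpower; rlra. Qed.
Lemma p2_nat k : INR (2 ^ k)%N = p2 (INR k).
Proof. by rewrite INR_X /p2 -Rpower_pow //=; rlra. Qed.
Lemma p2_X x k : p2 x ^ k = p2 (INR k * x). Proof. exact: Rpow_pow. Qed.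
Lemma nat_le_p2 c : INR c <= p2 (INR c).
Proof. by rewrite -p2_nat; apply: leq_INR; apply: ltnW; exact: ltn_expl. Qed.
Lemma p2_1 : p2 1 = 2. Proof. by rewrite /p2 Rpower_1; rlra. Qed.
Lemma p2_lge x : 0 < x -> exists y, p2 y = x /\ (forall z, x <= p2 z -> y <= z) /\ (forall z, p2 z <= x -> z <= y).
Proof.
move=> x0; have l2 := ln_lt_2; exists (ln x / ln 2).
have E : p2 (ln x / ln 2) = x by rewrite /p2 /Rpower; have -> : ln x / ln 2 * ln 2 = ln x by [field; rlra]; exact: exp_ln.
have mono y z : p2 y <= p2 z -> y <= z.
  move=> h; apply: Rnot_lt_le => lt; have : p2 z < p2 y by apply: Rpower_lt; rlra.
  rlra.
by split => //; split => z; rewrite -{1}E; exact: mono.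
Qed.

(** The second bound is the range of the separation argument. The third balances the boundary of the
    box against the required saving; after clearing common factors it reads (m + 2)/(2 m (m + 1)) <=
    1/m for m >= 2, and 3/8 <= 1 for m = 1. *)
Lemma mu_bounds m n l : (0 < m)%N -> (1 < n)%N -> (0 < l)%N ->
  [/\ 0 < mu_exp m n l, 2 * INR l * INR n.-1 * mu_exp m n l <= 1 &
      mu_exp m n l * (1 + 2 / INR m) <= 1 / (INR (m * totient n)%N * INR n.-1)].
Proof.
move=> m0 n1 l0; have q1 : 1 <= INR n.-1 by apply: INR_ge1; rewrite -ltnS prednK // ltnW.
have M1 := INR_ge1 m0; have L1 := INR_ge1 l0.
have F1 : 1 <= INR (totient n) by apply: INR_ge1; rewrite totient_gt0 ltnW.
have FQ : 0 < INR (totient n) * INR n.-1 by apply: Rmult_lt_0_compat; rlra.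
have MF : 0 < INR m * (INR (totient n) * INR n.-1) by apply: Rmult_lt_0_compat; rlra.
have LQ : 0 < 2 * INR l * INR n.-1 by apply: Rmult_lt_0_compat; rlra.
have [d0 d1] : 0 < delta_tilde m n /\ delta_tilde m n * (1 + 2 / INR m) <= 1 / (INR m * (INR (totient n) * INR n.-1)).
  have iFQ : 0 < / (INR (totient n) * INR n.-1) by exact: Rinv_0_lt_compat.
  rewrite /delta_tilde subn1; case: Nat.eqb_spec => [->|m1].
    have -> : 1 / (8 * INR (totient n) * INR n.-1) = / (INR (totient n) * INR n.-1) / 8 by field; rlra.
    rewrite [INR 1]/=; split; first rlra.
    have -> : 1 / (1 * (INR (totient n) * INR n.-1)) = / (INR (totient n) * INR n.-1) by field; rlra.
    rlra.
  have -> : INR (m + 1)%N = INR m + 1 by rewrite plus_INR.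
  have -> : 1 / (2 * (INR m + 1) * INR (totient n) * INR n.-1) = / (INR (totient n) * INR n.-1) * / (2 * (INR m + 1)) by field; rlra.
  have i2 : 0 < / (2 * (INR m + 1)) by apply: Rinv_0_lt_compat; rlra.
  split; first exact: Rmult_lt_0_compat.
  have -> : 1 / (INR m * (INR (totient n) * INR n.-1)) = / (INR (totient n) * INR n.-1) * / INR m by field; rlra.
  rewrite Rmult_assoc; apply: Rmult_le_compat_l; first rlra.
  apply: (Rmult_le_reg_r (2 * (INR m + 1) * INR m)); first by apply: Rmult_lt_0_compat; rlra.
  have -> : / (2 * (INR m + 1)) * (1 + 2 / INR m) * (2 * (INR m + 1) * INR m) = INR m + 2 by field; rlra.
  have -> : / INR m * (2 * (INR m + 1) * INR m) = 2 * INR m + 2 by field; rlra.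
  rlra.
rewrite INR_M [INR m * _ * _]Rmult_assoc /mu_exp subn1; set dl := 1 / (2 * INR l * INR n.-1).
have dl0 : 0 < dl by apply: Rdiv_lt_0_compat; rlra.
have m1 := Rmin_l dl (delta_tilde m n); have m2 := Rmin_r dl (delta_tilde m n).
split; first exact: Rmin_glb_lt.
  have -> : 1 = 2 * INR l * INR n.-1 * dl by rewrite /dl; field; rlra.
  by apply: Rmult_le_compat_l; rlra.
apply: Rle_trans d1; apply: Rmult_le_compat_r => //.
by have : 0 < 2 / INR m by [apply: Rdiv_lt_0_compat; rlra]; rlra.
Qed.

(** All parameters are powers of two determined by t, and every requirement of [dichotomy] becomes a
    linear inequality between exponents. The number of exceptional fields carries no constant
    factor: constants are absorbed into the exponent by t >= t0, and t0 may depend on l. *)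
Lemma dyadic_step F m n l e : number_field F -> ext_degree QQ F m -> (1 < n)%N -> lin_disjoint F (cyclo_field n) -> (0 < l)%N ->
  0 < e <= mu_exp m n l -> exists (C : R) (t0 : nat), 0 < C /\
  (forall K Dd N, in_T F n K -> absdisc K Dd -> cl_tors_card K l N -> INR N <= C * Rpower (INR Dd) (1 / 2 + e / 2)) /\
  forall t, (t0 <= t)%N -> exists Ks : seq cset, INR (size Ks) <= p2 (INR t * (1 / INR n.-1 - mu_exp m n l + e / 2)) /\
    forall K Dd N, in_T F n K -> absdisc K Dd -> cl_tors_card K l N -> (2 ^ t <= Dd < 2 ^ t.+1)%N -> ~ K \in Ks ->
      INR N <= 2 * C * Rpower (INR Dd) (1 / 2 - mu_exp m n l + e).
Proof.
move=> nF eF n1 ld l0 [e0 eD]; have [L [d [s [w [N0 [c [D Ed N00 c0 dich]]]]]]] := dichotomy nF eF n1 ld.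
have d0 : (0 < d)%N := qdata_pos (nfdata_qdata D).
have m0 : (0 < m)%N by move: d0; rewrite Ed muln_gt0 => /andP[].
have [D0 D1 D2] := mu_bounds m0 n1 l0; set dl := mu_exp m n l in D0 D1 D2 eD *.
have n10 : (0 < n.-1)%N by rewrite -ltnS prednK // ltnW.
have q1 := INR_ge1 n10; have L1 := INR_ge1 l0; set q := INR n.-1 in q1 D1 D2 *.
have dhalf : dl <= 1 / 2.
  have : 1 * dl <= INR l * q * dl by apply: Rmult_le_compat_r; [rlra | rnra].
  rlra.
set e1 := e / 100; have e1p : 0 < e1 <= 1 by rewrite /e1; rlra.
have [C0 [C00 hsup]] := supply D N00 e1p.
have e2p : 0 < e / 2 by rlra.
have [C [Cp hC]] := class_count (m * n) l e2p.
have Dp K Dd : in_T F n K -> absdisc K Dd -> (0 < Dd)%N.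
  by move=> [G _] hD; have [? [? [? [_ _ h _ _]]]] := field_data nF eF n1 G hD.
(* Three summands for three requirements: enough primes compared with E and k (T1), constants
   negligible against e t (T2), and room for the dyadic range given by [supply] (T3). *)
set T0 := INR (8 * n + 4 * c * (c + 4))%N + 2 + 5 / e * (4 * INR c + 5 + 3 * INR d) + 2 * (C0 + 1 + 2 * C0 * C0 / e1) / e1.
have cc := INR_ge1 c0; have dd := INR_ge1 d0.
have k1 : 0 <= 5 / e * (4 * INR c + 5 + 3 * INR d).
  by apply: Rmult_le_pos; [apply: Rlt_le; apply: Rdiv_lt_0_compat; rlra | rlra].
have k2 : 0 <= 2 * (C0 + 1 + 2 * C0 * C0 / e1) / e1.
  apply: Rlt_le; apply: Rdiv_lt_0_compat; last rlra.
  have : 0 < 2 * C0 * C0 / e1 by apply: Rdiv_lt_0_compat; [rnra | rlra].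
  rlra.
have n8 := INR_ge0 (8 * n + 4 * c * (c + 4)).
have T00 : 0 <= T0 by rewrite /T0; rlra.
have [t0 [_ ht0]] := nat_floor T00.
exists C, t0.+1; split => //; split.
  move=> K Dd N hT hD hcl; case: (hT) => G _; apply: hC (class_bound nF eF n1 G hD l0 hcl) _.
  exact: Dp hT hD.
move=> t tt; set ta := INR t.
have taT : T0 <= ta by have := leq_INR tt; rewrite S_INR -/ta; rlra.
have T1 : INR (8 * n + 4 * c * (c + 4))%N + 2 <= ta by move: taT; rewrite /T0; rlra.
have T2 : 5 * (4 * INR c + 5 + 3 * INR d) <= e * ta.
  have h : 5 / e * (4 * INR c + 5 + 3 * INR d) <= ta by move: taT; rewrite /T0; rlra.
  have := Rmult_le_compat_l e _ _ (Rlt_le _ _ e0) h.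
  by have -> : e * (5 / e * (4 * INR c + 5 + 3 * INR d)) = 5 * (4 * INR c + 5 + 3 * INR d) by field; rlra.
have T3 : 2 * (C0 + 1 + 2 * C0 * C0 / e1) <= e1 * ta.
  have h : 2 * (C0 + 1 + 2 * C0 * C0 / e1) / e1 <= ta by move: taT; rewrite /T0; rlra.
  have := Rmult_le_compat_l e1 _ _ (Rlt_le _ _ (proj1 e1p)) h.
  by have -> : e1 * (2 * (C0 + 1 + 2 * C0 * C0 / e1) / e1) = 2 * (C0 + 1 + 2 * C0 * C0 / e1) by field; rlra.
move: T1; rewrite plus_INR !INR_M !plus_INR => T1.
have i8 : INR 8 = 8 by rewrite /=; rlra.
have i4 : INR 4 = 4 by rewrite /=; rlra.
rewrite i8 i4 in T1; have nn : 1 <= INR n by apply: INR_ge1; exact: ltnW.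
have cc4 : 0 <= INR c * (INR c + 4) by apply: Rmult_le_pos; rlra.
have ta2 : 2 <= ta by rlra.
(* lt is the binary logarithm of t. Indices i >= lt / e1 satisfy 2^(i e1) >= t >= k, so a factor k^k
   costs no more than 2^(k i e1). *)
have [lt [Elt [lt1 lt2]]] := p2_lge (ltac:(rlra) : 0 < ta).
have lt0 : 0 <= lt by apply: lt2; rewrite /p2 Rpower_O; rlra.
have le0 : 0 <= lt / e1 by apply: Rmult_le_pos => //; apply: Rlt_le; apply: Rinv_0_lt_compat; rlra.
have [I0' [hI0 hI0']] := nat_floor le0.
have e1lt : lt / e1 * e1 = lt by field; rlra.
have hI0a : lt <= INR I0'.+1 * e1 by rewrite S_INR -e1lt; apply: Rmult_le_compat_r; rlra.
have hI0b : INR I0'.+1 * e1 <= lt + 1.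
  have : INR I0' * e1 <= lt / e1 * e1 by apply: Rmult_le_compat_r; rlra.
  by rewrite S_INR e1lt; rlra.
have [I1 [hI1 hI1']] := nat_floor (Rmult_le_pos _ _ (Rlt_le _ _ (proj1 e1p)) (ltac:(rlra) : 0 <= ta)).
(* For this I0 the quantity 2^(I0 e1 / 2) is of order t^(1/2), so I1 of order e1 t suffices for
   [supply], and i + 1 <= e1 t. *)
have [|i [/andP[iI0 iI1] hr]] := hsup I0'.+1 I1.
  set s0 := Rpower 2 _; have s00 : 0 < s0 by exact: p2_pos.
  have ss : s0 * s0 <= 2 * ta.
    rewrite /s0 -Rpower_plus; apply: Rle_trans (_ : p2 (lt + 1) <= _); first by apply: p2_le; rlra.
    by rewrite p2D p2_1 Elt; rlra.
  have : C0 * s0 <= e1 / 8 * (s0 * s0) + 2 * C0 * C0 / e1.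
    have : 0 <= (e1 * s0 - 4 * C0) * (e1 * s0 - 4 * C0) / (8 * e1).
      by apply: Rmult_le_pos; [exact: Rle_0_sqr | apply: Rlt_le; apply: Rinv_0_lt_compat; rlra].
    have -> : (e1 * s0 - 4 * C0) * (e1 * s0 - 4 * C0) / (8 * e1) = e1 / 8 * (s0 * s0) - C0 * s0 + 2 * C0 * C0 / e1 by field; rlra.
    rlra.
  have : 0 <= e1 * ta by apply: Rmult_le_pos; rlra.
  have : e1 / 8 * (s0 * s0) <= e1 / 8 * (2 * ta) by apply: Rmult_le_compat_l; rlra.
  rlra.
set io := INR i in hr *.
have y1 : ta <= p2 (io * e1).
  rewrite -Elt; apply: p2_le; apply: Rle_trans hI0a _; apply: Rmult_le_compat_r; [rlra | exact: leq_INR].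
have ioe : 1 <= io * e1.
  have : 1 <= lt by apply: lt2; rewrite p2_1.
  by have := lt1 _ y1; rlra.
have io1 : io + 1 <= e1 * ta by have := leq_INR iI1; rewrite S_INR -/io; rlra.
have io0 : 1 <= io by have := Rmult_le_compat_l io _ _ (INR_ge0 i) (proj2 e1p); rlra.
set r := size (slots L N0 i) in hr; set eps3 := e / 4.
have r2 : ta * ta <= INR r.
  apply: Rle_trans hr; apply: Rle_trans (_ : p2 (io * e1) * p2 (io * e1) <= _).
    by apply: Rmult_le_compat; rlra.
  by rewrite -p2D; apply: p2_le; have := Rmult_le_compat_l io _ _ (INR_ge0 i) (ltac:(rewrite /e1; rlra) : e1 <= / 4); rlra.
(* k is the largest integer with k (i + 1) <= ss: the auxiliary ideals have norm at most 2^ss,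
   slightly less than D^mu, and rounding k loses at most i + 1 <= e1 t in the exponent. *)
pose ss := ta * (dl - eps3).
have ss0 : e * ta <= 2 * ss by rewrite /ss /eps3; have := Rmult_le_compat_r ta _ _ (ltac:(rlra) : 0 <= ta) eD; rlra.
have ss1 : ss <= ta / 2 by rewrite /ss /eps3; have := Rmult_le_compat_r ta _ _ (ltac:(rlra) : 0 <= ta) dhalf; have : 0 <= e * ta by [apply: Rmult_le_pos; rlra]; rlra.
have [k [hk1 hk2]] := nat_floor (ltac:(apply: Rmult_le_pos; [have := Rmult_le_pos _ _ (Rlt_le _ _ e0) (ltac:(rlra) : 0 <= ta); rlra | apply: Rlt_le; apply: Rinv_0_lt_compat; rlra]) : 0 <= ss * / (io + 1)).
set ka := INR k in hk1 hk2; pose P := ka * (io + 1).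
have ka0 : 0 <= ka := INR_ge0 k.
have Ps : P <= ss.
  apply: Rle_trans (_ : ss * / (io + 1) * (io + 1) <= _); first by apply: Rmult_le_compat_r; rlra.
  by rewrite Rmult_assoc Rinv_l; rlra.
have sP : ss < P + (io + 1).
  have : ss * / (io + 1) * (io + 1) < (ka + 1) * (io + 1) by apply: Rmult_lt_compat_r; rlra.
  by rewrite Rmult_assoc Rinv_l /P; rlra.
have kP : ka <= e1 * P.
  by have := Rmult_le_compat_l ka _ _ ka0 (ltac:(rlra) : 1 <= e1 * (io + 1)); rewrite /P; rlra.
have kt : ka <= ta by have := Rmult_le_compat_l ka _ _ ka0 (ltac:(rlra) : 1 <= io + 1); rewrite -/P; rlra.
have k0 : (0 < k)%N.
  rewrite lt0n; apply/eqP => E; move: sP; rewrite /P /ka E /= Rmult_0_l.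
  by move: io1 ss0; rewrite /e1; rlra.
have eP : e1 * P <= e1 * ta / 2 by have := Rmult_le_compat_l e1 _ _ (Rlt_le _ _ (proj1 e1p)) (ltac:(rlra) : P <= ta / 2); rlra.
have eta : e1 * ta = e * ta / 100 by rewrite /e1; field.
have [Pf [p [hslot pinj pB]]] := slots_data L N0 i.
have dm : (0 < d * n.-1)%N by rewrite muln_gt0 d0.
(* Exponents of two for the side of the box, for the residue systems and for the norm of Theta(x) b;
   the successors round the quotients up. *)
pose a := ((c + t.+1) %/ (d * n.-1)).+1; pose H := ((c + i.+1 * (totient n * (k + k))) %/ d).+1; pose E := (c + a * c)%N.
have c2 : (c <= 2 ^ c)%N by apply: ltnW; exact: ltn_expl.
have hA : (c * 2 ^ t.+1 <= (2 ^ a) ^ (d * n.-1))%N.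
  apply: (@leq_trans (2 ^ (c + t.+1))%N); first by rewrite expnD leq_mul2r c2 orbT.
  by rewrite -expnM leq_exp2l //; apply: ltnW; exact: ltn_ceil.
have hH : (c * (2 ^ i.+1) ^ (totient n * (k + k)) <= (2 ^ H) ^ d)%N.
  rewrite -!expnM; apply: (@leq_trans (2 ^ (c + i.+1 * (totient n * (k + k))))%N); first by rewrite expnD leq_mul2r c2 orbT.
  by rewrite leq_exp2l //; apply: ltnW; exact: ltn_ceil.
have hE : (c * (2 ^ a) ^ c < 2 ^ E)%N.
  by rewrite /E -expnM expnD ltn_pmul2r ?expn_gt0 //; exact: ltn_expl.
have aR : (INR a - 1) * (INR d * q) <= INR c + ta + 1 /\ INR c + ta + 1 <= INR a * (INR d * q).
  have e' : INR (c + t.+1)%N = INR c + ta + 1 by rewrite plus_INR S_INR -/ta; rlra.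
  rewrite -e' /a S_INR /q -INR_M; split.
    have := leq_INR (leq_trunc_div (c + t.+1) (d * n.-1)); rewrite INR_M; set u := INR (_ %/ _); rlra.
  by have := leq_INR (ltnW (ltn_ceil (c + t.+1) dm)); rewrite INR_M S_INR.
have HR : (INR H - 1) * INR d <= INR c + 2 * INR (totient n) * P.
  have e' : INR (c + i.+1 * (totient n * (k + k)))%N = INR c + 2 * INR (totient n) * P.
    by rewrite plus_INR !INR_M plus_INR S_INR /P -/ka -/io; rlra.
  by rewrite -e' /H S_INR; have := leq_INR (leq_trunc_div (c + i.+1 * (totient n * (k + k))) d); rewrite INR_M; set u := INR (_ %/ _); rlra.
have dq1 : 1 <= INR d * q by rewrite -(Rmult_1_r 1); apply: Rmult_le_compat; rlra.
have a2 : INR a <= INR c + ta + 2.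
  have [h _] := aR; have : (INR a - 1) * 1 <= INR c + ta + 1; last rlra.
  have a1 : 0 <= INR a - 1 by have := INR_ge1 (ltn0Sn _ : (0 < a)%N); rlra.
  by apply: Rle_trans h; apply: Rmult_le_compat_l.
have hEr : (4 * E <= r)%N.
  apply/ssrnat.leP; apply: INR_le; apply: Rle_trans r2; rewrite INR_M i4 /E plus_INR INR_M.
  have : 4 * (INR c * (INR c + 4)) * ta <= ta * ta by apply: Rmult_le_compat_r; rlra.
  have : INR a * INR c <= (INR c + ta + 2) * INR c by apply: Rmult_le_compat_r; rlra.
  have : INR c * INR c * 1 <= INR c * INR c * ta by apply: Rmult_le_compat_l; [apply: Rmult_le_pos |]; rlra.
  have : INR c * 1 <= INR c * ta by apply: Rmult_le_compat_l; rlra.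
  rlra.
have [Ks [hsz hKs]] := dich r (2 ^ i.+1)%N Pf p k (2 ^ a)%N (2 ^ H)%N E hslot pinj pB k0 (ltac:(by rewrite expn_gt0)) (ltac:(by rewrite expn_gt0)) hH hE hEr.
exists Ks; split.
  set rr := INR r in hr r2; have rr0 : 0 < rr by have : 0 < ta * ta by [apply: Rmult_lt_0_compat; rlra]; rlra.
  have rk0 : 0 < rr ^ k by exact: pow_lt.
  set W := INR (2 ^ a + 2 ^ a).+1.
  have W0 : 0 <= W by exact: INR_ge0.
  have hW : W <= p2 (INR a + 2).
    have -> : INR a + 2 = INR (a + 2) by rewrite plus_INR.
    rewrite -p2_nat; apply: leq_INR; rewrite expnD; have : (0 < 2 ^ a)%N by rewrite expn_gt0.
    by rewrite -[expn 2 2]/4%N; move: (expn 2 a) => u; clear; lia.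
  have pin x k' : 0 <= x -> x <= p2 (io * e1) -> x ^ (k' + k') <= p2 (2 * INR k' * (io * e1)).
    move=> x0 hx; apply: Rle_trans (pow_incr _ _ (k' + k') (conj x0 hx)) _.
    by rewrite p2_X plus_INR; apply: p2_le; rlra.
  set cc' := INR (c * (2 * n) ^ (k + k)).
  have hcc : 0 <= cc' <= p2 (INR c + 2 * ka * (io * e1)).
    split; first exact: INR_ge0.
    rewrite /cc' INR_M INR_X p2D; apply: Rmult_le_compat; [exact: INR_ge0 | by apply: pow_le; exact: INR_ge0 | exact: nat_le_p2 |].
    apply: pin; first exact: INR_ge0.
    by rewrite INR_M [INR 2]/=; rlra.
  have hkk : 0 <= ka ^ (k + k) <= p2 (2 * ka * (io * e1)).
    by split; [exact: pow_le | apply: pin => //; rlra].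
  have hWd : 0 <= W ^ d <= p2 (INR d * (INR a + 2)).
    by split; [exact: pow_le | rewrite -p2_X; apply: pow_incr].
  have hWd1 : 0 <= W ^ d.-1 <= p2 ((INR d - 1) * (INR a + 2)).
    have -> : INR d - 1 = INR d.-1 by rewrite -[in INR d](prednK d0) S_INR; rlra.
    by split; [exact: pow_le | rewrite -p2_X; apply: pow_incr].
  have hrk : p2 (ka * (io * (1 - e1))) <= rr ^ k.
    by rewrite -p2_X; apply: pow_incr; split; [exact: Rlt_le (p2_pos _) | exact: hr].
  have da : INR d * INR a <= ta * (1 / q) + INR c + 1 + INR d.
    apply: (Rmult_le_reg_r q); first rlra.
    have -> : (ta * (1 / q) + INR c + 1 + INR d) * q = ta + (INR c + 1) * q + INR d * q by field; rlra.
    by have := Rmult_le_compat_l (INR c + 1) _ _ ltac:(rlra) q1; have := proj1 aR; rlra.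
  have ea0 : 0 <= e1 * ka by apply: Rmult_le_pos; rlra.
  have vE : ka * io = P - ka by rewrite /P; ring.
  (* Exponent of the contribution of tuples without a single prime, c (2 n k)^(2k) A^d / r^k up to
     constants; the main terms are t / (n-1) from A^d and -k i from r^k. *)
  have x1 : INR c + 2 * ka * (io * e1) + 2 * ka * (io * e1) + INR d * (INR a + 2) - ka * (io * (1 - e1)) <= ta * (1 / q - dl + e / 2) - 1.
    have -> : INR c + 2 * ka * (io * e1) + 2 * ka * (io * e1) + INR d * (INR a + 2) - ka * (io * (1 - e1)) =
      INR c + INR d * INR a + 2 * INR d - ka * io + 5 * (e1 * (ka * io)) by ring.
    rewrite vE; have : e1 * (P - ka) = e1 * P - e1 * ka by ring.
    by move: da Ps sP io1 kP eP eta T2; rewrite /ss /eps3; rlra.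
  (* Exponent of the boundary contribution c (2 n)^(2k) H A^(d-1); replacing A^d by H A^(d-1) saves
     at least D^mu by the third inequality of [mu_bounds]. *)
  have x2 : INR c + 2 * ka * (io * e1) + INR H + (INR d - 1) * (INR a + 2) <= ta * (1 / q - dl + e / 2) - 1.
    have M1 := INR_ge1 m0; have F1 : 1 <= INR (totient n) by apply: INR_ge1; rewrite totient_gt0 ltnW.
    have dE : INR d = INR m * INR (totient n) by rewrite Ed INR_M.
    have hH1 : INR H - 1 <= INR c + 2 * (ta * dl / INR m).
      apply: (Rmult_le_reg_r (INR d)); first rlra; apply: Rle_trans HR _.
      have -> : (INR c + 2 * (ta * dl / INR m)) * INR d = INR c * INR d + 2 * INR (totient n) * (ta * dl) by rewrite dE; field; rlra.
      have : INR c * 1 <= INR c * INR d by apply: Rmult_le_compat_l; rlra.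
      have : 2 * INR (totient n) * P <= 2 * INR (totient n) * (ta * dl).
        apply: Rmult_le_compat_l; first rlra.
        have : 0 <= ta * e by apply: Rmult_le_pos; rlra.
        by move: Ps; rewrite /ss /eps3; rlra.
      rlra.
    have ha : ta * dl + 2 * (ta * dl / INR m) <= INR a.
      apply: (Rmult_le_reg_r (INR d * q)); first rlra.
      have -> : (ta * dl + 2 * (ta * dl / INR m)) * (INR d * q) = ta * (dl * (1 + 2 / INR m) * (INR d * q)) by field; rlra.
      have h2 : dl * (1 + 2 / INR m) * (INR d * q) <= 1.
        have D2' : dl * (1 + 2 / INR m) <= 1 / (INR d * q) by rewrite Ed.
        have := Rmult_le_compat_r (INR d * q) _ _ ltac:(rlra) D2'.
        by have -> : 1 / (INR d * q) * (INR d * q) = 1 by field; split; rlra.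
      by have := Rmult_le_compat_l ta _ _ ltac:(rlra) h2; have := proj2 aR; rlra.
    have -> : INR c + 2 * ka * (io * e1) + INR H + (INR d - 1) * (INR a + 2) =
      INR c + 2 * (e1 * (ka * io)) + INR H + INR d * INR a - INR a + 2 * INR d - 2 by ring.
    rewrite vE; have : e1 * (P - ka) = e1 * P - e1 * ka by ring.
    by move: da hH1 ha eP eta T2; rlra.
  have main : INR (size Ks) * rr ^ (k + k) <= cc' * (rr ^ k * ka ^ (k + k) * W ^ d + rr ^ (k + k) * (p2 (INR H) * W ^ d.-1)).
    by rewrite /cc' /W /rr /ka -p2_nat -!INR_X -!INR_M -plus_INR -!INR_M; exact: leq_INR.
  have rkk : rr ^ (k + k) = rr ^ k * rr ^ k by exact: pow_add.
  have b1 : cc' * (rr ^ k * ka ^ (k + k) * W ^ d) <= p2 (ta * (1 / q - dl + e / 2) - 1) * rr ^ (k + k).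
    have h1 : cc' * (ka ^ (k + k) * W ^ d) <= p2 (ta * (1 / q - dl + e / 2) - 1) * rr ^ k.
      apply: Rle_trans (_ : p2 (INR c + 2 * ka * (io * e1)) * (p2 (2 * ka * (io * e1)) * p2 (INR d * (INR a + 2))) <= _).
        apply: Rmult_le_compat; [by case: hcc | by apply: Rmult_le_pos; [case: hkk | case: hWd] | by case: hcc |].
        by apply: Rmult_le_compat; [case: hkk | case: hWd | case: hkk | case: hWd].
      apply: Rle_trans (_ : p2 (ta * (1 / q - dl + e / 2) - 1) * p2 (ka * (io * (1 - e1))) <= _).
        by rewrite -!p2D; apply: p2_le; rlra.
      by apply: Rmult_le_compat_l => //; exact: Rlt_le (p2_pos _).
    by have := Rmult_le_compat_l (rr ^ k) _ _ (Rlt_le _ _ rk0) h1; rewrite rkk; rlra.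
  have b2 : cc' * (rr ^ (k + k) * (p2 (INR H) * W ^ d.-1)) <= p2 (ta * (1 / q - dl + e / 2) - 1) * rr ^ (k + k).
    have h1 : cc' * (p2 (INR H) * W ^ d.-1) <= p2 (ta * (1 / q - dl + e / 2) - 1).
      apply: Rle_trans (_ : p2 (INR c + 2 * ka * (io * e1)) * (p2 (INR H) * p2 ((INR d - 1) * (INR a + 2))) <= _).
        have Hp := p2_pos (INR H).
        apply: Rmult_le_compat; [by case: hcc | by apply: Rmult_le_pos; [rlra | case: hWd1] | by case: hcc |].
        by apply: Rmult_le_compat_l; [rlra | case: hWd1].
      by rewrite -!p2D; apply: p2_le; rlra.
    by have := Rmult_le_compat_l (rr ^ (k + k)) _ _ (pow_le _ _ (Rlt_le _ _ rr0)) h1; rlra.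
  apply: (Rmult_le_reg_r (rr ^ (k + k))); first exact: pow_lt.
  have -> : p2 (ta * (1 / q - dl + e / 2)) = p2 (ta * (1 / q - dl + e / 2) - 1) * 2.
    by rewrite -[X in _ = _ * X]p2_1 -p2D; congr p2; ring.
  rlra.
move=> K Dd N hT hD hcl /andP[DdL DdU] nKs.
have pt : (i.+1 * k <= t)%N.
  by apply/ssrnat.leP; apply: INR_le; rewrite INR_M S_INR -/io -/ta -/ka; move: Ps ss1; rewrite /P; rlra.
have [||G hG hcl'] := hKs K Dd l N hT hD hcl l0 _ _ nKs.
- by apply: leq_trans hA; rewrite leq_mul2l ltnW ?orbT.
(* The separation condition: 2 l (n-1) k (i + 1) <= t by the second inequality of [mu_bounds], with
   a multiple of e t to spare for the constant c. *)
- apply: leq_trans DdL; rewrite -expnM; set x := (i.+1 * _)%N.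
  have hx : (2 * (x + c) <= t)%N.
    apply/ssrnat.leP; apply: INR_le; rewrite INR_M plus_INR /x !INR_M (S_INR i) -/io -/ka -/q -/ta [INR 2]/=.
    have lq0 : 1 <= INR l * q by rewrite -(Rmult_1_r 1); apply: Rmult_le_compat; rlra.
    have h1 : (io + 1) * (ka * (INR l * q)) <= ss * (INR l * q).
      by have := Rmult_le_compat_r (INR l * q) _ _ ltac:(rlra) Ps; rewrite /P; rlra.
    have h2 : 2 * (ss * (INR l * q)) = ta * (2 * INR l * q * dl) - ta * e / 2 * (INR l * q) by rewrite /ss /eps3; field.
    have h3 := Rmult_le_compat_l ta _ _ (ltac:(rlra) : 0 <= ta) D1.
    have h4 : ta * e / 2 * 1 <= ta * e / 2 * (INR l * q).
      by apply: Rmult_le_compat_l => //; have : 0 <= ta * e by [apply: Rmult_le_pos; rlra]; rlra.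
    rlra.
  apply: (@leq_trans ((2 ^ x * 2 ^ c) ^ 2)%N); last by rewrite -expnD -expnM mulnC leq_exp2l.
  by rewrite ltn_exp2r // ltn_pmul2l ?expn_gt0 //; exact: ltn_expl.
have Dd0 := Dp K Dd hT hD.
have := hC K Dd _ _ hcl' (ltac:(by rewrite expn_gt0 expn_gt0 /= -expnM (leq_trans _ DdL) // leq_exp2l)).
rewrite INR_M; set M := INR 'C(G, k) => hN.
have DR : 1 <= INR Dd by exact: INR_ge1.
set rr := INR r in hr r2; have rr0 : 0 < rr by have : 0 < ta * ta by [apply: Rmult_lt_0_compat; rlra]; rlra.
have hG' : rr <= 4 * INR n * INR G by have := leq_INR hG; rewrite !INR_M i4.
have kr : 8 * INR n * ka <= rr.
  by apply: Rle_trans r2; apply: Rmult_le_compat; rlra.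
have kG : (k <= G)%N.
  apply/ssrnat.leP; apply: INR_le; rewrite -/ka; apply: (Rmult_le_reg_l (8 * INR n)); rlra.
set g := INR (G - k); have gE : g = INR G - ka by rewrite /g minus_INR //; exact/ssrnat.leP.
have g0 : 0 <= g := INR_ge0 _.
have hg : p2 (io * (1 - e1) - io * e1) <= g.
  apply: (Rmult_le_reg_l (p2 (io * e1))); first exact: p2_pos.
  rewrite -p2D; have -> : io * e1 + (io * (1 - e1) - io * e1) = io * (1 - e1) by ring.
  apply: Rle_trans hr _; apply: Rle_trans (_ : 8 * INR n * g <= _); first by rewrite gE; rlra.
  by apply: Rmult_le_compat_r; rlra.
have M0 : 0 <= M by exact: INR_ge0.
(* The binomial coefficient is at least ((G - k) / k)^k, where G - k >= r / (8 n); the factors k and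
   8 n cost 2^(i e1) each. *)
have hM : p2 (ta * (dl - e / 2)) <= M.
  have := leq_INR (bin_lower kG); rewrite INR_M !INR_X -/g -/M -/ka => bl.
  have u1 : p2 (ka * (io * (1 - e1) - io * e1)) <= g ^ k.
    by rewrite -p2_X; apply: pow_incr; split => //; exact: Rlt_le (p2_pos _).
  have u2 : ka ^ k <= p2 (ka * (io * e1)) by rewrite -p2_X; apply: pow_incr; rlra.
  have u3 : M * ka ^ k <= M * p2 (ka * (io * e1)) by exact: Rmult_le_compat_l.
  apply: Rle_trans (_ : p2 (ka * (io * (1 - e1) - io * e1) - ka * (io * e1)) <= _).
    apply: p2_le; have -> : ka * (io * (1 - e1) - io * e1) - ka * (io * e1) = ka * io - 3 * (e1 * (ka * io)) by ring.
    have -> : ka * io = P - ka by rewrite /P; ring.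
    have : e1 * (P - ka) = e1 * P - e1 * ka by ring.
    have : 0 <= e1 * ka by apply: Rmult_le_pos; rlra.
    by move: Ps sP io1 kP eP eta; rewrite /ss /eps3; have : 0 <= e * ta by [apply: Rmult_le_pos; rlra]; rlra.
  apply: (Rmult_le_reg_r (p2 (ka * (io * e1)))); first exact: p2_pos.
  by rewrite -p2D; have -> : ka * (io * (1 - e1) - io * e1) - ka * (io * e1) + ka * (io * e1) = ka * (io * (1 - e1) - io * e1) by [ring]; rlra.
have hDd : Rpower (INR Dd) (dl - e / 2) <= 2 * p2 (ta * (dl - e / 2)).
  apply: Rle_trans (_ : Rpower (p2 (ta + 1)) (dl - e / 2) <= _).
    apply: Rpow_mono; last rlra; split; first rlra.
    by rewrite /ta -S_INR -p2_nat; apply: leq_INR; exact: ltnW.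
  rewrite /p2 Rpower_mult -/(p2 _); have -> : (ta + 1) * (dl - e / 2) = ta * (dl - e / 2) + (dl - e / 2) by ring.
  rewrite -/(p2 _) p2D Rmult_comm; apply: Rmult_le_compat_r; first exact: Rlt_le (p2_pos _).
  by apply: Rle_trans (_ : p2 1 <= _); [apply: p2_le; rlra | rewrite p2_1; rlra].
have N1 := INR_ge0 N.
apply: (Rmult_le_reg_r (Rpower (INR Dd) (dl - e / 2))); first exact: Rpow_pos.
have -> : 2 * C * Rpower (INR Dd) (1 / 2 - dl + e) * Rpower (INR Dd) (dl - e / 2) = 2 * (C * Rpower (INR Dd) (1 / 2 + e / 2)).
  rewrite Rmult_assoc -Rpower_plus; have -> : 1 / 2 - dl + e + (dl - e / 2) = 1 / 2 + e / 2 by field.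
  ring.
have h1 := Rmult_le_compat_l (INR N) _ _ N1 hDd; have h2 := Rmult_le_compat_l (INR N) _ _ N1 hM.
rlra.
Qed.

Theorem theorem1p3 :
  forall (F : cset) (m n : nat),
    number_field F -> ext_degree QQ F m -> (1 < n)%nat ->
    lin_disjoint F (cyclo_field n) ->
  forall eps : R, 0 < eps ->
  exists C1 : R, forall l : nat, (0 < l)%nat -> exists C2 : R,
  forall X : R, 2 <= X ->
  exists Ks : list cset,
    INR (length Ks) <= C1 * Rpower X (1 / INR (n - 1) - mu_exp m n l + eps) /\
    (forall (K : cset) (D N : nat),
       in_T F n K -> absdisc K D -> INR D <= X -> cl_tors_card K l N ->
       C2 * Rpower (INR D) (1 / 2 - mu_exp m n l + eps) < INR N ->
       exists K', List.In K' Ks /\ seteq K K').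
Proof.
(* The constant comes from [lin_exp]: at most 1 + log_2 X dyadic ranges meet [1, X], which is
   O(X^(eps/2)) with a constant independent of l. *)
move=> F m n nF eF n1 ld eps eps0; exists (1 + / (eps / 2 * ln 2)) => l l0; have l2 := ln_lt_2.
have m0 : (0 < m)%N by case: eF => f hf; have [d [s [w D]]] := nfdata_exists nF; rewrite (qdata_deg (nfdata_qdata D) hf); exact: qdata_pos (nfdata_qdata D).
have [D0 D1 D2] := mu_bounds m0 n1 l0; rewrite subn1; set dl := mu_exp m n l in D0 D1 D2 *.
have q1 : 1 <= INR n.-1 by apply: INR_ge1; rewrite -ltnS prednK // ltnW.
have L1 := INR_ge1 l0; set q := INR n.-1 in q1 D1 D2 *.
(* [dyadic_step] requires e <= mu; a smaller exponent only strengthens both conclusions. *)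
pose e := Rmin eps dl; have e0 : 0 < e <= dl by split; [exact: Rmin_glb_lt | exact: Rmin_r].
have ee : e <= eps := Rmin_l _ _.
have [C [t0 [C0 [base step]]]] := dyadic_step nF eF n1 ld l0 e0; rewrite -/dl -/q in base step.
(* The first term serves the ranges t >= t0. The second serves D < 2^t0, where the trivial bound
   D^(1/2 + e/2) is at most 2^(t0 mu) D^(1/2 - mu + e), so no field of small discriminant is
   exceptional. *)
exists (2 * C + C * p2 (INR t0 * dl)) => X X2.
have dq : dl <= 1 / q.
  apply: (Rmult_le_reg_r q); first rlra; have -> : 1 / q * q = 1 by field; rlra.
  have : 0 < dl * q by apply: Rmult_lt_0_compat; rlra.
  have := Rmult_le_compat_r (dl * q) 1 (INR l) ; rlra.
have [g Hg] := choice_fun (P := fun t Ks => (t0 <= t)%N -> INR (size Ks) <= p2 (INR t * (1 / q - dl + e / 2)) /\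
    forall K Dd N, in_T F n K -> absdisc K Dd -> cl_tors_card K l N -> (2 ^ t <= Dd < 2 ^ t.+1)%N -> ~ K \in Ks ->
      INR N <= 2 * C * Rpower (INR Dd) (1 / 2 - dl + e))
  (fun t => match classic (t0 <= t)%N with or_introl h => let: ex_intro Ks h' := step t h in ex_intro _ Ks (fun=> h')
     | or_intror h => ex_intro _ [::] (fun h' => False_ind _ (h h')) end).
have [lx [Elx [lx1 lx2]]] := p2_lge (ltac:(rlra) : 0 < X).
have lx0 : 1 <= lx by apply: lx2; rewrite p2_1.
have [Tm [hTm hTm']] := nat_floor (ltac:(rlra) : 0 <= lx).
pose ts := [seq t <- iota 0 Tm.+1 | (t0 <= t)%N].
have X0 : 0 < X by rlra.
exists (flatten [seq g t | t <- ts]); split.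
  rewrite -/(size _) INR_flatten rsum_filter.
  apply: Rle_trans (_ : rsum (fun=> Rpower X (1 / q - dl + eps / 2)) (iota 0 Tm.+1) <= _).
    apply: rsum_le => t; rewrite mem_iota add0n ltnS => tT; case: ifP => tt; last exact: Rpow_ge0.
    apply: Rle_trans (proj1 (Hg t tt)) _; rewrite -Elx /p2 Rpower_mult; apply: Rle_Rpower; first rlra.
    have := leq_INR tT; have := INR_ge0 t => h1 h2.
    by apply: Rmult_le_compat; rlra.
  rewrite rsum_const size_iota S_INR; have -> : 1 / q - dl + eps = eps / 2 + (1 / q - dl + eps / 2) by field; rlra.
  rewrite [Rpower X (eps / 2 + _)]Rpower_plus -Rmult_assoc; apply: Rmult_le_compat_r; first exact: Rpow_ge0.
  have := lin_exp (INR_ge0 Tm) (ltac:(rlra) : 0 < eps / 2); rewrite Rplus_comm => h; apply: Rle_trans h _.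
  apply: Rmult_le_compat_l.
    by have : 0 < / (eps / 2 * ln 2) by [apply: Rinv_0_lt_compat; apply: Rmult_lt_0_compat; rlra]; rlra.
  by rewrite -Elx Rpower_mult; apply: Rle_Rpower; [rlra | apply: Rmult_le_compat_r; rlra].
move=> K D N hT hD DX hcl hN; exists K; split => //.
have Dp : (0 < D)%N by case: (hT) => G _; have [? [? [? [_ _ h _ _]]]] := field_data nF eF n1 G hD.
have DR := INR_ge1 Dp.
have pp := p2_pos (INR t0 * dl).
have up : Rpower (INR D) (1 / 2 - dl + e) <= Rpower (INR D) (1 / 2 - dl + eps) by apply: Rle_Rpower; rlra.
have R0 := Rpow_pos (INR D) (1 / 2 - dl + e).
pose t := trunc_log 2 D; have /andP[tl tu] : (2 ^ t <= D < 2 ^ t.+1)%N by exact: trunc_log_bounds.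
have bad : 2 * C * Rpower (INR D) (1 / 2 - dl + e) + C * p2 (INR t0 * dl) * Rpower (INR D) (1 / 2 - dl + e) < INR N.
  apply: Rle_lt_trans hN; rewrite Rmult_plus_distr_r; apply: Rplus_le_compat; apply: Rmult_le_compat_l => //; first rlra.
  by apply: Rmult_le_pos; rlra.
have tt : (t0 <= t)%N.
  rewrite leqNgt; apply/negP => lt; have h := base K D N hT hD hcl.
  have Dt : INR D <= p2 (INR t0) by rewrite -p2_nat; apply: leq_INR; apply: leq_trans (ltnW tu) _; rewrite leq_exp2l.
  have : Rpower (INR D) (1 / 2 + e / 2) <= p2 (INR t0 * dl) * Rpower (INR D) (1 / 2 - dl + e).
    apply: Rle_trans (_ : Rpower (INR D) (dl + (1 / 2 - dl + e)) <= _); first by apply: Rle_Rpower; rlra.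
    rewrite Rpower_plus; apply: Rmult_le_compat_r; first rlra.
    rewrite /p2 -Rpower_mult; apply: Rpow_mono; last rlra.
    by split; [rlra | exact: Dt].
  move/(Rmult_le_compat_l C _ _ (Rlt_le _ _ C0)); rewrite -Rmult_assoc => h2.
  have : 0 <= 2 * C * Rpower (INR D) (1 / 2 - dl + e) by apply: Rmult_le_pos; [apply: Rmult_le_pos |]; rlra.
  rlra.
have tT : (t <= Tm)%N.
  rewrite -ltnS; apply/ssrnat.ltP; apply: INR_lt; rewrite S_INR; apply: Rle_lt_trans hTm'.
  by apply: lx2; rewrite -p2_nat; apply: Rle_trans DX; exact: leq_INR.
apply: mem_In; apply/flattenP; exists (g t).
  by apply: map_f; rewrite mem_filter tt mem_iota.
apply: NNPP => nK; have := proj2 (Hg t tt) K D N hT hD hcl (ltac:(by rewrite tl tu)) nK.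
have : 0 <= C * p2 (INR t0 * dl) * Rpower (INR D) (1 / 2 - dl + e) by apply: Rmult_le_pos; [apply: Rmult_le_pos |]; rlra.
rlra.
Qed.
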